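(* Let $n\ge 1$. For real-valued $u\in\mathcal D_L$ with $\|u\|_{L^2(\mathbb S^n)}=1$, $$LS(u)\ \ge\ \frac{8\pi^{n/2}}{\Gamma(n/2)(n+2)}\,d^2(u,M)+o(d^2(u,M)),$$ where the term $o(d^2(u,M))$ depends only on $d(u,M)$ and not otherwise on $u$; that is, there is a function $\rho:[0,\infty)\to\mathbb R$ with $\rho(t)/t^2\to0$ as $t\to0^+$ such that $LS(u)\ge \frac{8\pi^{n/2}}{\Gamma(n/2)(n+2)}d^2(u,M)+\rho(d(u,M))$ for all such $u$. Moreover, the constant $\frac{8\pi^{n/2}}{\Gamma(n/2)(n+2)}$ is sharp, i.e. it cannot be replaced by any larger constant.
   Context: $\mathbb S^n\subset\mathbb R^{n+1}$ is the unit sphere, $d\omega$ is its (unnormalized) surface measure, $|\mathbb S^n|$ its total measure, $\|\cdot\|_{L^2}=\|\cdot\|_2$ is the norm of $L^2(\mathbb S^n,d\omega)$, and $|\omega-\eta|$ is Euclidean distance in $\mathbb R^{n+1}$. $B^{n+1}=\{\xi\in\mathbb R^{n+1}:|\xi|<1\}$. $$\mathcal D_L=\Big\{v\in L^2(\mathbb S^n):\iint_{\mathbb S^n\times\mathbb S^n}\frac{|v(\omega)-v(\eta)|^2}{|\omega-\eta|^n}\,d\omega\,d\eta<\infty\Big\}.$$ $$LS(u)=\iint_{\mathbb S^n\times\mathbb S^n}\frac{|u(\omega)-u(\eta)|^2}{|\omega-\eta|^n}\,d\omega\,d\eta-C_n\int_{\mathbb S^n}|u(\omega)|^2\ln\frac{|u(\omega)|^2|\mathbb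 S^n|}{\|u\|_2^2}\,d\omega,\qquad C_n=\frac4n\,\frac{\pi^{n/2}}{\Gamma(n/2)},$$ with the convention $0\ln0=0$. The set $M$ (the set of optimizers of Beckner's log-Sobolev inequality $LS(u)\ge0$) is $$M=\{v_{c,\xi}(\omega)=c(1-\xi\cdot\omega)^{-n/2}:\ \xi\in B^{n+1},\ c\in\mathbb R\},$$ and $d(u,M)=\inf_{\phi\in M}\|u-\phi\|_{L^2(\mathbb S^n)}$. *)

(* Defs.v *)
From HB Require Import structures.
From mathcomp Require Import all_boot all_order all_algebra.
From mathcomp Require Import all_classical all_reals all_analysis.
From mathcomp Require Import measurable_realfun.
Set Implicit Arguments.
Unset Strict Implicit.
Unset Printing Implicit Defensive.
Import Order.TTheory GRing.Theory Num.Theory.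
Import numFieldNormedType.Exports.
Local Open Scope classical_set_scope.
Local Open Scope ring_scope.

Section Euclidean.
Context {R : realType} {m : nat}.
Implicit Types x y : m.-tuple R.

Definition dotp x y : R := \sum_(i < m) tnth x i * tnth y i.
Definition enorm x : R := Num.sqrt (dotp x x).
Definition edist x y : R := Num.sqrt (\sum_(i < m) (tnth x i - tnth y i) ^+ 2).
Definition unit_ball : set (m.-tuple R) := [set x | enorm x < 1].

Lemma measurable_enorm : measurable_fun [set: m.-tuple R] enorm.
Proof.
apply: (@measurableT_comp _ _ _ _ _ _ (@Num.sqrt R)).
  exact: continuous_measurable_fun (@sqrt_continuous R).
apply: measurable_sum => i.
by apply: measurable_funM; exact: measurable_tnth.
Qed.

Lemma measurable_unit_ball : measurable unit_ball.
Proof.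
have -> : unit_ball = [set: m.-tuple R] `&` enorm @^-1` `]-oo, 1[%classic.
  by apply/seteqP; split => x; rewrite /unit_ball /= in_itv//= => -[].
exact: measurable_enorm.
Qed.

End Euclidean.

(* Lebesgue measure on R^m, by recursion on m through R * R^m = R^(m+1). *)
Section LebesgueTuple.
Context {R : realType}.
Local Open Scope ereal_scope.

Definition tcons m (p : measurableTypeR R * m.-tuple R) : m.+1.-tuple R :=
  [tuple of p.1 :: p.2].

Lemma measurable_tcons m :
  measurable_fun [set: measurableTypeR R * m.-tuple R] (@tcons m).
Proof. exact: measurable_cons. Qed.

Section step.
Context {m : nat} (mu : {sigma_finite_measure set (m.-tuple R) -> \bar R}).

Definition lebesgue_tcons : set (m.+1.-tuple R) -> \bar R :=
  pushforward (@lebesgue_measure R \x mu) (@tcons m).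

Let mtcons := @measurable_tcons m.

Let lebesgue_tcons0 : lebesgue_tcons set0 = 0.
Proof. exact: measure0. Qed.

Let lebesgue_tcons_ge0 A : 0 <= lebesgue_tcons A.
Proof. exact: measure_ge0. Qed.

Let lebesgue_tcons_sigma_additive : semi_sigma_additive lebesgue_tcons.
Proof. exact: measure_semi_sigma_additive. Qed.

HB.instance Definition _ := isMeasure.Build _ _ _ lebesgue_tcons
  lebesgue_tcons0 lebesgue_tcons_ge0 lebesgue_tcons_sigma_additive.

Let sigma_finite_tcons : sigma_finite setT lebesgue_tcons.
Proof.
have /sigma_finiteP[F [FT ndF Foo]] := sigma_finiteT (@lebesgue_measure R).
have /sigma_finiteP[G [GT ndG Goo]] := sigma_finiteT mu.
pose g (x : m.+1.-tuple R) : (measurableTypeR R * m.-tuple R)%type :=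
  (thead x, [tuple of behead x]).
have mg : measurable_fun setT g.
  apply: measurable_fun_pair; first exact: measurable_tnth.
  exact: measurable_behead.
exists (fun i => g @^-1` (F i `*` G i)).
  apply/seteqP; split => // x _.
  have [i _ Fi] : (\bigcup_i F i) (thead x) by rewrite -FT.
  have [j _ Gj] : (\bigcup_i G i) [tuple of behead x] by rewrite -GT.
  exists (maxn i j) => //; split => /=.
    by move: Fi; exact/subsetPset/ndF/leq_maxl.
  by move: Gj; exact/subsetPset/ndG/leq_maxr.
move=> i; have [mF Fioo] := Foo i; have [mG Gioo] := Goo i; split.
  by rewrite -[X in measurable X]setTI; apply: mg => //; exact: measurableX.
rewrite /lebesgue_tcons /pushforward -comp_preimage.
rewrite (_ : g \o _ = id); last first.
  by apply/funext => -[a t]; congr pair; exact/val_inj.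
by rewrite preimage_id product_measure1E// lte_mul_pinfty// ge0_fin_numE.
Qed.

HB.instance Definition _ :=
  Measure_isSigmaFinite.Build _ _ _ lebesgue_tcons sigma_finite_tcons.

End step.

Fixpoint lebesgue_tuple m : {sigma_finite_measure set (m.-tuple R) -> \bar R} :=
  if m is m'.+1 then lebesgue_tcons (lebesgue_tuple m') else \d_[tuple].

Lemma lebesgue_tuple_unit_ball m : lebesgue_tuple m unit_ball < +oo.
Proof.
pose C k : set (k.-tuple R) := [set x | forall i, `|tnth x i| <= 1]%R.
have mC k : measurable (C k).
  rewrite (_ : C k = \bigcap_(i in [set: 'I_k])
      ((fun x : k.-tuple R => `|tnth x i|%R) @^-1` `]-oo, 1%R]%classic)).
    apply: fin_bigcap_measurable => // i _; rewrite -[X in measurable X]setTI.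
    have mt : measurable_fun setT (fun x : k.-tuple R => `|tnth x i|%R).
      by apply: measurableT_comp => //; exact: measurable_tnth.
    exact: mt.
  apply/seteqP; split => x xi i /=; first by rewrite in_itv/=.
  by have := xi i Logic.I; rewrite /= in_itv.
have Coo k : lebesgue_tuple k (C k) < +oo.
  elim: k => [|k IH]; first by rewrite /= diracE ltry.
  have tC : @tcons k @^-1` (C k.+1) =
      (`[(-1)%R, 1%R]%classic : set (measurableTypeR R)) `*` C k.
    apply/seteqP; split => -[a t] /=.
      move=> h; split => [|i]; first by have := h ord0; rewrite in_itv/= ler_norml.
      by have := h (lift ord0 i); rewrite tnthS.
    rewrite in_itv/= => -[a1 h] i.
    have [j ->|->] := unliftP ord0 i; first by rewrite tnthS; exact: h.
    by rewrite ler_norml.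
  rewrite [X in X _ < _]/= /lebesgue_tcons /pushforward tC.
  rewrite product_measure1E//; last exact: mC.
  rewrite lte_mul_pinfty//.
  by rewrite [X in X \is a _]lebesgue_measure_itv/=; case: ifP.
rewrite (le_lt_trans _ (Coo m))// le_measure ?inE//.
- exact: measurable_unit_ball.
- exact: mC.
move=> x x1 i; apply/ltW/(le_lt_trans _ x1).
rewrite -sqrtr_sqr ler_wsqrtr// /dotp (bigD1 i)//= -expr2 lerDl sumr_ge0//.
by move=> j _; rewrite -expr2 sqr_ge0.
Qed.

End LebesgueTuple.

(* S^n, with the trace of the Borel sigma-algebra of R^(n+1). *)
Definition sphere (R : realType) (n : nat) :=
  {x : n.+1.-tuple R | enorm x == 1}.

Section Sphere.
Context {R : realType} {n : nat}.
Local Open Scope ereal_scope.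
Local Notation S := (sphere R n).

HB.instance Definition _ := SubChoice.on S.

Fact enorm_pole :
  enorm [tuple ((i == ord0)%:R : R)%R | i < n.+1] == 1%R.
Proof.
rewrite /enorm /dotp big_ord_recl big1 ?addr0 ?tnth_mktuple/= ?mul1r ?sqrtr1//.
by move=> i _; rewrite !tnth_mktuple/= mul0r.
Qed.

HB.instance Definition _ := isPointed.Build S
  (exist (fun x : n.+1.-tuple R => enorm x == 1%R) _ enorm_pole).

HB.instance Definition _ :=
  Measurable.copy S (g_sigma_algebra_preimageType (\val : S -> n.+1.-tuple R)).

(* The origin, which cannot be projected, is sent to an arbitrary point. *)
Definition sphere_proj (x : n.+1.-tuple R) : S :=
  insubd (point : S) [tuple (tnth x i / enorm x)%R | i < n.+1].

Lemma measurable_sphere_proj : measurable_fun setT sphere_proj.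
Proof.
move=> _ _ [A mA <-]; rewrite !setTI.
pose f (x : n.+1.-tuple R) := [tuple (tnth x i / enorm x)%R | i < n.+1].
have mf : measurable_fun setT f.
  apply/measurable_fun_tnthP => i.
  rewrite (_ : _ \o _ = fun x => (tnth x i / enorm x)%R); last first.
    by apply/funext => x /=; rewrite tnth_mktuple.
  apply: measurable_funM; first exact: measurable_tnth.
  rewrite (_ : (fun _ => _^-1) = (@powR R ^~ (-1)) \o enorm)%R; last first.
    by apply/funext => x /=; rewrite powR_inv1// sqrtr_ge0.
  apply: measurableT_comp; first exact: measurable_powR.
  exact: measurable_enorm.
have mE : measurable [set y : n.+1.-tuple R | enorm y = 1%R].
  rewrite (_ : mkset _ = enorm @^-1` [set 1%R])//.
  by rewrite -[X in measurable X]setTI; exact: measurable_enorm.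
have mI (B : set (n.+1.-tuple R)) : measurable B -> measurable (f @^-1` B).
  by move=> mB; rewrite -[X in measurable X]setTI; exact: mf.
have [pA|pA] := pselect (A (val (point : S))).
  rewrite (_ : _ @^-1` _ =
      (f @^-1` ([set y | enorm y = 1%R] `&` A)) `|`
      ~` (f @^-1` [set y | enorm y = 1%R])); last first.
    apply/seteqP; split => x /=; rewrite /sphere_proj val_insubd -/(f x).
      by case: ifPn => /eqP fx1 Ax; [left|right].
    by case: ifPn => /eqP fx1 [[_ Ax]|].
  apply: measurableU.
    by apply: (mI (_ `&` _)); exact: measurableI.
  by apply: measurableC; exact: (mI [set y | enorm y = 1%R]).
rewrite (_ : _ @^-1` _ = f @^-1` ([set y | enorm y = 1%R] `&` A)).
  by apply: (mI (_ `&` _)); exact: measurableI.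
apply/seteqP; split => x /=; rewrite /sphere_proj val_insubd -/(f x).
  by case: ifPn => /eqP fx1 Ax.
by case: ifPn => /eqP fx1 [].
Qed.

(* The polar-coordinates definition of surface measure: |A| is n+1 times the
   volume of {r w : 0 < r < 1, w in A}. *)
Definition surface (A : set S) : \bar R :=
  n.+1%:R%:E * lebesgue_tuple n.+1 (unit_ball `&` sphere_proj @^-1` A).

Let mproj (A : set S) : measurable A ->
  measurable (unit_ball `&` sphere_proj @^-1` A).
Proof.
move=> mA; apply: measurableI; first exact: measurable_unit_ball.
by rewrite -[X in measurable X]setTI; exact: measurable_sphere_proj.
Qed.

Let surface0 : surface set0 = 0.
Proof. by rewrite /surface preimage_set0 setI0 measure0 mule0. Qed.

Let surface_ge0 A : 0 <= surface A.
Proof. by rewrite mule_ge0. Qed.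

Let surface_sigma_additive : semi_sigma_additive surface.
Proof.
move=> F mF tF mUF; rewrite /surface preimage_bigcup setI_bigcupr.
under eq_fun do rewrite -ge0_sume_distrr//.
apply: cvgeZl => //.
apply: measure_semi_sigma_additive => [i||]; first exact: mproj.
- apply/trivIsetP => i j _ _ ij; rewrite setIACA.
  rewrite -[X in _ `&` X]preimage_setI.
  by move/trivIsetP : tF => -> //; rewrite preimage_set0 setI0.
- by apply: bigcup_measurable => i _; exact: mproj.
Qed.

HB.instance Definition _ := isMeasure.Build _ _ _ surface
  surface0 surface_ge0 surface_sigma_additive.

Let surface_finite : fin_num_fun surface.
Proof.
move=> A mA; rewrite fin_numM// ge0_fin_numE//.
apply: le_lt_trans (lebesgue_tuple_unit_ball n.+1).
by rewrite le_measure ?inE//; [exact: mproj|exact: measurable_unit_ball].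
Qed.

HB.instance Definition _ :=
  Measure_isFinite.Build _ _ _ surface surface_finite.

End Sphere.

Definition Gamma {R : realType} (x : R) : R :=
  \int[@lebesgue_measure R]_(t in `]0, +oo[) (t `^ (x - 1) * expR (- t)).

Section LogSobolev.
Context {R : realType} {n : nat}.
Local Notation S := (sphere R n).
Local Notation dw := (@surface R n).
Implicit Types u v : S -> R.

Definition L2norm u : R := fine 'N[dw]_2%:E[EFin \o u].

(* The diagonal, where the quotient is 0 / 0 = 0, is a null set for n >= 1. *)
Definition energy u : \bar R :=
  (\int[dw \x dw]_p
    ((u p.1 - u p.2) ^+ 2 / edist (\val p.1) (\val p.2) ^+ n)%:E)%E.

Definition DL : set (S -> R) :=
  [set v | v \in Lfun dw 2%:E /\ (energy v < +oo)%E].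

Definition Cn : R :=
  4 / n%:R * (pi `^ (n%:R / 2) / Gamma (n%:R / 2)).

(* 0 ln 0 = 0, since ln 0 = 0 in the library. *)
Definition entropy u : \bar R :=
  (\int[dw]_w
    (u w ^+ 2 * ln (u w ^+ 2 * fine (dw setT) / L2norm u ^+ 2))%:E)%E.

(* Extended-real valued, so that an infinite entropy is not discarded. *)
Definition LS u : \bar R := (energy u - Cn%:E * entropy u)%E.

Definition bubble (c : R) (xi : n.+1.-tuple R) : S -> R :=
  fun w => c * (1 - dotp xi (\val w)) `^ (- (n%:R / 2)).

Definition M : set (S -> R) :=
  [set phi | exists c, exists2 xi, unit_ball xi & phi = bubble c xi].

Definition distM u : R := inf [set L2norm (u \- phi) | phi in M].

End LogSobolev.

Arguments DL : clear implicits.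
Arguments M : clear implicits.

(* The remainder rho depends on n and K but not on u. *)
Definition stable_with (R : realType) (n : nat) (K : R) : Prop :=
  exists2 rho : R -> R, rho t / t ^+ 2 @[t --> 0^'+] --> 0 &
    forall u : sphere R n -> R, DL R n u -> L2norm u = 1 ->
      ((K * distM u ^+ 2 + rho (distM u))%:E <= LS u)%E.

(* Main.v *)
(* Write K for the kernel |w - y|^{-n}. Expanding it in powers of
   q = (1 + w . y) / 2, the quadratic form of K is a sum over j of positive
   multiples of |r|^2 - <r, G_j r>, with G_j the normalised kernel q^j. The
   relation between G_i o G_j, G_{i-1} o G_j and G_i o G_{j-1} given by the
   Laplacian, together with G_j -> Id, diagonalises all the G_j simultaneously.
   Hence the second variation of LS at the constants, on functions orthogonal to
   the harmonics of degree at most 1, has its least eigenvalue K0 in degree 2,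
   where the sum over j telescopes.

   LS is invariant under the conformal group, which is generated by the boosts in
   the first coordinate and the permutations of coordinates, and which acts
   transitively on M up to scalars; so an almost nearest element of M may be taken
   to be a constant m. Comparison with the neighbouring bubbles shows that
   r = u / m - 1 is then orthogonal to the coordinates up to O(|r|^2), and the
   deficit is estimated by truncating r at a small level: the spectral gap handles
   the bounded part, and a logarithmic Sobolev inequality with an additive error
   (whose proof truncates K at a scale depending on u) the unbounded one.

   For the sharpness take u proportional to 1 + e Y with Y a harmonic of degree 2:
   the nearest point of M is the constant, and LS(u) / d(u, M)^2 tends to K0. *)
From HB Require Import structures.
From mathcomp Require Import all_boot all_order all_fingroup all_algebra.
From mathcomp Require Import all_classical all_reals all_analysis.
From mathcomp Require Import measurable_realfun ring lra.
Require Import Defs.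
Set Implicit Arguments.
Unset Strict Implicit.
Unset Printing Implicit Defensive.
Import Order.TTheory GRing.Theory Num.Theory.
Import numFieldNormedType.Exports.
Local Open Scope classical_set_scope.
Local Open Scope ring_scope.

(** * Lebesgue measure of tuples and boosts *)

(** The constant is $K_0=\lambda_2-3C_n+C_n$: $\lambda_2$ ([lam2]) is the energy of a normalised
    harmonic of degree 2, $3C_n$ comes from $(1+x)^2\ln(1+x)^2=2x+3x^2+O(x^3)$, and one $C_n$ is
    given back by the normalisation $m^2(|\mathbb S|+\|r\|^2)=1$ through $-C_n\ln m^2$. The obstacle
    is that $r$ is small in $L^2$ only. Above the truncation level its entropy is measured relative
    to the mass $P=\|r\|_2^2$, as $t^2\ln(t^2/P)$; the gain $-\ln P$ exceeds any prescribed constant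
    once $P$ is small, so an additive error in the logarithmic Sobolev inequality is affordable.
    Integral calculus on the sphere has a single source, the transformation of the surface measure
    under boosts: to first order in the velocity it is the divergence theorem, hence Green's
    formula. The coefficient [ell] of the logarithmic singularity of the regularised kernel is tied
    to $C_n$ by the area of the sphere; this identity feeds the gap, the weak inequality and the
    conformal invariance. From the zonal functions on, the sphere has dimension [n.+1], and
    $a=(n+1)/2$ is half of it. *)

Section Density.
Import HBNNSimple.
Local Open Scope ereal_scope.
Context d (T : measurableType d) (R : realType).
Variables (mu : {measure set T -> \bar R}) (g : T -> R).

(* The hypotheses are arguments so that the measure structure can be inferred. *)
Definition density of (forall x, (0 <= g x)%R) & measurable_fun setT g :=
  fun A : set T => \int[mu]_(x in A) (g x)%:E.

Hypotheses (g0 : forall x, (0 <= g x)%R) (mg : measurable_fun setT g).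
Local Notation nu := (density g0 mg).

Let mgE (A : set T) : measurable_fun A (EFin \o g).
Proof. by apply/measurable_EFinP; exact: measurable_funTS. Qed.

Let density0 : nu set0 = 0. Proof. exact: integral_set0. Qed.

Let density_ge0 A : 0 <= nu A.
Proof. by apply: integral_ge0 => x _; rewrite lee_fin. Qed.

Let density_sigma_additive : semi_sigma_additive nu.
Proof.
move=> F mF tF mUF; rewrite /density ge0_integral_bigcup//=.
- apply: is_cvg_ereal_nneg_natsum_cond => k _ _.
  by apply: integral_ge0 => x _; rewrite lee_fin.
- by move=> x _; rewrite lee_fin.
Qed.

HB.instance Definition _ := isMeasure.Build _ _ _ nu
  density0 density_ge0 density_sigma_additive.

Lemma densityE A : nu A = \int[mu]_(x in A) (g x)%:E. Proof. by []. Qed.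

(** For an indicator this is the definition of the measure; linearity gives simple functions, and
    monotone convergence along [nnsfun_approx] the rest. *)
Lemma ge0_integral_density (f : T -> \bar R) : measurable_fun setT f ->
  (forall x, 0 <= f x) ->
  \int[nu]_x f x = \int[mu]_x (f x * (g x)%:E).
Proof.
move=> mf f0.
pose f_ := nnsfun_approx measurableT mf.
have f_0 n x : 0 <= (f_ n x)%:E by rewrite lee_fin.
have f_nd x : {homo (fun n => (f_ n x)%:E) : a b / (a <= b)%N >-> a <= b}.
  by move=> m n mn; rewrite lee_fin; exact/lefP/nd_nnsfun_approx.
have f_cvg x : (f_ n x)%:E @[n --> \oo] --> f x.
  by apply: cvg_nnsfun_approx.
transitivity (limn (fun n => \int[nu]_x (f_ n x)%:E)).
  rewrite -monotone_convergence//.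
  - by apply: eq_integral => x _; apply/esym/cvg_lim.
  - by move=> n; exact/measurable_EFinP/measurable_funTS.
transitivity (limn (fun n => \int[mu]_x ((f_ n x)%:E * (g x)%:E))).
  congr (limn _); apply/funext => n.
  under [LHS]eq_integral do rewrite fimfunE -fsumEFin//.
  rewrite ge0_integral_fsum//; last 2 first.
  - by move=> r; exact/measurable_EFinP/measurableT_comp.
  - by move=> r x _; rewrite nnfun_muleindic_ge0.
  under [RHS]eq_integral.
    move=> x _; rewrite fimfunE -fsumEFin// ge0_mule_fsuml; last first.
      by move=> r; rewrite nnfun_muleindic_ge0.
    over.
  rewrite /= ge0_integral_fsum//; last 2 first.
  - move=> r; apply: emeasurable_funM; last exact: mgE.
    exact/measurable_EFinP/measurableT_comp.
  - by move=> r x _; apply: mule_ge0; rewrite ?lee_fin//; exact: nnfun_muleindic_ge0.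
  apply: eq_fsbigr => r; rewrite inE/= => -[y _ fyr].
  rewrite integralZl_indic_nnsfun//= integral_indic//= setIT.
  have r0 : (0 <= r)%R by rewrite -fyr.
  under [RHS]eq_integral do rewrite EFinM -muleA.
  rewrite ge0_integralZl//; last 2 first.
  - apply: emeasurable_funM; last exact: mgE.
    exact/measurable_EFinP.
  - by move=> x _; rewrite mule_ge0 ?lee_fin.
  congr (_ * _); rewrite /density.
  rewrite integral_mkcond; apply: eq_integral => x _.
  rewrite patchE indicE.
  by case: ifPn => _; rewrite ?mul1e ?mul0e.
rewrite -monotone_convergence//.
- apply: eq_integral => x _; apply/cvg_lim => //.
  by under eq_fun do rewrite muleC; rewrite muleC; apply: cvgeZl => //; exact: f_cvg.
- move=> n; apply: emeasurable_funM; last exact: mgE.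
  exact/measurable_EFinP/measurable_funTS.
- by move=> n x _; rewrite mule_ge0 ?lee_fin.
- by move=> x _ m n mn; rewrite lee_pmul ?lee_fin//; exact/lefP/nd_nnsfun_approx.
Qed.

End Density.

Section ChangeOfVariable.
Context {R : realType}.
Notation mu := (@lebesgue_measure R).

(** The measure with density [b'], pushed forward along [b], gives every interval its length by the
    fundamental theorem of calculus on the preimage interval; by uniqueness it is Lebesgue
    measure. *)
Lemma ge0_integral_diffeo (b b' : R -> R) (f : R -> \bar R) :
  (forall t, 0 <= b' t) -> continuous b' ->
  (forall t : R, is_derive t 1 b (b' t)) ->
  {mono b : x y / x <= y} -> (forall y, exists x, b x = y) ->
  @measurable_fun _ _ (measurableTypeR R) _ setT f -> (forall x, 0 <= f x)%E ->
  (\int[mu]_t (f (b t) * (b' t)%:E) = \int[mu]_t f t)%E.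
Proof.
move=> b'0 cb' db bm bs mf f0.
have cb : continuous b.
  by move=> x; apply/differentiable_continuous/derivable1_diffP; have [] := db x.
have mb : @measurable_fun _ _ (measurableTypeR R) (measurableTypeR R) setT b.
  exact: continuous_measurable_fun.
have mb' : @measurable_fun _ _ (measurableTypeR R) _ setT b' by exact: continuous_measurable_fun.
rewrite -(ge0_integral_density mu b'0 mb' (f := f \o b)); last 2 first.
- exact: measurableT_comp.
- by move=> x /=.
have := @ge0_integral_pushforward _ _ (measurableTypeR R) (measurableTypeR R) R b mb (density mu b'0 mb') setT f.
rewrite preimage_setT => <- //.
apply: eq_measure_integral => /= A mA _.
apply/esym/lebesgue_measure_unique => //= _ [[x y]] _ <-.
rewrite /pushforward.
have [x' bx'] := bs x; have [y' by'] := bs y.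
have -> : b @^-1` `]x, y] = `]x', y']%classic.
  apply/seteqP; split => t /=; rewrite !in_itv/= -bx' -by' (leW_mono bm) bm//.
rewrite lebesgue_measure_itv/= lte_fin -bx' -by' (leW_mono bm).
rewrite densityE.
have [xy|yx] := ltP x' y'; last first.
  by rewrite set_itv_ge ?integral_set0// bnd_simp -leNgt.
rewrite integral_itv_bndoo; last by apply/measurable_EFinP; exact: measurable_funTS.
rewrite -(@integral_itv_bndoo R x' y' _ true false); last first.
  by apply/measurable_EFinP; exact: measurable_funTS.
rewrite (@continuous_FTC2 _ b' b)//.
- by apply: continuous_subspaceT => z; exact: cb'.
- split; first by move=> z _; have [] := db z.
  + exact/cvg_at_right_filter/cb.
  + exact/cvg_at_left_filter/cb.
- by move=> z _; rewrite derive1E; apply: derive_val.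
Qed.

End ChangeOfVariable.

(** * Permutations and dilations of the coordinates of R^m *)

Section LebesgueTupleTheory.
Context {R : realType}.
Notation mu := (@lebesgue_measure R).
Notation leb := (@lebesgue_tuple R).
Local Open Scope ereal_scope.

Lemma tnth_tcons0 m (t : R) (y : m.-tuple R) : tnth (tcons (t, y)) ord0 = t.
Proof. by []. Qed.

Lemma tnth_tconsS m (t : R) (y : m.-tuple R) i :
  tnth (tcons (t, y)) (lift ord0 i) = tnth y i.
Proof. by rewrite tnthS. Qed.

Lemma tcons_eta m (x : m.+1.-tuple R) : x = tcons (thead x, [tuple of behead x]).
Proof. by rewrite [LHS]tuple_eta; apply/val_inj. Qed.

Lemma ge0_integral_tcons m (f : m.+1.-tuple R -> \bar R) :
  measurable_fun setT f -> (forall x, 0 <= f x) ->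
  \int[leb m.+1]_x f x = \int[mu]_t \int[leb m]_y f (tcons (t, y)).
Proof.
move=> mf f0; rewrite [LHS](@ge0_integral_pushforward _ _ _ _ R (@tcons R m)
  (@measurable_tcons R m) (mu \x leb m) setT f)//.
rewrite preimage_setT fubini_tonelli1//; last by move=> x /=.
by apply: measurableT_comp => //; exact: measurable_tcons.
Qed.

Lemma ge0_integral_tcons2 m (f : m.+1.-tuple R -> \bar R) :
  measurable_fun setT f -> (forall x, 0 <= f x) ->
  \int[leb m.+1]_x f x = \int[leb m]_y \int[mu]_t f (tcons (t, y)).
Proof.
move=> mf f0; rewrite [LHS](@ge0_integral_pushforward _ _ _ _ R (@tcons R m)
  (@measurable_tcons R m) (mu \x leb m) setT f)//.
rewrite preimage_setT fubini_tonelli2//; last by move=> x /=.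
by apply: measurableT_comp => //; exact: measurable_tcons.
Qed.

Lemma measurable_tcons_r m (f : m.+1.-tuple R -> \bar R) t :
  measurable_fun setT f -> measurable_fun setT (fun y => f (tcons (t, y))).
Proof.
move=> mf; apply: (@measurableT_comp _ _ _ _ _ _ f) => //.
apply: (@measurableT_comp _ _ _ _ _ _ (@tcons R m)); first exact: measurable_tcons.
exact: measurable_pair1.
Qed.

Lemma measurable_tcons_l m (f : m.+1.-tuple R -> \bar R) y :
  measurable_fun setT f ->
  @measurable_fun _ _ (measurableTypeR R) _ setT (fun t => f (tcons (t, y))).
Proof.
move=> mf; apply: (@measurableT_comp _ _ _ _ _ _ f) => //.
apply: (@measurableT_comp _ _ _ _ _ _ (@tcons R m)); first exact: measurable_tcons.
exact: measurable_pair2.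
Qed.

Definition tswap m (a : 'I_m.+1) (x : m.+1.-tuple R) : m.+1.-tuple R :=
  [tuple tnth x (tperm ord0 a i) | i < m.+1].

Lemma measurable_tuple_map m k (g : 'I_k -> 'I_m) :
  measurable_fun setT (fun x : m.-tuple R => [tuple tnth x (g i) | i < k]).
Proof.
apply/measurable_fun_tnthP => i.
rewrite (_ : _ \o _ = (fun x => tnth x (g i))); first exact: measurable_tnth.
by apply/funext => x /=; rewrite tnth_mktuple.
Qed.

Lemma measurable_tswap m (a : 'I_m.+1) : measurable_fun setT (tswap a).
Proof. exact: measurable_tuple_map. Qed.

Lemma tswap0 m (x : m.+1.-tuple R) : tswap ord0 x = x.
Proof. by apply: eq_from_tnth => i; rewrite tnth_mktuple tperm1 perm1. Qed.

Lemma tswap1_tcons m t s (y : m.-tuple R) :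
  tswap (lift ord0 ord0) (tcons (t, tcons (s, y))) = tcons (s, tcons (t, y)).
Proof.
apply: eq_from_tnth => i; rewrite tnth_mktuple.
have [j ->|->] := unliftP ord0 i; last first.
  by rewrite tpermL tnth_tconsS !tnth_tcons0.
have [k ->|->] := unliftP ord0 j; last first.
  by rewrite tpermR tnth_tconsS !tnth_tcons0.
by rewrite tpermD// !tnth_tconsS.
Qed.

(** In cycle notation $(0\,b)=(0\,1)(1\,b)(0\,1)$ with $b=a+1$. This reduces a swap with coordinate
    0 to one inside the tail, where the induction of [ge0_integral_tswap] applies. *)
Lemma tperm0_conj m (a : 'I_m.+1) (i : 'I_m.+2) : a != ord0 ->
  tperm ord0 (lift ord0 a) i = tperm ord0 (lift ord0 ord0)
    (tperm (lift ord0 ord0) (lift ord0 a) (tperm ord0 (lift ord0 ord0) i)).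
Proof.
move=> a0.
have a1 : lift ord0 a != lift ord0 ord0 by rewrite (inj_eq lift_inj).
have [j ->|->] := unliftP ord0 i; last first.
  by rewrite [in LHS]tpermL [tperm ord0 _ ord0]tpermL tpermL tpermD// eq_sym.
have [->|j0] := eqVneq j ord0.
  rewrite [in LHS]tpermD//.
  rewrite [tperm ord0 _ (lift ord0 ord0)]tpermR [tperm _ (lift ord0 a) ord0]tpermD//.
  by rewrite tpermL.
have j1 : lift ord0 ord0 != lift ord0 j by rewrite (inj_eq lift_inj) eq_sym.
have [->|ja] := eqVneq j a.
  rewrite [in LHS]tpermR [tperm ord0 (lift ord0 ord0) (lift ord0 a)]tpermD// 1?eq_sym//.
  by rewrite tpermR tpermR.
have ja' : lift ord0 a != lift ord0 j by rewrite (inj_eq lift_inj) eq_sym.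
by rewrite !tpermD.
Qed.

(** Tonelli exchanges the two outermost integrals. *)
Let ge0_integral_tswap1 m (f : m.+2.-tuple R -> \bar R) :
  measurable_fun setT f -> (forall x, 0 <= f x) ->
  \int[leb m.+2]_x f (tswap (lift ord0 ord0) x) = \int[leb m.+2]_x f x.
Proof.
move=> mf f0.
have mfs : measurable_fun setT (f \o tswap (lift ord0 ord0)).
  by apply: measurableT_comp => //; exact: measurable_tswap.
rewrite (ge0_integral_tcons mf f0) (ge0_integral_tcons mfs (fun=> f0 _)).
under eq_integral.
  move=> t _; rewrite (@ge0_integral_tcons m) //.
  over.
    exact: (measurable_tcons_r _ mfs).
  by move=> y; exact: f0.
under [RHS]eq_integral.
  move=> t _; rewrite (@ge0_integral_tcons m) //.
  over.
  exact: (measurable_tcons_r _ mf).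
rewrite /=.
pose F (p : measurableTypeR R * measurableTypeR R) := \int[leb m]_y f (tcons (p.1, tcons (p.2, y))).
have mF : measurable_fun setT F.
  apply: (@measurable_fun_fubini_tonelli_F _ _ _ _ _ _ (fun q => f (tcons (q.1.1, tcons (q.1.2, q.2))))).
    2: by move=> ?.
  apply: (@measurableT_comp _ _ _ _ _ _ f) => //.
  apply: (@measurableT_comp _ _ _ _ _ _ (@tcons R m.+1)); first exact: measurable_tcons.
  apply: measurable_fun_pair => //=.
    by apply: measurableT_comp => //.
  apply: (@measurableT_comp _ _ _ _ _ _ (@tcons R m)); first exact: measurable_tcons.
  apply: measurable_fun_pair => //=.
  by apply: measurableT_comp => //.
have F0 p : 0 <= F p by apply: integral_ge0.
have FT := @fubini_tonelli _ _ _ _ R mu mu F mF F0.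
transitivity (\int[mu]_s \int[mu]_t F (t, s)); last exact/esym/FT.
apply: eq_integral => t _; apply: eq_integral => s _.
apply: eq_integral => y _; congr f.
exact: tswap1_tcons.
Qed.

Lemma ge0_integral_tswap m (a : 'I_m.+1) (f : m.+1.-tuple R -> \bar R) :
  measurable_fun setT f -> (forall x, 0 <= f x) ->
  \int[leb m.+1]_x f (tswap a x) = \int[leb m.+1]_x f x.
Proof.
elim: m a f => [|m IH] a f mf f0.
  by apply: eq_integral => x _; rewrite (ord1 a) tswap0.
have [a' ->|->] := unliftP ord0 a; last first.
  by apply: eq_integral => x _; rewrite tswap0.
have [a'0|a'0] := eqVneq a' ord0; first by rewrite a'0 ge0_integral_tswap1.
pose tl (x : m.+2.-tuple R) := tcons (thead x, tswap a' [tuple of behead x]).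
have tlE x i : tnth (tl x) i = tnth x (tperm (lift ord0 ord0) (lift ord0 a') i).
  have [j ->|->] := unliftP ord0 i; last first.
    by rewrite tnth_tcons0 tpermD// /thead.
  rewrite tnth_tconsS tnth_mktuple.
  rewrite [in RHS](tcons_eta x) -(inj_tperm _ _ _ lift_inj).
  by rewrite tnth_tconsS.
have sE x : tswap (lift ord0 a') x =
    tswap (lift ord0 ord0) (tl (tswap (lift ord0 ord0) x)).
  apply: eq_from_tnth => i.
  rewrite !tnth_mktuple tlE tnth_mktuple; congr (tnth x _).
  exact: tperm0_conj.
have mtl : measurable_fun setT tl.
  rewrite (_ : tl = fun x => [tuple tnth x (tperm (lift ord0 ord0) (lift ord0 a') i) | i < m.+2]).
    exact: measurable_tuple_map.
  by apply/funext => x; apply: eq_from_tnth => i; rewrite tlE tnth_mktuple.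
transitivity (\int[leb m.+2]_x f (tswap (lift ord0 ord0) (tl x))).
  rewrite -[RHS]ge0_integral_tswap1//.
    by apply: eq_integral => x _; rewrite sE.
  apply: (@measurableT_comp _ _ _ _ _ _ f) => //.
  by apply: measurableT_comp => //; exact: measurable_tswap.
have mfs : measurable_fun setT (f \o tswap (lift ord0 ord0)).
  by apply: measurableT_comp => //; exact: measurable_tswap.
rewrite -[RHS]ge0_integral_tswap1// (ge0_integral_tcons mfs (fun=> f0 _)).
rewrite (@ge0_integral_tcons _ (fun x => f (tswap (lift ord0 ord0) (tl x))));
  [|exact: (measurableT_comp mfs)|by []].
apply: eq_integral => t _.
rewrite -(IH a' (fun y => f (tswap (lift ord0 ord0) (tcons (t, y)))))//.
  apply: eq_integral => y _; congr (f (tswap _ _)).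
  by rewrite /tl; congr (tcons (_, tswap _ _)); apply/val_inj.
exact: (measurable_tcons_r _ mfs).
Qed.


Lemma ge0_integral_scale1 (c : R) (f : R -> \bar R) : (0 < c)%R ->
  @measurable_fun _ _ (measurableTypeR R) _ setT f -> (forall x, 0 <= f x) ->
  \int[mu]_t f (c * t)%R = (c^-1)%:E * \int[mu]_t f t.
Proof.
move=> c0 mf f0.
have mfc : @measurable_fun _ _ (measurableTypeR R) _ setT (fun t => f (c * t)%R).
  have mc : @measurable_fun _ _ (measurableTypeR R) (measurableTypeR R) setT (fun t => c * t)%R.
    exact: measurable_funM.
  exact: (measurableT_comp mf mc).
have D (t : R) : is_derive t (1%R : R) (fun t => c * t)%R c.
  have -> : (fun t => c * t)%R = c \*: (id : R -> R) by apply/funext.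
  by apply: is_derive_eq; rewrite [LHS]mulr1.
transitivity ((c^-1)%:E * \int[mu]_t (f (c * t)%R * c%:E)).
  rewrite ge0_integralZr; [|by []..|by rewrite lee_fin ltW].
  by rewrite muleCA -EFinM mulVf ?gt_eqF// mule1.
congr (_ * _); apply: (@ge0_integral_diffeo R (fun t => c * t)%R (cst c) f _ _ D _ _ mf f0).
- by move=> t; exact: ltW.
- by move=> t; apply: cst_continuous.
- by move=> x y; rewrite ler_pM2l.
- by move=> y; exists (c^-1 * y)%R; rewrite mulrA divff ?gt_eqF// mul1r.
Qed.

Definition tscale m (c : R) (x : m.-tuple R) : m.-tuple R :=
  [tuple (c * tnth x i)%R | i < m].

Lemma measurable_tscale m c : measurable_fun setT (@tscale m c).
Proof.
apply/measurable_fun_tnthP => i.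
rewrite (_ : _ \o _ = (fun x => c * tnth x i)%R).
  by apply: measurable_funM => //; exact: measurable_tnth.
by apply/funext => x /=; rewrite tnth_mktuple.
Qed.

Lemma tscale_tcons m c t (y : m.-tuple R) :
  tscale c (tcons (t, y)) = tcons (c * t, tscale c y)%R.
Proof.
apply: eq_from_tnth => i; rewrite tnth_mktuple.
by have [j ->|->] := unliftP ord0 i; rewrite ?tnth_tconsS ?tnth_mktuple.
Qed.

Lemma ge0_integral_scale m (c : R) (f : m.-tuple R -> \bar R) : (0 < c)%R ->
  measurable_fun setT f -> (forall x, 0 <= f x) ->
  \int[leb m]_x f (tscale c x) = (c ^- m)%:E * \int[leb m]_x f x.
Proof.
move=> c0; elim: m f => [|m IH] f mf f0.
  rewrite expr0 invr1 mul1e; apply: eq_integral => x _; congr f.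
  by apply: eq_from_tnth => -[].
have mfs : measurable_fun setT (fun x => f (tscale c x)).
  by apply: (measurableT_comp mf); exact: measurable_tscale.
rewrite !ge0_integral_tcons//.
transitivity (\int[mu]_t ((c ^- m)%:E * \int[leb m]_y f (tcons (c * t, y)%R))).
  apply: eq_integral => t _; rewrite -IH//.
    by apply: eq_integral => y _; rewrite tscale_tcons.
  exact: measurable_tcons_r.
have mF : @measurable_fun _ _ (measurableTypeR R) _ setT (fun t => \int[leb m]_y f (tcons (t, y))).
  apply: (@measurable_fun_fubini_tonelli_F _ _ _ _ _ _ (fun q => f (tcons (q.1, q.2)))).
  - apply: (@measurableT_comp _ _ _ _ _ _ f) => //.
    apply: (@measurableT_comp _ _ _ _ _ _ (@tcons R m)); first exact: measurable_tcons.
    exact: measurable_fun_pair.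
  - by move=> ?.
rewrite ge0_integralZl; first last.
- by rewrite lee_fin invr_ge0 exprn_ge0// ltW.
- by move=> t _; apply: integral_ge0.
- have mc : @measurable_fun _ _ (measurableTypeR R) (measurableTypeR R) setT (fun t => c * t)%R.
    exact: measurable_funM.
  exact: (measurableT_comp mF mc).
- by [].
rewrite (ge0_integral_scale1 c0 mF); first by rewrite muleA -EFinM exprS invfM mulrC.
by move=> t; apply: integral_ge0.
Qed.


End LebesgueTupleTheory.

(** * Lorentz boosts on the light cone *)

Section Boost.
Context {R : realType}.

(* The boost with velocity [v] in the first coordinate, acting on the spatial
   part of the light cone [{(|x|, x)}]. *)
Definition boost m (v : R) (x : m.+1.-tuple R) : m.+1.-tuple R :=
  tcons ((Num.sqrt (1 - v ^+ 2))^-1 * (thead x + v * enorm x), [tuple of behead x]).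

(** This one function is both the ratio of [enorm (boost v x)] to [enorm x] ([enorm_boost]) and the
    Jacobian of the boost ([boost1_derive]), only the first coordinate being moved. It expresses the
    Lorentz invariance of $dx/|x|$. *)
Definition boost_factor m (v : R) (x : m.+1.-tuple R) : R :=
  ((Num.sqrt (1 - v ^+ 2))^-1 * (1 + v * (thead x / enorm x))).

Lemma enorm_ge0 m (x : m.-tuple R) : (0 <= enorm x).
Proof. exact: sqrtr_ge0. Qed.

Lemma dotp_ge0 m (x : m.-tuple R) : (0 <= dotp x x).
Proof. by apply: sumr_ge0 => i _; rewrite -expr2 sqr_ge0. Qed.

Lemma sqr_enorm m (x : m.-tuple R) : (enorm x ^+ 2 = dotp x x).
Proof. by rewrite sqr_sqrtr// dotp_ge0. Qed.

Lemma dotp_tcons m t s (x y : m.-tuple R) :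
  dotp (tcons (t, x)) (tcons (s, y)) = (t * s + dotp x y).
Proof.
rewrite /dotp big_ord_recl !tnth_tcons0; congr (_ + _).
by apply: eq_bigr => i _; rewrite !tnth_tconsS.
Qed.


Section boost1.
Variables v s : R.
Hypotheses (v1 : (`|v| < 1)) (s0 : (0 < s)).
Let g := (Num.sqrt (1 - v ^+ 2))^-1.
(** The boost along a line parallel to the first axis, [s] being the squared norm of the other
    coordinates; $s>0$ keeps the square root differentiable. *)
Let b t := (g * (t + v * Num.sqrt (t ^+ 2 + s))).

Lemma gamma_subproof : (0 < 1 - v ^+ 2).
Proof. by rewrite subr_gt0 -real_normK ?num_real// expr_lt1. Qed.

Let g0 : (0 < g).
Proof. by rewrite invr_gt0 sqrtr_gt0 gamma_subproof. Qed.

Let g2 : (g ^+ 2 * (1 - v ^+ 2) = 1).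
Proof.
have h := gamma_subproof.
by rewrite exprVn sqr_sqrtr ?ltW// mulVf// gt_eqF.
Qed.

Let sq0 t : (0 < t ^+ 2 + s).
Proof. by rewrite ltr_wpDl// sqr_ge0. Qed.

Let lt_sqrt t : (`|t| < Num.sqrt (t ^+ 2 + s)).
Proof. by rewrite -sqrtr_sqr ltr_sqrt// ltrDl. Qed.

Let absv t : (0 < Num.sqrt (t ^+ 2 + s) + v * t).
Proof.
have vt : - (v * t) <= `|t|.
  by rewrite (le_trans (ler_norm _))// normrN normrM ler_piMl// ltW.
by have := lt_sqrt t; lra.
Qed.

Lemma boost1_inv t :
  (g * (b t - v * Num.sqrt (b t ^+ 2 + s)) = t).
Proof.
(* Lorentz invariance: the norm of the boosted vector is its boosted time component. *)
have -> : (b t ^+ 2 + s = (g * (Num.sqrt (t ^+ 2 + s) + v * t)) ^+ 2).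
  rewrite /b; have := g2; have := sqr_sqrtr (ltW (sq0 t)).
  move: (Num.sqrt _) => r r2 gg.
  transitivity (g ^+ 2 * (t + v * r) ^+ 2 + (g ^+ 2 * (1 - v ^+ 2)) * s).
    by rewrite gg; ring.
  have -> : s = (r ^+ 2 - t ^+ 2) by rewrite r2; ring.
  ring.
rewrite sqrtr_sqr gtr0_norm ?mulr_gt0// /b.
transitivity ((g ^+ 2 * (1 - v ^+ 2)) * t); first by ring.
by rewrite g2 mul1r.
Qed.

Lemma boost1_derive t :
  is_derive t (1 : R) b (g * (1 + v * (t / Num.sqrt (t ^+ 2 + s)))).
Proof.
have D1 : is_derive t (1 : R) (fun t => t ^+ 2 + s) (2 * t).
  have -> : (fun t => t ^+ 2 + s) = ((id : R -> R) ^+ 2 + cst s) by apply/funext.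
  by apply: is_derive_eq; rewrite addr0 [LHS]mulr1 expr1.
have D2 := @is_derive1_comp _ Num.sqrt (fun t => t ^+ 2 + s) _ _ _ (is_derive1_sqrt (sq0 t)) D1.
have -> : b = (g \*: ((id : R -> R) + v \*: (Num.sqrt \o (fun t => t ^+ 2 + s)))).
  by apply/funext.
apply: is_derive_eq; rewrite /GRing.scale/=.
congr (_ * (_ + _ * _)); rewrite invfM.
have : (Num.sqrt (t ^+ 2 + s) != 0) by rewrite gt_eqF// sqrtr_gt0.
by move: (Num.sqrt _) => r r0; field.
Qed.

(** The function $\sqrt{t^2+s}$ is 1-Lipschitz, so the term with the factor $v$, $|v|<1$, cannot
    outweigh the increase of $t$. *)
Lemma boost1_mono : {mono b : x y / (x <= y)}.
Proof.
apply: le_mono => x y xy; rewrite /b ltr_pM2l//.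
rewrite -subr_gt0.
have -> : (y + v * Num.sqrt (y ^+ 2 + s) - (x + v * Num.sqrt (x ^+ 2 + s)) =
  (y - x) + v * (Num.sqrt (y ^+ 2 + s) - Num.sqrt (x ^+ 2 + s))) by ring.
rewrite -ltrBlDr sub0r.
have yx0 : (0 < y - x) by rewrite subr_gt0.
apply: le_lt_trans (_ : `|v| * (y - x) < y - x); last by rewrite gtr_pMl.
rewrite (le_trans (ler_norm _))// normrN normrM ler_wpM2l//.
have sx := lt_sqrt x; have sy := lt_sqrt y.
have S0 : (0 < Num.sqrt (y ^+ 2 + s) + Num.sqrt (x ^+ 2 + s)).
  by rewrite addr_gt0// sqrtr_gt0.
rewrite -(ler_pM2r S0) -{1}(gtr0_norm S0) -normrM -subr_sqr !sqr_sqrtr ?ltW//.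
have -> : y ^+ 2 + s - (x ^+ 2 + s) = (y - x) * (y + x) by ring.
rewrite normrM (gtr0_norm yx0) ltr_pM2l//.
by rewrite (le_lt_trans (ler_normD _ _))// ltrD.
Qed.

End boost1.

End Boost.

(** * The surface measure under boosts and permutations of coordinates *)

Section LebesgueNull.
Context {R : realType}.
Notation mu := (@lebesgue_measure R).
Notation leb := (@lebesgue_tuple R).
Local Open Scope ereal_scope.

Lemma leb_enorm0 m : leb m.+1 [set x | enorm x = 0%R] = 0.
Proof.
apply/eqP; rewrite eq_le measure_ge0 andbT.
have mE : measurable [set x : m.+1.-tuple R | enorm x = 0%R].
  rewrite (_ : mkset _ = enorm @^-1` [set 0%R])//.
  by rewrite -[X in measurable X]setTI; exact: measurable_enorm.
pose N : set (m.+1.-tuple R) := [set x | tnth x ord0 = 0%R].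
have mN : measurable N.
  rewrite (_ : N = (fun x => tnth x ord0) @^-1` [set 0%R])//.
  by rewrite -[X in measurable X]setTI; exact: measurable_tnth.
apply: (@le_trans _ _ (leb m.+1 N)).
  rewrite le_measure ?inE// => x /= /eqP; rewrite sqrtr_eq0 /N /= => x0.
  apply/eqP; rewrite -sqrf_eq0 eq_le sqr_ge0 andbT (le_trans _ x0)//.
  rewrite /dotp big_ord_recl -expr2 lerDl sumr_ge0// => i _.
  by rewrite -expr2 sqr_ge0.
rewrite [X in X <= _](_ : _ = (mu \x leb m) ([set 0%R] `*` setT)); last first.
  congr (product_measure1 _ _ _); apply/seteqP; split => -[t y] //=.
    by move=> [->].
rewrite product_measure1E// [X in X * _](_ : _ = 0) ?mul0e//.
exact: lebesgue_measure_set1.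
Qed.

(** Serves to discard the origin, a null set where [sphere_proj] has an arbitrary value. *)
Lemma ge0_eq_integral_leb m (f g : m.+1.-tuple R -> \bar R) :
  measurable_fun setT f -> measurable_fun setT g ->
  (forall x, 0 <= f x) -> (forall x, 0 <= g x) ->
  (forall x, enorm x != 0%R -> f x = g x) ->
  \int[leb m.+1]_x f x = \int[leb m.+1]_x g x.
Proof.
move=> mf mg f0 g0 fg; apply: ge0_ae_eq_integral => //.
exists [set x | enorm x = 0%R]; split.
- rewrite (_ : mkset _ = enorm @^-1` [set 0%R])//.
  by rewrite -[X in measurable X]setTI; exact: measurable_enorm.
- exact: leb_enorm0.
- by move=> x /= /not_implyP[_ fgx]; apply: contra_notP fgx => /eqP /fg.
Qed.

End LebesgueNull.

Section BoostTuple.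
Context {R : realType} {m : nat} (v : R).
Hypothesis v1 : `|v| < 1.
Notation mu := (@lebesgue_measure R).
Notation leb := (@lebesgue_tuple R).

Lemma gamma_gt0 : 0 < (Num.sqrt (1 - v ^+ 2))^-1.
Proof. by rewrite invr_gt0 sqrtr_gt0 gamma_subproof. Qed.

Lemma sqr_gamma : (Num.sqrt (1 - v ^+ 2))^-1 ^+ 2 * (1 - v ^+ 2) = 1.
Proof.
have h := gamma_subproof v1.
by rewrite exprVn sqr_sqrtr ?ltW// mulVf// gt_eqF.
Qed.

Lemma thead_tcons k t (y : k.-tuple R) : thead (tcons (t, y)) = t.
Proof. by []. Qed.

Lemma enorm_tcons k t (y : k.-tuple R) :
  enorm (tcons (t, y)) = Num.sqrt (t ^+ 2 + dotp y y).
Proof. by rewrite /enorm dotp_tcons -expr2. Qed.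

Lemma boost_tcons k t (y : k.-tuple R) : boost v (tcons (t, y)) =
  tcons ((Num.sqrt (1 - v ^+ 2))^-1 * (t + v * Num.sqrt (t ^+ 2 + dotp y y)), y).
Proof.
rewrite /boost enorm_tcons thead_tcons; congr (tcons (_, _)).
exact/val_inj.
Qed.

Lemma normr_thead k (x : k.+1.-tuple R) : `|thead x| <= enorm x.
Proof.
rewrite -sqrtr_sqr ler_wsqrtr// /dotp big_ord_recl -expr2 lerDl sumr_ge0// => i _.
by rewrite -expr2 sqr_ge0.
Qed.

Lemma boost_factor_gt0 k (x : k.+1.-tuple R) : 0 < boost_factor v x.
Proof.
rewrite mulr_gt0 ?gamma_gt0//.
have h : `|v * (thead x / enorm x)| < 1.
  rewrite normrM (le_lt_trans _ v1)// ler_piMr//.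
  have [->|x0] := eqVneq (enorm x) 0; first by rewrite invr0 mulr0 normr0.
  rewrite normrM normfV (ger0_norm (enorm_ge0 x)) ler_pdivrMr ?mul1r ?normr_thead//.
  by rewrite lt0r x0 enorm_ge0.
by move: h; rewrite ltr_norml => /andP[]; lra.
Qed.

Lemma enorm_boost k (x : k.+1.-tuple R) : enorm x != 0 ->
  enorm (boost v x) = enorm x * boost_factor v x.
Proof.
move=> x0; have xpos : 0 < enorm x by rewrite lt0r x0 enorm_ge0.
rewrite /boost /boost_factor enorm_tcons.
set y := [tuple of behead x].
have e2 : enorm x ^+ 2 = thead x ^+ 2 + dotp y y.
  by rewrite sqr_enorm [in LHS](tcons_eta x) dotp_tcons -expr2.
have g2 := sqr_gamma; set g := (_)^-1 in g2 *.
have -> : (g * (thead x + v * enorm x)) ^+ 2 + dotp y y =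
    (enorm x * (g * (1 + v * (thead x / enorm x)))) ^+ 2.
  have -> : dotp y y = enorm x ^+ 2 - thead x ^+ 2 by rewrite e2; ring.
  have -> : enorm x * (g * (1 + v * (thead x / enorm x))) = g * (enorm x + v * thead x).
    by field.
  transitivity (g ^+ 2 * (thead x + v * enorm x) ^+ 2 +
    (g ^+ 2 * (1 - v ^+ 2)) * (enorm x ^+ 2 - thead x ^+ 2)); last by ring.
  by rewrite g2; ring.
rewrite sqrtr_sqr ger0_norm// mulr_ge0 ?enorm_ge0//.
exact: ltW (boost_factor_gt0 x).
Qed.

Lemma measurable_thead k : measurable_fun setT (fun x : k.+1.-tuple R => thead x).
Proof. exact: measurable_tnth. Qed.

Lemma measurable_boost k : measurable_fun setT (@boost R k v).
Proof.
apply: (@measurableT_comp _ _ _ _ _ _ (@tcons R k)); first exact: measurable_tcons.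
apply: measurable_fun_pair; last exact: measurable_behead.
apply: measurable_funM => //; apply: measurable_funD; first exact: measurable_thead.
by apply: measurable_funM => //; exact: measurable_enorm.
Qed.

Lemma measurable_funV (d : measure_display) (T : measurableType d) (f : T -> R) :
  measurable_fun setT f -> measurable_fun setT (fun x => (f x)^-1).
Proof.
move=> mf; rewrite (_ : (fun x => _) =
    (fun x => if f x < 0 then - ((- f x) `^ (-1)) else (f x) `^ (-1))).
  apply: measurable_fun_ifT.
  - exact: measurable_fun_ltr.
  - apply: measurableT_comp => //.
    apply: (measurableT_comp (measurable_powR _)); exact: measurableT_comp.
  - exact: (measurableT_comp (measurable_powR _)).
apply/funext => x; case: ifPn; rewrite -?leNgt => fx.
  by rewrite powR_inv1 ?oppr_ge0 ?ltW// invrN opprK.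
by rewrite powR_inv1.
Qed.

Lemma measurable_boost_factor k : measurable_fun setT (@boost_factor R k v).
Proof.
apply: measurable_funM => //; apply: measurable_funD => //.
apply: measurable_funM => //; apply: measurable_funM; first exact: measurable_thead.
by apply: measurable_funV; exact: measurable_enorm.
Qed.

Lemma continuous_sqrt_sqrD (c : R) : continuous (fun t : R => Num.sqrt (t ^+ 2 + c)).
Proof.
have cX : continuous (fun t : R => t ^+ 2 + c).
  by move=> t; apply: cvgD; [exact: exprn_continuous|exact: cvg_cst].
by move=> t; apply: (continuous_comp (cX t)); exact: sqrt_continuous.
Qed.

Local Open Scope ereal_scope.

Lemma measurable_fun_fubini_tcons2 k (f : k.+1.-tuple R -> \bar R) :
  measurable_fun setT f -> (forall x, 0 <= f x) ->
  measurable_fun setT (fun y : k.-tuple R => \int[mu]_t f (tcons (t, y))).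
Proof.
move=> mf f0.
apply: (@measurable_fun_fubini_tonelli_G _ _ _ _ R mu (fun q => f (tcons (q.1, q.2)))).
- apply: (@measurableT_comp _ _ _ _ _ _ f) => //.
  apply: (@measurableT_comp _ _ _ _ _ _ (@tcons R k)); first exact: measurable_tcons.
  exact: measurable_fun_pair.
- by move=> ?.
Qed.

(** On each line parallel to the first axis this is the one-dimensional change of variable. With at
    least two coordinates the line through the origin, where $s=0$, belongs to a null set of
    fibres. *)
Lemma ge0_integral_boost (f : m.+2.-tuple R -> \bar R) :
  measurable_fun setT f -> (forall x, 0 <= f x) ->
  \int[leb m.+2]_x (f (boost v x) * (boost_factor v x)%:E) =
  \int[leb m.+2]_x f x.
Proof.
move=> mf f0.
have bf0 x : 0 <= (@boost_factor R m.+1 v x)%:E by rewrite lee_fin ltW// boost_factor_gt0.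
have mfb : measurable_fun setT (fun x : m.+2.-tuple R => f (boost v x) * (boost_factor v x)%:E).
  apply: emeasurable_funM; first by apply: (measurableT_comp mf); exact: measurable_boost.
  by apply/measurable_EFinP; exact: measurable_boost_factor.
have fb0 (x : m.+2.-tuple R) : 0 <= f (boost v x) * (boost_factor v x)%:E.
  by rewrite mule_ge0.
rewrite (ge0_integral_tcons2 mf f0) (ge0_integral_tcons2 mfb fb0).
apply: ge0_eq_integral_leb.
- exact: (measurable_fun_fubini_tcons2 mfb fb0).
- exact: (measurable_fun_fubini_tcons2 mf f0).
- by move=> y; apply: integral_ge0.
- by move=> y; apply: integral_ge0.
move=> y y0.
have s0 : (0 < dotp y y)%R.
  by rewrite -sqr_enorm exprn_gt0// lt0r y0 enorm_ge0.
under eq_integral do rewrite boost_tcons /boost_factor thead_tcons enorm_tcons.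
have := @ge0_integral_diffeo R _ _ (fun t => f (tcons (t, y))) _ _ (boost1_derive v s0)
  (boost1_mono v1 s0).
apply.
- move=> t; have := boost_factor_gt0 (tcons (t, y)).
  by rewrite /boost_factor thead_tcons enorm_tcons => /ltW.
- move=> t; apply: cvgM; first exact: cvg_cst.
  apply: cvgD; first exact: cvg_cst.
  apply: cvgM; first exact: cvg_cst.
  apply: cvgM; first exact: cvg_id.
  apply: cvgV; first by rewrite gt_eqF// sqrtr_gt0 ltr_wpDl// sqr_ge0.
  exact: continuous_sqrt_sqrD.
- move=> t.
  exists ((Num.sqrt (1 - (- v) ^+ 2))^-1 * (t + - v * Num.sqrt (t ^+ 2 + dotp y y)))%R.
  have vN : (`|- v| < 1)%R by rewrite normrN.
  rewrite -[RHS](boost1_inv vN s0 t) !sqrrN.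
  have hv (z : R) : (v * z = - (- v * z))%R by rewrite mulNr opprK.
  by congr (_ * (_ + _))%R; exact: hv.
- exact: measurable_tcons_l.
- by move=> t.
Qed.

End BoostTuple.

(** * Boosts acting on the sphere *)

Section SphereProj.
Context {R : realType} {n : nat}.
Notation S := (sphere R n).
Notation T := (n.+1.-tuple R).

Lemma enorm_val (w : S) : enorm (val w) = 1.
Proof. by apply/eqP; exact: (valP w). Qed.

Lemma enorm_tscale m (c : R) (x : m.-tuple R) : 0 <= c ->
  enorm (tscale c x) = c * enorm x.
Proof.
move=> c0; rewrite /enorm (_ : dotp (tscale c x) _ = c ^+ 2 * dotp x x).
  by rewrite sqrtrM ?sqr_ge0// sqrtr_sqr ger0_norm.
rewrite /dotp mulr_sumr; apply: eq_bigr => i _; rewrite !tnth_mktuple; ring.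
Qed.

Lemma val_sphere_proj (x : T) : enorm x != 0 ->
  val (sphere_proj x) = tscale (enorm x)^-1 x.
Proof.
move=> x0; have xpos : 0 < enorm x by rewrite lt0r x0 enorm_ge0.
rewrite /sphere_proj val_insubd.
have -> : [tuple tnth x i / enorm x | i < n.+1] = tscale (enorm x)^-1 x.
  by apply: eq_from_tnth => i; rewrite !tnth_mktuple mulrC.
by rewrite enorm_tscale ?invr_ge0 ?ltW// mulVf// eqxx.
Qed.

Lemma sphere_proj_tscale (c : R) (x : T) : 0 < c ->
  sphere_proj (tscale c x) = sphere_proj x.
Proof.
move=> c0.
have [x0|x0] := eqVneq (enorm x) 0; last first.
  have cx0 : enorm (tscale c x) != 0.
    by rewrite enorm_tscale ?ltW// mulf_neq0// gt_eqF.
  apply: val_inj; rewrite !val_sphere_proj// enorm_tscale ?ltW//.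
  apply: eq_from_tnth => i; rewrite !tnth_mktuple.
  by field; rewrite x0 gt_eqF.
have x0' i : tnth x i = 0.
  apply/eqP; rewrite -sqrf_eq0 eq_le sqr_ge0 andbT.
  have : dotp x x <= 0 by rewrite -sqr_enorm x0 expr0n.
  apply: le_trans; rewrite /dotp (bigD1 i)//= -expr2 lerDl sumr_ge0// => j _.
  by rewrite -expr2 sqr_ge0.
congr sphere_proj; apply: eq_from_tnth => i.
by rewrite tnth_mktuple x0' mulr0.
Qed.

Lemma measurable_val : measurable_fun setT (val : S -> T).
Proof. by move=> _ A mA; rewrite setTI; exists A => //; rewrite setTI. Qed.

Lemma tscale_thead m (c : R) (x : m.+1.-tuple R) : thead (tscale c x) = c * thead x.
Proof. by rewrite /thead tnth_mktuple. Qed.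

Lemma boost_tscale m v (c : R) (x : m.+1.-tuple R) : 0 <= c ->
  boost v (tscale c x) = tscale c (boost v x).
Proof.
move=> c0; rewrite [in RHS]/boost tscale_tcons /boost enorm_tscale// tscale_thead.
congr (tcons (_, _)); first by ring.
by apply: eq_from_tnth => i; rewrite tnth_mktuple !tnth_behead tnth_mktuple.
Qed.

Lemma boost_factor_tscale m v (c : R) (x : m.+1.-tuple R) : 0 < c ->
  boost_factor v (tscale c x) = boost_factor v x.
Proof.
move=> c0; rewrite /boost_factor enorm_tscale ?ltW// tscale_thead.
rewrite -mulf_div divff ?gt_eqF// mul1r//.
Qed.

Definition sboost (v : R) (w : S) : S := sphere_proj (boost v (val w)).
Definition kappa (v : R) (w : S) : R := boost_factor v (val w).

Lemma measurable_sboost v : measurable_fun setT (sboost v).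
Proof.
apply: (measurableT_comp measurable_sphere_proj).
apply: (@measurableT_comp _ _ _ _ _ _ (boost v)); first exact: measurable_boost.
exact: measurable_val.
Qed.

Lemma measurable_kappa v : measurable_fun setT (kappa v).
Proof.
apply: (@measurableT_comp _ _ _ _ _ _ (boost_factor v)).
  exact: measurable_boost_factor.
exact: measurable_val.
Qed.

Lemma sphere_proj_boost v (x : T) : enorm x != 0 ->
  sphere_proj (boost v x) = sboost v (sphere_proj x).
Proof.
move=> x0; have xpos : 0 < enorm x by rewrite lt0r x0 enorm_ge0.
rewrite /sboost val_sphere_proj// boost_tscale ?invr_ge0 ?ltW//.
by rewrite sphere_proj_tscale// invr_gt0.
Qed.

Lemma boost_factor_proj v (x : T) : enorm x != 0 ->
  boost_factor v x = kappa v (sphere_proj x).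
Proof.
move=> x0; have xpos : 0 < enorm x by rewrite lt0r x0 enorm_ge0.
by rewrite /kappa val_sphere_proj// boost_factor_tscale// invr_gt0.
Qed.

End SphereProj.

(** * Surface integrals as integrals over Euclidean space *)

Section Polar.
Context {R : realType} {n : nat}.
Notation S := (sphere R n).
Notation T := (n.+1.-tuple R).
Notation mu := (@lebesgue_measure R).
Notation leb := (@lebesgue_tuple R).
Notation dw := (@surface R n).
Local Open Scope ereal_scope.

Let ball_ind (x : T) : R := \1_unit_ball x.

Let mball_ind : measurable_fun setT ball_ind.
Proof. by apply: measurable_indic; exact: measurable_unit_ball. Qed.

Let ball_ind0 x : (0 <= ball_ind x)%R. Proof. by []. Qed.

Lemma ge0_integral_dw (f : S -> \bar R) :
  measurable_fun setT f -> (forall x, 0 <= f x) ->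
  \int[dw]_w f w = n.+1%:R%:E *
    \int[leb n.+1]_x (f (sphere_proj x) * (\1_unit_ball x)%:E).
Proof.
move=> mf f0.
have mp := @measurable_sphere_proj R n.
rewrite -(ge0_integral_density (leb n.+1) ball_ind0 mball_ind (f := fun x => f (sphere_proj x)));
  [|exact: (measurableT_comp mf)|by move=> x].
rewrite -(@ge0_integral_pushforward _ _ _ _ R _ mp (density (leb n.+1) ball_ind0 mball_ind) setT f)//.
have n0 : (0 <= n.+1%:R :> R)%R by [].
rewrite -[in RHS](ge0_integral_mscale _ measurableT (NngNum n0))//.
apply: eq_measure_integral => A mA _.
rewrite -[RHS]/(n.+1%:R%:E * density (leb n.+1) ball_ind0 mball_ind (sphere_proj @^-1` A)).
rewrite densityE integral_indic//.
- by rewrite -[X in measurable X]setTI; exact: mp.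
- exact: measurable_unit_ball.
Qed.

(* The integral of ds/s over (r, rho) is invariant under scaling of (r, rho), so
   that integrating a function of x/|x| against it turns a change of radius by a
   function of the direction into the power rho^(n+1); this replaces polar
   coordinates. *)
Definition log_weight (r rho : R) : \bar R :=
  \int[mu]_s (if (r < s) && (s < rho) then s^-1 else 0)%R%:E.

Lemma log_weight_ge0 r rho : (0 <= r)%R -> 0 <= log_weight r rho.
Proof.
move=> r0; apply: integral_ge0 => s _; rewrite lee_fin; case: ifPn => // /andP[rs _].
by rewrite invr_ge0 (le_trans r0)// ltW.
Qed.


Lemma log_weight_scale (c r rho : R) : (0 < c)%R -> (0 <= r)%R ->
  log_weight (r * c) (rho * c) = log_weight r rho.
Proof.
move=> c0 r0; pose f s : \bar R := (if (r * c < s) && (s < rho * c) then s^-1 else 0)%R%:E.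
have f0 s : 0 <= f s.
  rewrite lee_fin; case: ifPn => // /andP[rs _].
  by rewrite invr_ge0 (le_trans _ (ltW rs))// mulr_ge0// ltW.
have mf : @measurable_fun _ _ (measurableTypeR R) _ setT f.
  apply/measurable_EFinP; apply: measurable_fun_ifT => //.
    by apply: measurable_and; apply: measurable_fun_ltr.
  exact: measurable_funV.
have := ge0_integral_scale1 c0 mf f0.
move/(congr1 (fun z => c%:E * z)); rewrite muleA -EFinM divff ?gt_eqF// mul1e.
rewrite -/(log_weight _ _) => <-.
rewrite -ge0_integralZl; first last.
- by rewrite lee_fin ltW.
- by move=> s _; exact: f0.
- have mc : @measurable_fun _ _ (measurableTypeR R) (measurableTypeR R) setT (fun t => c * t)%R.
    exact: measurable_funM.
  exact: (measurableT_comp mf mc).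
- by [].
apply: eq_integral => s _; rewrite /f -EFinM; congr EFin.
rewrite ![(_ * c)%R]mulrC !ltr_pM2l//; case: ifPn => _; last by rewrite mulr0.
by rewrite invfM mulrA divff ?gt_eqF// mul1r.
Qed.

Lemma integral_itv0_exprn (rho : R) : (0 < rho)%R ->
  \int[mu]_s (if (0 < s) && (s < rho) then s ^+ n else 0)%R%:E =
  (rho ^+ n.+1 / n.+1%:R)%:E.
Proof.
move=> rho0.
have cX : continuous (fun s : R => s ^+ n)%R by exact: exprn_continuous.
transitivity (\int[mu]_(s in `]0%R, rho[) (s ^+ n)%:E).
  rewrite [RHS]integral_mkcond; apply: eq_integral => s _.
  by rewrite patchE mem_setE in_itv/=; case: ifPn.
rewrite -(@integral_itv_bndoo R 0%R rho _ true false); last first.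
  apply/measurable_EFinP/measurable_funTS; exact: continuous_measurable_fun.
have D (s : R) : is_derive s (1%R : R) (fun s => n.+1%:R^-1 * s ^+ n.+1)%R (s ^+ n)%R.
  have -> : (fun s => n.+1%:R^-1 * s ^+ n.+1)%R =
      (n.+1%:R^-1 \*: ((id : R -> R) ^+ n.+1)%R).
    by apply/funext => z; rewrite /= fctE.
  apply: is_derive_eq; rewrite /GRing.scale/= mulr1 mulrA mulVf ?mul1r//.
rewrite (@continuous_FTC2 _ (fun s => s ^+ n)%R (fun s => n.+1%:R^-1 * s ^+ n.+1)%R)//.
- by rewrite expr0n/= mulr0 sube0 mulrC.
- exact: continuous_subspaceT.
- have cF : continuous (fun s : R => n.+1%:R^-1 * s ^+ n.+1)%R.
    move=> s; apply/differentiable_continuous/derivable1_diffP.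
    by have [] := D s.
  split; first by move=> s _; have [] := D s.
  + exact/cvg_at_right_filter/cF.
  + exact/cvg_at_left_filter/cF.
- by move=> s _; rewrite derive1E; apply: derive_val.
Qed.

Lemma measurable_log_weight (d : measure_display) (X : measurableType d) (a b : X -> R) :
  measurable_fun setT a -> measurable_fun setT b -> (forall x, 0 <= a x)%R ->
  measurable_fun setT (fun x => log_weight (a x) (b x)).
Proof.
move=> ma mb a0.
apply: (@measurable_fun_fubini_tonelli_F _ _ X (measurableTypeR R) R mu
  (fun q => (if (a q.1 < q.2) && (q.2 < b q.1) then q.2^-1 else 0)%R%:E)).
- apply/measurable_EFinP; apply: measurable_fun_ifT => //.
    apply: measurable_and; apply: measurable_fun_ltr => //.
      exact: (measurableT_comp ma measurable_fst).
    exact: (measurableT_comp mb measurable_fst).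
  exact: measurable_funV.
- move=> q; rewrite lee_fin; case: ifPn => // /andP[rs _].
  by rewrite invr_ge0 (le_trans _ (ltW rs)).
Qed.

Let measurable_inv_ind (a b : R) : @measurable_fun _ _ (measurableTypeR R) _ setT
  (fun s : R => (if (a < s) && (s < b) then s^-1 else 0)%R%:E).
Proof.
apply/measurable_EFinP; apply: measurable_fun_ifT => //.
  by apply: measurable_and; apply: measurable_fun_ltr.
exact: measurable_funV.
Qed.

Let measurable_pow_ind (c : bool) (b : R) : @measurable_fun _ _ (measurableTypeR R) _ setT
  (fun s : R => (if c && (0 < s) && (s < b) then s ^+ n else 0)%R%:E).
Proof.
apply/measurable_EFinP; apply: measurable_fun_ifT => //.
  apply: measurable_and; last exact: measurable_fun_ltr.
  by apply: measurable_and => //; apply: measurable_fun_ltr.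
Qed.

(** For fixed $s$, dilating $x$ by $s$ turns the domain $|x|<s$ into the unit ball and $s^{-1}$ into
    $s^n$, while the direction of $x$, and so [rho], is unchanged. Integrating $s^n$ over $(0,\rho)$
    gives the power. *)
Lemma integral_log_weight (F : S -> \bar R) (rho : S -> R) :
  measurable_fun setT F -> (forall w, 0 <= F w) ->
  measurable_fun setT rho -> (forall w, (0 < rho w)%R) ->
  \int[leb n.+1]_x (F (sphere_proj x) * log_weight (enorm x) (rho (sphere_proj x))) =
  \int[leb n.+1]_x (F (sphere_proj x) * (rho (sphere_proj x) ^+ n.+1 / n.+1%:R)%:E *
    (\1_unit_ball x)%:E).
Proof.
move=> mF F0 mrho rho0.
have mp := @measurable_sphere_proj R n.
have mFp : measurable_fun setT (fun x : T => F (sphere_proj x)).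
  exact: (measurableT_comp mF mp).
have mrp : measurable_fun setT (fun x : T => rho (sphere_proj x)).
  exact: (measurableT_comp mrho mp).
have me : measurable_fun setT (fun x : T => enorm x) by exact: measurable_enorm.
pose K (x : T) (s : R) : \bar R := F (sphere_proj x) *
  (if (enorm x < s) && (s < rho (sphere_proj x)) then s^-1 else 0)%R%:E.
pose L (x : T) (s : R) : \bar R := F (sphere_proj x) *
  (if (enorm x < 1) && (0 < s) && (s < rho (sphere_proj x)) then s ^+ n else 0)%R%:E.
have K0 x s : 0 <= K x s.
  rewrite mule_ge0// lee_fin; case: ifPn => // /andP[rs _].
  by rewrite invr_ge0 (le_trans _ (ltW rs))// enorm_ge0.
have L0 x s : 0 <= L x s.
  rewrite mule_ge0// lee_fin; case: ifPn => // /andP[/andP[_ s0] _].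
  by rewrite exprn_ge0// ltW.
have m1 (X : T -> R) : measurable_fun setT X ->
    measurable_fun setT (fun q : T * measurableTypeR R => X q.1).
  by move=> mX; exact: (measurableT_comp mX measurable_fst).
have mK : measurable_fun setT (fun q : T * measurableTypeR R => K q.1 q.2).
  apply: emeasurable_funM; first exact: (measurableT_comp mFp measurable_fst).
  apply/measurable_EFinP; apply: measurable_fun_ifT => //.
    by apply: measurable_and; apply: measurable_fun_ltr => //; [exact: (m1 _ me)|exact: (m1 _ mrp)].
  exact: measurable_funV.
have mL : measurable_fun setT (fun q : T * measurableTypeR R => L q.1 q.2).
  apply: emeasurable_funM; first exact: (measurableT_comp mFp measurable_fst).
  apply/measurable_EFinP; apply: measurable_fun_ifT => //.
    apply: measurable_and; first apply: measurable_and.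
    + by apply: measurable_fun_ltr => //; exact: (m1 _ me).
    + by apply: measurable_fun_ltr.
    + by apply: measurable_fun_ltr => //; exact: (m1 _ mrp).
  exact: measurable_funX.
transitivity (\int[leb n.+1]_x \int[mu]_s K x s).
  apply: eq_integral => x _; rewrite /log_weight -ge0_integralZl//.
  move=> s _; rewrite lee_fin; case: ifPn => // /andP[rs _].
  by rewrite invr_ge0 (le_trans _ (ltW rs))// enorm_ge0.
transitivity (\int[mu]_s \int[leb n.+1]_x K x s).
  exact: (@fubini_tonelli _ _ _ _ R (leb n.+1) mu (fun q => K q.1 q.2)).
transitivity (\int[mu]_s \int[leb n.+1]_x L x s); last first.
  transitivity (\int[leb n.+1]_x \int[mu]_s L x s).
    exact/esym/(@fubini_tonelli _ _ _ _ R (leb n.+1) mu (fun q => L q.1 q.2)).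
  apply: eq_integral => x _.
  rewrite /L ge0_integralZl; first last.
  - exact: F0.
  - move=> s _; rewrite lee_fin; case: ifPn => // /andP[/andP[_ s0] _].
    by rewrite exprn_ge0// ltW.
  - exact: measurable_pow_ind.
  - by [].
  rewrite -muleA; congr (_ * _).
  have [x1|x1] := ltP (enorm x) 1%R.
    by rewrite indicE mem_set// mule1 -integral_itv0_exprn.
  rewrite indicE memNset ?mule0; last by apply/negP; rewrite -leNgt.
  exact: integral0.
apply: eq_integral => s _.
have mKs : measurable_fun setT (fun x : T => K x s).
  exact: (measurableT_comp mK (measurable_pair2 _)).
have [s0|s0] := leP s 0%R.
  apply: eq_integral => x _; rewrite /K /L; congr (_ * _%:E).
  by rewrite !ltNge s0 (le_trans s0 (enorm_ge0 x))/= andbF.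
rewrite -[LHS]mul1e (_ : 1 = (s ^+ n.+1)%:E * (s ^- n.+1)%:E); last first.
  by rewrite -EFinM divff// gt_eqF// exprn_gt0.
rewrite -muleA -(ge0_integral_scale s0 mKs (fun=> K0 _ _)).
rewrite -ge0_integralZl; [|by []| | |].
  + apply: eq_integral => x _; rewrite /K /L muleCA; congr (_ * _).
      by rewrite sphere_proj_tscale.
    rewrite sphere_proj_tscale// enorm_tscale ?ltW// s0 andbT.
    rewrite -[X in (_ < X)%R]mulr1 ltr_pM2l// -EFinM.
    case: ifPn => _; last by rewrite mulr0.
    by rewrite exprSr mulfK// gt_eqF.
  + exact: (measurableT_comp mKs (@measurable_tscale R n.+1 s)).
  + by move=> x _; exact: K0.
  + by rewrite lee_fin exprn_ge0// ltW.
Qed.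

End Polar.

Section SphereBoost.
Context {R : realType} {n : nat} (v : R).
Hypothesis v1 : `|v| < 1.
Notation S := (sphere R n.+1).
Notation T := (n.+2.-tuple R).
Notation leb := (@lebesgue_tuple R).
Notation dw := (@surface R n.+1).

Lemma kappa_gt0 (w : S) : 0 < kappa v w.
Proof. exact: boost_factor_gt0. Qed.

Local Open Scope ereal_scope.

Lemma ge0_integral_dw_log_weight (f : S -> \bar R) (rho : S -> R) :
  measurable_fun setT f -> (forall w, 0 <= f w) ->
  measurable_fun setT rho -> (forall w, (0 < rho w)%R) ->
  \int[leb n.+2]_x (f (sphere_proj x) * log_weight (enorm x) (rho (sphere_proj x))) =
  (n.+2%:R ^- 2)%:E * \int[dw]_w (f w * (rho w ^+ n.+2)%:E).
Proof.
move=> mf f0 mrho rho0.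
have mr : measurable_fun setT (fun w => f w * (rho w ^+ n.+2)%:E).
  apply: emeasurable_funM => //; apply/measurable_EFinP; exact: measurable_funX.
have r0 w : 0 <= f w * (rho w ^+ n.+2)%:E.
  by rewrite mule_ge0// lee_fin exprn_ge0// ltW.
rewrite integral_log_weight// ge0_integral_dw// muleA -EFinM.
have -> : (n.+2%:R ^- 2 * n.+2%:R = n.+2%:R^-1 :> R)%R.
  by rewrite expr2 invfM mulfVK.
rewrite -ge0_integralZl//.
- apply: eq_integral => x _; rewrite muleA; congr (_ * _).
  by rewrite muleCA -EFinM mulrC.
- apply: emeasurable_funM; first exact: (measurableT_comp mr measurable_sphere_proj).
  apply/measurable_EFinP; apply: measurable_indic; exact: measurable_unit_ball.
- by move=> x _; rewrite mule_ge0// lee_fin.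
Qed.

(** Apply the boost in $\mathbb R^{n+2}$ to $f(x/|x|)$ times [log_weight (enorm x) 1]. It multiplies
    $|x|$ by $\kappa$, which by scaling moves the outer radius to $1/\kappa$ and yields
    $\kappa^{-(n+2)}$; the Jacobian of the boost restores one factor $\kappa$. *)
Lemma ge0_integral_sboost (f : S -> \bar R) :
  measurable_fun setT f -> (forall w, 0 <= f w) ->
  \int[dw]_w (f (sboost v w) * (kappa v w ^- n.+1)%:E) = \int[dw]_w f w.
Proof.
move=> mf f0.
have mk := @measurable_kappa R n.+1 v.
have mfb : measurable_fun setT (fun w => f (sboost v w)).
  exact: (measurableT_comp mf (@measurable_sboost R n.+1 v)).
have k0 (w : S) : (0 < kappa v w)%R by exact: kappa_gt0.
have kV0 (w : S) : (0 < (kappa v w)^-1)%R by rewrite invr_gt0.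
have mkV : measurable_fun setT (fun w : S => (kappa v w)^-1)%R by exact: measurable_funV.
have mp := @measurable_sphere_proj R n.+1.
have me : measurable_fun setT (fun x : T => enorm x) by exact: measurable_enorm.
have e0 (x : T) : (0 <= enorm x)%R by exact: enorm_ge0.
pose g (x : T) := f (sphere_proj x) * log_weight (enorm x) 1%R.
have mg : measurable_fun setT g.
  apply: emeasurable_funM; first exact: (measurableT_comp mf mp).
  by apply: measurable_log_weight.
have g0 x : 0 <= g x by rewrite mule_ge0// log_weight_ge0.
pose h (w : S) := f (sboost v w) * (kappa v w)%:E.
have mh : measurable_fun setT h by apply: emeasurable_funM => //; exact/measurable_EFinP.
have h0 w : 0 <= h w by rewrite mule_ge0// lee_fin ltW.
have : \int[leb n.+2]_x g x = (n.+2%:R ^- 2)%:E * \int[dw]_w f w.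
  rewrite (@ge0_integral_dw_log_weight f (cst 1%R))//.
  by congr (_ * _); apply: eq_integral => w _; rewrite expr1n mule1.
rewrite -(ge0_integral_boost v1 mg g0).
rewrite (@ge0_eq_integral_leb _ _ _ (fun x => h (sphere_proj x) *
    log_weight (enorm x) (kappa v (sphere_proj x))^-1)); first last.
- move=> x x0; rewrite /g /h sphere_proj_boost// enorm_boost// -boost_factor_proj//.
  rewrite muleAC; congr (_ * _).
  have bf0 : (0 < boost_factor v x)%R by exact: boost_factor_gt0.
  rewrite -[LHS](@log_weight_scale R (boost_factor v x)^-1%R) ?invr_gt0// ?mul1r.
    by rewrite mulfK// gt_eqF.
  by rewrite mulr_ge0// ltW.
- by move=> x; rewrite mule_ge0// log_weight_ge0.
- by move=> x; rewrite mule_ge0// lee_fin ltW// boost_factor_gt0.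
- apply: emeasurable_funM; first exact: (measurableT_comp mh mp).
  by apply: measurable_log_weight => //; exact: (measurableT_comp mkV mp).
- apply: emeasurable_funM; first exact: (measurableT_comp mg (@measurable_boost R v n.+1)).
  by apply/measurable_EFinP; exact: measurable_boost_factor.
rewrite (@ge0_integral_dw_log_weight h (fun w => (kappa v w)^-1)%R)//.
have N0 : (n.+2%:R ^- 2 != 0 :> R)%R by rewrite invr_eq0 expf_neq0.
move=> /(congr1 (fun z => ((n.+2%:R ^- 2)^-1)%:E * z)).
rewrite !muleA -EFinM mulVf// !mul1e => <-.
apply: eq_integral => w _; rewrite /h -muleA -EFinM; congr (_ * _%:E).
by rewrite exprVn [in RHS]exprS invfM mulrA divff ?mul1r// gt_eqF.
Qed.


Lemma integral_sboost (f : S -> \bar R) : measurable_fun setT f ->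
  \int[dw]_w (f (sboost v w) * (kappa v w ^- n.+1)%:E) = \int[dw]_w f w.
Proof.
move=> mf; rewrite [LHS]integralE [RHS]integralE.
have J0 (w : S) : 0 <= (kappa v w ^- n.+1)%:E.
  by rewrite lee_fin invr_ge0 exprn_ge0// ltW// kappa_gt0.
congr (_ - _).
- rewrite -[RHS]ge0_integral_sboost//; last exact: measurable_funepos.
  apply: eq_integral => w _; rewrite !funeposE.
  by rewrite maxe_pMl// mul0e.
- rewrite -[RHS]ge0_integral_sboost//; last exact: measurable_funeneg.
  apply: eq_integral => w _; rewrite !funenegE.
  by rewrite maxe_pMl// mul0e mulNe.
Qed.

End SphereBoost.

Section SphereSwap.
Context {R : realType} {n : nat} (a : 'I_n.+1).
Notation S := (sphere R n).
Notation T := (n.+1.-tuple R).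
Notation leb := (@lebesgue_tuple R).
Notation dw := (@surface R n).

Lemma dotp_tswap (x y : T) : dotp (tswap a x) (tswap a y) = dotp x y.
Proof.
rewrite /dotp [RHS](reindex_inj (@perm_inj _ (tperm ord0 a)))/=.
by apply: eq_bigr => i _; rewrite !tnth_mktuple.
Qed.

Lemma enorm_tswap (x : T) : enorm (tswap a x) = enorm x.
Proof. by rewrite /enorm dotp_tswap. Qed.

Definition sswap (w : S) : S := sphere_proj (tswap a (val w)).

Lemma val_sswap w : val (sswap w) = tswap a (val w).
Proof.
rewrite val_sphere_proj enorm_tswap enorm_val ?oner_neq0//.
by apply: eq_from_tnth => i; rewrite tnth_mktuple invr1 mul1r.
Qed.

Lemma measurable_sswap : measurable_fun setT sswap.
Proof.
apply: (measurableT_comp measurable_sphere_proj).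
apply: (@measurableT_comp _ _ _ _ _ _ (tswap a)); first exact: measurable_tswap.
exact: measurable_val.
Qed.

Local Open Scope ereal_scope.

Lemma ge0_integral_sswap (f : S -> \bar R) :
  measurable_fun setT f -> (forall w, 0 <= f w) ->
  \int[dw]_w f (sswap w) = \int[dw]_w f w.
Proof.
move=> mf f0.
have mp := @measurable_sphere_proj R n.
have mfs : measurable_fun setT (f \o sswap) by exact: (measurableT_comp mf measurable_sswap).
have mb : measurable_fun setT (fun x : T => (\1_unit_ball x)%:E : \bar R).
  by apply/measurable_EFinP/measurable_indic; exact: measurable_unit_ball.
have mg : measurable_fun setT (fun x => f (sphere_proj x) * (\1_unit_ball x)%:E).
  by apply: emeasurable_funM => //; exact: (measurableT_comp mf mp).
have g0 x : 0 <= f (sphere_proj x) * (\1_unit_ball x)%:E.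
  by rewrite mule_ge0// lee_fin.
apply: (etrans (ge0_integral_dw mfs (fun=> f0 _))).
suff -> : \int[leb n.+1]_x ((f \o sswap) (sphere_proj x) * (\1_unit_ball x)%:E) =
    \int[leb n.+1]_x (f (sphere_proj x) * (\1_unit_ball x)%:E).
  exact/esym/(ge0_integral_dw mf f0).
rewrite -[RHS](ge0_integral_tswap a mg g0).
apply: ge0_eq_integral_leb.
- by apply: emeasurable_funM => //; exact: (measurableT_comp mfs mp).
- exact: (measurableT_comp mg (@measurable_tswap R n a)).
- by move=> x; apply: mule_ge0; [exact: f0|rewrite lee_fin].
- by move=> x; apply: mule_ge0; [exact: f0|rewrite lee_fin].
- move=> x x0; have ex : (0 < enorm x)%R by rewrite lt0r x0 enorm_ge0.
  congr (f _ * _).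
    apply: val_inj; rewrite val_sswap !val_sphere_proj ?enorm_tswap//.
    by apply: eq_from_tnth => i; rewrite !tnth_mktuple.
  rewrite !indicE; congr (_%:R%:E); congr (nat_of_bool _).
  by apply/idP/idP; rewrite !inE /unit_ball /= enorm_tswap.
Qed.

Lemma integral_sswap (f : S -> \bar R) : measurable_fun setT f ->
  \int[dw]_w f (sswap w) = \int[dw]_w f w.
Proof.
move=> mf; rewrite [LHS]integralE [RHS]integralE; congr (_ - _).
- rewrite -[RHS](ge0_integral_sswap (measurable_funepos mf)).
    by apply: eq_integral => w _; rewrite !funeposE.
  exact: funepos_ge0.
- rewrite -[RHS](ge0_integral_sswap (measurable_funeneg mf)).
    by apply: eq_integral => w _; rewrite !funenegE.
  exact: funeneg_ge0.
Qed.

End SphereSwap.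

(** * Zonal functions *)

Section BoundedMeasurable.
Context {R : realType} {d : measure_display} {T : measurableType d}.
Implicit Types f g : T -> R.

Definition bmeas f := measurable_fun setT f /\ exists C, forall x, `|f x| <= C.

Lemma bmeas_cst c : bmeas (cst c).
Proof. by split => //; exists `|c|. Qed.

Lemma bmeasD f g : bmeas f -> bmeas g -> bmeas (fun x => f x + g x).
Proof.
move=> [mf [C fC]] [mg [D gD]]; split; first exact: measurable_funD.
by exists (C + D) => x; rewrite (le_trans (ler_normD _ _))// lerD.
Qed.

Lemma bmeasM f g : bmeas f -> bmeas g -> bmeas (fun x => f x * g x).
Proof.
move=> [mf [C fC]] [mg [D gD]]; split; first exact: measurable_funM.
by exists (C * D) => x; rewrite normrM ler_pM.
Qed.

Lemma bmeasZ c f : bmeas f -> bmeas (fun x => c * f x).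
Proof. by move=> bf; apply: bmeasM => //; exact: bmeas_cst. Qed.

Lemma bmeasN f : bmeas f -> bmeas (fun x => - f x).
Proof.
move=> /(bmeasZ (-1)); congr (bmeas _).
by apply/funext => x; rewrite mulN1r.
Qed.

Lemma bmeasB f g : bmeas f -> bmeas g -> bmeas (fun x => f x - g x).
Proof. by move=> bf bg; apply: bmeasD => //; exact: bmeasN. Qed.

Lemma bmeasX f k : bmeas f -> bmeas (fun x => f x ^+ k).
Proof.
move=> bf; elim: k => [|k IH]; first exact: bmeas_cst.
have -> : (fun x => f x ^+ k.+1) = (fun x => f x * f x ^+ k).
  by apply/funext => x; rewrite exprS.
exact: bmeasM.
Qed.

Lemma bmeas_sum (I : Type) (s : seq I) (P : pred I) (F : I -> T -> R) :
  (forall i, bmeas (F i)) -> bmeas (fun x => \sum_(i <- s | P i) F i x).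
Proof.
move=> bF; elim: s => [|i s IH].
  rewrite (_ : (fun _ => _) = cst 0); first exact: bmeas_cst.
  by apply/funext => x; rewrite big_nil.
rewrite (_ : (fun _ => _) = (fun x => (if P i then F i x else 0) + \sum_(i <- s | P i) F i x)).
  apply: bmeasD => //; case: (P i) => //; exact: bmeas_cst.
by apply/funext => x; rewrite big_cons; case: ifP; rewrite ?add0r.
Qed.

Lemma bmeas_comp (d' : measure_display) (X : measurableType d') (h : X -> T) f :
  measurable_fun setT h -> bmeas f ->
  measurable_fun setT (f \o h) /\ exists C, forall x, `|(f \o h) x| <= C.
Proof.
move=> mh [mf [C fC]]; split; first exact: measurableT_comp.
by exists C => x /=.
Qed.

End BoundedMeasurable.

Section Rint.
Context {R : realType} {d : measure_display} {T : measurableType d}.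
Variable mu : {finite_measure set T -> \bar R}.
Implicit Types f g a b : T -> R.

Definition intg f := mu.-integrable setT (EFin \o f).
Local Notation I f := (Rintegral mu setT f).

Lemma intg_measurable f : intg f -> measurable_fun setT f.
Proof. by move=> /(measurable_int mu)/measurable_EFinP. Qed.

Lemma bmeas_intg f : bmeas f -> intg f.
Proof.
move=> [mf [C fC]]; apply: measurable_bounded_integrable => //.
  by have := fin_num_measure mu setT measurableT; rewrite fin_numE -ltey => /andP[].
exists C; split; first exact: num_real.
by move=> y Cy x _; rewrite /= (le_trans (fC x))// ltW.
Qed.

Lemma intgD f g : intg f -> intg g -> intg (fun x => f x + g x).
Proof.
move=> hf hg; have := integrableD measurableT hf hg.
by apply: eq_integrable => // x _ /=; rewrite EFinD.
Qed.

Lemma intgZ c f : intg f -> intg (fun x => c * f x).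
Proof.
move=> hf; have := integrableZl measurableT c hf.
by apply: eq_integrable => // x _ /=; rewrite EFinM.
Qed.

Lemma intgB f g : intg f -> intg g -> intg (fun x => f x - g x).
Proof.
move=> hf hg; have := integrableB measurableT hf hg.
by apply: eq_integrable => // x _ /=; rewrite EFinB.
Qed.

Lemma intg_norm f : intg f -> intg (fun x => `|f x|).
Proof. exact: integrable_norm. Qed.

Lemma intg_le f g : measurable_fun setT f -> (forall x, `|f x| <= `|g x|) ->
  intg g -> intg f.
Proof.
move=> mf fg; apply: le_integrable => //; first exact/measurable_EFinP.
by move=> x _ /=; rewrite lee_fin.
Qed.

Lemma intgM f g : bmeas f -> intg g -> intg (fun x => f x * g x).
Proof.
move=> [mf [C fC]] hg; have hC := intgZ C hg.
apply: intg_le hC => [|x]; first exact: (measurable_funM mf (intg_measurable hg)).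
rewrite !normrM ler_wpM2r// (le_trans (fC x))// ler_norm//.
Qed.

Lemma IE f : intg f -> (I f)%:E = (\int[mu]_x (f x)%:E)%E.
Proof. by move=> hf; rewrite fineK//; exact: integrable_fin_num. Qed.

Lemma ID f g : intg f -> intg g -> I (fun x => f x + g x) = I f + I g.
Proof. exact: RintegralD. Qed.

Lemma IB f g : intg f -> intg g -> I (fun x => f x - g x) = I f - I g.
Proof. exact: RintegralB. Qed.

Lemma IZ c f : intg f -> I (fun x => c * f x) = c * I f.
Proof. exact: RintegralZl. Qed.

Lemma Icst c : I (cst c) = c * fine (mu setT).
Proof. exact: Rintegral_cst. Qed.

Lemma le_I f g : intg f -> intg g -> (forall x, f x <= g x) -> I f <= I g.
Proof. by move=> hf hg fg; apply: le_Rintegral. Qed.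

Lemma I_ge0 f : (forall x, 0 <= f x) -> 0 <= I f.
Proof. by move=> f0; exact: Rintegral_ge0. Qed.

Lemma norm_I f : intg f -> `|I f| <= I (fun x => `|f x|).
Proof. exact: le_normr_Rintegral. Qed.

Lemma eq_I f g : f =1 g -> I f = I g.
Proof. by move=> /funext ->. Qed.

Lemma intg_sum (J : Type) (s : seq J) (P : pred J) (F : J -> T -> R) :
  (forall i, intg (F i)) -> intg (fun x => \sum_(i <- s | P i) F i x).
Proof.
move=> hF; elim: s => [|i s IH].
  have := bmeas_intg (bmeas_cst 0).
  by apply: eq_integrable => // x _ /=; rewrite big_nil.
have h : intg (fun x => (if P i then F i x else 0) + \sum_(i <- s | P i) F i x).
  apply: intgD => //; case: (P i) => //; exact: (bmeas_intg (bmeas_cst 0)).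
move: h; apply: eq_integrable => // x _ /=.
by rewrite big_cons; case: ifP; rewrite ?add0r.
Qed.

Lemma I_sum (J : Type) (s : seq J) (P : pred J) (F : J -> T -> R) :
  (forall i, intg (F i)) ->
  I (fun x => \sum_(i <- s | P i) F i x) = \sum_(i <- s | P i) I (F i).
Proof.
move=> hF; elim: s => [|i s IH].
  rewrite big_nil -[RHS](mul0r (fine (mu setT))) -Icst.
  by apply: eq_I => x; rewrite big_nil.
rewrite big_cons; case: ifPn => Pi.
  by rewrite -IH -ID//; [apply: eq_I => x; rewrite big_cons Pi|exact: intg_sum].
by rewrite -IH; apply: eq_I => x; rewrite big_cons (negPf Pi).
Qed.

Lemma bmeas_section (k : T * T -> R) x : bmeas k -> bmeas (fun y => k (x, y)).
Proof.
move=> [mk [C kC]]; split; last by exists C.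
exact: (measurableT_comp mk (measurable_pair1 x)).
Qed.

Lemma bmeas_section2 (k : T * T -> R) y : bmeas k -> bmeas (fun x => k (x, y)).
Proof.
move=> [mk [C kC]]; split; last by exists C.
exact: (measurableT_comp mk (measurable_pair2 y)).
Qed.

Lemma bmeas_swap (k : T * T -> R) : bmeas k -> bmeas (fun p => k (p.2, p.1)).
Proof. by move=> bk; apply: (bmeas_comp _ bk); exact: measurable_swap. Qed.

Let intg2 (k : T * T -> R) a b : bmeas k -> intg a -> intg b ->
  (mu \x mu)%E.-integrable setT (fun p : T * T => (a p.1 * k p * b p.2)%:E).
Proof.
move=> bk ha hb.
have ma := intg_measurable ha; have mb := intg_measurable hb.
have mF : measurable_fun setT (fun p : T * T => (a p.1 * k p * b p.2)%:E).
  apply/measurable_EFinP; apply: measurable_funM.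
    by apply: measurable_funM; [exact: (measurableT_comp ma measurable_fst)|case: bk].
  exact: (measurableT_comp mb measurable_snd).
apply/integrable12ltyP => //=.
have [_ [C kC]] := bk.
have C0 : 0 <= C by rewrite (le_trans _ (kC (point, point))).
apply: (@le_lt_trans _ _ (\int[mu]_x (`|a x|%:E * (C * I (fun y => `|b y|))%:E))%E).
  apply: ge0_le_integral => //.
  - by move=> x _; apply: integral_ge0 => y _; rewrite lee_fin.
  - apply: (@measurable_fun_fubini_tonelli_F _ _ _ _ _ mu
      (fun p : T * T => (`|a p.1 * k p * b p.2|)%:E)) => //.
    by apply/measurable_EFinP; apply: measurableT_comp => //; exact/measurable_EFinP.
  - apply: emeasurable_funM => //; apply/measurable_EFinP; exact: measurableT_comp.
  - move=> x _; rewrite EFinM (IE (intg_norm hb)) -ge0_integralZl//; first last.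
    + by apply/measurable_EFinP; exact: measurableT_comp.
    rewrite -ge0_integralZl//; first last.
    + by move=> y _; rewrite -EFinM lee_fin mulr_ge0.
    + by apply/measurable_EFinP; apply: measurable_funM => //; exact: measurableT_comp.
    apply: ge0_le_integral => //.
    + apply/measurable_EFinP; apply: measurableT_comp => //.
      by apply: measurable_funM => //; apply: measurable_funM => //; case: (bmeas_section x bk).
    + apply/measurable_EFinP; apply: measurable_funM => //; apply: measurable_funM => //.
      exact: measurableT_comp.
    + by move=> y _; rewrite -!EFinM lee_fin !normrM mulrA ler_wpM2r// ler_wpM2l.
under eq_integral do rewrite -EFinM mulrC.
by have := integrable_lty measurableT (intgZ (C * I (fun y => `|b y|)) (intg_norm ha)).
Qed.

Lemma bmeas_I (k : T * T -> R) b : bmeas k -> intg b ->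
  bmeas (fun x => I (fun y => k (x, y) * b y)).
Proof.
move=> bk hb; split.
  have h := intg2 bk (bmeas_intg (bmeas_cst 1)) hb.
  have := measurable_fubini_F h.
  move=> /(measurableT_comp (fine_measurable measurableT)); apply: eq_measurable_fun => x _ /=.
  by congr fine; apply: eq_integral => y _; rewrite mul1r.
have [_ [C kC]] := bk.
exists (C * I (fun y => `|b y|)) => x.
have h := intgM (bmeas_section x bk) hb.
rewrite (le_trans (norm_I h))// -IZ; last exact: intg_norm.
apply: le_I => [||y]; [exact: intg_norm|by apply: intgZ; exact: intg_norm|].
by rewrite normrM ler_wpM2r.
Qed.

Lemma swapI (k : T * T -> R) a b : bmeas k -> intg a -> intg b ->
  I (fun x => a x * I (fun y => k (x, y) * b y)) =
  I (fun y => b y * I (fun x => k (x, y) * a x)).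
Proof.
move=> bk ha hb.
have h := intg2 bk ha hb.
apply: EFin_inj; rewrite IE; last first.
  by have := intgM (bmeas_I bk hb) ha; apply: eq_integrable => // x _ /=; rewrite mulrC.
rewrite IE; last first.
  have := intgM (bmeas_I (bmeas_swap bk) ha) hb.
  by apply: eq_integrable => // x _ /=; rewrite mulrC.
transitivity (\int[mu]_x \int[mu]_y (a x * k (x, y) * b y)%:E)%E.
  apply: eq_integral => x _.
  rewrite -IZ; last exact: (intgM (bmeas_section x bk)).
  rewrite IE; first by apply: eq_integral => y _; rewrite mulrA.
  by apply: intgZ; exact: (intgM (bmeas_section x bk)).
rewrite (Fubini h); apply: eq_integral => y _.
rewrite -IZ; last exact: (intgM (bmeas_section2 y bk)).
rewrite IE; first by apply: eq_integral => x _; congr EFin; ring.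
by apply: intgZ; exact: (intgM (bmeas_section2 y bk)).
Qed.

End Rint.

(** * First-order expansions in the velocity of a boost *)

Section Expansion.
Context {R : realType} {n : nat}.
Notation S := (sphere R n.+1).
Notation dw := (@surface R n.+1).
Notation I f := (Rintegral dw setT f).
Implicit Types (F G : R -> S -> R) (f g : S -> R).

(* [F v w = f0 w + v * f1 w + O(v ^ 2)], uniformly in [w]. *)
Definition expansion F f0 f1 := [/\ bmeas f0, bmeas f1 &
  exists C, forall v, `|v| <= 2^-1 -> forall w, `|F v w - f0 w - v * f1 w| <= C * v ^+ 2].

Lemma expansion_ext F f0 f1 g1 : expansion F f0 f1 -> f1 =1 g1 -> expansion F f0 g1.
Proof. by move=> ? /funext <-. Qed.

Lemma expansion_cst f : bmeas f -> expansion (fun _ => f) f (cst 0).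
Proof.
move=> bf; split => //; first exact: bmeas_cst.
by exists 0 => v _ w; rewrite mulr0 subrr subr0 normr0 mul0r.
Qed.

Lemma expansion_id : expansion (fun v _ => v) (cst 0) (cst 1).
Proof.
split; [exact: bmeas_cst|exact: bmeas_cst|].
by exists 0 => v _ w; rewrite mulr1 subr0 subrr normr0 mul0r.
Qed.

Lemma expansionD F G f0 f1 g0 g1 : expansion F f0 f1 -> expansion G g0 g1 ->
  expansion (fun v w => F v w + G v w) (fun w => f0 w + g0 w) (fun w => f1 w + g1 w).
Proof.
move=> [bF0 bF1 [C FC]] [bG0 bG1 [D GD]].
split; [exact: bmeasD|exact: bmeasD|].
exists (C + D) => v v2 w.
rewrite (_ : _ - _ = (F v w - f0 w - v * f1 w) + (G v w - g0 w - v * g1 w)); last by ring.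
by rewrite (le_trans (ler_normD _ _))// mulrDl lerD// ?FC ?GD.
Qed.

Lemma expansionM F G f0 f1 g0 g1 : expansion F f0 f1 -> expansion G g0 g1 ->
  expansion (fun v w => F v w * G v w) (fun w => f0 w * g0 w)
    (fun w => f0 w * g1 w + f1 w * g0 w).
Proof.
move=> [bF0 bF1 [C FC]] [bG0 bG1 [D GD]].
split; [exact: bmeasM|by apply: bmeasD; exact: bmeasM|].
have [_ [p0 Ff0]] := bF0; have [_ [p1 Ff1]] := bF1.
have [_ [q0 Gg0]] := bG0; have [_ [q1 Gg1]] := bG1.
exists (C * (D + q0 + q1) + (p0 + p1) * D + p1 * q1) => v v2 w.
set X := F v w - f0 w - v * f1 w; set Y := G v w - g0 w - v * g1 w.
have -> : F v w * G v w - f0 w * g0 w - v * (f0 w * g1 w + f1 w * g0 w) =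
    X * (Y + g0 w + v * g1 w) + (f0 w + v * f1 w) * Y + v ^+ 2 * (f1 w * g1 w).
  by rewrite /X /Y; ring.
have XC : `|X| <= C * v ^+ 2 by exact: FC.
have YD : `|Y| <= D * v ^+ 2 by exact: GD.
have v1 : `|v| <= 1 by rewrite (le_trans v2)// invf_le1// ler1n.
have vv : v ^+ 2 <= 1 by rewrite -real_normK ?num_real// expr_le1.
have vv0 : 0 <= v ^+ 2 by rewrite sqr_ge0.
have h12 : 0 < 2^-1 :> R by rewrite invr_gt0.
have C0 : 0 <= C.
  have := FC (2^-1) _ w; rewrite gtr0_norm// => /(_ (lexx _)).
  by move=> /(le_trans (normr_ge0 _)); rewrite pmulr_lge0// exprn_gt0.
have D0 : 0 <= D.
  have := GD (2^-1) _ w; rewrite gtr0_norm// => /(_ (lexx _)).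
  by move=> /(le_trans (normr_ge0 _)); rewrite pmulr_lge0// exprn_gt0.
have vG : `|v * g1 w| <= q1.
  by rewrite normrM (le_trans _ (Gg1 w))// ler_piMl.
have vF : `|v * f1 w| <= p1.
  by rewrite normrM (le_trans _ (Ff1 w))// ler_piMl.
have YD' : `|Y| <= D by rewrite (le_trans YD)// ler_piMr.
rewrite (le_trans (ler_normD _ _))// [leRHS]mulrDl lerD//; last first.
  by rewrite normrM (ger0_norm vv0) mulrC ler_wpM2r// normrM ler_pM.
rewrite (le_trans (ler_normD _ _))// [leRHS]mulrDl lerD//.
  rewrite normrM mulrAC ler_pM//.
  by rewrite (le_trans (ler_normD _ _))// lerD// (le_trans (ler_normD _ _))// lerD.
rewrite normrM -mulrA ler_pM//.
by rewrite (le_trans (ler_normD _ _))// lerD.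
Qed.

Lemma expansionX F f0 f1 k : expansion F f0 f1 ->
  expansion (fun v w => F v w ^+ k) (fun w => f0 w ^+ k)
    (fun w => k%:R * f0 w ^+ k.-1 * f1 w).
Proof.
move=> eF; elim: k => [|k IH].
  apply: expansion_ext (expansion_cst (bmeas_cst 1)) _ => w.
  by rewrite !mul0r.
have := expansionM eF IH.
have -> : (fun v w => F v w * F v w ^+ k) = (fun v w => F v w ^+ k.+1).
  by apply/funext => v; apply/funext => w; rewrite exprS.
have -> : (fun w => f0 w * f0 w ^+ k) = (fun w => f0 w ^+ k.+1).
  by apply/funext => w; rewrite exprS.
move=> h; apply: expansion_ext h _ => w.
case: k {IH} => [|k]; first by rewrite !mul0r mulr0 add0r expr0 !mul1r mulr1.
by rewrite /= -[k.+2%:R]natr1 exprS; ring.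
Qed.

Lemma expansion_sum (J : Type) (s : seq J) (F : J -> R -> S -> R) (f0 f1 : J -> S -> R) :
  (forall i, expansion (F i) (f0 i) (f1 i)) ->
  expansion (fun v w => \sum_(i <- s) F i v w) (fun w => \sum_(i <- s) f0 i w)
    (fun w => \sum_(i <- s) f1 i w).
Proof.
move=> eF; elim: s => [|i s IH].
  have -> : (fun v w => \sum_(i <- [::]) F i v w) = (fun _ => cst 0).
    by apply/funext => v; apply/funext => w; rewrite big_nil.
  have -> : (fun w => \sum_(i <- [::]) f0 i w) = cst 0.
    by apply/funext => w; rewrite big_nil.
  apply: expansion_ext (expansion_cst (bmeas_cst 0)) _ => w.
  by rewrite big_nil.
have := expansionD (eF i) IH; congr expansion.
- by apply/funext => v; apply/funext => w; rewrite big_cons.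
- by apply/funext => w; rewrite big_cons.
- by apply/funext => w; rewrite big_cons.
Qed.

(** An integral that is constant in $v$ has derivative 0 at $v=0$: the uniform remainder gives
    $v\,|\int f_1|\le C\,m\,v^2$ for all small $v>0$, with [m] the total mass. *)
Lemma expansion_I F f0 f1 : expansion F f0 f1 ->
  (forall v, `|v| < 1 -> bmeas (F v)) ->
  (forall v, `|v| < 1 -> I (F v) = I f0) -> I f1 = 0.
Proof.
move=> [bF0 bF1 [C FC]] bF IF.
pose m := fine (dw setT).
have key v : 0 < v -> v <= 2^-1 -> `|I f1| <= C * m * v.
  move=> v0 v2.
  have av : `|v| <= 2^-1 by rewrite gtr0_norm.
  have v1 : `|v| < 1 by rewrite (le_lt_trans av)// invf_lt1// ltr1n.
  have hF := bmeas_intg dw (bF v v1).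
  have hF0 := bmeas_intg dw bF0; have hF1 := bmeas_intg dw bF1.
  have hvF1 := intgZ v hF1.
  have E : v * I f1 = - I (fun w => F v w - f0 w - v * f1 w).
    by rewrite IB//; [rewrite IB// IZ// IF// subrr sub0r opprK|exact: intgB].
  have : v * `|I f1| <= C * m * v ^+ 2.
    rewrite -{1}(gtr0_norm v0) -normrM E normrN.
    have hD : intg dw (fun w => F v w - f0 w - v * f1 w) by apply: intgB => //; exact: intgB.
    rewrite (le_trans (norm_I hD))//.
    rewrite mulrAC -Icst; apply: le_I => //; first exact: intg_norm.
      exact: (bmeas_intg _ (bmeas_cst _)).
    by move=> w; exact: FC.
  by rewrite expr2 mulrA [leRHS]mulrC ler_pM2l.
apply/eqP; rewrite -normr_le0; apply/ler_addgt0Pl => e e0; rewrite addr0.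
have K0 : 0 < `|C * m| + 1 by rewrite ltr_wpDl.
pose v := Num.min 2^-1 (e / (`|C * m| + 1)).
have v0 : 0 < v by rewrite lt_min invr_gt0 ltr0n/= divr_gt0.
apply: le_trans (key v v0 _) _; first by rewrite ge_min lexx.
rewrite (@le_trans _ _ ((`|C * m| + 1) * v))//.
  by rewrite ler_wpM2r ?(ltW v0)// (le_trans (ler_norm _))// lerDl.
by rewrite mulrC -ler_pdivlMr// ge_min lexx orbT.
Qed.

End Expansion.

(** * Zonal functions and the divergence theorem *)

Section Zonal.
Context {R : realType} {n : nat}.
Notation S := (sphere R n.+1).
Notation dw := (@surface R n.+1).
Notation I f := (Rintegral dw setT f).
Implicit Types x y z w : S.

Definition crd w (i : 'I_n.+2) : R := tnth (val w) i.
Definition cosd x y : R := dotp (val x) (val y).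
(** Equal to $1-|x-y|^2/4$ ([edist_sqr]): it ranges in $[0,1]$, and the Riesz kernel is a multiple
    of $(1-q)^{-a}$, a power series in $q$ with positive coefficients. *)
Definition qd x y : R := (1 + cosd x y) / 2.

Lemma cosdC x y : cosd x y = cosd y x.
Proof. by apply: eq_bigr => i _; rewrite mulrC. Qed.

Lemma qdC x y : qd x y = qd y x. Proof. by rewrite /qd cosdC. Qed.

Lemma cosdxx x : cosd x x = 1.
Proof. by rewrite /cosd -sqr_enorm enorm_val expr1n. Qed.

Lemma qdxx x : qd x x = 1.
Proof. by rewrite /qd cosdxx -[1 + 1]/(2%:R) divff. Qed.

Lemma edist_sqr x y : edist (val x) (val y) ^+ 2 = 4 * (1 - qd x y).
Proof.
rewrite sqr_sqrtr; last by apply: sumr_ge0 => i _; exact: sqr_ge0.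
transitivity (cosd x x + cosd y y - 2 * cosd x y); last first.
  by rewrite !cosdxx /qd; field.
rewrite /cosd /dotp mulr_sumr -big_split -sumrB; apply: eq_bigr => i _ /=; ring.
Qed.

Lemma qd_le1 x y : qd x y <= 1.
Proof.
have := sqr_ge0 (edist (val x) (val y)); rewrite edist_sqr; lra.
Qed.

Lemma qd_ge0 x y : 0 <= qd x y.
Proof.
have : 0 <= \sum_i (tnth (val x) i + tnth (val y) i) ^+ 2.
  by apply: sumr_ge0 => i _; exact: sqr_ge0.
have -> : \sum_i (tnth (val x) i + tnth (val y) i) ^+ 2 = 4 * qd x y; last by lra.
transitivity (cosd x x + cosd y y + 2 * cosd x y); last first.
  by rewrite !cosdxx /qd; field.
rewrite /cosd /dotp mulr_sumr -!big_split; apply: eq_bigr => i _ /=; ring.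
Qed.

Lemma norm_crd w i : `|crd w i| <= 1.
Proof.
rewrite -(@expr_le1 _ 2)// real_normK ?num_real// -(cosdxx w) /cosd /dotp (bigD1 i)//=.
by rewrite -expr2 lerDl sumr_ge0// => j _; rewrite -expr2 sqr_ge0.
Qed.

Lemma bmeas_crd i : bmeas (fun w : S => crd w i).
Proof.
split; last by exists 1 => w; exact: norm_crd.
exact: (measurableT_comp (measurable_tnth i) measurable_val).
Qed.

Lemma bmeas_cosd2 : bmeas (fun p : S * S => cosd p.1 p.2).
Proof.
apply: bmeas_sum => i; apply: bmeasM.
- exact: (bmeas_comp measurable_fst (bmeas_crd i)).
- exact: (bmeas_comp measurable_snd (bmeas_crd i)).
Qed.

Lemma bmeas_cosd x : bmeas (cosd x).
Proof. exact: (bmeas_section x bmeas_cosd2). Qed.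

Lemma bmeas_qd2 : bmeas (fun p : S * S => qd p.1 p.2).
Proof.
have := bmeasZ 2^-1 (bmeasD (bmeas_cst 1) bmeas_cosd2); congr bmeas.
by apply/funext => p; rewrite /qd mulrC.
Qed.

Lemma bmeas_qd x : bmeas (qd x).
Proof. exact: (bmeas_section x bmeas_qd2). Qed.

Lemma kappaE v w : kappa v w = (Num.sqrt (1 - v ^+ 2))^-1 * (1 + v * crd w ord0).
Proof. by rewrite /kappa /boost_factor enorm_val divr1. Qed.

Section velocity.
Variable v : R.
Hypothesis v1 : `|v| < 1.

Lemma enorm_boost_val w : enorm (boost v (val w)) = kappa v w.
Proof. by rewrite enorm_boost// enorm_val ?oner_neq0// mul1r. Qed.

Lemma val_sboost w : val (sboost v w) = tscale (kappa v w)^-1 (boost v (val w)).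
Proof.
by rewrite val_sphere_proj enorm_boost_val// gt_eqF// kappa_gt0.
Qed.

Lemma crd_sboost0 w : crd (sboost v w) ord0 = (crd w ord0 + v) / (1 + v * crd w ord0).
Proof.
rewrite /crd val_sboost tnth_mktuple /boost tnth_tcons0 enorm_val mulr1 kappaE.
have g0 := gamma_gt0 v1; have := kappa_gt0 v1 w; rewrite kappaE pmulr_rgt0// => k0.
by rewrite invfM mulrACA mulVf ?mul1r 1?mulrC// gt_eqF.
Qed.

Lemma crd_sboostS w (i : 'I_n.+1) :
  crd (sboost v w) (lift ord0 i) = crd w (lift ord0 i) * (kappa v w)^-1.
Proof.
rewrite /crd val_sboost tnth_mktuple /boost tnth_tconsS mulrC; congr (_ * _).
by rewrite tnth_behead; congr (tnth _ _); apply: val_inj => /=; rewrite inordK// ltnS.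
Qed.

End velocity.

Let expansion_inv : expansion (fun v w => (1 + v * crd w ord0)^-1) (cst 1)
  (fun w => - crd w ord0).
Proof.
split; [exact: bmeas_cst|exact/bmeasN/bmeas_crd|exists 2 => v v2 w].
have c1 := norm_crd w ord0; set c := crd w ord0 in c1 *.
have vc : `|v * c| <= 2^-1.
  by rewrite normrM (le_trans _ v2)// ler_piMr.
have k0 : 2^-1 <= 1 + v * c.
  by move: vc; rewrite ler_norml => /andP[]; lra.
have kpos : 0 < 1 + v * c by rewrite (lt_le_trans _ k0)// invr_gt0.
have -> : (1 + v * c)^-1 - 1 - v * - c = (v * c) ^+ 2 * (1 + v * c)^-1.
  by field; rewrite gt_eqF.
rewrite normrM (gtr0_norm (_ : 0 < (1 + v * c)^-1)) ?invr_gt0// mulrC ler_pM//.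
- by rewrite invr_ge0 ltW.
- by rewrite -[leRHS]invrK lef_pV2// posrE invr_gt0.
rewrite normrX normrM exprMn real_normK ?num_real// ler_piMr ?sqr_ge0//.
by rewrite expr_le1.
Qed.

Let expansion_sqrt : expansion (fun v (_ : S) => Num.sqrt (1 - v ^+ 2)) (cst 1) (cst 0).
Proof.
split; [exact: bmeas_cst|exact: bmeas_cst|exists 1 => v v2 w].
have v1 : v ^+ 2 <= 1.
  rewrite -real_normK ?num_real// expr_le1// (le_trans v2)// invf_le1// ler1n//.
have s1 : Num.sqrt (1 - v ^+ 2) <= 1.
  by rewrite -[leRHS]sqrtr1 ler_wsqrtr// gerBl sqr_ge0.
have := sqr_sqrtr (_ : 0 <= 1 - v ^+ 2); rewrite subr_ge0 => /(_ v1).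
have := sqrtr_ge0 (1 - v ^+ 2).
move: (Num.sqrt _) s1 => s s1 s0 s2.
rewrite mulr0 subr0 mul1r distrC ger0_norm ?subr_ge0//.
have : 0 <= (1 - s) * s by rewrite mulr_ge0// subr_ge0.
rewrite /=; lra.
Qed.

Let expansion_kappaV : expansion (fun v w => (kappa v w)^-1) (cst 1)
  (fun w => - crd w ord0).
Proof.
have := expansionM expansion_sqrt expansion_inv.
have -> : (fun v w => Num.sqrt (1 - v ^+ 2) * (1 + v * crd w ord0)^-1) =
    (fun v w => (kappa v w)^-1).
  by apply/funext => v; apply/funext => w; rewrite kappaE invfM invrK.
have -> : (fun w : S => cst 1 w * cst 1 w) = cst (1 : R).
  by apply/funext => w; rewrite /= mulr1.
by move=> h; apply: expansion_ext h _ => w /=; rewrite mul0r addr0 mul1r.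
Qed.

(** The first-order term is the [i]-th component of the tangential projection of the first basis
    vector, that is of the gradient of the first coordinate. The value 0 for $|v|\ge1$ is a filler,
    since expansions look at $|v|\le1/2$. *)
Let expansion_crd i : expansion (fun v w => if `|v| < 1 then crd (sboost v w) i else 0)
  (fun w => crd w i) (fun w => (i == ord0)%:R - crd w i * crd w ord0).
Proof.
have ext (F G : R -> S -> R) f g : expansion F f g ->
    (forall v, `|v| < 1 -> F v =1 G v) -> expansion G f g.
  move=> [bf bg [C FC]] FG; split => //; exists C => v v2 w; rewrite -FG ?FC//.
  by rewrite (le_lt_trans v2)// invf_lt1// ltr1n.
have [j ->|->] := unliftP ord0 i.
  have h := expansionM (expansion_cst (bmeas_crd (lift ord0 j))) expansion_kappaV.
  have h0 : (fun w : S => crd w (lift ord0 j) * cst 1 w) = (fun w => crd w (lift ord0 j)).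
    by apply/funext => w; rewrite /= mulr1.
  rewrite h0 in h; apply: ext.
    by apply: expansion_ext h _ => w /=; rewrite mul0r addr0 mulrN sub0r.
  by move=> v v1 w; rewrite v1 crd_sboostS.
have h := expansionM (expansionD (expansion_cst (bmeas_crd ord0)) (@expansion_id R n)) expansion_inv.
have h0 : (fun w : S => (crd w ord0 + cst 0 w) * cst 1 w) = (fun w => crd w ord0).
  by apply/funext => w; rewrite /= mulr1 addr0.
rewrite h0 in h; apply: ext.
  by apply: expansion_ext h _ => w /=; rewrite addr0 add0r mulr1 mulrN addrC.
by move=> v v1 w; rewrite v1 crd_sboost0.
Qed.

Let expansion_qd x : expansion (fun v w => if `|v| < 1 then qd x (sboost v w) else 0)
  (qd x) (fun w => (crd x ord0 - crd w ord0 * cosd x w) / 2).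
Proof.
have ext (F G : R -> S -> R) f g : expansion F f g ->
    (forall v, `|v| < 1 -> F v =1 G v) -> expansion G f g.
  move=> [bf bg [C FC]] FG; split => //; exists C => v v2 w; rewrite -FG ?FC//.
  by rewrite (le_lt_trans v2)// invf_lt1// ltr1n.
have h := expansion_sum (index_enum 'I_n.+2) (fun i =>
  expansionM (expansion_cst (bmeas_cst (crd x i))) (expansion_crd i)).
have {}h := expansionM (expansion_cst (bmeas_cst 2^-1))
  (expansionD (expansion_cst (bmeas_cst 1)) h).
have h0 : (fun w : S => cst 2^-1 w * (cst 1 w + \sum_i cst (crd x i) w * crd w i)) = qd x.
  by apply/funext => w; rewrite /= mulrC.
rewrite h0 in h; apply: ext.
  apply: expansion_ext h _ => w /=; rewrite mul0r add0r addr0 mulrC; congr (_ / 2).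
  under eq_bigr do rewrite mul0r addr0 mulrBr.
  rewrite sumrB (bigD1 ord0)//= mulr1 big1 ?addr0; last first.
    by move=> i /negbTE ->; rewrite mulr0.
  congr (_ - _); rewrite mulr_sumr; apply: eq_bigr => i _.
  by rewrite /crd; ring.
by move=> v v1 w /=; rewrite v1 mulrC.
Qed.


Lemma cosd_sswap a x w : cosd (sswap a x) (sswap a w) = cosd x w.
Proof. by rewrite /cosd !val_sswap dotp_tswap. Qed.

Lemma qd_sswap a x w : qd (sswap a x) (sswap a w) = qd x w.
Proof. by rewrite /qd cosd_sswap. Qed.

Lemma crd_sswap a x : crd (sswap a x) ord0 = crd x a.
Proof. by rewrite /crd val_sswap tnth_mktuple tpermL. Qed.

Let bm_qq x y i j : bmeas (fun w : S => qd x w ^+ i * qd y w ^+ j).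
Proof. by apply: bmeasM; apply: bmeasX; exact: bmeas_qd. Qed.

(** The first-order term of $q(x,\cdot)^iq(y,\cdot)^j$ composed with the boost along the axis [a],
    times its Jacobian $\kappa^{-(n+1)}$; the last summand is the contribution of the Jacobian. *)
Let G0 x y i j (a : 'I_n.+2) w : R :=
  i%:R * qd x w ^+ i.-1 * ((crd x a - crd w a * cosd x w) / 2) * qd y w ^+ j +
  qd x w ^+ i * (j%:R * qd y w ^+ j.-1 * ((crd y a - crd w a * cosd y w) / 2)) -
  n.+1%:R * crd w a * (qd x w ^+ i * qd y w ^+ j).

Let bm_G0 x y i j a : bmeas (G0 x y i j a).
Proof.
have bX k z : bmeas (fun w : S => qd z w ^+ k) by apply: bmeasX; exact: bmeas_qd.
have bC z : bmeas (fun w : S => (crd z a - crd w a * cosd z w) / 2).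
  apply: bmeasM; last exact: bmeas_cst.
  apply: bmeasB; first exact: bmeas_cst.
  by apply: bmeasM; [exact: bmeas_crd|exact: bmeas_cosd].
have bK k z : bmeas (fun w : S => k%:R * qd z w ^+ k.-1) by exact: bmeasZ.
apply: bmeasB; last by apply: bmeasM => //; apply: bmeasZ; exact: bmeas_crd.
apply: bmeasD; apply: bmeasM => //; apply: bmeasM => //.
Qed.

Let I_G0 x y i j : I (G0 x y i j ord0) = 0.
Proof.
have e1 := expansionM (expansionM (expansionX i (expansion_qd x)) (expansionX j (expansion_qd y)))
  (expansionX n.+1 expansion_kappaV).
have h0 : (fun w : S => qd x w ^+ i * qd y w ^+ j * cst (1 : R) w ^+ n.+1) =
    (fun w => qd x w ^+ i * qd y w ^+ j).
  by apply/funext => w; rewrite /= expr1n mulr1.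
rewrite h0 in e1.
have {}e1 : expansion (fun v w => (if `|v| < 1 then qd x (sboost v w) else 0) ^+ i *
    (if `|v| < 1 then qd y (sboost v w) else 0) ^+ j * (kappa v w)^-1 ^+ n.+1)
    (fun w => qd x w ^+ i * qd y w ^+ j) (G0 x y i j ord0).
  by apply: expansion_ext e1 _ => w; rewrite /G0 /= !expr1n; ring.
apply: (expansion_I e1).
  move=> v v1; rewrite v1.
  apply: bmeasM.
    exact: (bmeas_comp (measurable_sboost v) (bm_qq x y i j)).
  apply: bmeasX; split.
    by apply: measurable_funV; exact: measurable_kappa.
  exists (Num.sqrt (1 - v ^+ 2) / (1 - `|v|)) => w.
  have h1 : 0 < 1 - `|v| by rewrite subr_gt0.
  rewrite kappaE invfM invrK normrM (ger0_norm (sqrtr_ge0 _)) ler_wpM2l ?sqrtr_ge0//.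
  have h2 : 1 - `|v| <= 1 + v * crd w ord0.
    rewrite lerD2l lerNl (le_trans (ler_norm _))// normrN normrM ler_piMr//.
    exact: norm_crd.
  have h3 : 0 < 1 + v * crd w ord0 by rewrite (lt_le_trans h1).
  by rewrite gtr0_norm ?invr_gt0// lef_pV2.
move=> v v1; rewrite v1.
rewrite /Rintegral -[in RHS](integral_sboost v1).
  by congr fine; apply: eq_integral => w _; rewrite -EFinM exprVn.
by apply/measurable_EFinP; case: (bm_qq x y i j).
Qed.

(** Exchanging the coordinates 0 and [a] carries the first axis to the axis [a]. *)
Let I_Ga x y i j a : I (G0 x y i j a) = 0.
Proof.
rewrite -(I_G0 (sswap a x) (sswap a y) i j) /Rintegral -[in RHS](integral_sswap a).
  congr fine; apply: eq_integral => w _; congr EFin.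
  by rewrite /G0 !qd_sswap !cosd_sswap !crd_sswap.
by apply/measurable_EFinP; case: (bm_G0 (sswap a x) (sswap a y) i j ord0).
Qed.

(* First order term, as the velocity tends to 0, of the invariance of the
   integral of (qd x)^i (qd y)^j under boosts in the direction x: the divergence
   theorem for the conformal field grad (cosd x). *)
Lemma zonal_divergence x y i j :
  I (fun w => i%:R * qd x w ^+ i.-1 * ((1 - cosd x w ^+ 2) / 2) * qd y w ^+ j +
    qd x w ^+ i * (j%:R * qd y w ^+ j.-1 * ((cosd x y - cosd x w * cosd y w) / 2)) -
    n.+1%:R * cosd x w * (qd x w ^+ i * qd y w ^+ j)) = 0.
Proof.
(* The direction [x] is the combination of the axes with coefficients [crd x a]. *)
transitivity (\sum_a crd x a * I (G0 x y i j a)); last first.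
  by rewrite big1// => a _; rewrite I_Ga mulr0.
have hG a : intg dw (fun w => crd x a * G0 x y i j a w).
  by apply: intgZ; apply: bmeas_intg; exact: bm_G0.
have -> : \sum_a crd x a * I (G0 x y i j a) = \sum_a I (fun w => crd x a * G0 x y i j a w).
  by apply: eq_bigr => a _; rewrite IZ//; apply: bmeas_intg; exact: bm_G0.
rewrite -I_sum//; apply: eq_I => w.
have E1 : \sum_a crd x a * crd x a = 1 by rewrite -(cosdxx x).
have E2 : \sum_a crd x a * crd w a = cosd x w by [].
have E3 : \sum_a crd x a * crd y a = cosd x y by [].
pose A := i%:R * qd x w ^+ i.-1 * qd y w ^+ j / 2.
pose B := qd x w ^+ i * (j%:R * qd y w ^+ j.-1) / 2.
pose C := n.+1%:R * (qd x w ^+ i * qd y w ^+ j).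
rewrite (eq_bigr (fun a => A * (crd x a * crd x a) - (A * cosd x w) * (crd x a * crd w a) +
  (B * (crd x a * crd y a) - (B * cosd y w) * (crd x a * crd w a)) - C * (crd x a * crd w a))); last first.
  by move=> a _; rewrite /G0 /A /B /C; ring.
by rewrite !(sumrB, big_split) /= -!mulr_sumr E1 E2 E3 /A /B /C; ring.
Qed.

Definition zonal_mx i j x y : R := I (fun w => qd x w ^+ i * qd y w ^+ j).
(* (-Laplacian) (qd x)^j = beltrami_a j * (qd x)^j - beltrami_b j * (qd x)^(j-1). *)
Definition beltrami_a (j : nat) : R := j%:R * (j%:R + n%:R).
Definition beltrami_b (j : nat) : R := j%:R * (j%:R - 1 + n.+1%:R / 2).

(** Green's formula $\langle-\Delta f,g\rangle=\int\nabla f\cdot\nabla g$ for $f=q(x,\cdot)^i$ and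
    $g=q(y,\cdot)^j$, since the gradients of $\cos(x,\cdot)$ and $\cos(y,\cdot)$ at $w$ have inner
    product $\cos(x,y)-\cos(x,w)\cos(y,w)$. The symmetry of the right side in the two functions is
    what [zonal_mx_rec] exploits. *)
Let zonal_green i j x y :
  beltrami_a i * zonal_mx i j x y - beltrami_b i * zonal_mx i.-1 j x y =
  i%:R * j%:R / 4 * I (fun w => qd x w ^+ i.-1 * qd y w ^+ j.-1 * (cosd x y - cosd x w * cosd y w)).
Proof.
case: i => [|i]; first by rewrite /beltrami_a /beltrami_b !mul0r subrr.
have hP k l := bmeas_intg dw (bm_qq x y k l).
have hX : intg dw (fun w => qd x w ^+ i * qd y w ^+ j.-1 * (cosd x y - cosd x w * cosd y w)).
  apply: bmeas_intg; apply: bmeasM => //; apply: bmeasB; first exact: bmeas_cst.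
  by apply: bmeasM; exact: bmeas_cosd.
have := zonal_divergence x y i j.
(* This factor turns the field $q^i\,\nabla\cos(x,\cdot)$ into $\nabla q^{i+1}$. *)
move=> /(congr1 (fun u : R => i.+1%:R / 2 * u)); rewrite mulr0.
set F := (F in I F); move=> h.
rewrite /zonal_mx -!IZ//= -IB//; [|exact: intgZ|exact: intgZ].
have hF : intg dw F.
  apply: bmeas_intg; have bX k z : bmeas (fun w : S => qd z w ^+ k) by apply: bmeasX; exact: bmeas_qd.
  apply: bmeasB; last by apply: bmeasM => //; apply: bmeasZ; exact: bmeas_cosd.
  apply: bmeasD; apply: bmeasM => //; apply: bmeasM => //.
  - exact: bmeasZ.
  - apply: bmeasM; last exact: bmeas_cst.
    by apply: bmeasB; [exact: bmeas_cst|apply: bmeasX; exact: bmeas_cosd].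
  - exact: bmeasZ.
  - apply: bmeasM; last exact: bmeas_cst.
    by apply: bmeasB; [exact: bmeas_cst|apply: bmeasM; exact: bmeas_cosd].
rewrite -[LHS]addr0 -h -IZ// -ID; last 2 first.
- by apply: intgB; exact: intgZ.
- exact: intgZ.
apply: eq_I => w; rewrite /F /beltrami_a /beltrami_b.
have -> : cosd x w = 2 * qd x w - 1 by rewrite /qd; field.
rewrite -[i.+1%:R]natr1 -[n.+1%:R]natr1.
case: i {hX h F hF} => [|i]; first by rewrite /= expr0 expr1; field.
by rewrite /= !exprS -[i.+1%:R]natr1; field.
Qed.

Lemma zonal_mxC i j x y : zonal_mx i j x y = zonal_mx j i y x.
Proof. by apply: eq_I => w; rewrite mulrC. Qed.

Lemma zonal_mx_rec i j x y :
  beltrami_a i * zonal_mx i j x y - beltrami_b i * zonal_mx i.-1 j x y =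
  beltrami_a j * zonal_mx i j x y - beltrami_b j * zonal_mx i j.-1 x y.
Proof.
rewrite zonal_green [in RHS]zonal_mxC [zonal_mx i j.-1 _ _]zonal_mxC zonal_green.
congr (_ * _); first by rewrite [i%:R * _]mulrC.
by apply: eq_I => w; rewrite [cosd y x]cosdC; ring.
Qed.


End Zonal.

(** * The Gamma function at half-integers and the area of the sphere *)

Section GammaFunction.
Context {R : realType}.
Notation mu := (@lebesgue_measure R).
Notation leb := (@lebesgue_tuple R).
Local Open Scope ereal_scope.

(** Extended-real valued, so that the recursion and the volume formula hold before finiteness is
    known; finiteness at half-integers is then read off from them. *)
Definition eGamma (x : R) : \bar R :=
  \int[mu]_t (if 0 < t then t `^ (x - 1) * expR (- t) else 0)%R%:E.

Lemma GammaE (x : R) : Gamma x = fine (eGamma x).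
Proof.
congr fine; rewrite /Rintegral [LHS]integral_mkcond.
apply: eq_integral => t _; rewrite patchE mem_setE in_itv/= andbT.
by case: ifPn.
Qed.

Let continuous_expRN : continuous (fun s : R => expR (- s))%R.
Proof.
move=> s; apply: continuous_comp; first exact: opp_continuous.
exact: continuous_expR.
Qed.

Let measurable_tail (c : R) : @measurable_fun _ _ (measurableTypeR R) _ setT
  (fun s : R => (if c < s then expR (- s) else 0)%R%:E).
Proof.
apply/measurable_EFinP; apply: measurable_fun_ifT => //.
  exact: measurable_fun_ltr.
exact: continuous_measurable_fun continuous_expRN.
Qed.

Lemma integral_exp_tail (c : R) :
  \int[mu]_s (if c < s then expR (- s) else 0)%R%:E = (expR (- c))%:E.
Proof.
have cE := continuous_expRN.
have D (s : R) : is_derive s (1%R : R) (fun s => - expR (- s))%R (expR (- s))%R.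
  have -> : (fun s => - expR (- s))%R = (- (expR \o (-%R : R -> R)))%R by apply/funext.
  by apply: is_derive_eq; rewrite /GRing.scale/= mulrN1 opprK.
transitivity (\int[mu]_(s in `]c, +oo[) (expR (- s))%:E).
  rewrite [RHS]integral_mkcond; apply: eq_integral => s _.
  by rewrite patchE mem_setE in_itv/= andbT; case: ifPn.
rewrite integral_itv_obnd_cbnd; last first.
  apply/measurable_EFinP/measurable_funTS; exact: continuous_measurable_fun.
rewrite (@ge0_continuous_FTC2y _ (fun s => expR (- s))%R (fun s => - expR (- s))%R c 0%R).
- by rewrite EFinN sub0e oppeK.
- by move=> s _; exact: expR_ge0.
- exact: continuous_subspaceT.
- rewrite -oppr0; apply: cvgN; exact: cvgr_expR.
- by move=> s _; have [] := D s.
- by apply: cvg_at_right_filter; apply: cvgN; exact: cE.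
- by move=> s _; rewrite derive1E; apply: derive_val.
Qed.

Lemma integral_itv0_powR (x t : R) : (0 < x)%R -> (0 < t)%R ->
  \int[mu]_s (if (0 < s) && (s < t) then x * s `^ (x - 1) else 0)%R%:E = (t `^ x)%:E.
Proof.
move=> x0 t0.
(* For $x<1$ the integrand is unbounded at 0, so $]0,t[$ is exhausted by the intervals []e i, t[].
   The choice makes $e_i^x=t^x/(i+2)$, and $i+2$ keeps every [e i] strictly below [t]. *)
pose e (i : nat) : R := (t * (i.+2%:R^-1 `^ x^-1))%R.
have e0 i : (0 < e i)%R by rewrite mulr_gt0// powR_gt0// invr_gt0.
have et i : (e i < t)%R.
  have p1 : (1 `^ x^-1 = 1 :> R)%R by rewrite powR1.
  rewrite gtr_pMr// -[ltRHS]p1 gt0_ltr_powR ?invr_gt0//.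
  - by rewrite nnegrE invr_ge0.
  - by rewrite nnegrE.
  - by rewrite invf_lt1// ltr1n.
have ex i : (e i `^ x = t `^ x * i.+2%:R^-1)%R.
  by rewrite powRM ?powR_ge0 ?ltW// -powRrM mulVf ?gt_eqF// powRr1 ?invr_ge0.
have D (s : R) : (0 < s)%R -> is_derive s (1%R : R) (@powR R ^~ x) (x * s `^ (x - 1))%R.
  by move=> s0; exact: is_derive1_powR.
have mpow : @measurable_fun _ _ (measurableTypeR R) _ setT (fun s : R => (x * s `^ (x - 1))%:E).
  by apply/measurable_EFinP; apply: measurable_funM => //; exact: measurable_powR.
pose F i : set R := `]e i, t[%classic.
have FE i : \int[mu]_(s in F i) (x * s `^ (x - 1))%:E = (t `^ x - t `^ x * i.+2%:R^-1)%:E.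
  rewrite /F -(@integral_itv_bndoo R (e i) t _ true false); last exact: measurable_funTS.
  rewrite (@continuous_FTC2 _ (fun s => x * s `^ (x - 1))%R (@powR R ^~ x))//.
  - by rewrite ex -EFinB.
  - apply: derivable_within_continuous => s; rewrite in_itv/= => /andP[es _].
    have s0 : (0 < s)%R by rewrite (lt_le_trans (e0 i)).
    by apply: derivableM => //; have [] := is_derive1_powR (x - 1) s0.
  - have cp (s : R) : (0 < s)%R -> {for s, continuous (@powR R ^~ x)}.
      by move=> s0; apply/differentiable_continuous/derivable1_diffP; have [] := D s s0.
    split.
    + move=> s; rewrite in_itv/= => /andP[es _].
      by have [] := D s (lt_trans (e0 i) es).
    + exact/cvg_at_right_filter/cp.
    + exact/cvg_at_left_filter/cp.
  - move=> s; rewrite in_itv/= => /andP[es _]; rewrite derive1E.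
    by have D' := D s (lt_trans (e0 i) es); apply: derive_val.
have ndF : nondecreasing_seq F.
  apply/nondecreasing_seqP => i; rewrite subsetEset /F => s /=; rewrite !in_itv/= => /andP[es ->].
  rewrite andbT (le_lt_trans _ es)// ler_pM2l// ge0_ler_powR ?invr_ge0 ?ltW//.
  - by rewrite nnegrE invr_ge0.
  - by rewrite nnegrE invr_ge0.
  - by rewrite ltf_pV2 ?posrE// ltr_nat.
have UF : \bigcup_i F i = `]0%R, t[%classic.
  apply/seteqP; split => s /=.
    by move=> [i _]; rewrite /F /= !in_itv/= => /andP[es ->]; rewrite (lt_trans (e0 i)).
  rewrite in_itv/= => /andP[s0 st].
  have sx0 : (0 < (s / t) `^ x)%R by rewrite powR_gt0// divr_gt0.
  have [k kx] : exists k : nat, (((s / t) `^ x)^-1 < k%:R)%R.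
    by exists (Num.truncn ((s / t) `^ x)^-1).+1; rewrite truncnS_gt.
  exists k => //=; rewrite /F /= in_itv/= st andbT -ltr_pdivlMl// mulrC.
  have sE : (s / t = (s / t) `^ x `^ x^-1)%R.
    by rewrite -powRrM divff ?gt_eqF// powRr1// divr_ge0 ?ltW.
  rewrite [ltRHS]sE gt0_ltr_powR ?invr_gt0//.
  - by rewrite nnegrE invr_ge0.
  - by rewrite nnegrE powR_ge0.
  - rewrite -[ltRHS]invrK ltf_pV2 ?posrE ?invr_gt0//.
    by rewrite (lt_le_trans kx)// ler_nat -addn2 leq_addr.
have cv : \int[mu]_(s in F i) (x * s `^ (x - 1))%:E @[i --> \oo] -->
    \int[mu]_(s in \bigcup_i F i) (x * s `^ (x - 1))%:E.
  apply: ge0_nondecreasing_set_cvg_integral => //.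
  - by move=> i; exact: measurable_itv.
  - by move=> i; exact: measurable_funTS.
  - by move=> i s _; rewrite lee_fin mulr_ge0 ?powR_ge0 ?ltW.
have cv2 : \int[mu]_(s in F i) (x * s `^ (x - 1))%:E @[i --> \oo] --> (t `^ x)%:E.
  under eq_fun do rewrite FE.
  apply: cvg_EFin; first by near=> i.
  have h : (fun i : nat => t `^ x - t `^ x * i.+2%:R^-1)%R @ \oo --> (t `^ x - t `^ x * 0)%R.
    apply: cvgB; first exact: cvg_cst.
    apply: cvgM; first exact: cvg_cst.
    by have := @cvg_harmonic R; rewrite -cvg_shiftS.
  by rewrite mulr0 subr0 in h.
have <- := cvg_unique _ cv cv2 => //.
rewrite UF [RHS]integral_mkcond; apply: eq_integral => s _.
by rewrite patchE mem_setE in_itv/=; case: ifPn.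
Unshelve. all: by end_near.
Qed.


Lemma eGamma_ge0 (x : R) : 0 <= eGamma x.
Proof.
apply: integral_ge0 => t _; rewrite lee_fin; case: ifPn => // _.
by rewrite mulr_ge0 ?powR_ge0 ?expR_ge0.
Qed.

Let mexp : @measurable_fun _ _ (measurableTypeR R) _ setT (fun t : R => expR (- t))%R.
Proof. exact: continuous_measurable_fun continuous_expRN. Qed.

(** Integration by parts in Tonelli form: write $t^x=\int_0^t x s^{x-1}ds$, exchange the integrals
    and use $\int_s^\infty e^{-t}dt=e^{-s}$. The identity holds for infinite values as well. *)
Lemma eGamma_rec (x : R) : (0 < x)%R -> eGamma (x + 1) = x%:E * eGamma x.
Proof.
move=> x0; rewrite /eGamma.
pose K (t s : R) : \bar R :=
  (if (0 < s) && (s < t) then x * s `^ (x - 1) * expR (- t) else 0)%R%:E.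
have K0 t s : 0 <= K t s.
  by rewrite lee_fin; case: ifPn => // _; rewrite !mulr_ge0 ?powR_ge0 ?expR_ge0 ?ltW.
have mK : measurable_fun setT (fun q : measurableTypeR R * measurableTypeR R => K q.1 q.2).
  apply/measurable_EFinP; apply: measurable_fun_ifT => //.
    by apply: measurable_and; apply: measurable_fun_ltr.
  apply: measurable_funM; last exact: (measurableT_comp mexp measurable_fst).
  by apply: measurable_funM => //; apply: (measurableT_comp (measurable_powR _)).
transitivity (\int[mu]_t \int[mu]_s K t s).
  apply: eq_integral => t _; rewrite addrK.
  have [t0|t0] := ltP 0%R t; last first.
    rewrite [RHS]integral0_eq// => s _; rewrite /K; case: ifPn => // /andP[s0 st].
    by have := lt_trans s0 st; rewrite ltNge t0.
  transitivity ((expR (- t))%:E * \int[mu]_s (if (0 < s) && (s < t) then x * s `^ (x - 1) else 0)%R%:E).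
    by rewrite integral_itv0_powR// -EFinM mulrC.
  rewrite -ge0_integralZl//.
  - apply: eq_integral => s _; rewrite /K -EFinM; case: ifPn => _; last by rewrite mulr0.
    by rewrite mulrC.
  - apply/measurable_EFinP; apply: measurable_fun_ifT => //.
      by apply: measurable_and; apply: measurable_fun_ltr.
    by apply: measurable_funM => //; exact: measurable_powR.
  - move=> s _; rewrite lee_fin; case: ifPn => // _.
    by rewrite mulr_ge0 ?powR_ge0 ?ltW.
transitivity (\int[mu]_s \int[mu]_t K t s).
  exact: (@fubini_tonelli _ _ _ _ R mu mu (fun q => K q.1 q.2)).
rewrite -ge0_integralZl//; last 3 first.
- apply/measurable_EFinP; apply: measurable_fun_ifT => //.
    exact: measurable_fun_ltr.
  by apply: measurable_funM => //; exact: measurable_powR.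
- move=> s _; rewrite lee_fin; case: ifPn => // _.
  by rewrite mulr_ge0 ?powR_ge0 ?expR_ge0.
- by rewrite lee_fin ltW.
apply: eq_integral => s _.
have [s0|s0] := ltP 0%R s; last first.
  by rewrite mule0 integral0_eq// => t _; rewrite /K ltNge s0.
transitivity ((x * s `^ (x - 1))%:E * \int[mu]_t (if s < t then expR (- t) else 0)%R%:E).
  rewrite -ge0_integralZl//.
  - by apply: eq_integral => t _; rewrite /K s0 /= -EFinM; case: ifPn => _; rewrite ?mulr0.
  - by move=> t _; rewrite lee_fin; case: ifPn => // _; exact: expR_ge0.
  - by rewrite lee_fin mulr_ge0 ?powR_ge0 ?ltW.
by rewrite integral_exp_tail -!EFinM mulrA.
Qed.

Lemma Gamma_rec (x : R) : (0 < x)%R -> Gamma (x + 1) = (x * Gamma x)%R.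
Proof.
move=> x0; rewrite !GammaE eGamma_rec//.
have := eGamma_ge0 x; case: (eGamma x) => [r| |]//= _.
by rewrite gt0_muley ?lte_fin// mulr0.
Qed.

Lemma integral_gauss_tuple m :
  \int[leb m]_y (expR (- dotp y y))%:E = (Num.sqrt pi ^+ m)%:E.
Proof.
have mf k : measurable_fun setT (fun y : k.-tuple R => (expR (- dotp y y))%:E).
  apply/measurable_EFinP; apply: measurableT_comp; first exact: measurable_expR.
  apply: measurableT_comp => //; apply: measurable_sum => i.
  by apply: measurable_funM; exact: measurable_tnth.
elim: m => [|m IH].
  rewrite [LHS](@integral_dirac _ _ _ _ _ measurableT _ (mf 0%N)) [X in X * _]diracT mul1e.
  by rewrite /dotp big_ord0 oppr0 expR0 expr0.
rewrite (ge0_integral_tcons (mf _)); last by move=> y; rewrite lee_fin expR_ge0.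
transitivity (\int[mu]_t ((gauss_fun t)%:E * (Num.sqrt pi ^+ m)%:E)).
  apply: eq_integral => t _; rewrite -IH -ge0_integralZl//.
  - by apply: eq_integral => y _; rewrite dotp_tcons -expr2 opprD expRD.
  - apply/measurable_EFinP; apply: measurableT_comp; first exact: measurable_expR.
    apply: measurableT_comp => //; apply: measurable_sum => i.
    by apply: measurable_funM; exact: measurable_tnth.
  - by rewrite lee_fin gauss_fun_ge0.
rewrite ge0_integralZr//; last 2 first.
- by apply/measurable_EFinP; exact: measurable_gauss_fun.
- by move=> t _; rewrite lee_fin gauss_fun_ge0.
by rewrite integralT_gauss -EFinM exprS.
Qed.

(** Layer-cake form of the Gaussian integral: $e^{-|y|^2}=\int_{s>|y|^2}e^{-s}ds$, and $\{|y|^2<s\}$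
    has $s^{m/2}$ times the volume of the unit ball. *)
Lemma ball_volume_Gamma m :
  leb m unit_ball * eGamma (m%:R / 2 + 1) = (Num.sqrt pi ^+ m)%:E.
Proof.
have mdot : measurable_fun setT (fun y : m.-tuple R => dotp y y).
  by apply: measurable_sum => i; apply: measurable_funM; exact: measurable_tnth.
pose K (y : m.-tuple R) (s : R) : \bar R :=
  (if dotp y y < s then expR (- s) else 0)%R%:E.
have K0 y s : 0 <= K y s.
  by rewrite lee_fin; case: ifPn => // _; rewrite expR_ge0.
have mK : measurable_fun setT (fun q : m.-tuple R * measurableTypeR R => K q.1 q.2).
  apply/measurable_EFinP; apply: measurable_fun_ifT => //.
    by apply: measurable_fun_ltr => //; exact: (measurableT_comp mdot measurable_fst).
  exact: (measurableT_comp mexp measurable_snd).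
rewrite -integral_gauss_tuple.
transitivity (\int[leb m]_y \int[mu]_s K y s); last first.
  by apply: eq_integral => y _; rewrite integral_exp_tail.
transitivity (\int[mu]_s \int[leb m]_y K y s); last first.
  exact/esym/(@fubini_tonelli _ _ _ _ R (leb m) mu (fun q => K q.1 q.2)).
rewrite /eGamma -ge0_integralZl//; last 2 first.
- apply/measurable_EFinP; apply: measurable_fun_ifT => //.
    exact: measurable_fun_ltr.
  by apply: measurable_funM => //; exact: measurable_powR.
- move=> s _; rewrite lee_fin; case: ifPn => // _.
  by rewrite mulr_ge0 ?powR_ge0 ?expR_ge0.
apply: eq_integral => s _.
have [s0|s0] := ltP 0%R s; last first.
  rewrite mule0 integral0_eq// => y _; rewrite /K ltNge.
  by rewrite (le_trans s0 (dotp_ge0 y)).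
rewrite addrK.
have ss : (0 < Num.sqrt s)%R by rewrite sqrtr_gt0.
have mKs : measurable_fun setT (fun y : m.-tuple R => K y s).
  exact: (measurableT_comp mK (measurable_pair2 _)).
have := ge0_integral_scale ss mKs (fun=> K0 _ _).
move/(congr1 (fun z => (Num.sqrt s ^+ m)%:E * z)).
rewrite muleA -EFinM divff ?gt_eqF ?exprn_gt0// mul1e => <-.
have -> : \int[leb m]_y K (tscale (Num.sqrt s) y) s = (expR (- s))%:E * leb m unit_ball.
  rewrite -[X in leb m X]setIT -integral_indic//; last exact: measurable_unit_ball.
  rewrite -ge0_integralZl//.
  - apply: eq_integral => y _; rewrite /K -sqr_enorm enorm_tscale ?ltW//.
    rewrite exprMn sqr_sqrtr ?ltW// gtr_pMr// -EFinM indicE.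
    rewrite (_ : (y \in unit_ball) = (enorm y ^+ 2 < 1)%R).
      by case: ifPn => _; rewrite ?mulr1 ?mulr0.
    by rewrite expr_lt1 ?enorm_ge0//; apply/idP/idP; rewrite inE.
  - by apply/measurable_EFinP/measurable_indic; exact: measurable_unit_ball.
rewrite muleA muleC; congr (_ * _); rewrite -EFinM; congr (_ * _)%:E.
by rewrite -powR12_sqrt ?ltW// -powR_mulrn ?powR_ge0// -powRrM mulrC.
Qed.

End GammaFunction.

Section HalfIntegerGamma.
Context {R : realType}.
Notation mu := (@lebesgue_measure R).
Notation leb := (@lebesgue_tuple R).

Lemma Gamma1 : Gamma 1 = 1 :> R.
Proof.
have := @integral_exp_tail R 0; rewrite oppr0 expR0 => h.
rewrite GammaE -[RHS]/(fine 1%:E) -h; congr fine; apply: eq_integral => t _.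
by case: ifPn => // t0; rewrite subrr powRr0 mul1r.
Qed.

Local Opaque Gamma eGamma.

(** Two nonnegative extended reals whose product is a positive real are both positive and finite. *)
Lemma eGammaS_fin m : exists2 V : R, 0 < V & leb m unit_ball = V%:E /\
  (eGamma (m%:R / 2 + 1) = (Gamma (m%:R / 2 + 1 : R))%:E /\
   V * Gamma (m%:R / 2 + 1 : R) = Num.sqrt pi ^+ m).
Proof.
have sp : 0 < Num.sqrt pi ^+ m :> R by rewrite exprn_gt0// sqrtr_gt0 pi_gt0.
have := ball_volume_Gamma (R := R) m; have := @lebesgue_tuple_unit_ball R m.
have : (0 <= leb m unit_ball)%E by exact: measure_ge0.
rewrite GammaE; move: (leb m unit_ball) => [V| |]//=.
rewrite lee_fin le_eqVlt => /orP[/eqP <-|V0] _.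
  by rewrite mul0e => -[/eqP]; rewrite lt_eqF.
have := @eGamma_ge0 R (m%:R / 2 + 1); move: (eGamma _) => [G| |]//= G0.
  by rewrite -EFinM => -[VG]; exists V.
by rewrite gt0_muley ?lte_fin.
Qed.

Lemma Gamma_half_gt0 m : 0 < Gamma (m.+1%:R / 2 : R).
Proof.
have [V V0 [_ [_ VG]]] := eGammaS_fin m.+1.
have : 0 < Gamma (m.+1%:R / 2 + 1 : R).
  by rewrite -(pmulr_rgt0 _ V0) VG exprn_gt0// sqrtr_gt0 pi_gt0.
by rewrite Gamma_rec ?divr_gt0// pmulr_rgt0 ?divr_gt0.
Qed.

Lemma eGamma_half m : eGamma (m.+1%:R / 2 : R) = (Gamma (m.+1%:R / 2))%:E.
Proof.
have [V V0 [_ [E _]]] := eGammaS_fin m.+1.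
have m0 : 0 < m.+1%:R / 2 :> R by rewrite divr_gt0.
move: E; rewrite (eGamma_rec m0) (GammaE (m.+1%:R / 2)).
have := eGamma_ge0 (m.+1%:R / 2 : R).
by case: (eGamma (m.+1%:R / 2)) => [x| |]//= _; rewrite gt0_muley ?lte_fin.
Qed.

Lemma surface_gt0 n : 0 < fine (@surface R n setT).
Proof.
have [V V0 [E _]] := eGammaS_fin n.+1.
by rewrite /surface preimage_setT setIT E -EFinM/= mulr_gt0.
Qed.

Lemma surface_Gamma n :
  fine (@surface R n setT) * Gamma (n.+1%:R / 2 : R) = 2 * Num.sqrt pi ^+ n.+1.
Proof.
have [V V0 [E [_ VG]]] := eGammaS_fin n.+1.
rewrite /surface preimage_setT setIT E -EFinM/= -VG Gamma_rec ?divr_gt0//.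
by field.
Qed.

(** The unit ball of the line has length 2, so the volume formula reads
    $2\,\Gamma(3/2)=\sqrt\pi$. *)
Lemma Gamma_half : Gamma (2^-1) = Num.sqrt pi :> R.
Proof.
have [V V0 [E [_ VG]]] := eGammaS_fin 1.
have V2 : V = 2.
  apply: EFin_inj; rewrite -E.
  have mB := @measurable_unit_ball R 1.
  rewrite -[X in leb 1 X]setIT -integral_indic//.
  rewrite (@ge0_integral_tcons R 0 (fun x => (\1_unit_ball x)%:E)); last 2 first.
  - by apply/measurable_EFinP/measurable_indic.
  - by move=> x; rewrite lee_fin.
  transitivity (\int[mu]_t (\1_`](-1)%R, 1%R[ t)%:E)%E.
    apply: eq_integral => t _.
    have tB : unit_ball (tcons (t, [tuple] : 0.-tuple R)) = (-1 < t < 1) :> Prop.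
      rewrite /unit_ball /= /enorm dotp_tcons /dotp big_ord0 addr0 -expr2 sqrtr_sqr.
      by rewrite ltr_norml.
    transitivity (\int[leb 0]_y (cst (\1_`](-1)%R, 1%R[ t)%:E y))%E.
      apply: eq_integral => y _; rewrite (tuple0 y) /cst; congr (_%:E).
      rewrite !indicE; congr (_%:R); congr nat_of_bool.
      by apply/idP/idP; rewrite !inE tB/= in_itv.
    by rewrite integral_cst// [X in (_ * X)%E]diracT mule1.
  rewrite integral_indic// setIT [LHS]lebesgue_measure_itv/= lte_fin.
  have -> : (-1 < 1 :> R) by rewrite (@lt_trans _ _ 0)// ltrN10.
  by rewrite -EFinB opprK.
move: VG; rewrite V2 expr1 Gamma_rec ?divr_gt0// => <-.
by rewrite !div1r; field.
Qed.

Let amgm (A G B : R) : 0 < A -> 0 < G -> G <= (G / A / 2) * A + (A / G / 2) * B ->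
  G ^+ 2 <= A * B.
Proof.
move=> A0 G0; have -> : G / A / 2 * A = G / 2 by field; rewrite gt_eqF.
rewrite -subr_ge0 => h.
have : 0 <= 2 * G * (G / 2 + A / G / 2 * B - G) by rewrite mulr_ge0// mulr_ge0 ?(ltW G0).
have -> : 2 * G * (G / 2 + A / G / 2 * B - G) = A * B - G ^+ 2.
  by field; rewrite gt_eqF.
by rewrite subr_ge0.
Qed.

(** A weighted arithmetic-geometric mean inequality under the integral, with a free weight [l]. The
    choice $l=\Gamma(x+1/2)/\Gamma(x)$ makes [amgm] give the Cauchy-Schwarz bound
    $\Gamma(x+1/2)^2\le\Gamma(x)\Gamma(x+1)$. *)
Let eGamma_amgm (x l : R) : 0 < l ->
  (eGamma (x + 2^-1) <= (l / 2)%:E * eGamma x + (l^-1 / 2)%:E * eGamma (x + 1))%E.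
Proof.
Local Transparent eGamma.
move=> l0; rewrite /eGamma.
have mP (y : R) : @measurable_fun _ _ (measurableTypeR R) _ setT
    (fun t : R => (if 0 < t then t `^ (y - 1) * expR (- t) else 0)%:E).
  apply/measurable_EFinP; apply: measurable_fun_ifT => //.
    exact: measurable_fun_ltr.
  apply: measurable_funM; first exact: measurable_powR.
  by apply: (measurableT_comp (@measurable_expR R)); exact: oppr_measurable.
have pos (y t : R) : (0 <= (if 0 < t then t `^ (y - 1) * expR (- t) else 0)%:E)%E.
  by rewrite lee_fin; case: ifPn => // _; rewrite mulr_ge0 ?powR_ge0 ?expR_ge0.
have c1 : (0 <= (l / 2)%:E)%E by rewrite lee_fin divr_ge0 ?ltW.
have c2 : (0 <= (l^-1 / 2)%:E)%E by rewrite lee_fin divr_ge0 ?invr_ge0 ?ltW.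
have mZ (c y : R) : @measurable_fun _ _ (measurableTypeR R) _ setT
    (fun t : R => c%:E * (if 0 < t then t `^ (y - 1) * expR (- t) else 0)%:E)%E.
  by apply: emeasurable_funM.
rewrite -ge0_integralZl// -ge0_integralZl// -ge0_integralD//; last 2 first.
- by move=> t _; rewrite mule_ge0.
- by move=> t _; rewrite mule_ge0.
apply: ge0_le_integral => //.
- by apply: emeasurable_funD.
move=> t _; rewrite -!EFinM -EFinD lee_fin.
case: ifPn => [t0|_]; last by rewrite !mulr0 addr0.
set s := t `^ (x / 2 - 2^-1).
have E1 : t `^ (x - 1) = s ^+ 2.
  by rewrite -powR_mulrn ?powR_ge0// -powRrM; congr (_ `^ _); field.
have E2 : t `^ (x + 1 - 1) = (s * t `^ 2^-1) ^+ 2.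
  rewrite -powR_mulrn ?mulr_ge0 ?powR_ge0// -powRD; last by rewrite (gt_eqF t0) implybT.
  by rewrite -powRrM; congr (_ `^ _); field.
have E3 : t `^ (x + 2^-1 - 1) = s * (s * t `^ 2^-1).
  rewrite -!powRD; try by rewrite (gt_eqF t0) implybT.
  by congr (_ `^ _); field.
rewrite E1 E2 E3; move: (s * t `^ _) => r.
have := expR_ge0 (- t); move: (expR _) s {E1 E2 E3} => e s e0.
rewrite -subr_ge0.
have -> : l / 2 * (s ^+ 2 * e) + l^-1 / 2 * (r ^+ 2 * e) - s * r * e =
   e / (2 * l) * (l * s - r) ^+ 2 by field; rewrite gt_eqF.
by rewrite mulr_ge0 ?sqr_ge0// divr_ge0// mulr_ge0// ltW.
Qed.

Local Opaque eGamma.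

Lemma Gamma_half_logconvex m :
  Gamma (m.+1%:R / 2 + 2^-1 : R) ^+ 2 <= Gamma (m.+1%:R / 2) * Gamma (m.+1%:R / 2 + 1).
Proof.
have x2 : m.+1%:R / 2 + 2^-1 = m.+2%:R / 2 :> R by rewrite -[m.+2%:R]natr1 mulrDl div1r.
have A0 := Gamma_half_gt0 m; have G0 := Gamma_half_gt0 m.+1.
have [V V0 [_ [BE _]]] := eGammaS_fin m.+1.
have l0 : 0 < Gamma (m.+2%:R / 2) / Gamma (m.+1%:R / 2) :> R by rewrite divr_gt0.
have := eGamma_amgm (m.+1%:R / 2) l0.
rewrite BE x2 !eGamma_half invf_div -!EFinM -EFinD lee_fin.
exact: amgm.
Qed.

End HalfIntegerGamma.

(** * Asymptotics of the hypergeometric coefficients *)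

Section ZonalCoefficients.
Context {R : realType}.
Implicit Types a l : R.
Local Opaque Gamma.

(* The coefficients of the hypergeometric series F(a, a; 2a; t). *)
Definition cf a j : R :=
  \prod_(i < j) ((a + i%:R) ^+ 2 / (i.+1%:R * (2 * a + i%:R))).

Lemma cf0 a : cf a 0 = 1. Proof. exact: big_ord0. Qed.

Lemma cfS a j : cf a j.+1 = cf a j * ((a + j%:R) ^+ 2 / (j.+1%:R * (2 * a + j%:R))).
Proof. exact: big_ord_recr. Qed.

Lemma cf_gt0 a j : 0 < a -> 0 < cf a j.
Proof.
move=> a0; apply: prodr_gt0 => i _.
by rewrite divr_gt0 ?exprn_gt0 ?mulr_gt0 ?ltr_wpDr ?mulr_gt0.
Qed.

Lemma cf_tel a j : 0 < a ->
  j.+1%:R * cf a j.+1 - j%:R * cf a j = a ^+ 2 * cf a j / (2 * a + j%:R).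
Proof.
move=> a0; rewrite cfS -natr1; have j0 : 0 <= j%:R :> R by rewrite ler0n.
by field; rewrite !gt_eqF//; lra.
Qed.

Lemma cvg_inv_addn (x : R) : 0 < x -> (x + j%:R)^-1 @[j --> \oo] --> 0.
Proof.
move=> x0.
apply: (@squeeze_cvgr _ _ _ _ (cst 0) (fun j => (1 + x^-1) * j.+1%:R^-1)).
- apply: nearW => j; have j0 : 0 <= j%:R :> R by rewrite ler0n.
  rewrite /cst invr_ge0 addr_ge0 ?(ltW x0)//=.
  rewrite ler_pdivlMr// ler_pdivrMl ?ltr_wpDr//.
  have -> : (x + j%:R) * (1 + x^-1) = j.+1%:R + x + j%:R / x.
    by rewrite -natr1; field; rewrite gt_eqF.
  by rewrite -addrA lerDl addr_ge0 ?divr_ge0// ltW.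
- exact: cvg_cst.
- rewrite -(mulr0 (1 + x^-1)); apply: cvgM; first exact: cvg_cst.
  exact: cvg_harmonic.
Qed.

(** Passing from $a$ to $a+1$ multiplies the coefficients by a rational function of $j$, so the
    limit of [j * cf a j] propagates by steps of two in [n] from the cases $a=1/2$ and $a=1$. *)
Lemma cf_shift a j : 0 < a -> cf (a + 1) j =
  cf a j * ((a + j%:R) ^+ 2 / a ^+ 2 * (2 * a * (2 * a + 1)) /
    ((2 * a + j%:R) * (2 * a + j.+1%:R))).
Proof.
move=> a0; elim: j => [|j IH].
  by rewrite !cf0; field; rewrite !gt_eqF//; lra.
have j0 : 0 <= j%:R :> R by rewrite ler0n.
rewrite !cfS IH -![_.+1%:R]natr1; field; rewrite !gt_eqF//; lra.
Qed.

(** By the duplication formula this is $\Gamma(2a)/\Gamma(a)^2$ with $a=(n+1)/2$: the limit of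
    $j\,c_j$, and hence the coefficient of $-\ln(1-t)$ in the hypergeometric series. *)
Definition ell n : R := 2 ^+ n * Gamma (n.+2%:R / 2) / (Num.sqrt pi * Gamma (n.+1%:R / 2)).

Lemma ell_gt0 n : 0 < ell n.
Proof.
by rewrite divr_gt0 ?mulr_gt0 ?exprn_gt0 ?Gamma_half_gt0// sqrtr_gt0 pi_gt0.
Qed.

Lemma ellSS n : ell n.+2 = ell n * (4 * n.+2%:R / n.+1%:R).
Proof.
have s0 : Num.sqrt pi != 0 :> R by rewrite gt_eqF// sqrtr_gt0 pi_gt0.
have h m : (m.+2%:R / 2 : R) = m%:R / 2 + 1 by rewrite -2!natr1; field.
have g0 : Gamma (n.+1%:R / 2 : R) != 0 by rewrite gt_eqF// Gamma_half_gt0.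
have n0 : n.+1%:R != 0 :> R by [].
rewrite /ell !exprS (h n.+2) (h n.+1) !Gamma_rec ?divr_gt0//; field.
by rewrite s0 g0 nat1r n0.
Qed.

Let wallis j : cf (2^-1) j.+1 =
  Gamma (j.+1%:R + 2^-1) ^+ 2 / (pi * Gamma (j.+2%:R) ^+ 2).
Proof.
have s2 : Num.sqrt pi ^+ 2 = pi :> R by rewrite sqr_sqrtr// pi_ge0.
have G j' : Gamma j'.+1%:R != 0 :> R.
  have -> : j'.+1%:R = (j'.*2.+1).+1%:R / 2 :> R.
    by rewrite -[(_.*2.+1).+1]doubleS -muln2 natrM mulfK.
  by rewrite gt_eqF// Gamma_half_gt0.
elim: j => [|j IH].
  have -> : Gamma (1 + 2^-1) = 2^-1 * Num.sqrt pi :> R by rewrite addrC Gamma_rec ?Gamma_half.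
  have -> : Gamma 2%:R = 1 :> R by rewrite -natr1 Gamma_rec// Gamma1 mul1r.
  rewrite cfS cf0 addr0.
  have p0 : pi != 0 :> R by rewrite gt_eqF ?pi_gt0.
  rewrite exprMn s2; move: (pi : R) p0 => p p0.
  by field.
have r1 : Gamma (j.+2%:R + 2^-1) = (j.+1%:R + 2^-1) * Gamma (j.+1%:R + 2^-1) :> R.
  by rewrite -[j.+2%:R]natr1 addrAC Gamma_rec// addr_gt0.
have r2 : Gamma j.+3%:R = j.+2%:R * Gamma j.+2%:R :> R.
  by rewrite -[j.+3%:R]natr1 Gamma_rec.
rewrite cfS IH r1 r2 {IH r1 r2 s2}.
have : pi != 0 :> R by rewrite gt_eqF ?pi_gt0.
move: (pi : R); have := G j.+1; move: (Gamma _) (Gamma _) => x y y0 p p0.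
rewrite -[j.+2%:R]natr1 -[j.+1%:R]natr1; have j0 : 0 <= j%:R :> R by rewrite ler0n.
by field; rewrite p0 y0 !gt_eqF//; lra.
Qed.

(** Wallis' product: log-convexity of Gamma used at $j+1$ bounds the term from above, and used at
    $j+3/2$ from below. *)
Let cvg_cf0 : j%:R * cf (2^-1) j @[j --> \oo] --> (pi^-1 : R).
Proof.
have p0 : 0 < pi :> R by exact: pi_gt0.
rewrite -cvg_shiftS.
have D j : j.+1%:R = (j.*2.+1).+1%:R / 2 :> R.
  by rewrite -[(_.*2.+1).+1]doubleS -muln2 natrM mulfK.
have D' j : j.+1%:R + 2^-1 = (j.+1).*2.+1%:R / 2 :> R.
  by rewrite -[_.*2.+1%:R]natr1 -muln2 natrM mulrDl mulfK// div1r.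
apply: (@squeeze_cvgr _ _ _ _ (fun j => pi^-1 * (1 - (3 / 2 + j%:R)^-1 / 2)) (cst pi^-1)).
- apply: nearW => j; rewrite /= wallis -[j.+2%:R]natr1.
  have h1 := @Gamma_half_logconvex R j.*2.+1; rewrite -D in h1.
  have h2 := @Gamma_half_logconvex R (j.+1).*2; rewrite -D' in h2.
  have e2 : j.+1%:R + 2^-1 + 2^-1 = j.+1%:R + 1 :> R by field.
  rewrite e2 in h2; move: h1 h2.
  have G0 : 0 < Gamma (j.+1%:R : R) by rewrite D Gamma_half_gt0.
  have H0 : 0 < Gamma (j.+1%:R + 2^-1 : R) by rewrite D' Gamma_half_gt0.
  rewrite [Gamma (j.+1%:R + 2^-1 + 1)]Gamma_rec ?addr_gt0// [Gamma (j.+1%:R + 1)]Gamma_rec//.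
  move: (Gamma _) (Gamma _) G0 H0 => H G G0 H0 h1 h2.
  move: (pi : R) p0 => p p0.
  have j0 : 0 <= j%:R :> R by rewrite ler0n.
  have j1 : 0 < j.+1%:R :> R by [].
  have q0 : 0 < p * (j.+1%:R * G) ^+ 2 by rewrite mulr_gt0 ?exprn_gt0 ?mulr_gt0.
  rewrite /cst [j.+1%:R * (_ / _)]mulrA ler_pdivlMr// ler_pdivrMr//; apply/andP; split.
    have -> : p^-1 * (1 - (3 / 2 + j%:R)^-1 / 2) * (p * (j.+1%:R * G) ^+ 2) =
        j.+1%:R / (j.+1%:R + 2^-1) * (j.+1%:R * G) ^+ 2.
      rewrite -natr1; field; rewrite !gt_eqF//; lra.
    rewrite mulrAC ler_pdivrMr ?addr_gt0// -[leRHS]mulrA.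
    by rewrite ler_pM2l// (le_trans h2)// mulrA mulrAC.
  have -> : p^-1 * (p * (j.+1%:R * G) ^+ 2) = j.+1%:R * (G * (j.+1%:R * G)).
    by field; rewrite gt_eqF.
  by rewrite ler_pM2l.
- have {2}-> : pi^-1 = pi^-1 * (1 - 0 / 2) :> R by rewrite mul0r subr0 mulr1.
  apply: cvgM; first exact: cvg_cst.
  apply: cvgB; first exact: cvg_cst.
  apply: cvgM; last exact: cvg_cst.
  by apply: cvg_inv_addn; lra.
- exact: cvg_cst.
Qed.

Let cvg_cf1 : j%:R * cf 1 j @[j --> \oo] --> (1 : R).
Proof.
have cE j : cf (1 : R) j = j.+1%:R^-1.
  elim: j => [|j IH]; first by rewrite cf0 invr1.
  rewrite cfS IH -![_.+1%:R]natr1; have j0 : 0 <= j%:R :> R by rewrite ler0n.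
  by field; rewrite !gt_eqF//; lra.
have -> : (fun j => j%:R * cf (1 : R) j) = (fun j => 1 - (1 + j%:R)^-1).
  apply/funext => j; rewrite cE -natr1; have j0 : 0 <= j%:R :> R by rewrite ler0n.
  by field; rewrite !gt_eqF//; lra.
rewrite -[X in _ --> X]subr0; apply: cvgB; first exact: cvg_cst.
exact: cvg_inv_addn.
Qed.

Lemma cvg_cf n : j%:R * cf (n.+1%:R / 2) j @[j --> \oo] --> ell n.
Proof.
have p0 : Num.sqrt pi != 0 :> R by rewrite gt_eqF// sqrtr_gt0 pi_gt0.
have [] : (j%:R * cf (n.+1%:R / 2) j @[j --> \oo] --> ell n) /\
  (j%:R * cf (n.+2%:R / 2) j @[j --> \oo] --> ell n.+1) => //.
elim: n => [|n [IH1 IH2]].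
  have l0 : ell 0 = pi^-1.
    rewrite /ell expr0 mul1r divff// Gamma1 (_ : 1%:R / 2 = 2^-1) ?mul1r// Gamma_half.
    by rewrite -expr2 sqr_sqrtr ?pi_ge0// mul1r.
  have l1 : ell 1 = 1.
    rewrite /ell expr1 divff// Gamma1 mulr1.
    have -> : 3%:R / 2 = 2^-1 + 1 :> R by field.
    by rewrite Gamma_rec// Gamma_half; field.
  have h1 : 1%:R / 2 = 2^-1 :> R by rewrite mul1r.
  by split; [rewrite l0 h1; exact: cvg_cf0|rewrite l1 divff//; exact: cvg_cf1].
split; first exact: IH2.
set a : R := n.+1%:R / 2.
have a0 : 0 < a by rewrite divr_gt0.
have aS : n.+3%:R / 2 = a + 1 by rewrite /a -2![_.+1%:R]natr1; field.
have -> : (fun j => j%:R * cf (n.+3%:R / 2 : R) j) = (fun j => j%:R * cf a j *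
   ((1 - a * (2 * a + j%:R)^-1) * (1 - (a + 1) * (2 * a + 1 + j%:R)^-1) *
   (2 * (2 * a + 1) / a))).
  apply/funext => j; rewrite aS cf_shift// -[j.+1%:R]natr1.
  have j0 : 0 <= j%:R :> R by rewrite ler0n.
  by field; rewrite !gt_eqF//; lra.
have -> : ell n.+2 = ell n * ((1 - a * 0) * (1 - (a + 1) * 0) * (2 * (2 * a + 1) / a)).
  rewrite ellSS /a -[n.+2%:R]natr1; field.
  by rewrite nat1r.
apply: cvgM; first exact: IH1.
apply: cvgM; last exact: cvg_cst.
by apply: cvgM; apply: cvgB; try exact: cvg_cst; apply: cvgM; try exact: cvg_cst;
  apply: cvg_inv_addn; lra.
Qed.

End ZonalCoefficients.

(** * Spherical harmonics and the spectral gap *)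

Section Triangular.
Context {R : realType}.
Variable al : nat -> R.
Hypothesis al0 : al 0 = 0.
Hypothesis al_lt : forall i j, (i < j)%N -> al i < al j.
Implicit Types (g h : nat -> R) (i j k : nat).

(** [zc] and [mc] are inverse triangular matrices ([dcE]). The row [zc k] combines $G_0,\dots,G_k$
    into a kernel living in degree [k]; [mc j k] is, up to a factor depending on [k] alone, the
    eigenvalue of $G_j$ in degree [k]. *)
Definition zc k i : R := \prod_(i <= l < k) (al l.+1 / (al l - al k)).
Definition mc j k : R := \prod_(k <= l < j) (al l.+1 / (al l.+1 - al k)).
Definition zsum g k : R := \sum_(i < k.+1) zc k i * g i.

Lemma zckk k : zc k k = 1. Proof. by rewrite /zc big_geq. Qed.

Let al_neq i j : (i < j)%N -> al i - al j != 0.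
Proof. by move=> /al_lt ij; rewrite subr_eq0 lt_eqF. Qed.

Let al_gt0 i : 0 < al i.+1. Proof. by rewrite -al0 al_lt. Qed.

Let zc_rec k i : (i <= k)%N ->
  (al i - al k) * zc k i = al i.+1 * (if (i < k)%N then zc k i.+1 else 0).
Proof.
rewrite leq_eqVlt => /orP[/eqP ->|ik]; first by rewrite ltnn subrr mul0r mulr0.
rewrite ik /zc big_ltn//; set P := \prod_(_ <= _ < _) _.
by field; exact: al_neq.
Qed.

Lemma mc_ge0 j k : 0 <= mc j k.
Proof.
rewrite /mc big_nat; apply: prodr_ge0 => l /andP[kl _].
by rewrite divr_ge0 ?(ltW (al_gt0 _))// subr_ge0 ltW// al_lt// ltnS.
Qed.

Lemma mc_rec j k : (k <= j)%N -> mc j k = (1 - al k / al j.+1) * mc j.+1 k.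
Proof.
move=> kj; rewrite /mc big_nat_recr//=; set P := \prod_(_ <= _ < _) _.
have := al_lt (_ : (k < j.+1)%N); rewrite ltnS => /(_ kj) h; have := al_gt0 j.
by move=> h0; field; rewrite subr_eq0 !gt_eqF.
Qed.

(** The recursion [zc_rec] of the coefficients makes the difference of the two sides a telescoping
    sum; its ends vanish because [al 0 = 0] and because the coefficients stop at [k]. *)
Lemma zsum_eigen g h k (A : R) :
  (forall i, al i * (g i - g i.-1) = A * (g i - h i)) ->
  A * (zsum g k - zsum h k) = al k * zsum g k.
Proof.
move=> gh; rewrite /zsum -sumrB 2!mulr_sumr; apply/eqP; rewrite -subr_eq0 -sumrB.
pose u i := (if (i <= k)%N then zc k i else 0) * (al i * g i.-1).
rewrite (eq_bigr (fun i : 'I_k.+1 => u i.+1 - u i)); last first.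
  move=> i _; have ik : (i <= k)%N by rewrite -ltnS.
  have := zc_rec ik => e; rewrite -mulrBr mulrCA -gh /u ik.
  rewrite /= [_ * (al i.+1 * g i)]mulrCA mulrA [(if _ then _ else _) * g i]mulrC.
  transitivity ((al i - al k) * zc k i * g i - zc k i * (al i * g i.-1)); first by ring.
  by rewrite e; case: ltnP => _; ring.
by rewrite -(big_mkord xpredT (fun i => u i.+1 - u i)) telescope_sumr//; rewrite /u ltnn mul0r al0 mul0r mulr0 subrr.
Qed.

Let dc j i := \sum_(i <= k < j.+1) mc j k * zc k i.

(** The sums [dc] obey a recursion between rows [m] and [m.+1] ([step]). It determines each row from
    the previous one by descending induction on the column, starting from the diagonal entry 1. *)
Let dcE j i : (i <= j)%N -> dc j i = (i == j)%:R.
Proof.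
have djj m : dc m m = 1 by rewrite /dc big_nat1 zckk mulr1 /mc big_geq.
have step m i' : (i' <= m)%N -> (1 - al i' / al m.+1) * dc m.+1 i' =
    dc m i' - al i'.+1 / al m.+1 * dc m.+1 i'.+1.
  move=> im; have a0 := al_gt0 m.
  have -> : dc m i' = \sum_(i' <= k < m.+2) (1 - al k / al m.+1) * (mc m.+1 k * zc k i').
    rewrite big_nat_recr ?(leqW im)//= divff ?gt_eqF// subrr mul0r addr0 /dc.
    apply: eq_big_nat => k /andP[_ km].
    by rewrite (mc_rec (_ : (k <= m)%N))// mulrA.
  have -> : dc m.+1 i'.+1 = \sum_(i' <= k < m.+2) mc m.+1 k * (if (i' < k)%N then zc k i'.+1 else 0).
    rewrite big_ltn ?ltnn ?ltnS ?(leqW im)// mulr0 add0r /dc.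
    by apply: eq_big_nat => k /andP[-> _].
  rewrite /dc !mulr_sumr -sumrB; apply: eq_big_nat => k /andP[ik _].
  have := zc_rec ik => e.
  have -> : (if (i' < k)%N then zc k i'.+1 else 0) = (al i' - al k) * zc k i' / al i'.+1.
    by rewrite e mulrC mulKf// gt_eqF.
  by field; rewrite !gt_eqF.
elim: j i => [|j IH] i; first by rewrite leqn0 => /eqP ->; rewrite djj.
rewrite leq_eqVlt => /orP[/eqP ->|]; first by rewrite djj eqxx.
rewrite ltnS => ij; rewrite ltn_eqF//.
have nz l : (l <= j)%N -> 1 - al l / al j.+1 != 0.
  move=> lj; rewrite subr_eq0 eq_sym lt_eqF// ltr_pdivrMr// mul1r al_lt//.
have [m jm] : exists m, j = (i + m)%N by exists (j - i)%N; rewrite subnKC.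
elim: m i ij jm => [|m IHm] i ij jm.
  have ji : j = i by rewrite jm addn0.
  apply: (mulfI (nz i ij)); rewrite step// mulr0 IH// ji eqxx djj.
  by rewrite divff ?gt_eqF// mul1r subrr.
have ij' : (i < j)%N by rewrite jm addnS ltnS leq_addr.
apply: (mulfI (nz i ij)); rewrite step// mulr0 IH// (ltn_eqF ij').
by rewrite IHm// ?mulr0 ?subrr// jm addnS addSn.
Qed.

Lemma zsum_inv g j : g j = \sum_(k < j.+1) mc j k * zsum g k.
Proof.
transitivity (\sum_(k < j.+1) \sum_(i < j.+1 | (i < k.+1)%N) mc j k * zc k i * g i); last first.
  apply: eq_bigr => k _; rewrite /zsum mulr_sumr.
  rewrite (big_ord_widen_cond j.+1 xpredT (fun i => mc j k * (zc k i * g i)))//.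
  by apply: eq_bigr => i _; rewrite mulrA.
rewrite (exchange_big_dep xpredT)//=.
rewrite (bigD1 ord_max)//= [X in _ + X]big1 ?addr0.
  rewrite (bigD1 ord_max)//= big1 ?addr0 /mc ?big_geq// ?zckk ?mulr1 ?mul1r//.
  move=> k /andP[jk /negP[]]; apply/eqP/val_inj/eqP; rewrite /= eqn_leq -ltnS ltn_ord/=.
  by rewrite -ltnS.
move=> i ij; rewrite -mulr_suml.
suff -> : \sum_(k < j.+1 | (i < k.+1)%N) mc j k * zc k i = 0 by rewrite mul0r.
have ilj : (i < j)%N by rewrite ltn_neqAle -ltnS ltn_ord andbT; apply: contra ij => /eqP ij; exact/eqP/val_inj.
rewrite -[RHS](_ : dc j i = 0); last by rewrite dcE ?(ltn_eqF ilj)// ltnW.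
by rewrite /dc big_geq_mkord.
Qed.

End Triangular.

(** * The normalised zonal kernels *)

Section ZonalHarmonics.
Context {R : realType} {n : nat}.
Notation S := (sphere R n.+1).
Notation dw := (@surface R n.+1).
Notation I f := (Rintegral dw setT f).
Notation al := (@beltrami_a R n).
Notation sph := (fine (dw setT)).
Notation a := (n.+1%:R / 2 : R).
Implicit Types (x y z w : S) (r : S -> R).

Let a_gt0 : 0 < a. Proof. by rewrite divr_gt0. Qed.
Let a2 : 2 * a = n.+1%:R. Proof. by rewrite mulrC divfK. Qed.
Let al0 : al 0 = 0. Proof. by rewrite /beltrami_a mul0r. Qed.

Lemma beltrami_a_lt i j : (i < j)%N -> al i < al j.
Proof.
move=> ij; rewrite /beltrami_a; have : i%:R < j%:R :> R by rewrite ltr_nat.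
have : 0 <= i%:R :> R by rewrite ler0n.
have : 0 <= n%:R :> R by rewrite ler0n.
nra.
Qed.

Definition qmom j : R := sph * \prod_(i < j) ((a + i%:R) / (2 * a + i%:R)).

Lemma qmom_gt0 j : 0 < qmom j.
Proof.
rewrite mulr_gt0 ?surface_gt0//; apply: prodr_gt0 => i _.
by rewrite divr_gt0 ?ltr_wpDr// mulr_gt0.
Qed.

Lemma qmomS j : qmom j.+1 = qmom j * ((a + j%:R) / (2 * a + j%:R)).
Proof. by rewrite /qmom big_ord_recr/= mulrA. Qed.

(** Dividing by the moments turns the coefficient [beltrami_b] into [beltrami_a], so that the
    recursion for the normalised kernels ([gqc_rec]) contains differences only. *)
Let b_qmom i : @beltrami_b R n i * qmom i.-1 = al i * qmom i.-1 * (qmom i / qmom i.-1).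
Proof.
case: i => [|i] /=; first by rewrite /beltrami_b al0 !mul0r.
have := qmom_gt0 i; rewrite qmomS /beltrami_b /beltrami_a a2 -![_.+1%:R]natr1.
move: (qmom i) => q q0; have i0 : 0 <= i%:R :> R by rewrite ler0n.
have n0 : 0 <= n%:R :> R by rewrite ler0n.
by field; rewrite !gt_eqF//; lra.
Qed.

Lemma bmeas_qdX x j : bmeas (fun w : S => qd x w ^+ j).
Proof. by apply: bmeasX; exact: bmeas_qd. Qed.

(** [zonal_mx_rec] against the constant function, whose coefficients vanish, is a first-order
    recursion for the moments. *)
Lemma I_qdX x j : I (fun w => qd x w ^+ j) = qmom j.
Proof.
transitivity (zonal_mx j 0 x x); first by apply: eq_I => w; rewrite expr0 mulr1.
elim: j => [|j IH].
  transitivity (I (fun=> 1)); first by apply: eq_I => w; rewrite !expr0 mulr1.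
  by rewrite Icst mul1r /qmom big_ord0 mulr1.
have := zonal_mx_rec j.+1 0 x x; rewrite /= IH al0 {2}/beltrami_b !mul0r subrr.
have := b_qmom j.+1; rewrite /= => -> /eqP; rewrite subr_eq0 => /eqP.
rewrite -mulrA => /mulfI -> //.
  by rewrite mulrC divfK// gt_eqF// qmom_gt0.
by rewrite gt_eqF// -al0 beltrami_a_lt.
Qed.

(* As j tends to infinity, these kernels form an approximation of the identity. *)
Definition gq j x y : R := qd x y ^+ j / qmom j.

Lemma bmeas_gq2 j : bmeas (fun p : S * S => gq j p.1 p.2).
Proof. by apply: bmeasM; [apply: bmeasX; exact: bmeas_qd2|exact: bmeas_cst]. Qed.

Lemma bmeas_gq j x : bmeas (gq j x).
Proof. exact: (bmeas_section x (bmeas_gq2 j)). Qed.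

Lemma gqC j x y : gq j x y = gq j y x. Proof. by rewrite /gq qdC. Qed.

Lemma gq_ge0 j x y : 0 <= gq j x y.
Proof. by rewrite divr_ge0 ?exprn_ge0 ?qd_ge0// ltW// qmom_gt0. Qed.

Lemma I_gq j x : I (gq j x) = 1.
Proof.
have h := bmeas_intg dw (bmeas_qdX x j).
transitivity ((qmom j)^-1 * I (fun w => qd x w ^+ j)).
  by rewrite -IZ//; apply: eq_I => w; rewrite mulrC.
by rewrite I_qdX mulVf// gt_eqF// qmom_gt0.
Qed.

Definition gqc i j x y : R := I (fun w => gq i x w * gq j w y).

Let gqcE i j x y : gqc i j x y = zonal_mx i j x y / (qmom i * qmom j).
Proof.
rewrite mulrC -IZ; last by apply: bmeas_intg; apply: bmeasM; exact: bmeas_qdX.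
apply: eq_I => w; rewrite /gq [qd w y]qdC; field.
by rewrite !gt_eqF// qmom_gt0.
Qed.

Lemma gqc_rec i j x y :
  al i * (gqc i j x y - gqc i.-1 j x y) = al j * (gqc i j x y - gqc i j.-1 x y).
Proof.
have nz k : qmom k != 0 by rewrite gt_eqF// qmom_gt0.
have := zonal_mx_rec i j x y.
move=> /(congr1 (fun u => u / (qmom i * qmom j))).
have bE k : @beltrami_b R n k = al k * (qmom k / qmom k.-1).
  by apply: (mulIf (nz k.-1)); rewrite b_qmom; field.
rewrite !bE !gqcE => h; rewrite !mulrBr.
transitivity ((al i * zonal_mx i j x y - al i * (qmom i / qmom i.-1) * zonal_mx i.-1 j x y) / (qmom i * qmom j)).
  by field; rewrite !nz.
by rewrite h; field; rewrite !nz.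
Qed.

Lemma I_gq_1Bqd j x : I (fun w => gq j x w * (1 - qd w x)) = a / (2 * a + j%:R).
Proof.
have h k : intg dw (fun w => gq k x w) by apply: bmeas_intg; exact: bmeas_gq.
transitivity (I (fun w => gq j x w - (qmom j.+1 / qmom j) * gq j.+1 x w)).
  apply: eq_I => w; rewrite /gq exprS qdC; field.
  by rewrite !gt_eqF// qmom_gt0.
rewrite IB ?IZ// ?I_gq ?qmomS; last exact: intgZ.
have := qmom_gt0 j; have j0 : 0 <= j%:R :> R by rewrite ler0n.
by have := a_gt0; move: a (qmom j) => b q b0 q0; field; rewrite !gt_eqF//; lra.
Qed.

(** As $1-q(w,y)=|w-y|^2/4$, this says that the linear function $\langle x,\cdot\rangle$ is
    1-Lipschitz; the sum of squares in the proof is $|(w-y)-Dx|^2$. *)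
Lemma sqr_qdB x y w : (qd x w - qd x y) ^+ 2 <= 1 - qd w y.
Proof.
have e4 : edist (val w) (val y) ^+ 2 = 4 * (1 - qd w y) by exact: edist_sqr.
have -> : (qd x w - qd x y) ^+ 2 = (cosd x w - cosd x y) ^+ 2 / 4 by rewrite /qd; field.
have -> : 1 - qd w y = edist (val w) (val y) ^+ 2 / 4 by rewrite e4; field.
rewrite ler_pM2r ?invr_gt0// sqr_sqrtr; last by apply: sumr_ge0 => i _; exact: sqr_ge0.
set D := cosd x w - cosd x y.
have : 0 <= \sum_i ((tnth (val w) i - tnth (val y) i) - D * tnth (val x) i) ^+ 2.
  by apply: sumr_ge0 => i _; exact: sqr_ge0.
have DE : D = \sum_i (tnth (val w) i - tnth (val y) i) * tnth (val x) i.
  by rewrite /D /cosd /dotp -sumrB; apply: eq_bigr => i _; ring.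
have X1 : \sum_i tnth (val x) i * tnth (val x) i = 1 by exact: cosdxx.
rewrite (eq_bigr (fun i => (tnth (val w) i - tnth (val y) i) ^+ 2 -
   2 * D * ((tnth (val w) i - tnth (val y) i) * tnth (val x) i) +
   D ^+ 2 * (tnth (val x) i * tnth (val x) i))); last by move=> i _; ring.
rewrite big_split sumrB/= -!mulr_sumr -DE X1; lra.
Qed.

Let amgm (t u eta : R) : 0 < eta -> t ^+ 2 <= u -> t <= eta / 2 + u / (2 * eta).
Proof.
move=> eta0 tu; have -> : eta / 2 + u / (2 * eta) = (eta ^+ 2 + u) / (2 * eta).
  by field; rewrite gt_eqF.
rewrite ler_pdivlMr ?mulr_gt0//; have := sqr_ge0 (eta - t); lra.
Qed.

(** The mass of $G_j(\cdot,y)$ concentrates at $y$, the mean of $1-q(\cdot,y)$ being $a/(2a+j)$. The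
    parameter [eta] trades the Lipschitz bound, of first order in the distance, for this
    second-order quantity. *)
Lemma gqc_cvg i e : 0 < e ->
  exists J, forall j, (J <= j)%N -> forall x y, `|gqc i j x y - gq i x y| <= e.
Proof.
move=> e0; pose L := i%:R / qmom i.
have L0 : 0 <= L by rewrite divr_ge0// ltW// qmom_gt0.
pose eta : R := e / (L + 1); have eta0 : 0 < eta by rewrite divr_gt0// ltr_wpDl.
have lip x y w : `|gq i x w - gq i x y| <= L * (eta / 2 + (1 - qd w y) / (2 * eta)).
  rewrite /gq -mulrBl normrM subrXX normrM (gtr0_norm (_ : 0 < (qmom i)^-1)) ?invr_gt0 ?qmom_gt0//.
  set A := \sum_(_ < _) _.
  have A0 : `|A| <= i%:R.
    rewrite (le_trans (ler_norm_sum _ _ _))// -[i in leRHS]card_ord -sum1_card natr_sum.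
    apply: ler_sum => k _; rewrite normrM !normrX mulr_ile1// exprn_ile1//.
    - by rewrite ger0_norm ?qd_ge0 ?qd_le1.
    - by rewrite ger0_norm ?qd_ge0 ?qd_le1.
  have d0 : 0 <= 1 - qd w y by rewrite subr_ge0 qd_le1.
  have : `|qd x w - qd x y| <= eta / 2 + (1 - qd w y) / (2 * eta).
    by apply: amgm => //; rewrite real_normK ?num_real// sqr_qdB.
  move=> h; rewrite /L [leRHS]mulrAC ler_wpM2r ?invr_ge0 ?(ltW (qmom_gt0 _))//.
  by rewrite mulrC ler_pM.
have [J hJ] : exists J : nat, a / eta ^+ 2 <= J%:R.
  exists (Num.truncn (a / eta ^+ 2)).+1; exact/ltW/truncnS_gt.
exists J => j Jj x y.
have hg k z : intg dw (gq k z) by apply: bmeas_intg; exact: bmeas_gq.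
have hm1 : intg dw (fun w => gq i x w * gq j w y).
  apply: bmeas_intg; apply: bmeasM; first exact: bmeas_gq.
  by have := bmeas_gq j y; congr bmeas; apply/funext => w; rewrite gqC.
have -> : gqc i j x y - gq i x y = I (fun w => gq j y w * (gq i x w - gq i x y)).
  have gE : gq i x y = I (fun w => gq i x y * gq j y w) by rewrite IZ// I_gq mulr1.
  rewrite {1}gE -IB//; last exact: intgZ.
  by apply: eq_I => w; rewrite (gqC j w); ring.
have hm2 : intg dw (fun w => gq j y w * (gq i x w - gq i x y)).
  apply: bmeas_intg; apply: bmeasM; first exact: bmeas_gq.
  by apply: bmeasB; [exact: bmeas_gq|exact: bmeas_cst].
rewrite (le_trans (norm_I hm2))//.
have hm3 : intg dw (fun w => gq j y w * (1 - qd w y)).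
  apply: bmeas_intg; apply: bmeasM; first exact: bmeas_gq.
  apply: bmeasB; first exact: bmeas_cst.
  by have := bmeas_qd y; congr bmeas; apply/funext => w; rewrite qdC.
rewrite (@le_trans _ _ (I (fun w => (L * eta / 2) * gq j y w + L / (2 * eta) * (gq j y w * (1 - qd w y)))))//.
  apply: le_I; [exact: intg_norm|by apply: intgD; exact: intgZ|move=> w].
  rewrite normrM (ger0_norm (gq_ge0 _ _ _)).
  have -> : L * eta / 2 * gq j y w + L / (2 * eta) * (gq j y w * (1 - qd w y)) =
     gq j y w * (L * (eta / 2 + (1 - qd w y) / (2 * eta))) by field; rewrite gt_eqF.
  by rewrite ler_wpM2l ?gq_ge0.
rewrite ID ?IZ//; [|exact: intgZ|exact: intgZ].
rewrite I_gq I_gq_1Bqd mulr1.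
have h1 : a / (2 * a + j%:R) <= eta ^+ 2.
  have Jj' : J%:R <= j%:R :> R by rewrite ler_nat.
  rewrite ler_pdivrMr ?ltr_wpDr ?mulr_gt0//.
  move: (le_trans hJ Jj'); rewrite ler_pdivrMr ?exprn_gt0// => h.
  by rewrite (le_trans h)// mulrC ler_wpM2l ?sqr_ge0// lerDr mulr_ge0 ?ltW.
rewrite (@le_trans _ _ (L * eta))//.
  have : L / (2 * eta) * (a / (2 * a + j%:R)) <= L / (2 * eta) * eta ^+ 2.
    by rewrite ler_wpM2l// divr_ge0// mulr_ge0// ltW.
  have -> : L / (2 * eta) * eta ^+ 2 = L * eta / 2 by field; rewrite gt_eqF.
  lra.
rewrite /eta mulrCA ger_pMr// ler_pdivrMr ?ltr_wpDl// mul1r; lra.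
Qed.

End ZonalHarmonics.

(** * Quadratic forms of bounded kernels *)

Section QuadraticForms.
Context {R : realType} {d : measure_display} {T : measurableType d}.
Variable mu : {finite_measure set T -> \bar R}.
Local Notation I f := (Rintegral mu setT f).
Implicit Types (k : T -> T -> R) (r : T -> R).

Definition qform k r : R := I (fun x => r x * I (fun y => k x y * r y)).
Definition bmeas2 k := bmeas (fun p : T * T => k p.1 p.2).

Lemma bmeas2_section k x : bmeas2 k -> bmeas (k x).
Proof. exact: bmeas_section. Qed.

Lemma bmeas2_sum (J : finType) (F : J -> T -> T -> R) :
  (forall i, bmeas2 (F i)) -> bmeas2 (fun x y => \sum_i F i x y).
Proof. by move=> bF; apply: bmeas_sum => i; exact: bF. Qed.

Lemma bmeas2Z c k : bmeas2 k -> bmeas2 (fun x y => c * k x y).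
Proof. exact: bmeasZ. Qed.

Lemma bmeas2_swap k : bmeas2 k -> bmeas2 (fun x y => k y x).
Proof. exact: bmeas_swap. Qed.

Lemma intg_kernel k r x : bmeas2 k -> intg mu r -> intg mu (fun y => k x y * r y).
Proof. by move=> bk; apply: intgM; exact: bmeas2_section. Qed.

Lemma bmeas_kernel k r : bmeas2 k -> intg mu r -> bmeas (fun x => I (fun y => k x y * r y)).
Proof. by move=> bk hr; exact: (bmeas_I bk hr). Qed.

Lemma intg_qform k r : bmeas2 k -> intg mu r ->
  intg mu (fun x => r x * I (fun y => k x y * r y)).
Proof.
move=> bk hr; have := intgM (bmeas_kernel bk hr) hr.
by apply: eq_integrable => // x _ /=; rewrite mulrC.
Qed.

Lemma kernel_swap k r s : bmeas2 k -> intg mu r -> intg mu s ->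
  I (fun x => r x * I (fun y => k x y * s y)) = I (fun y => s y * I (fun x => k x y * r x)).
Proof. by move=> bk; exact: (swapI bk). Qed.

Lemma bmeas2_comp k1 k2 : bmeas2 k1 -> bmeas2 k2 ->
  bmeas2 (fun x y => I (fun w => k1 x w * k2 w y)).
Proof.
move=> b1 b2; pose F (q : (T * T) * T) := k1 q.1.1 q.2 * k2 q.2 q.1.2.
have [mF [C FC]] : bmeas F.
  apply: bmeasM.
  - apply: (@bmeas_comp _ _ _ _ _ (fun q : (T * T) * T => (q.1.1, q.2)) _ _ b1).
    apply/measurable_fun_pair => //; exact: measurableT_comp measurable_fst measurable_fst.
  - apply: (@bmeas_comp _ _ _ _ _ (fun q : (T * T) * T => (q.2, q.1.2)) _ _ b2).
    apply/measurable_fun_pair => //; exact: measurableT_comp measurable_snd measurable_fst.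
have C0 : 0 <= C by rewrite (le_trans _ (FC ((point, point), point))).
have hF p : intg mu (fun w => F (p, w)).
  apply: bmeas_intg; split; last by exists C.
  exact: (measurableT_comp mF (measurable_pair1 p)).
have hc c : intg mu (fun=> c) by exact: bmeas_intg (bmeas_cst c).
split; last first.
  exists (C * fine (mu setT)) => p; rewrite (le_trans (norm_I (hF p)))// -Icst.
  by apply: le_I; [exact: (intg_norm (hF p))|exact: hc|move=> w; exact: FC].
have h : measurable_fun setT (fun p : T * T => \int[mu]_w (F (p, w) + C)%:E)%E.
  apply: (@measurable_fun_fubini_tonelli_F _ _ _ _ _ mu (fun q => (F q + C)%:E)) => //.
    by apply/measurable_EFinP; apply: measurable_funD.
  move=> q; rewrite lee_fin; have := FC q; rewrite ler_norml => /andP[]; lra.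
have := measurable_funB (measurableT_comp (fine_measurable measurableT) h) (measurable_cst (C * fine (mu setT))).
apply: eq_measurable_fun => p _ /=.
rewrite -[LHS]/(Rintegral mu setT (fun w => F (p, w) + C) - C * fine (mu setT)).
by rewrite ID// -Icst addrK.
Qed.

Lemma eq_qform k1 k2 r : (forall x y, k1 x y = k2 x y) -> qform k1 r = qform k2 r.
Proof. by move=> kk; apply: eq_I => x; congr (_ * _); apply: eq_I => y; rewrite kk. Qed.

Lemma qform_sum (J : finType) (c : J -> R) (F : J -> T -> T -> R) r :
  (forall i, bmeas2 (F i)) -> intg mu r ->
  qform (fun x y => \sum_i c i * F i x y) r = \sum_i c i * qform (F i) r.
Proof.
move=> bF hr; rewrite /qform.
transitivity (I (fun x => \sum_i c i * (r x * I (fun y => F i x y * r y)))).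
  apply: eq_I => x.
  transitivity (r x * \sum_i c i * I (fun y => F i x y * r y)); last first.
    by rewrite mulr_sumr; apply: eq_bigr => i _; rewrite mulrCA.
  congr (_ * _); transitivity (I (fun y => \sum_i c i * (F i x y * r y))).
    by apply: eq_I => y; rewrite mulr_suml; apply: eq_bigr => i _; rewrite mulrA.
  rewrite I_sum => [|i]; last by apply: intgZ; exact: intg_kernel.
  by apply: eq_bigr => i _; rewrite IZ//; exact: intg_kernel.
rewrite I_sum => [|i]; last by apply: intgZ; exact: intg_qform.
by apply: eq_bigr => i _; rewrite IZ//; exact: intg_qform.
Qed.

Lemma qformB k1 k2 r : bmeas2 k1 -> bmeas2 k2 -> intg mu r ->
  qform (fun x y => k1 x y - k2 x y) r = qform k1 r - qform k2 r.
Proof.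
move=> b1 b2 hr; rewrite /qform -IB; try exact: intg_qform.
apply: eq_I => x; rewrite -mulrBr -IB; try exact: intg_kernel.
by congr (_ * _); apply: eq_I => y; rewrite mulrBl.
Qed.

Lemma qform_bound k r e : bmeas2 k -> intg mu r -> (forall x y, `|k x y| <= e) ->
  `|qform k r| <= e * I (fun x => `|r x|) ^+ 2.
Proof.
move=> bk hr ke; have hn := intg_norm hr.
rewrite (le_trans (norm_I (intg_qform bk hr)))//.
rewrite expr2 mulrA -IZ; last exact: intg_norm.
apply: le_I; [exact/intg_norm/intg_qform|exact: intgZ|move=> x].
rewrite normrM mulrC; apply: ler_wpM2r => //.
rewrite (le_trans (norm_I (intg_kernel _ bk hr)))// -IZ//.
apply: le_I; [exact/intg_norm/intg_kernel|exact: intgZ|move=> y].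
by rewrite normrM ler_wpM2r.
Qed.

(* The form of [k o k] is the integral of [(k r) ^ 2]. *)
Lemma qform_comp_ge0 k r : bmeas2 k -> (forall x y, k x y = k y x) -> intg mu r ->
  0 <= qform (fun x y => I (fun w => k x w * k w y)) r.
Proof.
move=> bk kC hr; pose h w := I (fun y => k w y * r y).
have bh : bmeas h by exact: bmeas_kernel.
have hh : intg mu h by exact: bmeas_intg.
have E x : I (fun y => I (fun w => k x w * k w y) * r y) = I (fun w => k x w * h w).
  transitivity (I (fun y => r y * I (fun w => k y w * k x w))).
    apply: eq_I => y; rewrite mulrC; congr (_ * _); apply: eq_I => w.
    by rewrite mulrC (kC w).
  rewrite (kernel_swap bk hr); last exact/bmeas_intg/bmeas2_section.
  by apply: eq_I => w; congr (_ * _); apply: eq_I => y; rewrite kC.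
rewrite /qform; under [X in 0 <= X]eq_I do rewrite E.
rewrite (kernel_swap bk hr hh); apply: I_ge0 => w.
have -> : I (fun x => k x w * r x) = h w by apply: eq_I => x; rewrite kC.
by rewrite -expr2 sqr_ge0.
Qed.

(** A symmetric Markov kernel is a contraction: bound $r(x)r(y)$ by half the sum of the squares and
    integrate out one variable. *)
Lemma qform_le_sqr k r : bmeas2 k -> (forall x y, k x y = k y x) ->
  (forall x y, 0 <= k x y) -> (forall x, I (k x) = 1) ->
  intg mu r -> intg mu (fun x => r x ^+ 2) -> qform k r <= I (fun x => r x ^+ 2).
Proof.
move=> bk kC k0 k1 hr hr2.
have hk x : intg mu (k x) by apply: bmeas_intg; exact: bmeas2_section.
have hs : intg mu (fun x => I (fun y => k x y * r y ^+ 2)).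
  by apply: bmeas_intg; exact: bmeas_kernel.
have sw : I (fun x => I (fun y => k x y * r y ^+ 2)) = I (fun x => r x ^+ 2).
  have := kernel_swap bk (bmeas_intg mu (bmeas_cst 1)) hr2.
  under eq_I do rewrite mul1r; move=> ->; apply: eq_I => y.
  transitivity (r y ^+ 2 * I (k y)); last by rewrite k1 mulr1.
  by congr (_ * _); apply: eq_I => x; rewrite mulr1 kC.
apply: (@le_trans _ _ (I (fun x => 2^-1 * (r x ^+ 2 + I (fun y => k x y * r y ^+ 2))))).
  apply: le_I; [exact: intg_qform|by apply: intgZ; exact: intgD|move=> x].
  have E : r x ^+ 2 = I (fun y => r x ^+ 2 * k x y) by rewrite IZ// k1 mulr1.
  rewrite [in leRHS]E -ID; [|exact: intgZ|exact: intg_kernel].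
  rewrite -!IZ; [|apply: intgD; [exact: intgZ|exact: intg_kernel]|exact: intg_kernel].
  apply: le_I.
  - by apply: intgZ; exact: intg_kernel.
  - by apply: intgZ; apply: intgD; [exact: intgZ|exact: intg_kernel].
  move=> y; rewrite -subr_ge0.
  have -> : 2^-1 * (r x ^+ 2 * k x y + k x y * r y ^+ 2) - r x * (k x y * r y) =
    2^-1 * (k x y * (r x - r y) ^+ 2) by field.
  by rewrite mulr_ge0 ?invr_ge0// mulr_ge0// sqr_ge0.
rewrite IZ; last exact: intgD.
by rewrite ID// sw; lra.
Qed.

End QuadraticForms.

(** * Simultaneous diagonalisation and the gap in degree 2 *)

Section SpectralGap.
Context {R : realType} {n : nat}.
Notation S := (sphere R n.+1).
Notation dw := (@surface R n.+1).
Notation I f := (Rintegral dw setT f).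
Notation al := (@beltrami_a R n).
Implicit Types (x y z w : S) (r : S -> R).

Let al0 : al 0 = 0. Proof. by rewrite /beltrami_a mul0r. Qed.
Let al_lt := @beltrami_a_lt R n.

(* A multiple of the reproducing kernel of the spherical harmonics of degree k. *)
Definition zk k x y : R := zsum al (fun i => gq i x y) k.
(** The composition of [zk k] with $G_j$ ([zwE]). *)
Definition zw k j x y : R := zsum al (fun i => gqc i j x y) k.

Lemma zkC k x y : zk k x y = zk k y x.
Proof. by apply: eq_bigr => i _; rewrite gqC. Qed.

Let b2gq j : bmeas2 (@gq R n j). Proof. exact: bmeas_gq2. Qed.

Lemma bmeas2_zk k : bmeas2 (zk k).
Proof. by apply: bmeas2_sum => i; exact: bmeas2Z. Qed.

Lemma zwE k j x y : zw k j x y = I (fun w => zk k x w * gq j w y).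
Proof.
transitivity (I (fun w => \sum_(i < k.+1) zc al k i * (gq i x w * gq j w y))); last first.
  by apply: eq_I => w; rewrite /zk /zsum mulr_suml; apply: eq_bigr => i _; rewrite mulrA.
have h i : intg dw (fun w => gq i x w * gq j w y).
  apply: bmeas_intg; apply: bmeasM; first exact: bmeas_gq.
  exact: (bmeas2_section y (bmeas2_swap (b2gq j))).
by rewrite I_sum => [|i]; [apply: eq_bigr => i _; rewrite IZ|exact: intgZ].
Qed.

Let zw_rec k j x y : al j * (zw k j x y - zw k j.-1 x y) = al k * zw k j x y.
Proof.
by apply: zsum_eigen => // i; exact: gqc_rec.
Qed.

(** The recursion reads $(\alpha_j-\alpha_k)\,zw_j=\alpha_j\,zw_{j-1}$. As $\alpha_0=0$ it starts at
    0 and stays there while $j<k$; at $j=k$ it leaves the value free, and beyond it multiplies by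
    the factors of [mc] ([zw_mc]). *)
Lemma zw_eq0 k j x y : (j < k)%N -> zw k j x y = 0.
Proof.
elim: j => [|j IH] jk.
  have := zw_rec k 0 x y; rewrite al0 mul0r => /esym/eqP.
  by rewrite mulf_eq0 gt_eqF -?[ltLHS]al0 ?al_lt// => /eqP.
have := zw_rec k j.+1 x y; rewrite /= IH ?(ltnW jk)// subr0 => /eqP.
by rewrite -subr_eq0 -mulrBl mulf_eq0 subr_eq0 lt_eqF ?al_lt//= => /eqP.
Qed.

Lemma zw_mc k j x y : (k <= j)%N -> zw k j x y = mc al j k * zw k k x y.
Proof.
elim: j => [|j IH].
  by rewrite leqn0 => /eqP ->; rewrite /mc big_geq// mul1r.
rewrite leq_eqVlt => /orP[/eqP ->|]; first by rewrite /mc big_geq// mul1r.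
rewrite ltnS => kj; have h : al k < al j.+1 by rewrite al_lt.
have := zw_rec k j.+1 x y; rewrite /= IH// (mc_rec al0 al_lt kj).
have a0 : 0 < al j.+1 by rewrite -al0 al_lt.
move: (al j.+1) (al k) h a0 => A B h a0 /eqP e.
have nz : A - B != 0 by rewrite subr_eq0 gt_eqF.
apply: (mulfI nz); move: (zw k j.+1 x y) (zw k k x y) (mc al j.+1 k) e => u v c e.
suff : A * (u - (1 - B / A) * c * v) - B * u = (A - B) * u - (A - B) * (c * v).
  by rewrite (eqP e) subrr => /esym/eqP; rewrite subr_eq0 => /eqP.
by field; rewrite gt_eqF.
Qed.

(** Only the last term of the second factor survives: the lower ones are killed by [zw_eq0], and its
    coefficient is [zc k k = 1]. *)
Lemma zkzk k x y : I (fun w => zk k x w * zk k w y) = zw k k x y.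
Proof.
have h j : intg dw (fun w => zk k x w * gq j w y).
  apply: bmeas_intg; apply: bmeasM; first exact: (bmeas2_section x (bmeas2_zk k)).
  exact: (bmeas2_section y (bmeas2_swap (b2gq j))).
transitivity (I (fun w => \sum_(j < k.+1) zc al k j * (zk k x w * gq j w y))).
  by apply: eq_I => w; rewrite {2}/zk /zsum mulr_sumr; apply: eq_bigr => i _; rewrite mulrCA.
rewrite I_sum => [|i]; last exact: intgZ.
rewrite big_ord_recr/= big1 ?add0r => [|i _].
  by rewrite IZ// -zwE zckk mul1r.
by rewrite IZ// -zwE zw_eq0 ?mulr0.
Qed.

Lemma zw_cvg k e : 0 < e ->
  exists J, forall j, (J <= j)%N -> forall x y, `|zw k j x y - zk k x y| <= e.
Proof.
move=> e0; pose C := \sum_(i < k.+1) `|zc al k i| + 1.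
have s0 : 0 <= \sum_(i < k.+1) `|zc al k i| by apply: sumr_ge0.
have C0 : 0 < C by rewrite ltr_wpDl.
have [J hJ] : exists J : 'I_k.+1 -> nat, forall i j, (J i <= j)%N ->
    forall x y, `|gqc i j x y - gq i x y| <= e / C.
  have h (i : 'I_k.+1) : exists J, forall j, (J <= j)%N ->
      forall x y, `|gqc i j x y - gq i x y| <= e / C.
    by apply: gqc_cvg; rewrite divr_gt0.
  by exists (fun i => projT1 (cid (h i))) => i; exact: (projT2 (cid (h i))).
exists (\max_i J i) => j Jj x y.
rewrite /zw /zk /zsum -sumrB (le_trans (ler_norm_sum _ _ _))//.
apply: (@le_trans _ _ (\sum_(i < k.+1) `|zc al k i| * (e / C))).
  apply: ler_sum => i _; rewrite -mulrBr normrM ler_wpM2l// hJ//.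
  by rewrite (leq_trans _ Jj)//; exact: leq_bigmax.
rewrite -mulr_suml mulrCA ger_pMr// ler_pdivrMr// mul1r /C lerDl//.
Qed.

Let bmeas2_zw k j : bmeas2 (zw k j).
Proof.
have := bmeas2_comp dw (bmeas2_zk k) (b2gq j); congr bmeas.
by apply/funext => p; rewrite -zwE.
Qed.

(** For $j\ge k$ the kernel $Z_k\circ G_j$ is a nonnegative multiple of $Z_k\circ Z_k$, whose form
    is nonnegative, and it tends uniformly to $Z_k$. *)
Lemma qform_zk_ge0 k r : intg dw r -> 0 <= qform dw (zk k) r.
Proof.
move=> hr; have bz := bmeas2_zk k.
rewrite leNgt; apply/negP => q0.
set N := I (fun x => `|r x|) ^+ 2.
have N0 : 0 <= N by rewrite sqr_ge0.
pose e : R := - qform dw (zk k) r / (N + 1) / 2.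
have e0 : 0 < e by rewrite !divr_gt0 ?oppr_gt0 ?ltr_wpDl.
have [J hJ] := zw_cvg k e0; pose j := maxn J k.
have bd : bmeas2 (fun x y => zw k j x y - zk k x y) by exact: bmeasB (bmeas2_zw k j) bz.
have := qform_bound bd hr (hJ j (leq_maxl _ _)).
rewrite qformB// => h.
have : 0 <= qform dw (zw k j) r.
  have -> : qform dw (zw k j) r = mc al j k * qform dw (zw k k) r.
    have := qform_sum (fun=> mc al j k) (fun _ : 'I_1 => bmeas2_zw k k) hr.
    rewrite big_ord1 => <-; apply: eq_qform => x y.
    by rewrite big_ord1 -zw_mc// leq_maxr.
  rewrite mulr_ge0//; first exact: mc_ge0.
  rewrite (eq_qform dw r (fun x y => esym (zkzk k x y))).
  exact: qform_comp_ge0 (zkC k) hr.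
have : e * N < - qform dw (zk k) r.
  rewrite /e mulrAC ltr_pdivrMr// mulrAC ltr_pdivrMr ?ltr_wpDl// -/N.
  rewrite -mulrA ltr_pM2l ?oppr_gt0//; lra.
move=> lt_e ge0; have := le_lt_trans (le_trans (ler_norm _) h) lt_e.
by rewrite gtrDr ltNge ge0.
Qed.

(** The eigenvalue of $G_j$ on harmonics of degree 2; the recursion [gapS] and the limit 1 single it
    out. *)
Definition gap_ratio (j : nat) : R := j%:R * (j%:R - 1) / ((j%:R + n.+1%:R) * (j%:R + n.+2%:R)).

Let gapS j : gap_ratio j.+2 = (1 - al 2 / al j.+3) * gap_ratio j.+3.
Proof.
rewrite /gap_ratio /beltrami_a -[n.+2%:R]natr1 -[n.+1%:R]natr1 -[j.+3%:R]natr1 -[j.+2%:R]natr1 -[j.+1%:R]natr1.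
have -> : 2%:R = 1 + 1 :> R by [].
have j0 : 0 <= j%:R :> R by rewrite ler0n.
have n0 : 0 <= n%:R :> R by rewrite ler0n.
field; rewrite !gt_eqF//; lra.
Qed.

Let gap_gt0 j : 0 < gap_ratio j.+2.
Proof.
rewrite /gap_ratio -[j.+2%:R]natr1; have j0 : 0 < j.+1%:R :> R by [].
by rewrite addrK divr_gt0// mulr_gt0// addr_gt0// addr_gt0.
Qed.

Let cvg_gap : gap_ratio j @[j --> \oo] --> (1 : R).
Proof.
have -> : gap_ratio = (fun j => (1 - n.+1%:R * (n.+1%:R + j%:R)^-1) * (1 - n.+3%:R * (n.+2%:R + j%:R)^-1)).
  apply/funext => j; rewrite /gap_ratio -[n.+3%:R]natr1 -[n.+2%:R]natr1.
  have j0 : 0 <= j%:R :> R by rewrite ler0n.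
  have n0 : 0 < n.+1%:R :> R by [].
  field; rewrite !gt_eqF//; lra.
have h : (fun j => (1 - n.+1%:R * (n.+1%:R + j%:R)^-1) * (1 - n.+3%:R * (n.+2%:R + j%:R)^-1)) @ \oo -->
    ((1 - n.+1%:R * 0) * (1 - n.+3%:R * 0) : R).
  by apply: cvgM; apply: cvgB; try exact: cvg_cst; apply: cvgM; try exact: cvg_cst;
    exact: cvg_inv_addn.
by rewrite !mulr0 subr0 mulr1 in h.
Qed.

Section gap.
Variable r : S -> R.
Hypothesis hr : intg dw r.
Hypothesis hr2 : intg dw (fun x => r x ^+ 2).
Hypothesis r0 : I r = 0.
Hypothesis r1 : forall y, I (fun x => r x * cosd x y) = 0.

Let f j := qform dw (@gq R n j) r.

Let qform_zsum k : qform dw (zk k) r = zsum al f k.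
Proof. by rewrite /zk /zsum qform_sum. Qed.

Let f_inv j : f j = \sum_(k < j.+1) mc al j k * qform dw (zk k) r.
Proof. by rewrite [LHS](zsum_inv al0 al_lt); apply: eq_bigr => k _; rewrite qform_zsum. Qed.

Let f0 : f 0 = 0.
Proof.
rewrite /f /qform.
transitivity (I (cst 0)); last by rewrite Icst mul0r.
apply: eq_I => x; rewrite (_ : I (fun y => gq 0 x y * r y) = (@qmom R n 0)^-1 * I r); first by rewrite r0 !mulr0.
rewrite -(IZ _ hr); by apply: eq_I => y; rewrite /gq expr0 mul1r.
Qed.

Let f1 : f 1 = 0.
Proof.
rewrite /f /qform.
transitivity (I (cst 0)); last by rewrite Icst mul0r.
have h x : intg dw (fun y => r y * cosd y x).
  have := intgM (bmeas_cosd x) hr; apply: eq_integrable => // y _ /=.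
  by rewrite mulrC cosdC.
apply: eq_I => x.
rewrite (_ : I (fun y => gq 1 x y * r y) = (@qmom R n 1)^-1 / 2 * (I r + I (fun y => r y * cosd y x))).
  by rewrite r0 r1 addr0 !mulr0.
rewrite -ID// -IZ; last exact: intgD.
by apply: eq_I => y; rewrite /gq expr1 /qd cosdC; ring.
Qed.

Let z01 k : (k < 2)%N -> qform dw (zk k) r = 0.
Proof.
rewrite qform_zsum /zsum; case: k => [|[|//]] _.
  by rewrite big_ord1 f0 mulr0.
by rewrite big_ord_recl big_ord1 /= f0 f1 !mulr0 addr0.
Qed.

(** In [f_inv] only degrees $k\ge2$ contribute, each with a nonnegative form, and the factor
    $1-\alpha_k/\alpha_{j+3}$ between consecutive values of [mc] is largest at $k=2$. *)
Let f_step j : f j.+2 <= (1 - al 2 / al j.+3) * f j.+3.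
Proof.
have a0 : 0 < al j.+3 by rewrite -al0 al_lt.
have -> : f j.+2 = \sum_(k < j.+4) (1 - al k / al j.+3) * mc al j.+3 k * qform dw (zk k) r.
  rewrite big_ord_recr/= divff ?gt_eqF// subrr !mul0r addr0 f_inv.
  by apply: eq_bigr => k _; rewrite (mc_rec al0 al_lt)// -ltnS.
rewrite f_inv mulr_sumr; apply: ler_sum => k _; rewrite mulrA.
have [k2|k2] := ltnP k 2; first by rewrite z01// !mulr0.
rewrite ler_wpM2r ?qform_zk_ge0// ler_wpM2r ?mc_ge0// lerD2l lerN2.
rewrite ler_pM2r ?invr_gt0//; move: k2; rewrite leq_eqVlt => /orP[/eqP <-//|/al_lt/ltW//].
Qed.

Let f_le j : f j <= I (fun x => r x ^+ 2).
Proof. by apply: qform_le_sqr => //; [exact: gqC|exact: gq_ge0|exact: I_gq]. Qed.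

(** By [f_step] and [gapS] the quotient of the form by [gap_ratio] is nondecreasing in [j]. Each
    $G_j$ is a contraction and [gap_ratio] tends to 1, so this quotient never exceeds $\|r\|^2$. *)
Lemma qform_gap j : qform dw (@gq R n j) r <= gap_ratio j * I (fun x => r x ^+ 2).
Proof.
case: j => [|[|j]].
- by rewrite -/(f 0) f0 /gap_ratio !mul0r.
- by rewrite -/(f 1) f1 /gap_ratio subrr mulr0 !mul0r.
have mono : nondecreasing_seq (fun j => f j.+2 / gap_ratio j.+2).
  apply/nondecreasing_seqP => i; rewrite ler_pdivrMr//.
  by rewrite (gapS i) mulrCA divfK ?gt_eqF// f_step.
rewrite -/(f j.+2) mulrC -ler_pdivrMr//.
have cv : I (fun x => r x ^+ 2) / gap_ratio i.+2 @[i --> \oo] --> I (fun x => r x ^+ 2).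
  rewrite -[X in _ --> X]divr1; apply: cvgM; first exact: cvg_cst.
  apply: cvgV; first exact: oner_neq0.
  by have := cvg_gap; rewrite -cvg_shiftS -cvg_shiftS.
apply: (cvgr_to_ge cv); near=> i.
apply: (@le_trans _ _ (f i.+2 / gap_ratio i.+2)).
  by apply: mono; near: i; exact: nbhs_infty_ge.
by rewrite ler_pM2r ?invr_gt0.
Unshelve. all: by end_near.
Qed.

End gap.

Let mc_gap j : mc al j.+2 2 * gap_ratio 2 = gap_ratio j.+2.
Proof.
elim: j => [|j IH]; first by rewrite /mc big_geq// mul1r.
have nz : 1 - al 2 / al j.+3 != 0.
  by rewrite subr_eq0 eq_sym lt_eqF// ltr_pdivrMr -?[ltLHS]al0 ?al_lt// mul1r al_lt.
by apply: (mulfI nz); rewrite -(gapS j) -IH mulrA -(mc_rec al0 al_lt).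
Qed.

(** $Z_2\circ G_j$ is $Z_2\circ Z_2$ times the quotient of [gap_ratio j] by [gap_ratio 2], and it
    tends to $Z_2$. *)
Let zk2E x y : zw 2 2 x y = gap_ratio 2 * zk 2 x y.
Proof.
have g2 : gap_ratio 2 != 0 by rewrite gt_eqF// (gap_gt0 0).
have c1 : zw 2 j.+2 x y @[j --> \oo] --> zw 2 2 x y / gap_ratio 2.
  have h : (fun j => gap_ratio j.+2 * (zw 2 2 x y / gap_ratio 2)) @ \oo -->
      1 * (zw 2 2 x y / gap_ratio 2).
    apply: cvgM; last exact: cvg_cst.
    by have := cvg_gap; rewrite -cvg_shiftS -cvg_shiftS.
  rewrite mul1r in h; apply: cvg_trans h; apply: near_eq_cvg; near=> j.
  rewrite (@zw_mc 2 j.+2)// -(mc_gap j); move: (gap_ratio 2) g2 => g g2.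
  by field.
have c2 : zw 2 j.+2 x y @[j --> \oo] --> zk 2 x y.
  apply/cvgrPdist_le => e e0; have [J hJ] := zw_cvg 2 e0.
  near=> j; rewrite distrC hJ//; apply: leq_trans (leqW (leqnSn j)).
  by near: j; exact: nbhs_infty_ge.
have <- := cvg_unique _ c1 c2 => //.
by rewrite mulrC divfK.
Unshelve. all: by end_near.
Qed.

(** Ensures that the extremal function built from this kernel is not zero. *)
Let zk2_gt0 x : 0 < zk 2 x x.
Proof.
have S0 := surface_gt0 (R := R) n.+1.
have n0 : 0 <= n%:R :> R by rewrite ler0n.
rewrite /zk /zsum !big_ord_recr big_ord0 /= /gq qdxx !expr1n !qmomS.
have -> : @qmom R n 0 = fine (dw setT) by rewrite /qmom big_ord0 mulr1.
have -> : zc al 2 2 = 1 by exact: zckk.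
have -> : zc al 2 1 = al 2 / (al 1 - al 2) by rewrite /zc big_nat1.
have -> : zc al 2 0 = al 1 / (al 0 - al 2) * (al 2 / (al 1 - al 2)).
  by rewrite /zc big_ltn// big_nat1.
move: (fine _) S0 => sp S0; rewrite /beltrami_a -[n.+1%:R]natr1.
set X := (X in 0 < X).
suff -> : X = (n%:R + 1) / ((n%:R + 3) * sp) by rewrite divr_gt0 ?mulr_gt0 ?ltr_wpDl.
rewrite /X; field.
do ?[apply/andP; split]; first [rewrite gt_eqF//; lra | rewrite lt_eqF//; lra].
Qed.

Lemma gap_extremal : exists Y : S -> R, [/\ bmeas Y, 0 < I (fun w => Y w ^+ 2),
  I Y = 0, (forall y, I (fun w => Y w * cosd w y) = 0) &
  forall j, qform dw (@gq R n j) Y = gap_ratio j * I (fun w => Y w ^+ 2)].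
Proof.
(* The zonal harmonic of degree 2 around an arbitrary pole. *)
pose e : S := point; pose Y := zk 2 e.
have bY : bmeas Y by exact: (bmeas2_section e (bmeas2_zk 2)).
have hY := bmeas_intg dw bY.
have YW j y : I (fun w => gq j y w * Y w) = zw 2 j e y.
  by rewrite zwE; apply: eq_I => w; rewrite gqC mulrC.
have Y2 : I (fun w => Y w ^+ 2) = gap_ratio 2 * zk 2 e e.
  by rewrite -zk2E -zkzk; apply: eq_I => w; rewrite (zkC 2 w).
have Y0 : I Y = 0.
  have := YW 0 e; rewrite zw_eq0//.
  rewrite (_ : I _ = (@qmom R n 0)^-1 * I Y); last first.
    by rewrite -(IZ _ hY); apply: eq_I => w; rewrite /gq expr0 mul1r.
  by move/eqP; rewrite mulf_eq0 invr_eq0 gt_eqF ?qmom_gt0//= => /eqP.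
have hc y : intg dw (fun w => Y w * cosd w y).
  have := intgM (bmeas_cosd y) hY; apply: eq_integrable => // w _ /=.
  by rewrite mulrC cosdC.
exists Y; split => //.
- by rewrite Y2; exact: mulr_gt0 (gap_gt0 0) (zk2_gt0 e).
- move=> y; have := YW 1 y; rewrite zw_eq0//.
  rewrite (_ : I (fun w => gq 1 y w * Y w) = (@qmom R n 1)^-1 / 2 * (I Y + I (fun w => Y w * cosd w y))).
    move/eqP; rewrite Y0 add0r mulf_eq0 mulf_eq0 !invr_eq0 gt_eqF ?qmom_gt0//=.
    by rewrite pnatr_eq0/= => /eqP.
  rewrite -ID// -IZ; last exact: intgD.
  by apply: eq_I => w; rewrite /gq expr1 /qd cosdC; ring.
move=> j; rewrite /qform; under eq_I do rewrite YW.
have [j2|j2] := ltnP j 2.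
  transitivity (I (cst 0)); first by apply: eq_I => x; rewrite zw_eq0// mulr0.
  by rewrite Icst mul0r /gap_ratio; case: j j2 => [|[|]]//; rewrite ?subrr ?mulr0 !mul0r.
rewrite -IZ; last by apply: bmeas_intg; exact: bmeasX.
apply: eq_I => x; rewrite zw_mc// zk2E -/(Y x).
by case: j j2 => [|[|j]]// _; rewrite -(mc_gap j); ring.
Qed.

End SpectralGap.

(** * The Riesz kernel *)

Section BinomialSeries.
Context {R : realType}.

Lemma nd_cvg_le (u : R^nat) (l : R) : nondecreasing_seq u -> u @ \oo --> l ->
  forall j, u j <= l.
Proof.
move=> nu ul j; rewrite -(cvg_lim (@Rhausdorff R) ul).
by apply: nondecreasing_cvgn_le => //; apply/cvg_ex; exists l.
Qed.

Lemma ni_cvg_ge (u : R^nat) (l : R) : nonincreasing_seq u -> u @ \oo --> l ->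
  forall j, l <= u j.
Proof.
move=> nu ul j; rewrite -(cvg_lim (@Rhausdorff R) ul).
by apply: nonincreasing_cvgn_ge => //; apply/cvg_ex; exists l.
Qed.

Implicit Types s t : R.

Definition bc s j : R := \prod_(i < j) ((s + i%:R) / i.+1%:R).
Definition bsum s N t : R := \sum_(j < N) bc s j * t ^+ j.

Lemma bcS s j : bc s j.+1 = bc s j * ((s + j%:R) / j.+1%:R).
Proof. by rewrite /bc big_ord_recr. Qed.

Lemma bc_ge0 s j : 0 <= s -> 0 <= bc s j.
Proof. by move=> s0; apply: prodr_ge0 => i _; rewrite divr_ge0 ?addr_ge0. Qed.

Let bcS_mul s j : j.+1%:R * bc s j.+1 = (s + j%:R) * bc s j.
Proof. by rewrite bcS; field; rewrite nat1r pnatr_eq0. Qed.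

Let bc_shift s j : j.+1%:R * bc s j.+1 = s * bc (s + 1) j.
Proof.
elim: j => [|j IH]; first by rewrite bcS_mul addr0 /bc !big_ord0.
rewrite bcS_mul -natr1 addrA addrAC [bc (s + 1) _]bcS mulrA -IH -natr1; field.
by rewrite natr1 pnatr_eq0.
Qed.

Lemma bsum_nd s t : 0 <= s -> 0 <= t -> nondecreasing_seq (fun N => bsum s N t).
Proof.
move=> s0 t0; apply/nondecreasing_seqP => N; rewrite /bsum big_ord_recr/= lerDl.
by rewrite mulr_ge0 ?bc_ge0// exprn_ge0.
Qed.

Let bsum_derive s N t : exists2 D : R, is_derive t (1 : R) (bsum s N) D &
  (1 - t) * D - s * bsum s N t = - (N%:R * bc s N * t ^+ N.-1).
Proof.
elim: N => [|N [D dD DE]].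
  exists 0; last by rewrite /bsum big_ord0 !mulr0 subrr !mul0r oppr0.
  have -> : bsum s 0 = cst 0 by apply/funext => x; rewrite /bsum big_ord0.
  exact: is_derive_cst.
have -> : bsum s N.+1 = bsum s N + bc s N *: (fun x : R => x ^+ N).
  by apply/funext => x; rewrite /bsum big_ord_recr.
exists (D + bc s N * (N%:R * t ^+ N.-1)).
  apply: is_deriveD.
  have h : is_derive t (1 : R) (fun x : R => x ^+ N) (N%:R * t ^+ N.-1).
    have -> : (fun x : R => x ^+ N) = id ^+ N.
      by elim: N {dD DE} => [|N IH]; apply/funext => x; rewrite ?expr0// !exprS -IH.
    by apply: is_derive_eq; rewrite /GRing.scale/= mulr1 -mulr_natl.
  exact: is_deriveZ.
rewrite -[(_ + _) t]/(bsum s N t + bc s N * t ^+ N) /=.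
have -> : N.+1%:R * bc s N.+1 * t ^+ N = s * bc s N * t ^+ N + N%:R * bc s N * t ^+ N.
  by rewrite bcS_mul; ring.
transitivity (((1 - t) * D - s * bsum s N t) + (N%:R * bc s N * t ^+ N.-1 -
    N%:R * bc s N * (t * t ^+ N.-1) - s * bc s N * t ^+ N)); first by ring.
rewrite DE; case: N {D dD DE} => [|N] /=; first by ring.
by rewrite -exprS; ring.
Qed.

(** The ratio of the partial sum to $(1-t)^{-s}$. It is 1 at $t=0$ for $N\ge1$, and all terms but
    one cancel in its derivative, so the mean value theorem controls the remainder. *)
Let F s N t := (1 - t) `^ s * bsum s N t.

Let F_derive s N t : t < 1 ->
  is_derive t (1 : R) (F s N) (- ((1 - t) `^ (s - 1) * (N%:R * bc s N * t ^+ N.-1))).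
Proof.
move=> t1; have t0 : 0 < 1 - t by rewrite subr_gt0.
have [D dD DE] := bsum_derive s N t.
have dp : is_derive t (1 : R) (fun t => (1 - t) `^ s) (- (s * (1 - t) `^ (s - 1))).
  have -> : (fun t => (1 - t) `^ s) = (@powR R ^~ s) \o (fun t => 1 - t) by [].
  have h1 : is_derive (1 - t) (1 : R) (@powR R ^~ s) (s * (1 - t) `^ (s - 1)).
    exact: is_derive1_powR.
  have h2 : is_derive t (1 : R) (fun t => 1 - t) (- 1).
    have -> : (fun t => 1 - t) = cst 1 - id :> (R -> R) by [].
    by apply: is_derive_eq; rewrite sub0r.
  have := @is_derive1_comp _ (@powR R ^~ s) (fun t => 1 - t) t _ _ h1 h2; rewrite /GRing.scale/= mulrN1; exact.
have -> : F s N = (fun t => (1 - t) `^ s) * bsum s N by apply/funext.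
apply: is_derive_eq.
rewrite /GRing.scale/= -[RHS]mulrN -DE.
have -> : (1 - t) `^ s = (1 - t) * (1 - t) `^ (s - 1).
  by rewrite -{2}(powRr1 (ltW t0)) -powRD ?(gt_eqF t0) ?implybT//; congr (_ `^ _); ring.
by ring.
Qed.

Let mvt0 (G dG : R -> R) t : 0 <= t < 1 ->
  (forall x : R, x < 1 -> is_derive x (1 : R) G (dG x)) ->
  exists2 c, 0 <= c <= t & G t - G 0 = dG c * t.
Proof.
move=> /andP[t0 t1] D; have [|/=|c c0t ->] := @MVT_segment R G dG 0 t t0.
- move=> x; rewrite in_itv/= => /andP[_ xt]; apply: D; exact: lt_trans xt t1.
- apply: derivable_within_continuous => x; rewrite in_itv/= => /andP[_ xt].
  by have [] := D x (le_lt_trans xt t1).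
by exists c; rewrite ?subr0//; move: c0t; rewrite in_itv.
Qed.

Let F_mvt s N t : 0 <= t < 1 -> exists2 c, 0 <= c <= t &
  1 - F s N.+1 t = (1 - c) `^ (s - 1) * (N.+1%:R * bc s N.+1 * c ^+ N) * t.
Proof.
move=> t01; have [c ct E] := mvt0 t01 (fun x => @F_derive s N.+1 x); exists c => //.
have F0 : F s N.+1 0 = 1.
  rewrite /F subr0 powR1 mul1r /bsum big_ord_recl expr0 mulr1 big1 ?addr0.
    by rewrite /bc big_ord0.
  by move=> i _; rewrite exprS mul0r mulr0.
by move: E; rewrite F0 mulNr => E; rewrite -[LHS]opprB E opprK.
Qed.

Lemma bsum_le s N t : 0 <= s -> 0 <= t < 1 -> bsum s N t <= (1 - t) `^ (- s).
Proof.
move=> s0 t01; have /andP[t0 t1] := t01.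
have p0 : 0 < (1 - t) `^ s by rewrite powR_gt0// subr_gt0.
apply: (@le_trans _ _ (bsum s N.+1 t)); first exact: bsum_nd.
have [c /andP[c0 ct] E] := F_mvt s N t01.
rewrite powRN -[leRHS]mul1r ler_pdivlMr// mulrC -/(F s N.+1 t) -subr_ge0 E.
by rewrite !mulr_ge0 ?powR_ge0 ?bc_ge0 ?exprn_ge0.
Qed.

Lemma cvg_bc0 s t : 0 <= s -> 0 <= t < 1 -> bc s j * t ^+ j @[j --> \oo] --> 0.
Proof.
move=> s0 t01; have /andP[t0 t1] := t01.
apply: (@cvg_series_cvg_0 _ _ (fun j => bc s j * t ^+ j)).
apply: nondecreasing_is_cvgn.
  by apply/nondecreasing_seqP => N; rewrite /series/= big_nat_recr//= lerDl mulr_ge0 ?bc_ge0// exprn_ge0.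
exists ((1 - t) `^ (- s)) => _ [N _ <-].
by rewrite /series/= big_mkord; exact: bsum_le.
Qed.

Lemma cvg_bsum s t : 0 <= s -> 0 <= t < 1 -> bsum s N t @[N --> \oo] --> (1 - t) `^ (- s).
Proof.
move=> s0 t01; have /andP[t0 t1] := t01; have t1' : 0 < 1 - t by rewrite subr_gt0.
have p0 : 0 < (1 - t) `^ s by rewrite powR_gt0.
suff : F s N.+1 t @[N --> \oo] --> (1 : R).
  move=> h; rewrite powRN -[X in _ --> X]mulr1 -cvg_shiftS.
  have -> : [sequence bsum s n.+1 t]_n = (fun N => ((1 - t) `^ s)^-1 * F s N.+1 t).
    by apply/funext => N; rewrite /F mulKf// gt_eqF.
  by apply: cvgM => //; exact: cvg_cst.
have h : (fun N => 1 - s * t / (1 - t) * (bc (s + 1) N * t ^+ N)) @ \oo --> (1 - s * t / (1 - t) * 0 : R).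
  by apply: cvgB; [exact: cvg_cst|apply: cvgM; [exact: cvg_cst|apply: cvg_bc0; rewrite ?addr_ge0]].
rewrite mulr0 subr0 in h.
apply: (squeeze_cvgr _ h (@cvg_cst _ _ _ _ _)); apply: nearW => N.
have [c /andP[c0 ct] E] := F_mvt s N t01.
have c1 : c < 1 by exact: le_lt_trans ct t1.
have c1' : 0 < 1 - c by rewrite subr_gt0.
rewrite lerBlDr addrC -lerBlDr -(subr_ge0 _ 1) E bc_shift.
rewrite !mulr_ge0 ?powR_ge0 ?bc_ge0 ?exprn_ge0 ?addr_ge0// andbT.
have pc : (1 - c) `^ (s - 1) <= (1 - t)^-1.
  rewrite -div1r ler_pdivlMr//.
  rewrite (@le_trans _ _ ((1 - c) `^ (s - 1) * (1 - c)))//.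
    by rewrite mulrC [leRHS]mulrC ler_wpM2r ?powR_ge0// lerD2l lerN2.
  rewrite -{2}(powRr1 (ltW c1')) -powRD ?(gt_eqF c1') ?implybT// subrK.
  have p1 : 1 `^ s = 1 :> R by rewrite powR1.
  by rewrite -[leRHS]p1 ge0_ler_powR ?nnegrE ?(ltW c1')// gerBl.
rewrite [leLHS](_ : _ = (1 - c) `^ (s - 1) * (s * bc (s + 1) N) * (c ^+ N * t)); last by ring.
rewrite [leRHS](_ : _ = (1 - t)^-1 * (s * bc (s + 1) N) * (t ^+ N * t)); last by ring.
rewrite ler_pM ?mulr_ge0 ?powR_ge0 ?bc_ge0 ?exprn_ge0 ?addr_ge0//.
  by rewrite ler_wpM2r ?mulr_ge0 ?bc_ge0 ?addr_ge0.
by rewrite ler_wpM2r// lerXn2r.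
Qed.

Definition lsum N t : R := \sum_(j < N) t ^+ j.+1 / j.+1%:R.

Let lsum_mvt N t : 0 <= t < 1 -> exists2 c, 0 <= c <= t &
  - ln (1 - t) - lsum N t = c ^+ N / (1 - c) * t.
Proof.
move=> t01; pose G x : R := - ln (1 - x) - lsum N x.
have D (x : R) : x < 1 -> is_derive x (1 : R) G (x ^+ N / (1 - x)).
  move=> x1; have x0 : 0 < 1 - x by rewrite subr_gt0.
  have dl : is_derive x (1 : R) (fun t => ln (1 - t)) (- (1 - x)^-1).
    have h1 : is_derive (1 - x) (1 : R) (@ln R) (1 - x)^-1 by exact: is_derive1_ln.
    have h2 : is_derive x (1 : R) (fun t => 1 - t) (- 1).
      have -> : (fun t => 1 - t) = cst 1 - id :> (R -> R) by [].
      by apply: is_derive_eq; rewrite sub0r.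
    have := @is_derive1_comp _ (@ln R) (fun t => 1 - t) x _ _ h1 h2.
    by rewrite /GRing.scale/= mulrN1.
  have ds : is_derive x (1 : R) (lsum N) (\sum_(j < N) x ^+ j).
    elim: N {G} => [|N IH].
      rewrite big_ord0; have -> : lsum 0 = cst 0 by apply/funext => y; rewrite /lsum big_ord0.
      exact: is_derive_cst.
    have -> : lsum N.+1 = lsum N + N.+1%:R^-1 *: (id ^+ N.+1).
      apply/funext => y; rewrite /lsum big_ord_recr/= mulrC; congr (_ + _ * _).
      by elim: N {IH} => [|N IH]; rewrite ?expr1// exprS IH [in RHS]exprS.
    rewrite big_ord_recr/=; apply: is_deriveD; apply: is_derive_eq.
    by rewrite /GRing.scale/= mulr1 -mulr_natl mulrA mulVf ?mul1r// pnatr_eq0.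
  have -> : G = - (fun t => ln (1 - t)) - lsum N by apply/funext.
  apply: is_derive_eq; rewrite opprK.
  have -> : x ^+ N = 1 + (x ^+ N - 1) by ring.
  by rewrite subrX1; move: (\sum_(_ < _) _) => u; field; rewrite gt_eqF.
have [c ct E] := mvt0 t01 D; exists c => //; rewrite -E.
have -> : G 0 = 0; last by rewrite subr0.
rewrite /G subr0 ln1 /lsum big1 ?oppr0 ?addr0// => i _.
by rewrite exprS mul0r mul0r.
Qed.

Lemma lsum_le N t : 0 <= t < 1 -> lsum N t <= - ln (1 - t).
Proof.
move=> t01; have [c /andP[c0 ct] E] := lsum_mvt N t01; have /andP[t0 t1] := t01.
rewrite -subr_ge0 E mulr_ge0// divr_ge0 ?exprn_ge0// subr_ge0.
by rewrite (le_trans ct)// ltW.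
Qed.

Lemma cvg_lsum t : 0 <= t < 1 -> lsum N t @[N --> \oo] --> - ln (1 - t).
Proof.
move=> t01; have /andP[t0 t1] := t01; have t1' : 0 < 1 - t by rewrite subr_gt0.
have h : (fun N => - ln (1 - t) - (1 - t)^-1 * t * t ^+ N) @ \oo --> (- ln (1 - t) - (1 - t)^-1 * t * 0 : R).
  apply: cvgB; [exact: cvg_cst|apply: cvgM; first exact: cvg_cst].
  by apply: cvg_expr; rewrite ger0_norm.
rewrite mulr0 subr0 in h.
apply: (squeeze_cvgr _ h (@cvg_cst _ _ _ _ _)); apply: nearW => N; rewrite lsum_le// andbT.
have [c /andP[c0 ct] E] := lsum_mvt N t01.
have c1' : 0 < 1 - c by rewrite subr_gt0 (le_lt_trans ct).
rewrite lerBlDr -lerBlDl E [leRHS]mulrAC ler_wpM2r//.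
rewrite mulrC ler_pM ?invr_ge0 ?exprn_ge0 ?(ltW c1')// ?lerXn2r//.
by rewrite lef_pV2 ?posrE// lerD2l lerN2.
Qed.

Lemma sum_inv_sqr N : \sum_(j < N) (j.+1%:R ^+ 2)^-1 <= 2 :> R.
Proof.
have h M : \sum_(j < M.+1) (j.+1%:R ^+ 2)^-1 <= 2 - M.+1%:R^-1 :> R.
  elim: M => [|M IH]; first by rewrite big_ord1 expr1n invr1; lra.
  rewrite big_ord_recr/= (le_trans (lerD IH (lexx _)))//.
  have M0 : 0 < M.+1%:R :> R by [].
  rewrite -addrA lerD2l addrC -subr_ge0 -[M.+2%:R]natr1.
  move: (M.+1%:R : R) M0 => m m0.
  have -> : - (m + 1)^-1 - (((m + 1) ^+ 2)^-1 - m^-1) = (m * (m + 1) ^+ 2)^-1.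
    by field; rewrite !gt_eqF// addr_gt0.
  by rewrite invr_ge0 mulr_ge0 ?sqr_ge0// ltW.
case: N => [|N]; first by rewrite big_ord0.
by rewrite (le_trans (h N))// lerBlDr lerDl invr_ge0.
Qed.

Section coefficients.
Variable n : nat.
Notation a := (n.+1%:R / 2 : R).
Notation l := (@ell R n).
Notation c := (@cf R a).

Let a_gt0 : 0 < a. Proof. by rewrite divr_gt0. Qed.
Let a2_ge1 : 1 <= 2 * a. Proof. by rewrite mulrC divfK// ler1n. Qed.

Lemma cf_le_ell j : j%:R * c j <= l.
Proof.
apply: (nd_cvg_le (u := fun j => j%:R * c j)); last exact: cvg_cf.
apply/nondecreasing_seqP => i; rewrite -subr_ge0 cf_tel//.
by rewrite divr_ge0 ?mulr_ge0 ?sqr_ge0 ?addr_ge0 ?mulr_ge0 ?(ltW (cf_gt0 _ _)) ?(ltW a_gt0).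
Qed.

(** The corrected sequence $j\,c_j+a^2\ell/j$ decreases to $\ell$ while $j\,c_j$ increases to it.
    Hence $0\le\ell/j-c_j\le a^2\ell/j^2$, which is summable and keeps [gk] bounded up to $t=1$. *)
Lemma cf_ge_ell j : l <= j.+1%:R * c j.+1 + a ^+ 2 * l / j.+1%:R.
Proof.
have h : (fun j => j%:R * c j + a ^+ 2 * l * (0 + j%:R)^-1) @ \oo --> (l + a ^+ 2 * l * 0 : R).
  apply: cvgD; first exact: cvg_cf.
  apply: cvgM; first exact: cvg_cst.
  have := @cvg_harmonic R; have -> : @harmonic R = [sequence (0 + n.+1%:R)^-1]_n.
    by apply/funext => i; rewrite /= add0r.
  by rewrite (cvg_shiftS (fun n => (0 + n%:R)^-1 : R)).
have {h} : (fun j => j.+1%:R * c j.+1 + a ^+ 2 * l / j.+1%:R) @ \oo --> l.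
  move: h; rewrite mulr0 addr0 -cvg_shiftS; apply: cvg_trans; apply: near_eq_cvg.
  by apply: nearW => i /=; rewrite add0r.
move=> h; apply: (ni_cvg_ge (u := fun j => j.+1%:R * c j.+1 + a ^+ 2 * l / j.+1%:R) _ h).
apply/nonincreasing_seqP => i; rewrite -lerBrDl -subr_ge0.
have := cf_tel i.+1 a_gt0; have := cf_le_ell i.+1.
have i0 : 0 < i.+1%:R :> R by [].
have := cf_gt0 i.+1 a_gt0; have := ell_gt0 (R := R) n.
rewrite -[i.+2%:R]natr1; move: (i.+1%:R : R) (c i.+1) ((i.+1%:R + 1) * c i.+2) l i0 a_gt0 a2_ge1.
move=> m ci T L m0; move: a => b b0 b1 L0 ci0 mL e.
have -> : T = m * ci + b ^+ 2 * ci / (2 * b + m) by rewrite -e; ring.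
have -> : m * ci + b ^+ 2 * L / m - (m * ci + b ^+ 2 * ci / (2 * b + m)) - b ^+ 2 * L / (m + 1) =
   b ^+ 2 / m * (L / (m + 1) - m * ci / (2 * b + m)).
  by field; rewrite !gt_eqF//; lra.
rewrite mulr_ge0 ?divr_ge0 ?sqr_ge0 ?(ltW m0)// subr_ge0.
rewrite ler_pdivlMr ?addr_gt0// mulrAC ler_pdivrMr; last lra.
apply: ler_pM => //; [by rewrite mulr_ge0 ?ltW|by rewrite addr_ge0 ?(ltW m0)|lra].
Qed.

Definition gap_total : R := (2 * n.+2%:R) / (a * (a + 1)).

(** The partial sums have the closed form [E], namely $N c_N$ times a rational function of $N$. This
    is the telescoping that makes the constant explicit. *)
Lemma cvg_gap_series :
  \sum_(j < N) c j * (1 - @gap_ratio R n j) @[N --> \oo] --> l * gap_total.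
Proof.
have a0 := a_gt0; have a2 : 2 * a = n.+1%:R by rewrite mulrC divfK.
have E N : \sum_(j < N) c j * (1 - @gap_ratio R n j) = N%:R * c N *
    ((2 * n.+2%:R) / (a + 1) * (a^-1 + (1 - n.+1%:R / a) * (n.+1%:R + N%:R)^-1)).
  elim: N => [|N IH]; first by rewrite big_ord0 !mul0r.
  rewrite big_ord_recr/= {}IH /gap_ratio cfS a2.
  have N0 : 0 <= N%:R :> R by rewrite ler0n.
  have -> : n.+1%:R = 2 * a :> R by [].
  rewrite -[N.+1%:R]natr1 -[n.+2%:R]natr1 -a2; move: a0 N0; move: a (c N) (N%:R) => b cN m b0 m0.
  by field; rewrite !gt_eqF//; lra.
have -> : l * gap_total = l * ((2 * n.+2%:R) / (a + 1) * (a^-1 + (1 - n.+1%:R / a) * 0)).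
  by rewrite /gap_total; move: a0; move: a => b b0; field; rewrite !gt_eqF//; lra.
under eq_fun do rewrite E.
apply: cvgM; first exact: cvg_cf.
apply: cvgM; first exact: cvg_cst.
apply: cvgD; first exact: cvg_cst.
apply: cvgM; first exact: cvg_cst.
exact: cvg_inv_addn.
Qed.

(* [-ln (1 - t)] is the leading part of the series as [t] tends to [1]. *)
Lemma cf_series_split t (h : R) : 0 <= t < 1 -> \sum_(j < N) c j * t ^+ j @[N --> \oo] --> h ->
  (fun N => \sum_(j < N) (l / j.+1%:R - c j.+1) * t ^+ j.+1) @ \oo --> 1 - l * ln (1 - t) - h.
Proof.
move=> t01 hh; have -> : 1 - l * ln (1 - t) - h = l * - ln (1 - t) - (h - 1) by ring.
have h1 : (fun N => \sum_(j < N) c j.+1 * t ^+ j.+1) @ \oo --> h - 1.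
  have : (fun N => \sum_(j < N.+1) c j * t ^+ j - 1) @ \oo --> h - 1.
    by apply: cvgB; [rewrite (cvg_shiftS (fun N => \sum_(j < N) c j * t ^+ j))|exact: cvg_cst].
  apply: cvg_trans; apply: near_eq_cvg; apply: nearW => N.
  by rewrite big_ord_recl/= cf0 mul1r expr0 addrAC subrr add0r.
have h2 : (fun N => l * lsum N t) @ \oo --> l * - ln (1 - t).
  by apply: cvgM; [exact: cvg_cst|exact: cvg_lsum].
apply: cvg_trans (cvgB h2 h1); apply: near_eq_cvg; apply: nearW => N.
rewrite -[LHS]/(l * lsum N t - \sum_(j < N) c j.+1 * t ^+ j.+1).
rewrite /lsum mulr_sumr -sumrB; apply: eq_bigr => j _; ring.
Qed.

Lemma cf_rest_ge0 j : 0 <= l / j.+1%:R - c j.+1.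
Proof. by rewrite subr_ge0 ler_pdivlMr// mulrC cf_le_ell. Qed.

Lemma cf_rest_le j : l / j.+1%:R - c j.+1 <= a ^+ 2 * l / j.+1%:R ^+ 2.
Proof.
rewrite lerBlDl ler_pdivrMr// (le_trans (cf_ge_ell j))//.
by rewrite le_eqVlt; apply/orP; left; apply/eqP; field.
Qed.

End coefficients.

End BinomialSeries.

Lemma cvgn_eq (R : realType) (u v : R^nat) (l : R) : u =1 v -> u @ \oo --> l -> v @ \oo --> l.
Proof. by move=> /funext ->. Qed.

Lemma cvgn_uniq (R : realType) (u : R^nat) (l1 l2 : R) : u @ \oo --> l1 -> u @ \oo --> l2 -> l1 = l2.
Proof. by move=> h1 h2; rewrite -(cvg_lim (@Rhausdorff R) h1); exact/cvg_lim. Qed.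

Lemma cvgnZ (R : realType) (c : R) (u : R^nat) (l : R) : u @ \oo --> l -> (fun N => c * u N) @ \oo --> c * l.
Proof. by move=> h; apply: cvgM => //; exact: cvg_cst. Qed.

(** * Integrals of the regularised kernel *)

Section KernelSeries.
Context {R : realType} {n : nat}.
Notation S := (sphere R n.+1).
Notation dw := (@surface R n.+1).
Notation I f := (Rintegral dw setT f).
Notation a := (n.+1%:R / 2 : R).
Notation sph := (fine (dw setT)).
Implicit Types (x y z w : S) (s t : R).

Let a_gt0 : 0 < a. Proof. by rewrite divr_gt0. Qed.

(** Integrating the binomial series of $(1-tq)^{-a}$ over the sphere gives the hypergeometric series
    with coefficients [cf a]. With the exponent $2a$ ([bc_qmom_full]) it collapses to the binomial
    series of $(1-t)^{-a}$. *)
Lemma bc_qmom_half j : bc a j * @qmom R n j = sph * cf a j.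
Proof.
rewrite /qmom mulrCA; congr (_ * _); rewrite /bc /cf -big_split/=.
apply: eq_bigr => i _; have i0 : 0 <= i%:R :> R by rewrite ler0n.
by have := a_gt0; move: a => b b0; field; rewrite nat1r pnatr_eq0/= gt_eqF//; lra.
Qed.

Lemma bc_qmom_full j : bc n.+1%:R j * @qmom R n j = sph * bc a j.
Proof.
have a2 : n.+1%:R = 2 * a by rewrite mulrC divfK.
rewrite /qmom mulrCA; congr (_ * _); rewrite /bc -big_split/=.
apply: eq_bigr => i _; have i0 : 0 <= i%:R :> R by rewrite ler0n.
by have := a_gt0; rewrite a2; move: a => b b0; field; rewrite nat1r pnatr_eq0/= gt_eqF//; lra.
Qed.

Lemma bmeas_powqd s t x : 0 <= s -> 0 <= t < 1 -> bmeas (fun w : S => (1 - t * qd x w) `^ (- s)).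
Proof.
move=> s0 /andP[t0 t1]; split.
  apply: (measurableT_comp (measurable_powR _)).
  by apply: measurable_funB => //; apply: measurable_funM => //; case: (bmeas_qd x).
exists ((1 - t) `^ (- s)) => w; rewrite ger0_norm ?powR_ge0// !powRN lef_pV2 ?posrE.
- have tq : t * qd x w <= t by rewrite ler_piMr// qd_le1.
  rewrite ge0_ler_powR// ?nnegrE ?lerD2l ?lerN2// subr_ge0 ?(ltW t1)//.
  by rewrite (le_trans tq) ?ltW.
- rewrite powR_gt0// subr_gt0 (le_lt_trans _ t1)// ler_piMr// qd_le1//.
- by rewrite powR_gt0// subr_gt0.
Qed.

Lemma cvg_I_powqd s t x : 0 <= s -> 0 <= t < 1 ->
  \sum_(j < N) bc s j * @qmom R n j * t ^+ j @[N --> \oo] -->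
  I (fun w => (1 - t * qd x w) `^ (- s)).
Proof.
move=> s0 t01; have /andP[t0 t1] := t01.
have tq w : 0 <= t * qd x w < 1.
  rewrite mulr_ge0 ?qd_ge0//= (le_lt_trans _ t1)// ler_piMr// qd_le1//.
have bN N : bmeas (fun w : S => bsum s N (t * qd x w)).
  apply: bmeas_sum => j; apply: bmeasZ; apply: bmeasX; apply: bmeasZ; exact: bmeas_qd.
have hF := bmeas_intg dw (bmeas_powqd x s0 t01).
have hN N := bmeas_intg dw (bN N).
have E N : \sum_(j < N) bc s j * @qmom R n j * t ^+ j = I (fun w => bsum s N (t * qd x w)).
  rewrite /bsum I_sum => [|j]; last first.
    by apply: bmeas_intg; apply: bmeasZ; apply: bmeasX; apply: bmeasZ; exact: bmeas_qd.
  apply: eq_bigr => j _; rewrite -(I_qdX x j) mulrAC -IZ.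
    by apply: eq_I => w; rewrite (exprMn j t (qd x w)) mulrA.
  exact: bmeas_intg (bmeas_qdX x j).
under eq_fun do rewrite E.
(* The remainder has nonnegative terms, so it is largest at $q=1$ and the convergence is uniform in
   [w]. *)
have diff N w : 0 <= (1 - t * qd x w) `^ (- s) - bsum s N (t * qd x w) <= (1 - t) `^ (- s) - bsum s N t.
  rewrite subr_ge0 bsum_le//=.
  have hx : (fun M => bsum s M (t * qd x w) - bsum s N (t * qd x w)) @ \oo -->
    (1 - t * qd x w) `^ (- s) - bsum s N (t * qd x w).
    by apply: cvgB; [exact: cvg_bsum|exact: cvg_cst].
  have hy : (fun M => bsum s M t - bsum s N t) @ \oo --> (1 - t) `^ (- s) - bsum s N t.
    by apply: cvgB; [exact: cvg_bsum|exact: cvg_cst].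
  apply: (ler_cvg_to hx hy); near=> M.
  have NM : (N <= M)%N by near: M; exact: nbhs_infty_ge.
  rewrite /bsum -(subnKC NM) !big_split_ord/= ![_ + _ - _]addrAC !subrr !add0r.
  apply: ler_sum => j _; rewrite ler_wpM2l ?bc_ge0// lerXn2r ?nnegrE//.
  - by have /andP[] := tq w.
  - by rewrite ler_piMr// qd_le1.
apply/cvgrPdist_le => e e0.
have ee : 0 < e / (sph + 1) by rewrite divr_gt0 ?addr_gt0 ?surface_gt0.
have /cvgrPdist_le /(_ _ ee) := cvg_bsum s0 t01.
apply: filterS => N hNe; rewrite -IB//.
have hB : intg dw (fun w => (1 - t * qd x w) `^ (- s) - bsum s N (t * qd x w)) by exact: intgB.
rewrite (le_trans (norm_I hB))// (@le_trans _ _ (I (cst (e / (sph + 1)))))//.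
  apply: le_I; [exact: intg_norm|exact: bmeas_intg (bmeas_cst _)|move=> w /=].
  have /andP[d0 d1] := diff N w; rewrite ger0_norm//.
  by rewrite (le_trans d1)// (le_trans (ler_norm _)).
rewrite Icst mulrAC ler_pdivrMr ?addr_gt0 ?surface_gt0// ler_wpM2l ?(ltW e0)// lerDl//.
Unshelve. all: by end_near.
Qed.

Definition hk t x : R := I (fun w => (1 - t * qd x w) `^ (- a)) / sph.

Let sph_neq0 : sph != 0. Proof. by rewrite gt_eqF// surface_gt0. Qed.

Lemma cvg_hk t x : 0 <= t < 1 -> \sum_(j < N) cf a j * t ^+ j @[N --> \oo] --> hk t x.
Proof.
move=> t01; rewrite /hk [_ / sph]mulrC.
apply: (cvgn_eq _ (cvgnZ (c := sph^-1) (cvg_I_powqd (x := x) (ltW a_gt0) t01))) => N.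
rewrite mulr_sumr; apply: eq_bigr => j _.
by rewrite bc_qmom_half !mulrA mulVf ?mul1r.
Qed.

Lemma I_powqd_full t x : 0 <= t < 1 ->
  I (fun w => (1 - t * qd x w) `^ (- n.+1%:R)) = sph * (1 - t) `^ (- a).
Proof.
move=> t01; have n0 : 0 <= n.+1%:R :> R by [].
have h1 := cvg_I_powqd (x := x) n0 t01.
apply: (cvgn_uniq h1); apply: (cvgn_eq _ (cvgnZ (c := sph) (cvg_bsum (ltW a_gt0) t01))) => N.
by rewrite mulr_sumr; apply: eq_bigr => j _; rewrite bc_qmom_full mulrA.
Qed.

(* [gk] is the bounded part of [hk]: [hk t x = 1 - ell n * ln (1 - t) - gk t]. *)
Definition gk t : R := 1 - ell n * ln (1 - t) - hk t point.

Lemma hkE t x : 0 <= t < 1 -> hk t x = 1 - ell n * ln (1 - t) - gk t.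
Proof.
move=> t01; rewrite /gk opprB addrC subrK.
exact: cvgn_uniq (cvg_hk (x := x) t01) (cvg_hk (x := point) t01).
Qed.

Lemma gk_bound t : 0 <= t < 1 -> 0 <= gk t <= 2 * (a ^+ 2 * ell n).
Proof.
move=> t01; have /andP[t0 t1] := t01; have c := cf_series_split t01 (cvg_hk (x := point) t01).
apply/andP; split.
  apply: (cvgr_to_ge c); apply: nearW => N; apply: sumr_ge0 => j _.
  by rewrite mulr_ge0 ?cf_rest_ge0// exprn_ge0.
apply: (cvgr_to_le c); apply: nearW => N.
apply: (@le_trans _ _ (\sum_(j < N) (j.+1%:R ^+ 2)^-1 * (a ^+ 2 * ell n))).
  apply: ler_sum => j _; rewrite [leRHS]mulrC.
  rewrite (@le_trans _ _ (ell n / j.+1%:R - cf a j.+1)) ?cf_rest_le//.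
  by rewrite ler_piMr ?cf_rest_ge0// exprn_ile1// ltW.
rewrite -mulr_suml ler_wpM2r ?sum_inv_sqr// mulr_ge0 ?sqr_ge0// ltW// ell_gt0//.
Qed.

Lemma gk_nd t1 t2 : 0 <= t1 -> t1 <= t2 -> t2 < 1 -> gk t1 <= gk t2.
Proof.
move=> t0 t12 t21.
have T1 : 0 <= t1 < 1 by rewrite t0 (le_lt_trans t12).
have T2 : 0 <= t2 < 1 by rewrite t21 (le_trans t0).
have c1 := cf_series_split T1 (cvg_hk (x := point) T1).
have c2 := cf_series_split T2 (cvg_hk (x := point) T2).
apply: (ler_cvg_to c1 c2); apply: nearW => N; apply: ler_sum => j _.
by rewrite ler_wpM2l ?cf_rest_ge0// lerXn2r ?nnegrE// (le_trans t0).
Qed.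

End KernelSeries.

Section SquareIntegrable.
Context {R : realType} {d : measure_display} {T : measurableType d}.
Variable mu : {finite_measure set T -> \bar R}.
Local Notation I f := (Rintegral mu setT f).
Implicit Types (u v : T -> R).

Definition sqi u := measurable_fun setT u /\ intg mu (fun x => u x ^+ 2).

Lemma sqiM u v : sqi u -> sqi v -> intg mu (fun x => u x * v x).
Proof.
move=> [mu' iu] [mv iv].
have h := intgZ 2^-1 (intgD iu iv); apply: intg_le h => [|x]; first exact: measurable_funM.
rewrite (ger0_norm (_ : 0 <= 2^-1 * _)); last first.
  by rewrite mulr_ge0 ?invr_ge0 ?addr_ge0 ?sqr_ge0.
rewrite normrM -(real_normK (num_real (u x))) -(real_normK (num_real (v x))).
move: `|u x| `|v x| => s t; have := sqr_ge0 (s - t); lra.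
Qed.

Lemma bmeas_sqi u : bmeas u -> sqi u.
Proof. by move=> bu; split; [case: bu|apply: bmeas_intg; exact: bmeasX]. Qed.

Lemma sqi_intg u : sqi u -> intg mu u.
Proof.
move=> hu; have := sqiM (bmeas_sqi (bmeas_cst 1)) hu.
by apply: eq_integrable => // x _ /=; rewrite mul1r.
Qed.

Lemma sqi_bmeasM f u : bmeas f -> sqi u -> sqi (fun x => f x * u x).
Proof.
move=> bf [mu' iu]; split; first by apply: measurable_funM => //; case: bf.
have := intgM (bmeasX 2 bf) iu; apply: eq_integrable => // x _ /=.
by rewrite exprMn.
Qed.

Lemma sqiZ c u : sqi u -> sqi (fun x => c * u x).
Proof. by apply: sqi_bmeasM; exact: bmeas_cst. Qed.

Lemma sqiD u v : sqi u -> sqi v -> sqi (fun x => u x + v x).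
Proof.
move=> hu hv; split; first by apply: measurable_funD; [case: hu|case: hv].
have := intgD (intgD (proj2 hu) (proj2 hv)) (intgZ 2 (sqiM hu hv)).
by apply: eq_integrable => // x _ /=; congr EFin; ring.
Qed.

Lemma sqiB u v : sqi u -> sqi v -> sqi (fun x => u x - v x).
Proof.
move=> hu /(sqiZ (-1)) /(sqiD hu); congr sqi.
by apply/funext => x; rewrite mulN1r.
Qed.

Lemma sqi_le u v : measurable_fun setT u -> (forall x, `|u x| <= `|v x|) -> sqi v -> sqi u.
Proof.
move=> mu' uv [mv iv]; split => //; apply: (intg_le _ _ iv) => [|x].
  exact: measurable_funX.
by rewrite !normrX lerXn2r ?nnegrE.
Qed.

Lemma LfunP u : u \in Lfun mu 2%:E <-> sqi u.
Proof.
split=> [hu|[mu' iu]].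
  have mf : measurable_fun setT u by move: hu; rewrite inE => /andP[/[1!inE]].
  split => //; apply: eq_integrable (Lfun2_integrable_sqr hu) => // x _ /=.
rewrite inE; apply/andP; split; rewrite inE/=; first exact: mu'.
rewrite /finite_norm unlock poweR_lty//.
have := integrable_lty measurableT iu; congr (_ < _)%E.
apply: eq_integral => x _ /=.
by rewrite powR_mulrn// real_normK// num_real.
Qed.

Lemma fine_LnormE u : measurable_fun setT u ->
  fine ('N[mu]_2%:E[EFin \o u])%E = Num.sqrt (I (fun x => u x ^+ 2)).
Proof.
move=> mu'; rewrite unlock /Rintegral.
have -> : (\int[mu]_x (`|(EFin \o u) x| `^ 2)%E)%E = (\int[mu]_x (u x ^+ 2)%:E)%E.
  by apply: eq_integral => x _ /=; rewrite powR_mulrn// real_normK// num_real.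
have : (0 <= \int[mu]_x (u x ^+ 2)%:E)%E.
  by apply: integral_ge0 => x _; rewrite lee_fin sqr_ge0.
case: (\int[mu]_x _)%E => [r| |]//= r0; first by rewrite powR12_sqrt.
by rewrite gt_eqF// sqrtr0.
Qed.

Lemma CS u v : sqi u -> sqi v ->
  I (fun x => u x * v x) ^+ 2 <= I (fun x => u x ^+ 2) * I (fun x => v x ^+ 2).
Proof.
move=> hu hv.
set A := I (fun x => u x ^+ 2); set B := I (fun x => v x ^+ 2); set X := I _.
have A0 : 0 <= A by apply: I_ge0 => x; exact: sqr_ge0.
have key t : 0 <= A * t ^+ 2 + 2 * X * t + B.
  have iu := proj2 hu; have iv := proj2 hv; have iuv := sqiM hu hv.
  have -> : A * t ^+ 2 + 2 * X * t + B = I (fun x => (t * u x + v x) ^+ 2).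
    transitivity (I (fun x => t ^+ 2 * u x ^+ 2 + 2 * t * (u x * v x) + v x ^+ 2)); last first.
      by apply: eq_I => x; ring.
    rewrite ID//; last by apply: intgD; exact: intgZ.
    by rewrite ID ?IZ//; [rewrite -/A -/B -/X; ring|exact: intgZ|exact: intgZ].
  by apply: I_ge0 => x; exact: sqr_ge0.
have [A0'|A_neq0] := eqVneq A 0.
  have [X0|X_neq0] := eqVneq X 0; first by rewrite X0 A0' expr0n/= mul0r.
  (* With $A=0$ the polynomial is affine in $t$, and at this point it equals $-1$. *)
  have := key (- (B + 1) / (2 * X)); rewrite A0' mul0r add0r.
  by have -> : 2 * X * (- (B + 1) / (2 * X)) + B = -1 by [field]; rewrite oppr_ge0 ler10.
have Ap : 0 < A by rewrite lt_neqAle eq_sym A_neq0.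
have := key (- X / A).
have -> : A * (- X / A) ^+ 2 + 2 * X * (- X / A) + B = (A * B - X ^+ 2) / A by field.
by rewrite pmulr_lge0 ?invr_gt0// subr_ge0.
Qed.

End SquareIntegrable.

(** * Dirichlet forms of kernels *)

Section DirichletForm.
Context {R : realType} {d : measure_display} {T : measurableType d}.
Variable mu : {finite_measure set T -> \bar R}.
Local Notation I f := (Rintegral mu setT f).
Implicit Types (k : T -> T -> R) (u v : T -> R).

Definition dform k u : \bar R :=
  (\int[mu \x mu]_p ((u p.1 - u p.2) ^+ 2 * k p.1 p.2)%:E)%E.

Lemma measurable_dform k u : measurable_fun setT (fun p : T * T => k p.1 p.2) ->
  measurable_fun setT u ->
  measurable_fun setT (fun p : T * T => ((u p.1 - u p.2) ^+ 2 * k p.1 p.2)%:E).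
Proof.
move=> mk mf; apply/measurable_EFinP; apply: measurable_funM => //.
apply: measurable_funX; apply: measurable_funB.
  exact: (measurableT_comp mf measurable_fst).
exact: (measurableT_comp mf measurable_snd).
Qed.

Lemma dformE k u : bmeas2 k -> (forall x y, 0 <= k x y) -> (forall x y, k x y = k y x) ->
  sqi mu u -> dform k u = (2 * (I (fun x => u x ^+ 2 * I (k x)) - qform mu k u))%:E.
Proof.
move=> bk k0 kC hu; have iu := sqi_intg hu; have iu2 := proj2 hu.
have b1 : bmeas (fun x => I (k x)).
  have := bmeas_kernel bk (bmeas_intg mu (bmeas_cst 1)); congr bmeas.
  by apply/funext => x; apply: eq_I => y; rewrite mulr1.
have h1 : intg mu (fun x => u x ^+ 2 * I (k x)).
  by have := intgM b1 iu2; apply: eq_integrable => // x _ /=; rewrite mulrC.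
have h2 : intg mu (fun x => I (fun y => k x y * u y ^+ 2)).
  by apply: bmeas_intg; exact: bmeas_kernel.
have hk x : intg mu (k x) by apply: bmeas_intg; exact: bmeas2_section.
have p0 (p : T * T) : (0 <= ((u p.1 - u p.2) ^+ 2 * k p.1 p.2)%:E)%E.
  by rewrite lee_fin mulr_ge0 ?sqr_ge0.
rewrite /dform (@fubini_tonelli1 _ _ _ _ R mu mu _ (measurable_dform (proj1 bk) (proj1 hu)) p0).
transitivity (\int[mu]_x (u x ^+ 2 * I (k x) - 2 * (u x * I (fun y => k x y * u y)) + I (fun y => k x y * u y ^+ 2))%:E)%E.
  apply: eq_integral => x _ /=; rewrite /fubini_F/=.
  have e1 := intg_kernel x bk iu; have e2 := intg_kernel x bk iu2.
  rewrite -IZ// -IZ// -IZ; last exact: intgZ.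
  rewrite -IB; [|exact: intgZ|by apply: intgZ; exact: intgZ].
  rewrite -ID//; last by apply: intgB; apply: intgZ => //; exact: intgZ.
  rewrite IE; last by apply: intgD => //; apply: intgB; apply: intgZ => //; exact: intgZ.
  by apply: eq_integral => y _; congr EFin; ring.
have h3 := intg_qform bk iu.
rewrite -IE; last by apply: intgD => //; apply: intgB => //; exact: intgZ.
congr EFin; rewrite ID//; last by apply: intgB => //; exact: intgZ.
rewrite IB//; last exact: intgZ.
rewrite IZ// -/(qform mu k u).
have -> : I (fun x => I (fun y => k x y * u y ^+ 2)) = I (fun x => u x ^+ 2 * I (k x)).
  have := kernel_swap bk (bmeas_intg mu (bmeas_cst 1)) iu2.
  under eq_I do rewrite mul1r; move=> ->; apply: eq_I => y; congr (_ * _).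
  by apply: eq_I => x; rewrite mulr1 kC.
by ring.
Qed.

Lemma dform_ge0 k u : (forall x y, 0 <= k x y) -> (0 <= dform k u)%E.
Proof. by move=> k0; apply: integral_ge0 => p _; rewrite lee_fin mulr_ge0 ?sqr_ge0. Qed.

(** Monotone convergence. Asking for convergence only where [u x != u y] leaves out the diagonal,
    where [riesz 1] has the value 0 although its approximations tend to infinity. *)
Lemma cvg_dform (k_ : nat -> T -> T -> R) k u :
  (forall N, measurable_fun setT (fun p : T * T => k_ N p.1 p.2)) ->
  (forall N x y, 0 <= k_ N x y) -> (forall x y, nondecreasing_seq (fun N => k_ N x y)) ->
  measurable_fun setT u ->
  (forall x y, u x != u y -> k_ N x y @[N --> \oo] --> k x y) ->
  (dform (k_ N) u @[N --> \oo] --> dform k u)%E.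
Proof.
move=> mk k0 knd mf kk.
have h0 N (p : T * T) : (0 <= ((u p.1 - u p.2) ^+ 2 * k_ N p.1 p.2)%:E)%E.
  by rewrite lee_fin mulr_ge0 ?sqr_ge0.
have h1 (p : T * T) : {homo (fun N => ((u p.1 - u p.2) ^+ 2 * k_ N p.1 p.2)%:E) : n m / (n <= m)%N >-> (n <= m)%E}.
  by move=> N M NM; rewrite lee_fin ler_wpM2l ?sqr_ge0// knd.
have := @cvg_monotone_convergence _ _ _ (mu \x mu)%E setT measurableT
  (fun N p => ((u p.1 - u p.2) ^+ 2 * k_ N p.1 p.2)%:E)
  (fun N => measurable_dform (mk N) mf) (fun N p _ => h0 N p) (fun p _ => h1 p).
congr (_ --> _); apply: eq_integral => p _.
apply/cvg_lim => //; apply: cvg_EFin; first exact: nearW.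
have [e|ne] := eqVneq (u p.1) (u p.2).
  rewrite e subrr expr0n/= !mul0r.
  by apply: cvg_near_cst; apply: nearW => N /=; rewrite mul0r.
by apply: cvgM; [exact: cvg_cst|exact: kk].
Qed.

End DirichletForm.

(** * The energy as a series of zonal forms *)

Section Energy.
Context {R : realType} {n : nat}.
Notation S := (sphere R n.+1).
Notation dw := (@surface R n.+1).
Notation I f := (Rintegral dw setT f).
Notation a := (n.+1%:R / 2 : R).
Notation sph := (fine (dw setT)).
Implicit Types (x y z w : S) (u : S -> R).

Let a_gt0 : 0 < a. Proof. by rewrite divr_gt0. Qed.

Lemma L2normE u : measurable_fun setT u -> L2norm u = Num.sqrt (I (fun x => u x ^+ 2)).
Proof. exact: fine_LnormE. Qed.

(** For [b = 1] this is $|x-y|^{-(n+1)}$ ([riesz1E]; both are 0 on the diagonal). For [b > 1] it is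
    a bounded regularisation. *)
Definition riesz (b : R) x y : R := 2 ^- n.+1 * (b - qd x y) `^ (- a).

Lemma riesz1E x y : riesz 1 x y = (edist (val x) (val y) ^+ n.+1)^-1.
Proof.
have e0 : 0 <= edist (val x) (val y) by exact: sqrtr_ge0.
have q0 : 0 <= 1 - qd x y by rewrite subr_ge0 qd_le1.
have a2 : 2%:R * a = n.+1%:R by rewrite mulrC divfK.
have -> : edist (val x) (val y) ^+ n.+1 = (4 * (1 - qd x y)) `^ a.
  by rewrite -edist_sqr -(powR_mulrn 2 e0) -powRrM a2 powR_mulrn.
have p4 : 4 `^ a = 2 ^+ n.+1 :> R.
  have -> : 4 = 2 ^+ 2 :> R by rewrite -natrX.
  by rewrite -(powR_mulrn 2)// -powRrM a2 powR_mulrn.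
by rewrite /riesz powRM// p4 invfM powRN.
Qed.

Lemma energyE u : energy u = dform dw (riesz 1) u.
Proof. by apply: eq_integral => p _; rewrite riesz1E. Qed.

Lemma bmeas2_riesz b : 1 < b -> bmeas2 (riesz b).
Proof.
move=> b1; split.
  apply: measurable_funM => //; apply: (measurableT_comp (measurable_powR _)).
  by apply: measurable_funB => //; case: (@bmeas_qd2 R n).
exists (2 ^- n.+1 * (b - 1) `^ (- a)) => p.
rewrite ger0_norm ?mulr_ge0 ?powR_ge0 ?invr_ge0 ?exprn_ge0//.
rewrite ler_wpM2l ?invr_ge0 ?exprn_ge0// !powRN lef_pV2 ?posrE ?powR_gt0 ?subr_gt0//; last first.
  by rewrite (le_lt_trans _ b1)// qd_le1.
have q1 := qd_le1 p.1 p.2.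
by apply: ge0_ler_powR; rewrite ?nnegrE ?subr_ge0 ?(ltW b1) ?(ltW a_gt0) ?(le_trans q1 (ltW b1))// lerD2l lerN2.
Qed.

Let bsum2 N x y : R := 2 ^- n.+1 * bsum a N (qd x y).

Let bmeas2_bsum2 N : bmeas2 (bsum2 N).
Proof.
apply: bmeas2Z; apply: bmeas_sum => j; apply: bmeasZ; apply: bmeasX; exact: bmeas_qd2.
Qed.

Let bsum2_ge0 N x y : 0 <= bsum2 N x y.
Proof.
rewrite mulr_ge0 ?invr_ge0 ?exprn_ge0//; apply: sumr_ge0 => j _.
by rewrite mulr_ge0 ?bc_ge0 ?(ltW a_gt0)// exprn_ge0// qd_ge0.
Qed.

Lemma qd_eq1 x y : qd x y = 1 -> x = y.
Proof.
move=> q1; have := edist_sqr x y; rewrite q1 subrr mulr0 => /eqP.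
rewrite sqrf_eq0 sqrtr_eq0 => s0; apply/val_inj/eq_from_tnth => i.
have : \sum_i (tnth (val x) i - tnth (val y) i) ^+ 2 == 0.
  by rewrite eq_le s0/= sumr_ge0// => k _; exact: sqr_ge0.
rewrite psumr_eq0 => [/allP/(_ i (mem_index_enum _))/=|k _]; last exact: sqr_ge0.
by rewrite sqrf_eq0 subr_eq0 => /eqP.
Qed.

Let dform_bsum2 N u : sqi dw u -> dform dw (bsum2 N) u =
  (2 / 2 ^+ n.+1 * sph * \sum_(j < N) cf a j * (I (fun x => u x ^+ 2) - qform dw (@gq R n j) u))%:E.
Proof.
move=> hu; rewrite dformE//; last by move=> x y; rewrite /bsum2 qdC.
congr EFin; rewrite -!mulrA; congr (_ * _).
have hu2 := proj2 hu; have iu := sqi_intg hu.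
have Ib x : I (bsum2 N x) = 2 ^- n.+1 * \sum_(j < N) bc a j * @qmom R n j.
  rewrite /bsum2 IZ; last first.
    apply: bmeas_intg; apply: bmeas_sum => j; apply: bmeasZ; exact: bmeas_qdX.
  congr (_ * _); rewrite /bsum I_sum => [|j]; last first.
    by apply: bmeas_intg; apply: bmeasZ; exact: bmeas_qdX.
  by apply: eq_bigr => j _; rewrite IZ ?I_qdX//; apply: bmeas_intg; exact: bmeas_qdX.
under eq_I do rewrite Ib mulrC.
rewrite IZ//.
have -> : qform dw (bsum2 N) u = 2 ^- n.+1 * \sum_(j < N) bc a j * @qmom R n j * qform dw (@gq R n j) u.
  rewrite mulr_sumr; under eq_bigr do rewrite mulrA.
  rewrite -(qform_sum _ (fun j : 'I_N => @bmeas_gq2 R n j) iu).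
  apply: eq_qform => x y; rewrite /bsum2 /bsum mulr_sumr; apply: eq_bigr => j _.
  have := @qmom_gt0 R n j; rewrite /gq -mulrA; move: (qmom j) (2 ^- _) => q c q0.
  by field; rewrite gt_eqF.
rewrite -mulrA -mulrBr; congr (_ * _); rewrite mulr_suml mulr_sumr -sumrB.
by apply: eq_bigr => j _; rewrite bc_qmom_half; ring.
Qed.

(** The binomial series of the kernel with each $q^j$ written as [qmom j] times $G_j$; the diagonal
    part of the form is $\|u\|^2$ because $G_j$ has total mass 1. *)
Lemma cvg_energy u : sqi dw u ->
  ((2 / 2 ^+ n.+1 * sph * \sum_(j < N) cf a j * (I (fun x => u x ^+ 2) - qform dw (@gq R n j) u))%:E
    @[N --> \oo] --> energy u)%E.
Proof.
move=> hu; rewrite energyE; under eq_fun do rewrite -dform_bsum2//.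
apply: cvg_dform => //.
- by move=> N; case: (bmeas2_bsum2 N).
- move=> x y N M NM; rewrite /bsum2 ler_wpM2l ?invr_ge0 ?exprn_ge0//.
  by apply: (bsum_nd (ltW a_gt0) (qd_ge0 x y)).
- by case: hu.
move=> x y uxy; apply: cvgM; first exact: cvg_cst.
apply: cvg_bsum; first exact: ltW.
rewrite qd_ge0/= lt_neqAle qd_le1 andbT; apply: contra uxy => /eqP/qd_eq1 ->//.
Qed.

(** The energy of a normalised harmonic of degree 2: the series of [cvg_energy] with
    $1-$[gap_ratio j] in the place of the [j]-th bracket. *)
Definition lam2 : R := 2 / 2 ^+ n.+1 * sph * (ell n * gap_total n).

Lemma energy_gap u : sqi dw u -> I u = 0 -> (forall y, I (fun x => u x * cosd x y) = 0) ->
  ((lam2 * I (fun x => u x ^+ 2))%:E <= energy u)%E.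
Proof.
move=> hu u0 u1; have c := cvg_energy hu.
have c2 : (2 / 2 ^+ n.+1 * sph * (\sum_(j < N) cf a j * (1 - @gap_ratio R n j)) * I (fun x => u x ^+ 2))%:E @[N --> \oo] --> (lam2 * I (fun x => u x ^+ 2))%:E.
  apply: cvg_EFin; first exact: nearW.
  apply: cvgM; last exact: cvg_cst.
  by apply: cvgM; [exact: cvg_cst|exact: cvg_gap_series].
rewrite -(cvg_lim _ c2)// -(cvg_lim _ c)//; apply: lee_lim; [exact: cvgP c2|exact: cvgP c|].
apply: nearW => N; rewrite lee_fin -mulrA ler_wpM2l//.
  by rewrite mulr_ge0 ?divr_ge0 ?exprn_ge0// ltW// surface_gt0.
rewrite mulr_suml; apply: ler_sum => j _; rewrite -mulrA ler_wpM2l ?(ltW (cf_gt0 _ _))//.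
by rewrite mulrBl mul1r lerD2l lerN2 qform_gap//; [exact: sqi_intg|case: hu].
Qed.

Lemma energy_extremal : exists Y : S -> R, [/\ bmeas Y, 0 < I (fun w => Y w ^+ 2),
  I Y = 0, (forall y, I (fun w => Y w * cosd w y) = 0) &
  energy Y = (lam2 * I (fun w => Y w ^+ 2))%:E].
Proof.
have [Y [bY Y2 Y0 Y1 Yq]] := @gap_extremal R n; exists Y; split => //.
have c2 : (2 / 2 ^+ n.+1 * sph * (\sum_(j < N) cf a j * (1 - @gap_ratio R n j)) * I (fun x => Y x ^+ 2))%:E @[N --> \oo] --> (lam2 * I (fun x => Y x ^+ 2))%:E.
  apply: cvg_EFin; first exact: nearW.
  apply: cvgM; last exact: cvg_cst.
  by apply: cvgM; [exact: cvg_cst|exact: cvg_gap_series].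
apply: (cvg_unique _ (cvg_energy (bmeas_sqi dw bY))) => //.
apply: cvg_trans c2; apply: near_eq_cvg; apply: nearW => N; congr EFin.
rewrite -mulrA; congr (_ * _); rewrite mulr_suml; apply: eq_bigr => j _.
by rewrite Yq; ring.
Qed.

Lemma powR_pi_half : pi `^ a = Num.sqrt pi ^+ n.+1 :> R.
Proof.
rewrite -powR12_sqrt ?pi_ge0// -[in RHS]powR_mulrn ?powR_ge0// -powRrM.
by rewrite mulrC.
Qed.

Let GA_gt0 : 0 < Gamma a. Proof. exact: Gamma_half_gt0. Qed.

(** The area of the sphere identifies the coefficient of the logarithmic singularity with a multiple
    of Beckner's constant. This makes the energy produce exactly the logarithms that occur in the
    entropy. *)
Lemma sph_ell : 2 / 2 ^+ n.+1 * sph * ell n = n.+1%:R / 2 * @Cn R n.+1.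
Proof.
have s0 : Num.sqrt pi != 0 :> R by rewrite gt_eqF// sqrtr_gt0 pi_gt0.
have sG := surface_Gamma (R := R) n.+1.
rewrite /ell /Cn powR_pi_half.
transitivity (sph * Gamma (n.+2%:R / 2) / (Num.sqrt pi * Gamma a)).
  have := GA_gt0; move: (Gamma _) (Gamma _) (Num.sqrt pi) s0 sph => g h s s0 sp g0.
  have p2 : 2 ^+ n != 0 :> R by rewrite expf_neq0.
  by rewrite exprS; field; rewrite s0 p2 gt_eqF.
rewrite sG exprS; have := GA_gt0; move: (Gamma _) (Num.sqrt pi) s0 => g s s0 g0.
by field; rewrite s0 nat1r pnatr_eq0 gt_eqF.
Qed.

Lemma Cn_gt0 : 0 < @Cn R n.+1.
Proof. by rewrite /Cn mulr_gt0 ?divr_gt0 ?powR_gt0 ?pi_gt0. Qed.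

Lemma lam2E : lam2 = 2 * @Cn R n.+1 + 8 * pi `^ a / (Gamma a * (n.+1%:R + 2)).
Proof.
rewrite /lam2 mulrA sph_ell /gap_total /Cn.
have := GA_gt0; move: (Gamma _) (pi `^ _) => g p g0.
have n0 : 0 <= n%:R :> R by rewrite ler0n.
rewrite -[n.+2%:R]natr1 -[n.+1%:R]natr1; field; rewrite !gt_eqF//; lra.
Qed.

End Energy.

(** * A weak logarithmic Sobolev inequality *)

Section DoubleIntegrals.
Context {R : realType} {d : measure_display} {T : measurableType d}.
Variable mu : {finite_measure set T -> \bar R}.
Local Open Scope ereal_scope.
Implicit Types F : T * T -> \bar R.

Lemma ge0_integral_prod F : measurable_fun setT F -> (forall p, 0 <= F p) ->
  \int[mu \x mu]_p F p = \int[mu]_x \int[mu]_y F (x, y).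
Proof. by move=> mF F0; rewrite (@fubini_tonelli1 _ _ _ _ R mu mu F mF F0). Qed.

Lemma ge0_integral_prod_swap F : measurable_fun setT F -> (forall p, 0 <= F p) ->
  \int[mu \x mu]_p F (p.2, p.1) = \int[mu \x mu]_p F p.
Proof.
move=> mF F0; have mF' : measurable_fun setT (fun p : T * T => F (p.2, p.1)).
  exact: (measurableT_comp mF (measurable_fun_pair measurable_snd measurable_fst)).
rewrite (ge0_integral_prod mF')// (ge0_integral_prod mF F0).
exact/esym/(@fubini_tonelli _ _ _ _ R mu mu F mF F0).
Qed.

(** The pointwise inequality is available only after symmetrisation, and it is written without
    subtraction because the integrals may be infinite. *)
Lemma ge0_integral_prod_le A B D : measurable_fun setT A -> measurable_fun setT B ->
  measurable_fun setT D -> (forall p, 0 <= A p) -> (forall p, 0 <= B p) -> (forall p, 0 <= D p) ->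
  (forall p, A p + A (p.2, p.1) <= D p + 2%:E * (B p + B (p.2, p.1))) ->
  \int[mu \x mu]_p A p + \int[mu \x mu]_p A p <=
  \int[mu \x mu]_p D p + 2%:E * (\int[mu \x mu]_p B p + \int[mu \x mu]_p B p).
Proof.
move=> mA mB mD A0 B0 D0 le.
have msw F : measurable_fun setT F -> measurable_fun setT (fun p : T * T => F (p.2, p.1)).
  by move=> mF; exact: (measurableT_comp mF (measurable_fun_pair measurable_snd measurable_fst)).
rewrite -{2}(ge0_integral_prod_swap mA A0) -{2}(ge0_integral_prod_swap mB B0).
have mA' := msw _ mA; have mB' := msw _ mB.
have mAA := emeasurable_funD mA mA'; have mBB := emeasurable_funD mB mB'.
have m2 : measurable_fun setT (fun p => 2%:E * (B p + B (p.2, p.1))) by exact: emeasurable_funM.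
have p2 p : 0 <= 2%:E * (B p + B (p.2, p.1)) by rewrite mule_ge0// adde_ge0.
rewrite -ge0_integralD// -ge0_integralD// -ge0_integralZl//; last first.
  by move=> p _; rewrite adde_ge0.
rewrite -ge0_integralD//; apply: ge0_le_integral => //.
- by move=> p _; rewrite adde_ge0.
- exact: emeasurable_funD mD m2.
Qed.

Lemma measurable_row (f : T -> R) F : measurable_fun setT F -> (forall p, 0 <= F p) ->
  (forall x, \int[mu]_y F (x, y) = (f x)%:E) -> measurable_fun setT f.
Proof.
move=> mF F0 FE; have := @measurable_fun_fubini_tonelli_F _ _ _ _ _ mu F mF F0.
have -> : fubini_F mu F = EFin \o f by apply/funext => x; exact: FE.
by move/measurable_EFinP.
Qed.

End DoubleIntegrals.

Section WeakLogSobolev.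
Context {R : realType} {n : nat}.
Notation S := (sphere R n.+1).
Notation dw := (@surface R n.+1).
Notation I f := (Rintegral dw setT f).
Notation a := (n.+1%:R / 2 : R).
Notation sph := (fine (dw setT)).
Implicit Types (x y z w : S) (u : S -> R) (t : R).

Let a_gt0 : 0 < a. Proof. by rewrite divr_gt0. Qed.

Definition lnp t : R := ln (Num.max 1 t).

Lemma lnp_ge0 t : 0 <= lnp t. Proof. by rewrite ln_ge0// le_max lexx. Qed.

Lemma measurable_lnp : @measurable_fun _ _ (measurableTypeR R) (measurableTypeR R) setT lnp.
Proof.
apply: (@measurableT_comp _ _ _ _ _ _ (@ln R)); first exact: measurable_ln.
exact: measurable_maxr.
Qed.

Section truncated_kernel.
Variable u : S -> R.
Hypothesis hu : sqi dw u.

(* The Riesz kernel truncated at a scale depending on the value of u at x: it is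
   square integrable in the second variable with a bound that absorbs |u x|, and
   its integral is of the order of ln |u x|. *)
Let m x := Num.max 1 `|u x|.
(** The exponent makes $(1-th)^{-a}=m^2$, so by [I_powqd_full] the norm of $k(x,\cdot)$ in $L^2$ is
    a multiple of $m$; and $-\ln(1-th)=\frac{2}{n+1}\ln m^2$. *)
Let th x := 1 - m x `^ (- (4 / n.+1%:R)).
Let k x y := 2 ^- n.+1 * (1 - th x * qd x y) `^ (- a).

Let m_ge1 x : 1 <= m x. Proof. by rewrite le_max lexx. Qed.
Let m_gt0 x : 0 < m x. Proof. by rewrite (lt_le_trans _ (m_ge1 x)). Qed.

Let th01 x : 0 <= th x < 1.
Proof.
rewrite /th subr_ge0 gtrBl powR_gt0// andbT powRN invf_le1 ?powR_gt0//.
have p1 : 1 `^ (4 / n.+1%:R) = 1 :> R by rewrite powR1.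
by rewrite -[leLHS]p1 ge0_ler_powR// nnegrE ltW.
Qed.

Let mth : measurable_fun setT th.
Proof.
apply: measurable_funB => //; apply: (measurableT_comp (measurable_powR _)).
apply: measurable_maxr => //; apply: measurableT_comp => //; by case: hu.
Qed.

Let mk : measurable_fun setT (fun p : S * S => k p.1 p.2).
Proof.
apply: measurable_funM => //; apply: (measurableT_comp (measurable_powR _)).
apply: measurable_funB => //; apply: measurable_funM.
  exact: (measurableT_comp mth measurable_fst).
by case: (@bmeas_qd2 R n).
Qed.

Let k_ge0 x y : 0 <= k x y.
Proof. by rewrite mulr_ge0 ?invr_ge0 ?exprn_ge0 ?powR_ge0. Qed.

Let bk x : bmeas (k x).
Proof. by apply: bmeasZ; apply: bmeas_powqd; [exact: ltW|exact: th01]. Qed.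

Let k_le x y : qd x y < 1 -> k x y <= riesz 1 x y.
Proof.
move=> q1; rewrite ler_wpM2l ?invr_ge0 ?exprn_ge0// !powRN.
have /andP[t0 t1] := th01 x.
have tq : th x * qd x y <= qd x y by rewrite ler_piMl ?qd_ge0// ltW.
have tq1 : th x * qd x y < 1 by exact: le_lt_trans q1.
rewrite lef_pV2 ?posrE ?powR_gt0 ?subr_gt0//.
by rewrite ge0_ler_powR ?(ltW a_gt0)// ?nnegrE ?subr_ge0 ?(ltW q1) ?(ltW tq1)// lerD2l lerN2.
Qed.

Let pointwise x y : u x ^+ 2 * k x y + u y ^+ 2 * k y x <=
  (u x - u y) ^+ 2 * riesz 1 x y + 2 * (`|u x| * `|u y| * k x y + `|u y| * `|u x| * k y x).
Proof.
have [q1|q1] := ltP (qd x y) 1; last first.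
  have -> : x = y by apply: qd_eq1; apply/eqP; rewrite eq_le qd_le1 q1.
  rewrite subrr expr0n/= mul0r add0r -!expr2 real_normK ?num_real//.
  by have := mulr_ge0 (sqr_ge0 (u y)) (k_ge0 y y); lra.
have k1 := k_le q1; have k2 : k y x <= riesz 1 x y by rewrite /riesz qdC k_le// qdC.
have k10 := k_ge0 x y; have k20 := k_ge0 y x.
have : (u x - u y) ^+ 2 = u x ^+ 2 - 2 * (u x * u y) + u y ^+ 2 by ring.
have : u x * u y <= `|u x| * `|u y| by rewrite -normrM ler_norm.
have := sqr_ge0 (u x); have := sqr_ge0 (u y); have := sqr_ge0 (u x - u y).
have : 0 <= `|u x| * `|u y| by rewrite mulr_ge0.
rewrite [`|u y| * _]mulrC.
move: (k x y) (k y x) (riesz 1 x y) (`|u x| * `|u y|) (u x * u y) k1 k2 k10 k20.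
move: ((u x - u y) ^+ 2) (u x ^+ 2) (u y ^+ 2) => D A B p q r c e pr qr p0 q0 c0 D0 B0 A0 ec DE.
(* The truncated kernel is not symmetric, but the larger of its two values still lies below the
   Riesz kernel and can stand in for it. *)
wlog pq : p q A B pr qr p0 q0 A0 B0 DE / p <= q.
  move=> h; have [pq|/ltW pq] := leP p q; first exact: h.
  by rewrite addrC [c * p + _]addrC; apply: h => //; rewrite DE; ring.
have h1 : D * q <= D * r by rewrite ler_wpM2l.
have h2 : A * p <= A * q by rewrite ler_wpM2l.
have h3 : e * q <= c * q by rewrite ler_wpM2r.
have h4 : 0 <= c * p by rewrite mulr_ge0.
have h5 : D * q = A * q - 2 * (e * q) + B * q by rewrite DE; ring.
lra.
Qed.

(** The integral of $k(x,\cdot)$ is explicit: by [sph_ell] its term $-\ell\ln(1-th)$ becomes the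
    logarithm of $u^2$ with coefficient $C_n$, and [gk] is bounded. *)
Let k_row x : u x ^+ 2 * (@Cn R n.+1 * lnp (u x ^+ 2)) <=
  2 * (u x ^+ 2 * I (k x)) + u x ^+ 2 * (4 / 2 ^+ n.+1 * sph * (a ^+ 2 * ell n)).
Proof.
have t01 := th01 x; have /andP[g0 g1] := gk_bound (n := n) t01.
have Ik : I (k x) = 2 ^- n.+1 * (sph * hk (n := n) (th x) x).
  rewrite /k IZ; last by apply: bmeas_intg; apply: bmeas_powqd; [exact: ltW|].
  by rewrite /hk [sph * _]mulrC divfK// gt_eqF// surface_gt0.
rewrite Ik hkE//.
have -> : ln (1 - th x) = - (2 / n.+1%:R * lnp (u x ^+ 2)).
  rewrite /th subKr powRN lnV ?posrE ?powR_gt0// ln_powR; congr -%R.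
  rewrite /m /lnp; have [u1|u1] := leP `|u x| 1.
    have u2 : u x ^+ 2 <= 1 by rewrite -real_normK ?num_real// expr_le1.
    by rewrite !(max_idPl _)// ln1 !mulr0.
  have u2 : 1 <= u x ^+ 2 by rewrite -real_normK ?num_real//; apply: exprn_ege1; exact: ltW.
  have -> : Num.max 1 (u x ^+ 2) = `|u x| ^+ 2 by rewrite real_normK ?num_real//; exact/max_idPr.
  by rewrite lnXn ?(lt_trans _ u1)// mulr2n; field; rewrite nat1r pnatr_eq0.
have c1 := sph_ell (R := R) (n := n).
have s0 : 0 <= 2 ^- n.+1 * sph by rewrite mulr_ge0 ?invr_ge0 ?exprn_ge0// ltW// surface_gt0.
have -> : 2 * (u x ^+ 2 * (2 ^- n.+1 * (sph * (1 - ell n * - (2 / n.+1%:R * lnp (u x ^+ 2)) - @gk R n (th x))))) =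
  u x ^+ 2 * (lnp (u x ^+ 2) * (2 / n.+1%:R * (2 / 2 ^+ n.+1 * sph * ell n)) + 2 * (2 ^- n.+1 * sph * (1 - @gk R n (th x)))).
  by ring.
rewrite c1.
have -> : 2 / n.+1%:R * (n.+1%:R / 2 * @Cn R n.+1) = @Cn R n.+1 by field; rewrite nat1r pnatr_eq0.
rewrite -mulrDr ler_wpM2l ?sqr_ge0// mulrC -addrA lerDl.
have -> : 4 / 2 ^+ n.+1 * sph * (a ^+ 2 * ell n) = 2 * (2 ^- n.+1 * sph * (2 * (a ^+ 2 * ell n))) by ring.
rewrite -mulrDr mulr_ge0// -mulrDr mulr_ge0//; lra.
Qed.

(** Cauchy-Schwarz: the norm of $k(x,\cdot)$ is a multiple of $m=\max(1,|u(x)|)$, so the product is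
    at most quadratic in $u(x)$. *)
Let k_cross x : I (fun y => u y ^+ 2) = 1 ->
  `|u x| * I (fun y => k x y * `|u y|) <= 2 ^- n.+1 * Num.sqrt sph * (1 + u x ^+ 2).
Proof.
move=> u1; have t01 := th01 x.
have hn : sqi dw (fun y => `|u y|).
  by apply: (sqi_le _ _ hu) => [|y]; [apply: measurableT_comp => //; case: hu|rewrite normr_id].
have cs := CS (bmeas_sqi dw (bk x)) hn.
have e1 : I (fun y => `|u y| ^+ 2) = 1.
  transitivity (I (fun y => u y ^+ 2)) => //.
    by apply: eq_I => y; rewrite real_normK// num_real.
have e2 : I (fun y => k x y ^+ 2) = (2 ^- n.+1) ^+ 2 * sph * m x ^+ 2.
  transitivity (I (fun y => (2 ^- n.+1) ^+ 2 * (1 - th x * qd x y) `^ (- n.+1%:R))).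
    apply: eq_I => y; rewrite exprMn; congr (_ * _).
    by rewrite -powR_mulrn ?powR_ge0// -powRrM; congr (_ `^ _); field.
  rewrite IZ; last by apply: bmeas_intg; exact: bmeas_powqd.
  rewrite I_powqd_full// mulrA; congr (_ * _).
  rewrite /th subKr -powRrM -powR_mulrn ?(ltW (m_gt0 x))//; congr (_ `^ _).
  by field; rewrite nat1r pnatr_eq0.
have h : I (fun y => k x y * `|u y|) <= 2 ^- n.+1 * Num.sqrt sph * m x.
  rewrite -(@ler_pXn2r _ 2)// ?nnegrE; last 2 first.
  - by apply: I_ge0 => y; rewrite mulr_ge0.
  - by rewrite !mulr_ge0 ?invr_ge0 ?exprn_ge0 ?sqrtr_ge0 ?(ltW (m_gt0 x)).
  by rewrite (le_trans cs)// e1 mulr1 e2 !exprMn sqr_sqrtr// ltW// surface_gt0.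
rewrite (le_trans (ler_wpM2l (normr_ge0 (u x)) h))// mulrCA ler_wpM2l//.
rewrite -(real_normK (num_real (u x))) /m; have u0 := normr_ge0 (u x).
have [_|_] := leP `|u x| 1; have := sqr_ge0 (`|u x| - 1); nra.
Qed.

Definition weak_const : R :=
  4 / 2 ^+ n.+1 * sph * (a ^+ 2 * ell n) + 4 * (2 ^- n.+1 * Num.sqrt sph * (sph + 1)).

(** Twice $\iint u(x)^2k(x,y)$ dominates the entropy up to a constant ([k_row]); by [pointwise] it
    is at most the energy plus cross terms, which [k_cross] bounds by a constant. *)
Lemma weak_log_sobolev : I (fun y => u y ^+ 2) = 1 ->
  (\int[dw]_x (@Cn R n.+1 * (u x ^+ 2 * lnp (u x ^+ 2)))%:E <= energy u + weak_const%:E)%E.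
Proof.
move=> u1; have [mu iu] := hu.
have mnu : measurable_fun setT (fun x => `|u x|) by exact: measurableT_comp.
pose A (p : S * S) : \bar R := (u p.1 ^+ 2 * k p.1 p.2)%:E.
pose B (p : S * S) : \bar R := (`|u p.1| * `|u p.2| * k p.1 p.2)%:E.
pose D (p : S * S) : \bar R := ((u p.1 - u p.2) ^+ 2 * riesz 1 p.1 p.2)%:E.
have A0 p : (0 <= A p)%E by rewrite lee_fin mulr_ge0 ?sqr_ge0.
have B0 p : (0 <= B p)%E by rewrite lee_fin; apply: mulr_ge0 => //; exact: mulr_ge0.
have D0 p : (0 <= D p)%E.
  by rewrite lee_fin mulr_ge0 ?sqr_ge0// mulr_ge0 ?invr_ge0 ?exprn_ge0 ?powR_ge0.
have mA : measurable_fun setT A.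
  apply/measurable_EFinP; apply: measurable_funM => //; apply: measurable_funX.
  exact: (measurableT_comp mu measurable_fst).
have mB : measurable_fun setT B.
  apply/measurable_EFinP; apply: measurable_funM => //; apply: measurable_funM.
    exact: (measurableT_comp mnu measurable_fst).
  exact: (measurableT_comp mnu measurable_snd).
have mR : measurable_fun setT (fun p : S * S => riesz 1 p.1 p.2).
  apply: measurable_funM => //; apply: (measurableT_comp (measurable_powR _)).
  by apply: measurable_funB => //; case: (@bmeas_qd2 R n).
have mD : measurable_fun setT D by exact: measurable_dform.
have key : (\int[dw \x dw]_p A p + \int[dw \x dw]_p A p <=
    energy u + 2%:E * (\int[dw \x dw]_p B p + \int[dw \x dw]_p B p))%E.
  rewrite energyE; apply: ge0_integral_prod_le mA mB mD A0 B0 D0 _ => p.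
  have pw := pointwise p.1 p.2.
  by rewrite -lee_fin 2!EFinD (EFinM 2) EFinD in pw.
have hk x : intg dw (k x) by exact: bmeas_intg (bk x).
have hku x : intg dw (fun y => k x y * `|u y|).
  by apply: intgM => //; apply: intg_norm; exact: sqi_intg.
have EA : (\int[dw \x dw]_p A p = \int[dw]_x (u x ^+ 2 * I (k x))%:E)%E.
  rewrite (ge0_integral_prod dw mA A0); apply: eq_integral => x _.
  by rewrite -(IZ _ (hk x)) IE//; exact: intgZ.
have EB : (\int[dw \x dw]_p B p = \int[dw]_x (`|u x| * I (fun y => k x y * `|u y|))%:E)%E.
  rewrite (ge0_integral_prod dw mB B0); apply: eq_integral => x _.
  rewrite -(IZ _ (hku x)) IE; last exact: intgZ.
  by apply: eq_integral => y _; rewrite /B; congr EFin; rewrite /=; ring.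
have hc : intg dw (fun x => 2 ^- n.+1 * Num.sqrt sph * (1 + u x ^+ 2)).
  by apply: intgZ; apply: intgD => //; exact: bmeas_intg (bmeas_cst 1).
have mIA : measurable_fun setT (fun x => u x ^+ 2 * I (k x)).
  apply: (measurable_row mA A0) => x; rewrite -IZ// IE//; exact: intgZ.
have mIB : measurable_fun setT (fun x => `|u x| * I (fun y => k x y * `|u y|)).
  apply: (measurable_row mB B0) => x; rewrite -IZ// IE; last exact: intgZ.
  by apply: eq_integral => y _; rewrite /B; congr EFin; rewrite /=; ring.
have IB0 x : 0 <= `|u x| * I (fun y => k x y * `|u y|).
  by rewrite mulr_ge0//; apply: I_ge0 => y; rewrite mulr_ge0.
have IA0 x : 0 <= u x ^+ 2 * I (k x) by rewrite mulr_ge0 ?sqr_ge0//; exact: I_ge0.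
have boundB : (\int[dw \x dw]_p B p <= (2 ^- n.+1 * Num.sqrt sph * (sph + 1))%:E)%E.
  rewrite EB; have -> : 2 ^- n.+1 * Num.sqrt sph * (sph + 1) = I (fun x => 2 ^- n.+1 * Num.sqrt sph * (1 + u x ^+ 2)).
    have h1 : intg dw (cst 1) := bmeas_intg dw (bmeas_cst 1).
    by rewrite IZ ?ID ?Icst ?mul1r ?u1//; exact: intgD.
  rewrite IE//; apply: ge0_le_integral => //.
  - by move=> x _; rewrite lee_fin.
  - exact/measurable_EFinP.
  - by apply/measurable_EFinP; exact: intg_measurable hc.
  - by move=> x _; rewrite lee_fin k_cross.
pose c1 : R := 4 / 2 ^+ n.+1 * sph * (a ^+ 2 * ell n).
have c10 : 0 <= c1.
  have S0 := surface_gt0 (R := R) n.+1; have L0 := ell_gt0 (R := R) n.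
  apply: mulr_ge0; last by apply: mulr_ge0; [exact: sqr_ge0|exact: ltW].
  by apply: mulr_ge0; [rewrite divr_ge0 ?exprn_ge0|exact: ltW].
apply: (@le_trans _ _ (\int[dw \x dw]_p A p + \int[dw \x dw]_p A p + c1%:E)%E).
  rewrite EA -ge0_integralD//; last 4 first.
  - by move=> x _; rewrite lee_fin.
  - exact/measurable_EFinP.
  - by move=> x _; rewrite lee_fin.
  - exact/measurable_EFinP.
  have hc1 : intg dw (fun x => c1 * u x ^+ 2) := intgZ c1 iu.
  have -> : c1%:E = (\int[dw]_x (c1 * u x ^+ 2)%:E)%E by rewrite -IE// IZ// u1 mulr1.
  rewrite -ge0_integralD//; last 4 first.
  - by move=> x _; rewrite -EFinD lee_fin addr_ge0.
  - by apply: emeasurable_funD; exact/measurable_EFinP.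
  - by move=> x _; rewrite lee_fin mulr_ge0 ?sqr_ge0.
  - by apply/measurable_EFinP; apply: measurable_funM => //; exact: measurable_funX.
  apply: ge0_le_integral => //.
  - move=> x _; rewrite lee_fin mulr_ge0 ?(ltW Cn_gt0)// mulr_ge0 ?sqr_ge0 ?lnp_ge0//.
  - apply/measurable_EFinP; apply: measurable_funM => //; apply: measurable_funM; first exact: measurable_funX.
    by apply: (measurableT_comp measurable_lnp); exact: measurable_funX.
  - apply: emeasurable_funD; first by apply: emeasurable_funD; exact/measurable_EFinP.
    by apply/measurable_EFinP; apply: measurable_funM => //; exact: measurable_funX.
  move=> x _; rewrite -!EFinD lee_fin mulrCA; apply: (le_trans (k_row x)).
  by rewrite -/c1 [_ * c1]mulrC mulr_natl mulr2n.
pose b : R := 2 ^- n.+1 * Num.sqrt sph * (sph + 1).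
have -> : weak_const = 4 * b + c1 by rewrite /weak_const -/c1 -/b [RHS]addrC.
clear EA EB; move: key boundB; rewrite -/b.
move: (\int[_]_p A p)%E (\int[_]_p B p)%E (energy u) => X Y E key Yb.
rewrite EFinD addeA leeD2r// (le_trans key)// leeD2l//.
have -> : (4 * b)%:E = (2%:E * (b%:E + b%:E))%E.
  by rewrite -EFinD -EFinM; congr EFin; ring.
by rewrite lee_pmul2l//; apply: leeD.
Qed.

End truncated_kernel.

End WeakLogSobolev.

(** * Conformal invariance *)

Section CommutatorLimit.
Context {R : realType}.
Implicit Types s r a e : R.

Lemma ln_lip s r m : 0 < m -> m <= s -> m <= r -> `|ln s - ln r| <= `|s - r| / m.
Proof.
wlog sr : s r / r <= s.
  move=> h m0 ms mr; have [rs|/ltW sr] := leP r s; first exact: h.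
  by rewrite distrC [`|s - r|]distrC; exact: h.
move=> m0 ms mr; have s0 := lt_le_trans m0 ms; have r0 := lt_le_trans m0 mr.
rewrite !ger0_norm ?subr_ge0 ?ler_ln ?posrE// -lnV ?posrE// -lnM ?posrE ?invr_gt0//.
have -> : s / r = 1 + (s - r) / r by field; rewrite gt_eqF.
rewrite (le_trans (le_ln1Dx _))//; first by rewrite (lt_le_trans (ltrN10 R))// divr_ge0 ?subr_ge0// ltW.
by rewrite ler_wpM2l ?subr_ge0// lef_pV2 ?posrE.
Qed.

Lemma powRN_lip a s r m : 0 <= a -> 0 < m -> m <= s -> m <= r ->
  `|s `^ (- a) - r `^ (- a)| <= m `^ (- a) * a * (`|s - r| / m).
Proof.
wlog sr : s r / s <= r.
  move=> h a0 m0 ms mr; have [rs|/ltW sr] := leP s r; first exact: h.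
  by rewrite distrC [`|s - r|]distrC; exact: h.
move=> a0 m0 ms mr; have s0 := lt_le_trans m0 ms; have r0 := lt_le_trans m0 mr.
have dec x y : 0 < x -> x <= y -> y `^ (- a) <= x `^ (- a).
  move=> x0 xy; have y0 := lt_le_trans x0 xy.
  rewrite !powRN lef_pV2 ?posrE ?powR_gt0//.
  by apply: ge0_ler_powR => //; rewrite nnegrE ltW.
rewrite ger0_norm ?subr_ge0 ?dec//.
have -> : r `^ (- a) = s `^ (- a) * expR (- (a * (ln r - ln s))).
  rewrite /powR !gt_eqF// -expRD; congr expR; ring.
rewrite -[X in X - _]mulr1 -mulrBr -mulrA ler_pM ?powR_ge0 ?dec//.
  by rewrite subr_ge0 -expR0 ler_expR oppr_le0 mulr_ge0// subr_ge0 ler_ln ?posrE.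
rewrite (@le_trans _ _ (a * (ln r - ln s)))//.
  by rewrite lerBlDr addrC -lerBlDr; have := expR_ge1Dx (- (a * (ln r - ln s))); lra.
by rewrite ler_wpM2l// (le_trans (ler_norm _))// distrC ln_lip// ltW.
Qed.

Lemma xlnx_sqrt (x : R) : 0 < x -> - (x * ln x) <= 2 * Num.sqrt x.
Proof.
move=> x0; have s0 : 0 < Num.sqrt x by rewrite sqrtr_gt0.
have xE : x = Num.sqrt x ^+ 2 by rewrite sqr_sqrtr// ltW.
move: s0 xE; move: (Num.sqrt x) => s s0 ->.
have h : - ln s <= s^-1.
  have s1 : -1 < s^-1 - 1 by rewrite ltrBrDr addNr invr_gt0.
  have := le_ln1Dx s1; rewrite addrC subrK lnV ?posrE//; lra.
rewrite lnXn// -mulr_natl.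
rewrite (_ : - _ = 2 * (s * (s * - ln s))); last by ring.
rewrite mulr1 -[X in _ <= X]mulr1 -mulrA !ler_wpM2l ?mulr_ge0 ?(ltW s0)//.
by rewrite (le_trans (ler_wpM2l (ltW s0) h))// divff ?gt_eqF.
Qed.

Variables (a l G k0 k1 c : R) (g : R -> R).
Hypotheses (a0 : 0 <= a) (l0 : 0 <= l) (k00 : 0 < k0) (c0 : 0 <= c).
Hypothesis gG : forall t, 0 <= t < 1 -> 0 <= g t <= G.
Hypothesis g_nd : forall t1 t2, 0 <= t1 -> t1 <= t2 -> t2 < 1 -> g t1 <= g t2.

(** A bounded monotone [g] has a left limit at 1; here this is a Cauchy property, obtained from an
    almost maximal value. *)
Let g_cauchy e : 0 < e -> exists2 t, 0 < t < 1 &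
  forall t1 t2, t <= t1 < 1 -> t <= t2 < 1 -> `|g t1 - g t2| <= e.
Proof.
move=> e0; pose E := [set g t | t in [set t | 0 <= t < 1]].
have hE : has_sup E.
  split; first by exists (g 0), 0 => //=; rewrite lexx ltr01.
  by exists G => _ [t t01 <-]; have /andP[] := gG t01.
have [_ [t /= /andP[t0 t1] <-] lt_g] := sup_adherent e0 hE.
exists ((t + 1) / 2) => [|t1' t2']; first by lra.
have up s : (t + 1) / 2 <= s < 1 -> g t <= g s <= sup E.
  move=> /andP[ts s1]; have ts' : t <= s by lra.
  rewrite g_nd//=; apply: ub_le_sup; first by case: hE.
  by exists s => //=; rewrite s1 (le_trans t0).
by move=> /up /andP[h1 h2] /up /andP[h3 h4]; rewrite ler_norml; lra.
Qed.

(** [P], [Q], [K] stand for the three powers, [Ld], [Lb], [Lr], [Lk] for the logarithms of $d$,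
    $1+d$, $r$, $\kappa$, and [G1], [G2] for values of [g]; [sd] is $\sqrt d$. The unbounded [Ld]
    occurs only with the factor $P-Q=O(d)$, and $d\,|\ln d|\le2\sqrt d$. *)
Let commutator_arith (W Z C1 L d sd e Ld Lb Lr Lk G2 G1 Q P K : R) :
  let D := Z * (1 + 2 * l + G) + 2 * (l * W) + 2 * l * (W * C1 + L * Z) in
  0 <= W -> 0 <= L -> 0 <= Z -> 0 <= C1 -> 0 <= d -> 0 <= G -> 0 <= e ->
  0 <= P <= W -> 0 <= Q <= W -> `|P - Q| <= Z * d -> `|Q - K| <= Z * d ->
  `|Lr - Lk| <= C1 * d -> `|Lk| <= L -> 0 <= Lb -> Lb <= d -> Ld <= 0 ->
  0 <= G1 <= G -> `|G2 - G1| <= e / 2 / (W + 1) -> 0 <= sd -> d <= sd ->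
  sd * (D + 1) <= e / 2 -> - (d * Ld) <= 2 * sd ->
  `|P * (1 - l * (Ld - Lb) - G1) - Q * (1 - l * (Ld + Lb - 2 * Lr) - G2) + 2 * l * (K * Lk)| <= e.
Proof.
move=> D W0 L0 Z0 Cm0 d0 G0 e0 P01 Q01 PQ QK lnr lnk lnb0 lnb lnd g1 gg sq0 dsq sqD xl.
have W10 : 0 < W + 1 by rewrite ltr_wpDl.
rewrite (_ : _ + _ = (P - Q) * (1 - l * Ld - G1) + Q * (G2 - G1)
  + l * Lb * (P + Q) - 2 * l * (Q * (Lr - Lk) + Lk * (Q - K))); last by ring.
have t1' : `|(P - Q) * (1 - l * Ld - G1)| <= Z * (1 + 2 * l + G) * sd.
  rewrite normrM.
  have : `|1 - l * Ld - G1| <= 1 - l * Ld + G.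
    have : 0 <= l * (- Ld) by rewrite mulr_ge0// oppr_ge0.
    by rewrite ler_norml mulrN; move: (l * Ld) => q; lra.
  move=> h; rewrite (le_trans (ler_pM _ _ PQ h))// -[X in X <= _]mulrA -[X in _ <= X]mulrA.
  apply: ler_wpM2l => //.
  have h1 : l * (- (d * Ld)) <= l * (2 * sd) by rewrite ler_wpM2l.
  have h2 : d * G <= sd * G by rewrite ler_wpM2r.
  rewrite (_ : d * _ = d + l * - (d * Ld) + d * G); last by ring.
  rewrite (_ : (1 + 2 * l + G) * sd = sd + l * (2 * sd) + sd * G); last by ring.
  by rewrite !lerD.
have t2 : `|Q * (G2 - G1)| <= e / 2.
  rewrite normrM ger0_norm; last by case/andP: Q01.
  rewrite (@le_trans _ _ ((W + 1) * (e / 2 / (W + 1))))//.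
    case/andP: Q01 => ? ?; rewrite ler_pM// (le_trans (y := W))//.
    by rewrite lerDl.
  by rewrite mulrC divfK ?gt_eqF.
have t3 : `|l * Lb * (P + Q)| <= 2 * (l * W) * sd.
  rewrite !normrM (ger0_norm l0) (ger0_norm lnb0) -[X in X <= _]mulrA.
  rewrite (_ : 2 * _ * sd = l * (2 * (W * sd))); last by ring.
  apply: ler_wpM2l => //.
  rewrite ger0_norm; last by case/andP: P01 Q01 => ? _ /andP[? _]; rewrite addr_ge0.
  case/andP: P01 Q01 => ? ? /andP[? ?].
  rewrite (_ : 2 * (W * sd) = sd * (W + W)); last by ring.
  by apply: ler_pM; rewrite ?addr_ge0 ?lerD// (le_trans lnb).
have t4 : `|2 * l * (Q * (Lr - Lk) + Lk * (Q - K))| <= 2 * l * (W * C1 + L * Z) * sd.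
  rewrite normrM ger0_norm; last by rewrite mulr_ge0.
  rewrite -mulrA ler_wpM2l ?mulr_ge0//.
  rewrite (le_trans (ler_normD _ _))// mulrDl lerD// normrM -mulrA ler_pM//.
  - by case/andP: Q01 => ? ?; rewrite ger0_norm.
  - by rewrite (le_trans lnr)// ler_wpM2l.
  - by rewrite (le_trans QK)// ler_wpM2l.
rewrite (le_trans (ler_normB _ _))//.
have := ler_normD ((P - Q) * (1 - l * Ld - G1) + Q * (G2 - G1)) (l * Lb * (P + Q)).
have := ler_normD ((P - Q) * (1 - l * Ld - G1)) (Q * (G2 - G1)).
have DE : sd * (D + 1) = Z * (1 + 2 * l + G) * sd + 2 * (l * W) * sd +
  2 * l * (W * C1 + L * Z) * sd + sd by rewrite /D; ring.
move: t1' t2 t3 t4 sqD; rewrite DE.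
move: (Z * _ * sd) (2 * (l * W) * sd) (2 * l * _ * sd) => q1 q2 q3.
by do 4!move: `|_|; move=> *; lra.
Qed.

(** [d] is the regularisation, [kp] the value $\kappa(x)$, and [r], [th] are the parameters of the
    boosted kernel ([boost_cap]). Both terms diverge like $-\ell\ln d$ with nearly equal prefactors;
    the surviving difference comes from $r^2$ in the second logarithm, with $r\to\kappa$. *)
Lemma commutator_limit e : 0 < e -> exists2 d0 : R, 0 < d0 <= 1 &
  forall d kp r th, 0 < d < d0 -> k0 <= kp <= k1 -> 0 < r ->
  r + d * (1 + d) / r = kp + 2 * c * d -> (kp + 2 * c * d) / 2 <= r ->
  th = 1 - d * (1 + d) / r ^+ 2 ->
  `|(kp * (1 + d)) `^ (- a) * (1 - l * ln (d / (1 + d)) - g (1 + d)^-1)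
    - r `^ (- a) * (1 - l * ln (d * (1 + d) / r ^+ 2) - g th)
    + 2 * l * (kp `^ (- a) * ln kp)| <= e.
Proof.
move=> e0; pose m : R := k0 / 2; have m0 : 0 < m by rewrite divr_gt0.
pose W : R := m `^ (- a); have W0 : 0 <= W by rewrite powR_ge0.
pose L : R := `|ln k0| + `|ln k1|; have L0 : 0 <= L by rewrite addr_ge0.
pose C : R := `|k1| + 2 * c + 2 / m.
have m20 : 0 <= 2 / m by rewrite divr_ge0// ltW.
have C0 : 0 <= C by rewrite !addr_ge0// mulr_ge0.
have G0 : 0 <= G by have := gG (_ : 0 <= 0 < 1); rewrite lexx ltr01 => /(_ isT); lra.
pose Z : R := W * a * (C / m).
have Cm0 : 0 <= C / m by rewrite divr_ge0// ltW.
have Z0 : 0 <= Z by rewrite /Z; apply: mulr_ge0 => //; exact: mulr_ge0.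
pose D : R := Z * (1 + 2 * l + G) + 2 * (l * W) + 2 * l * (W * (C / m) + L * Z).
have D0 : 0 <= D.
  by apply: addr_ge0; [apply: addr_ge0|]; repeat (apply: mulr_ge0 || apply: addr_ge0) => //.
have D10 : 0 < D + 1 by rewrite ltr_wpDl.
have W10 : 0 < W + 1 by rewrite ltr_wpDl.
have eW : 0 < e / 2 / (W + 1) by rewrite !divr_gt0.
have [t /andP[t0 t1] ht] := g_cauchy eW.
pose d1 : R := Num.min (1 - t) ((1 - t) * m ^+ 2 / 2).
pose d2 : R := Num.min d1 ((e / 2 / (D + 1)) ^+ 2).
have d20 : 0 < d2.
  by rewrite !lt_min subr_gt0 t1/= ?exprn_gt0 ?divr_gt0 ?mulr_gt0 ?subr_gt0 ?exprn_gt0.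
exists (Num.min 1 d2); first by rewrite lt_min ltr01 d20 ge_min lexx.
move=> d kp r th; rewrite !lt_min => /andP[d0 /and3P[d1' /andP[dt dm] dD]].
move=> /andP[k0k kk1] r0 hr r2 thE.
have kp0 : 0 < kp := lt_le_trans k00 k0k.
have cd0 : 0 <= 2 * c * d by rewrite !mulr_ge0// ltW.
have mr : m <= r by rewrite /m; lra.
have mk : m <= kp by rewrite /m; lra.
have b0 : 0 < 1 + d by lra.
have ms : m <= kp * (1 + d) by rewrite mulrDr mulr1 (le_trans mk)// lerDl mulr_ge0// ltW.
have s0 : 0 < kp * (1 + d) by rewrite mulr_gt0.
have br : (1 + d) / r <= 2 / m.
  by rewrite ler_pM ?invr_ge0 ?lef_pV2 ?posrE// ?ltW//; lra.
have br0 : 0 <= (1 + d) / r by rewrite divr_ge0// ltW.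
have kpd0 : 0 <= kp * d by rewrite mulr_ge0// ltW.
have k1k : kp <= `|k1| by rewrite (le_trans kk1)// ler_norm.
have dC (x y z : R) : 0 <= x <= `|k1| -> 0 <= y <= 2 * c -> 0 <= z <= 2 / m ->
    `|d * (x - y + z)| <= C * d.
  move=> x01 y01 z01; rewrite normrM gtr0_norm// mulrC ler_wpM2r ?(ltW d0)//.
  by rewrite /C ler_norml; move: (2 / m) x01 y01 z01 m20 => q; lra.
have rE : r = kp + 2 * c * d - d * ((1 + d) / r) by rewrite -hr; ring.
have c20 : 0 <= 2 * c <= 2 * c by rewrite lexx mulr_ge0.
have kr : `|r - kp| <= C * d.
  rewrite distrC rE (_ : kp - _ = d * (0 - 2 * c + (1 + d) / r)); last by ring.
  by apply: dC => //; [rewrite lexx normr_ge0|rewrite br br0].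
have sr : `|kp * (1 + d) - r| <= C * d.
  rewrite [X in _ - X]rE (_ : _ - _ = d * (kp - 2 * c + (1 + d) / r)); last by ring.
  by apply: dC => //; [rewrite k1k ltW|rewrite br br0].
have Q01 : 0 <= r `^ (- a) <= W.
  rewrite powR_ge0/= /W !powRN lef_pV2 ?posrE ?powR_gt0//.
  by apply: ge0_ler_powR => //; rewrite nnegrE ltW.
have P01 : 0 <= (kp * (1 + d)) `^ (- a) <= W.
  rewrite powR_ge0/= /W !powRN lef_pV2 ?posrE ?powR_gt0//.
  by apply: ge0_ler_powR => //; rewrite nnegrE ltW.
have lip x y : m <= x -> m <= y -> `|x - y| <= C * d ->
    `|x `^ (- a) - y `^ (- a)| <= Z * d.
  move=> mx my xy; rewrite (le_trans (powRN_lip a0 m0 mx my))// /Z -/W -mulrA.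
  rewrite -!mulrA; apply: ler_wpM2l => //; apply: ler_wpM2l => //.
  rewrite (_ : C * _ = C * d / m); last by ring.
  by rewrite ler_wpM2r// invr_ge0 ltW.
have PQ := lip _ _ ms mr sr; have QK := lip _ _ mr mk kr.
have lnr : `|ln r - ln kp| <= C / m * d.
  by rewrite (le_trans (ln_lip m0 mr mk))// mulrAC ler_wpM2r// invr_ge0 ltW.
have lnk : `|ln kp| <= L.
  have h1 : ln k0 <= ln kp by rewrite ler_ln ?posrE.
  have h2 : ln kp <= ln k1 by rewrite ler_ln ?posrE// (lt_le_trans kp0).
  rewrite /L ler_norml; have := ler_norm (ln k1); have := ler_norm (- ln k0).
  rewrite normrN; have := normr_ge0 (ln k0); have := normr_ge0 (ln k1); lra.
have lnb0 : 0 <= ln (1 + d) by rewrite ln_ge0//; lra.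
have lnb : ln (1 + d) <= d by apply: le_ln1Dx; lra.
have lnd : ln d <= 0 by rewrite ln_le0// ltW.
have bi : (1 + d)^-1 = 1 - d / (1 + d) by field; rewrite gt_eqF.
have db : 0 < d / (1 + d) <= d.
  by rewrite divr_gt0//= ler_pdivrMr// mulrDr mulr1 lerDl mulr_ge0// ltW.
have b01 : 0 <= (1 + d)^-1 < 1 by rewrite bi; move: (d / (1 + d)) db => q; lra.
have g1 : 0 <= g (1 + d)^-1 <= G by apply: gG.
have gg : `|g th - g (1 + d)^-1| <= e / 2 / (W + 1).
  apply: ht.
    have h1 : 0 < d * (1 + d) / r ^+ 2 by rewrite !(divr_gt0, mulr_gt0, exprn_gt0).
    have h2 : d * (1 + d) / r ^+ 2 <= 1 - t.
      rewrite ler_pdivrMr ?exprn_gt0//.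
      have : (1 - t) * m ^+ 2 <= (1 - t) * r ^+ 2.
        apply: ler_wpM2l; first by rewrite subr_ge0 ltW.
        by rewrite lerXn2r ?nnegrE// ltW.
      have : d * (1 + d) <= d * 2 by rewrite ler_wpM2l ?(ltW d0)//; lra.
      by move: dm; move: ((1 - t) * m ^+ 2) ((1 - t) * r ^+ 2) (d * (1 + d)) => q1 q2 q3; lra.
    by move: h1 h2; rewrite thE; move: (_ / r ^+ 2) => q; lra.
  by rewrite bi; move: (d / (1 + d)) db => q; lra.
have sq0 : 0 <= Num.sqrt d by rewrite sqrtr_ge0.
have dsq : d <= Num.sqrt d.
  rewrite -[X in X <= _](sqr_sqrtr (ltW d0)) expr2 ler_piMl//.
  by rewrite -(@sqrtr1 R) ler_wsqrtr// ltW.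
have sqD : Num.sqrt d * (D + 1) <= e / 2.
  have eD : 0 <= e / 2 / (D + 1) by rewrite !divr_ge0// ltW.
  rewrite -ler_pdivlMr// -[X in _ <= X](ger0_norm eD) -sqrtr_sqr.
  by rewrite ler_wsqrtr//; exact: ltW.
have xl := xlnx_sqrt d0.
have lnq : ln (d / (1 + d)) = ln d - ln (1 + d) by rewrite ln_div ?posrE.
have lnr2 : ln (d * (1 + d) / r ^+ 2) = ln d + ln (1 + d) - 2 * ln r.
  by rewrite ln_div ?posrE ?mulr_gt0 ?exprn_gt0// lnM ?posrE// lnXn// mulr_natl.
rewrite lnq lnr2.
move: (ln d) (ln (1 + d)) (ln r) (ln kp) (g th) (g (1 + d)^-1)
  (r `^ (- a)) ((kp * (1 + d)) `^ (- a)) (kp `^ (- a)) (Num.sqrt d)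
  P01 Q01 PQ QK lnr lnk lnb0 lnb lnd g1 gg sq0 dsq sqD xl =>
  Ld Lb Lr Lk G2 G1 Q P K sd P01 Q01 PQ QK lnr lnk lnb0 lnb lnd g1 gg sq0 dsq sqD xl.
apply: (@commutator_arith W Z (C / m) L d sd) => //; exact: ltW.
Qed.

End CommutatorLimit.

(** * Conformal geometry of the boosts *)

Section BoostGeometry.
Context {R : realType} {n : nat} (v : R).
Hypothesis v1 : `|v| < 1.
Notation S := (sphere R n.+1).
Notation dw := (@surface R n.+1).
Notation I f := (Rintegral dw setT f).
Notation a := (n.+1%:R / 2 : R).
Notation sph := (fine (dw setT)).
Notation gam := ((Num.sqrt (1 - v ^+ 2))^-1).
Notation Phi := (@sboost R n.+1 v).
Notation kap := (@kappa R n.+1 v).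
Implicit Types (x y w : S).

Let g0 : 0 < gam. Proof. exact: gamma_gt0. Qed.

Lemma kappa_crd0 w : kap w * crd (Phi w) ord0 = gam * (crd w ord0 + v).
Proof.
rewrite crd_sboost0// kappaE; have := kappa_gt0 v1 w; rewrite kappaE pmulr_rgt0// => k0.
by rewrite -mulrA; congr (_ * _); rewrite mulrC divfK ?gt_eqF.
Qed.

Lemma kappa_crdS w (i : 'I_n.+1) :
  kap w * crd (Phi w) (lift ord0 i) = crd w (lift ord0 i).
Proof. by rewrite crd_sboostS// mulrC divfK// gt_eqF// kappa_gt0. Qed.

Lemma cosd_recl x y : cosd x y =
  crd x ord0 * crd y ord0 + \sum_(i < n.+1) crd x (lift ord0 i) * crd y (lift ord0 i).
Proof. by rewrite /cosd /dotp big_ord_recl. Qed.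

(** $1-q(x,y)$ is half the Minkowski product of the light-like vectors $(1,x)$ and $(1,y)$. The
    boost preserves the product, and dividing by $\kappa$ brings the images back to time component
    1. *)
Lemma qd_sboost x y : 1 - qd (Phi x) (Phi y) = (1 - qd x y) / (kap x * kap y).
Proof.
have kx := kappa_gt0 v1 x; have ky := kappa_gt0 v1 y.
have kxy : kap x * kap y != 0 by rewrite mulf_neq0// gt_eqF.
apply: (mulIf kxy); rewrite divfK// /qd !cosd_recl.
have -> : \sum_(i < n.+1) crd x (lift ord0 i) * crd y (lift ord0 i) = (kap x * kap y) *
    \sum_(i < n.+1) crd (Phi x) (lift ord0 i) * crd (Phi y) (lift ord0 i).
  by rewrite mulr_sumr; apply: eq_bigr => i _; rewrite -(kappa_crdS x) -(kappa_crdS y); ring.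
move: (\sum_(i < _) _) => s.
have e1 := kappa_crd0 x; have e2 := kappa_crd0 y.
have e3 : kap x * kap y - kap x * crd (Phi x) ord0 * (kap y * crd (Phi y) ord0) =
    1 - crd x ord0 * crd y ord0.
  transitivity (gam ^+ 2 * (1 - v ^+ 2) * (1 - crd x ord0 * crd y ord0)).
    by rewrite e1 e2 !kappaE; ring.
  by rewrite (sqr_gamma v1) mul1r.
have : (1 - (1 + (crd (Phi x) ord0 * crd (Phi y) ord0 + s)) / 2) * (kap x * kap y) =
  (kap x * kap y - kap x * crd (Phi x) ord0 * (kap y * crd (Phi y) ord0) - kap x * kap y * s) / 2.
  by field.
by rewrite e3 => ->; field.
Qed.

Lemma enorm_eq0_tnth m (z : m.-tuple R) : enorm z = 0 -> forall i, tnth z i = 0.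
Proof.
move=> z0 i; have := sqr_enorm z; rewrite z0 expr0n/= => /esym /eqP.
rewrite /dotp psumr_eq0 => [/allP/(_ i)|j _]; last by rewrite -expr2 sqr_ge0.
by rewrite mem_index_enum => /(_ isT)/=; rewrite -expr2 sqrf_eq0 => /eqP.
Qed.

Lemma exists_direction (z : n.+2.-tuple R) :
  exists eta : S, forall w, dotp z (val w) = enorm z * cosd eta w.
Proof.
exists (sphere_proj z) => w; have [z0|z0] := eqVneq (enorm z) 0.
  by rewrite z0 mul0r /dotp big1// => i _; rewrite (enorm_eq0_tnth z0) mul0r.
rewrite /cosd val_sphere_proj// /dotp mulr_sumr; apply: eq_bigr => i _.
by rewrite tnth_mktuple -mulrA mulVKf.
Qed.

Lemma boost_cap (dl : R) x : 0 < dl -> exists r th (eta : S), [/\ 0 < r,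
  r + dl * (1 + dl) / r = kap x + 2 * gam * dl,
  (kap x + 2 * gam * dl) / 2 <= r,
  th = 1 - dl * (1 + dl) / r ^+ 2 /\ 0 <= th < 1 &
  forall y, (1 + dl) - qd x y = kap y * r * (1 - th * qd eta (Phi y))].
Proof.
move=> d0; pose X : R := 1 + 2 * dl.
pose z := tcons (gam * (crd x ord0 + v * X), [tuple crd x (lift ord0 i) | i < n.+1]).
have [eta etaE] := exists_direction z.
pose N := enorm z; pose Y0 := kap x + 2 * gam * dl.
have kx := kappa_gt0 v1 x.
have Y0gt : 0 < Y0 by rewrite addr_gt0// !mulr_gt0.
have N0 : 0 <= N by exact: sqrtr_ge0.
have x1 := cosdxx x.
have N2 : N ^+ 2 = Y0 ^+ 2 - 4 * dl * (1 + dl).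
  rewrite /N sqr_enorm /dotp big_ord_recl !tnth_tcons0.
  rewrite (eq_bigr (fun i => crd x (lift ord0 i) * crd x (lift ord0 i))) => [|i _]; last first.
    by rewrite tnth_tconsS tnth_mktuple.
  move: x1; rewrite cosd_recl; move: (\sum_(i < _) _) => s x1.
  have -> : s = 1 - crd x ord0 ^+ 2 by rewrite -x1; ring.
  rewrite /Y0 kappaE.
  have -> : 1 - crd x ord0 ^+ 2 = gam ^+ 2 * (1 - v ^+ 2) * (1 - crd x ord0 ^+ 2).
    by rewrite (sqr_gamma v1) mul1r.
  have -> : 4 * dl * (1 + dl) = gam ^+ 2 * (1 - v ^+ 2) * (4 * dl * (1 + dl)).
    by rewrite (sqr_gamma v1) mul1r.
  rewrite /X; ring.
have db0 : 0 < dl * (1 + dl) by rewrite mulr_gt0// addr_gt0.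
pose r := (Y0 + N) / 2.
have r0 : 0 < r by rewrite divr_gt0// ltr_wpDr.
have rm : dl * (1 + dl) / r = (Y0 - N) / 2.
  apply: (@mulIf _ r); first by rewrite gt_eqF.
  rewrite divfK ?gt_eqF// /r.
  have -> : (Y0 - N) / 2 * ((Y0 + N) / 2) = (Y0 ^+ 2 - N ^+ 2) / 4 by field.
  by rewrite N2; field.
have thr : (1 - dl * (1 + dl) / r ^+ 2) * r = N.
  rewrite (_ : _ * r = r - dl * (1 + dl) / r); last by field; rewrite gt_eqF.
  by rewrite rm /r; field.
exists r, (1 - dl * (1 + dl) / r ^+ 2), eta; split => //.
- have gen (p q : R) : (p + q) / 2 + (p - q) / 2 = p by field.
  by rewrite rm gen.
- by rewrite -/Y0 /r ler_pM2r ?invr_gt0// lerDl.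
- split => //; apply/andP; split; last by rewrite gtrBl divr_gt0// exprn_gt0.
  by rewrite -(pmulr_lge0 _ r0) thr.
move=> y; have ky := kappa_gt0 v1 y.
have -> : kap y * r * (1 - (1 - dl * (1 + dl) / r ^+ 2) * qd eta (Phi y)) =
  kap y * (r - (1 - dl * (1 + dl) / r ^+ 2) * r * qd eta (Phi y)) by ring.
rewrite thr /qd.
have -> : kap y * (r - N * ((1 + cosd eta (Phi y)) / 2)) =
  (kap y * Y0 - kap y * (N * cosd eta (Phi y))) / 2 by rewrite /r; field.
have -> : kap y * (N * cosd eta (Phi y)) = gam * (crd x ord0 + v * X) * (gam * (crd y ord0 + v)) +
    \sum_(i < n.+1) crd x (lift ord0 i) * crd y (lift ord0 i).
  rewrite /N -etaE /dotp big_ord_recl tnth_tcons0 -/(crd (Phi y) ord0) mulrDr.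
  rewrite [X in X + _]mulrCA kappa_crd0; congr (_ + _); rewrite mulr_sumr; apply: eq_bigr => i _.
  by rewrite tnth_tconsS tnth_mktuple mulrCA -/(crd (Phi y) _) kappa_crdS.
rewrite cosd_recl.
move: (\sum_(i < _) _) => s; rewrite /Y0 !kappaE.
have h := sqr_gamma v1.
have -> : gam * (1 + v * crd y ord0) * (gam * (1 + v * crd x ord0) + 2 * gam * dl) -
  (gam * (crd x ord0 + v * X) * (gam * (crd y ord0 + v)) + s) =
  gam ^+ 2 * (1 - v ^+ 2) * (1 + 2 * dl - crd x ord0 * crd y ord0) - s by rewrite /X; ring.
by rewrite h; field.
Qed.

Lemma kappa_bounds : exists k0 k1 : R, 0 < k0 /\ forall w, k0 <= kap w <= k1.
Proof.
exists (gam * (1 - `|v|)), (gam * (1 + `|v|)); split; first by rewrite mulr_gt0// subr_gt0.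
move=> w; rewrite kappaE !ler_pM2l//.
have : `|v * crd w ord0| <= `|v| by rewrite normrM ler_piMr// norm_crd.
by rewrite ler_norml => /andP[h1 h2]; rewrite !lerD2l h2 andbT.
Qed.

Lemma bmeas_kappa_powR s : bmeas (fun w => kap w `^ s).
Proof.
split; first by apply: (measurableT_comp (measurable_powR _)); exact: measurable_kappa.
have [k0 [k1 [k00 h]]] := kappa_bounds.
have sE t : t `^ s = (t `^ (- s))^-1 by rewrite -powRN opprK.
exists (k0 `^ s + k1 `^ s) => w; have /andP[h1 h2] := h w.
rewrite ger0_norm ?powR_ge0//; have kw := kappa_gt0 v1 w.
have [s0|s0] := leP 0 s.
  rewrite (@le_trans _ _ (k1 `^ s)) ?lerDr ?powR_ge0//.
  by apply: ge0_ler_powR; rewrite ?nnegrE ?(ltW kw)// (le_trans (ltW kw)).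
rewrite (@le_trans _ _ (k0 `^ s)) ?lerDl ?powR_ge0//.
rewrite (sE (kap w)) (sE k0) lef_pV2 ?posrE ?powR_gt0//.
by apply: ge0_ler_powR => //; rewrite ?nnegrE ?oppr_ge0 ltW.
Qed.

Lemma bmeas_ln_kappa : bmeas (fun w => ln (kap w)).
Proof.
split; first by apply: (measurableT_comp (@measurable_ln R)); exact: measurable_kappa.
have [k0 [k1 [k00 h]]] := kappa_bounds.
exists (`|ln k0| + `|ln k1|) => w; have /andP[h1 h2] := h w.
have kw := kappa_gt0 v1 w.
have e1 : ln k0 <= ln (kap w) by rewrite ler_ln ?posrE.
have e2 : ln (kap w) <= ln k1 by rewrite ler_ln ?posrE// (lt_le_trans kw).
rewrite ler_norml (le_trans e2) ?andbT; last first.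
  by rewrite (le_trans (ler_norm _))// lerDr.
by rewrite (le_trans _ e1)// lerNl (le_trans _ (_ : `|ln k0| <= _)) ?lerDl// -normrN ler_norm.
Qed.

End BoostGeometry.

(** * Transformation of the energy under boosts *)

Section ConformalEnergy.
Context {R : realType} {n : nat} (v : R).
Hypothesis v1 : `|v| < 1.
Notation S := (sphere R n.+1).
Notation dw := (@surface R n.+1).
Notation I f := (Rintegral dw setT f).
Notation a := (n.+1%:R / 2 : R).
Notation sph := (fine (dw setT)).
Notation gam := ((Num.sqrt (1 - v ^+ 2))^-1).
Notation Phi := (@sboost R n.+1 v).
Notation kap := (@kappa R n.+1 v).
Implicit Types (x y w : S) (u : S -> R).

Let a0 : 0 < a. Proof. by rewrite divr_gt0. Qed.

(** The square root of the Jacobian ([sqr_cfactor]), so that [ctrans] preserves the $L^2$ norm. *)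
Definition cfactor w : R := kap w `^ (- a).

Definition ctrans u w : R := cfactor w * u (Phi w).

Lemma cfactor_gt0 w : 0 < cfactor w.
Proof. by rewrite powR_gt0 ?kappa_gt0. Qed.

Lemma sqr_cfactor w : cfactor w ^+ 2 = kap w ^- n.+1.
Proof.
have k0 := kappa_gt0 v1 w.
rewrite -powR_mulrn ?powR_ge0// -powRrM -[RHS]powR_inv1 ?exprn_ge0 ?ltW//.
rewrite -powR_mulrn ?ltW// -powRrM; congr (_ `^ _); rewrite mulrN1 mulNr divfK//.
Qed.

Lemma bmeas_cfactor : bmeas cfactor.
Proof. exact: bmeas_kappa_powR. Qed.

Lemma intg_sboost f : intg dw f -> intg dw (fun w => f (Phi w) * cfactor w ^+ 2).
Proof.
move=> hf; have mf := intg_measurable hf.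
have mfk : measurable_fun setT (fun w => f (Phi w) * cfactor w ^+ 2).
  apply: measurable_funM; first exact: (measurableT_comp mf (measurable_sboost _)).
  by apply: measurable_funX; exact: (proj1 bmeas_cfactor).
apply/integrableP; split; first exact/measurable_EFinP.
case/integrableP: hf => mf' ; apply: le_lt_trans.
have mf2 : measurable_fun setT (fun w => `|(f w)%:E|%E) by exact: measurableT_comp.
rewrite -(ge0_integral_sboost v1 mf2)// le_eqVlt; apply/orP; left; apply/eqP.
apply: eq_integral => w _; rewrite -sqr_cfactor/=; congr EFin.
by rewrite normrM (ger0_norm (sqr_ge0 _)).
Qed.

Lemma I_sboost (f : S -> R) : measurable_fun setT f -> I (fun w => f (Phi w) * cfactor w ^+ 2) = I f.
Proof.
move=> mf; congr fine.
have := integral_sboost v1 (_ : measurable_fun setT (EFin \o f)).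
move=> <-; last exact/measurable_EFinP.
by apply: eq_integral => w _; rewrite sqr_cfactor.
Qed.

Lemma intg_comp_sboost f : intg dw f -> intg dw (fun w => f (Phi w)).
Proof.
move=> hf; have := intgM (bmeas_kappa_powR v1 n.+1%:R) (intg_sboost hf).
apply: eq_integrable => // w _ /=; congr EFin.
have k0 := kappa_gt0 v1 w.
by rewrite sqr_cfactor powR_mulrn ?ltW// mulrCA divff ?mulr1// gt_eqF// exprn_gt0.
Qed.

Lemma sqi_comp_sboost u : sqi dw u -> sqi dw (fun w => u (Phi w)).
Proof.
move=> [mu hu]; split; first exact: (measurableT_comp mu (measurable_sboost _)).
exact: (intg_comp_sboost hu).
Qed.

Lemma sqi_ctrans u : sqi dw u -> sqi dw (ctrans u).
Proof. by move=> hu; apply: sqi_bmeasM; [exact: bmeas_cfactor|exact: sqi_comp_sboost]. Qed.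

Lemma I_sqr_ctrans u : measurable_fun setT u ->
  I (fun w => ctrans u w ^+ 2) = I (fun w => u w ^+ 2).
Proof.
move=> mu; rewrite -(I_sboost (f := fun w => u w ^+ 2)); last exact: measurable_funX.
by apply: eq_I => w; rewrite /ctrans exprMn mulrC.
Qed.

Lemma mul_sph_hk t x : sph * hk t x = I (fun w => (1 - t * qd x w) `^ (- a)).
Proof. by rewrite /hk mulrC divfK ?gt_eqF ?surface_gt0. Qed.

Lemma I_riesz b x : 1 < b ->
  I (riesz b x) = 2 ^- n.+1 * (b `^ (- a) * (sph * hk b^-1 x)).
Proof.
move=> b1; have b0 : 0 < b by rewrite (lt_trans _ b1).
have t01 : 0 <= b^-1 < 1 by rewrite invr_ge0 ltW//= invf_lt1.
have hb := bmeas_intg dw (@bmeas_powqd R n a b^-1 x (ltW a0) t01).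
rewrite mul_sph_hk -IZ// -IZ; last exact: intgZ.
apply: eq_I => y; rewrite /riesz; congr (_ * _).
have q1 := qd_le1 x y.
rewrite -powRM ?(ltW b0)//; first by congr (_ `^ _); field; rewrite gt_eqF.
by rewrite subr_ge0 ler_pdivrMl// mulr1 (le_trans q1)// ltW.
Qed.

Lemma I_riesz_cfactor (dl r th : R) x (eta : S) : 0 < dl -> 0 < r -> 0 <= th < 1 ->
  (forall y, (1 + dl) - qd x y = kap y * r * (1 - th * qd eta (Phi y))) ->
  I (fun y => riesz (1 + dl) x y * cfactor y) = 2 ^- n.+1 * (r `^ (- a) * (sph * hk th eta)).
Proof.
move=> d0 r0 th01 hq.
have hb := @bmeas_powqd R n a th eta (ltW a0) th01.
have hi := intg_sboost (bmeas_intg dw hb).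
rewrite mul_sph_hk -(I_sboost (proj1 hb)).
rewrite -IZ// -IZ; last exact: intgZ.
apply: eq_I => y; rewrite /riesz hq -[LHS]mulrA; congr (_ * _).
have k0 := kappa_gt0 v1 y; have q1 := qd_le1 eta (Phi y); have q0 := qd_ge0 eta (Phi y).
have h1 : 0 <= 1 - th * qd eta (Phi y).
  case/andP: th01 => t0 t1; rewrite subr_ge0 (le_trans _ (ltW t1))// ler_piMr//.
have kr0 : 0 <= kap y * r by apply: mulr_ge0; exact: ltW.
rewrite powRM// powRM ?(ltW k0) ?(ltW r0)// /cfactor.
by do 3!move: (_ `^ _) => ?; ring.
Qed.

(* The defect of invariance of the form of the regularised kernel, which diverges
   termwise but has a logarithmic limit. *)
Definition commutator (dl : R) x : R := cfactor x * I (riesz (1 + dl) x) -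
  I (fun y => riesz (1 + dl) x y * cfactor y).

Definition lnfactor w : R := - n.+1%:R * ln (kap w).

Lemma commutator_cvg e : 0 < e -> exists2 d0 : R, 0 < d0 & forall dl, 0 < dl < d0 ->
  forall x, `|commutator dl x - @Cn R n.+1 / 2 * (cfactor x * lnfactor x)| <= e.
Proof.
move=> e0; have [k0 [k1 [k00 kb]]] := kappa_bounds (n := n) v1.
pose c0 : R := 2 ^- n.+1 * sph.
have c00 : 0 < c0 by rewrite mulr_gt0 ?surface_gt0// invr_gt0 exprn_gt0.
have [d0 /andP[d00 _] hd] := @commutator_limit R a (ell n) (2 * (a ^+ 2 * ell n)) k0 k1 gam
  (@gk R n) (ltW a0) (ltW (ell_gt0 n)) k00 (ltW (gamma_gt0 v1)) (@gk_bound R n) (@gk_nd R n)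
  _ (divr_gt0 e0 c00).
exists d0 => // dl dl0 x; have dlg : 0 < dl by case/andP: dl0.
have [r [th [eta [r0 rE r2 [thE th01] hq]]]] := boost_cap v1 x dlg.
have b1 : 1 < 1 + dl by rewrite ltrDl.
have b0 : 0 < 1 + dl by rewrite (lt_trans _ b1).
have t01 : 0 <= (1 + dl)^-1 < 1 by rewrite invr_ge0 ltW//= invf_lt1.
rewrite /commutator I_riesz// (I_riesz_cfactor dlg r0 th01 hq) !hkE//.
have -> : 1 - (1 + dl)^-1 = dl / (1 + dl) by field; rewrite gt_eqF.
have -> : 1 - th = dl * (1 + dl) / r ^+ 2 by rewrite thE; ring.
have kx := kappa_gt0 v1 x.
have -> : @Cn R n.+1 / 2 * (cfactor x * lnfactor x) =
    - (c0 * (2 * ell n * (kap x `^ (- a) * ln (kap x)))).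
  rewrite /cfactor /lnfactor.
  have -> : c0 * (2 * ell n * (kap x `^ (- a) * ln (kap x))) =
    (2 / 2 ^+ n.+1 * sph * ell n) * (kap x `^ (- a) * ln (kap x)) by rewrite /c0; ring.
  by rewrite sph_ell; field.
have := hd dl (kap x) r th dl0 (kb x) r0 rE r2 thE.
rewrite powRM ?(ltW kx) ?(ltW b0)// ler_pdivlMr// mulrC -[c0 in X in X -> _]gtr0_norm// -normrM.
congr (is_true (`|_| <= e)); rewrite /c0 /cfactor.
move: (ln _) (ln _) (ln _) (gk th) (gk _) (2 ^- _) sph => ? ? ? ? ? ? ?.
by do 3!move: (_ `^ _) => ?; ring.
Qed.

Lemma bmeas_lnfactor : bmeas lnfactor.
Proof. by apply: bmeasZ; exact: bmeas_ln_kappa. Qed.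

Lemma bmeas_commutator dl : 0 < dl -> bmeas (commutator dl).
Proof.
move=> d0; have b1 : 1 < 1 + dl by rewrite ltrDl.
apply: bmeasB; last by apply: bmeas_kernel; [exact: bmeas2_riesz|exact/bmeas_intg/bmeas_cfactor].
apply: bmeasM; first exact: bmeas_cfactor.
have := bmeas_kernel (bmeas2_riesz b1) (bmeas_intg dw (bmeas_cst 1)); congr bmeas.
by apply/funext => x; apply: eq_I => y; rewrite mulr1.
Qed.

Lemma riesz_ge0 b x y : 0 <= @riesz R n b x y.
Proof. by rewrite mulr_ge0 ?invr_ge0 ?exprn_ge0 ?powR_ge0. Qed.

Lemma rieszC b x y : @riesz R n b x y = riesz b y x.
Proof. by rewrite /riesz qdC. Qed.

(** For [b = 1] this is the Riesz kernel transported by the boost, Jacobians included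
    ([riesz1_sboost]). *)
Definition wriesz b x y : R := cfactor x * cfactor y * riesz b x y.

Lemma wriesz_ge0 b x y : 0 <= wriesz b x y.
Proof. by rewrite mulr_ge0 ?riesz_ge0// mulr_ge0 ?ltW ?cfactor_gt0. Qed.

(** When the squares are expanded the cross terms of the two forms coincide, and the diagonal terms
    differ by [cfactor] times [commutator]. *)
Lemma dform_commutator dl u : 0 < dl -> sqi dw u ->
  dform dw (riesz (1 + dl)) (ctrans u) =
  (dform dw (wriesz (1 + dl)) (fun w => u (Phi w)) +
   (2 * I (fun x => u (Phi x) ^+ 2 * (cfactor x * commutator dl x)))%:E)%E.
Proof.
move=> d0 hu; have b1 : 1 < 1 + dl by rewrite ltrDl.
have hU := sqi_comp_sboost hu; have hT := sqi_ctrans hu.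
pose U w := u (Phi w); pose k := wriesz (1 + dl).
have bk : bmeas2 k.
  apply: bmeasM (bmeas2_riesz b1); apply: bmeasM.
    exact: (bmeas_comp measurable_fst bmeas_cfactor).
  exact: (bmeas_comp measurable_snd bmeas_cfactor).
have k0 x y : 0 <= k x y by exact: wriesz_ge0.
have kC x y : k x y = k y x by rewrite /k /wriesz rieszC [cfactor x * _]mulrC.
rewrite (dformE bk k0 kC hU) (dformE (bmeas2_riesz b1) (riesz_ge0 _) (rieszC _) hT).
have rp x : I (k x) = cfactor x * I (fun y => riesz (1 + dl) x y * cfactor y).
  rewrite -IZ; last by apply: intg_kernel; [exact: bmeas2_riesz|exact/bmeas_intg/bmeas_cfactor].
  by apply: eq_I => y; rewrite /k /wriesz; ring.
have qE : qform dw (riesz (1 + dl)) (ctrans u) = qform dw k U.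
  apply: eq_I => x; rewrite /ctrans -/(U x) mulrAC mulrC; congr (_ * _).
  rewrite -IZ; last by apply: intg_kernel; [exact: bmeas2_riesz|exact: (sqi_intg hT)].
  by apply: eq_I => y; rewrite /k /wriesz -/(U y); ring.
rewrite -EFinD -mulrDr qE; congr (2 * _)%:E.
have bI : bmeas (fun x => I (riesz (1 + dl) x)).
  have := bmeas_kernel (bmeas2_riesz b1) (bmeas_intg dw (bmeas_cst 1)); congr bmeas.
  by apply/funext => x; apply: eq_I => y; rewrite mulr1.
have bIk : bmeas (fun x => I (k x)).
  have := bmeas_kernel bk (bmeas_intg dw (bmeas_cst 1)); congr bmeas.
  by apply/funext => x; apply: eq_I => y; rewrite mulr1.
have i1 f : bmeas f -> intg dw (fun x => U x ^+ 2 * f x).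
  move=> bf; have := intgM bf (proj2 hU); apply: eq_integrable => // x _ /=.
  by rewrite mulrC.
rewrite addrAC; congr (_ - _); rewrite -ID; [|exact: i1|].
  apply: eq_I => x; rewrite /ctrans /commutator rp -/(U x).
  by do 2!move: (Rintegral _ _ _) => ?; ring.
by apply: i1; apply: bmeasM bmeas_cfactor _; exact: bmeas_commutator.
Qed.

Lemma riesz1_sboost x y : riesz 1 (Phi x) (Phi y) * (cfactor x ^+ 2 * cfactor y ^+ 2) =
  wriesz 1 x y.
Proof.
have kx := kappa_gt0 v1 x; have ky := kappa_gt0 v1 y.
have px := cfactor_gt0 x; have py := cfactor_gt0 y.
have kk0 : 0 <= (kap x * kap y)^-1 by rewrite invr_ge0; apply: mulr_ge0; exact: ltW.
rewrite /wriesz /riesz qd_sboost// powRM ?subr_ge0 ?qd_le1//.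
have -> : (kap x * kap y)^-1 `^ (- a) = (cfactor x * cfactor y)^-1.
  have inv (t : R) : 0 < t -> t^-1 `^ (- a) = (t `^ (- a))^-1.
    by move=> t0; rewrite -[X in X `^ _]powR_inv1 ?ltW// -powRrM mulN1r opprK powRN invrK.
  by rewrite /cfactor -powRM ?ltW// inv//; exact: mulr_gt0.
by move: (cfactor x) (cfactor y) (_ `^ _) px py => p q ? p0 q0; field; rewrite !gt_eqF.
Qed.

Lemma dform_sboost u : measurable_fun setT u ->
  dform dw (wriesz 1) (fun w => u (Phi w)) = energy u.
Proof.
move=> mu; rewrite energyE /dform.
have mr : measurable_fun setT (fun p : S * S => riesz 1 p.1 p.2).
  apply: measurable_funM => //; apply: (measurableT_comp (measurable_powR _)).
  by apply: measurable_funB => //; case: (@bmeas_qd2 R n).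
have mc : measurable_fun setT (fun p : S * S => cfactor p.1 * cfactor p.2 * riesz 1 p.1 p.2).
  apply: measurable_funM mr; apply: measurable_funM.
    exact: (measurableT_comp (proj1 bmeas_cfactor) measurable_fst).
  exact: (measurableT_comp (proj1 bmeas_cfactor) measurable_snd).
have mU : measurable_fun setT (fun w => u (Phi w)).
  exact: (measurableT_comp mu (measurable_sboost _)).
pose H (p : S * S) := ((u p.1 - u p.2) ^+ 2 * riesz 1 p.1 p.2)%:E.
have mH : measurable_fun setT H by exact: measurable_dform.
have H0 p : (0 <= H p)%E by rewrite lee_fin mulr_ge0 ?sqr_ge0 ?riesz_ge0.
rewrite (ge0_integral_prod dw mH H0) ge0_integral_prod; first last.
- by move=> p; rewrite lee_fin mulr_ge0 ?sqr_ge0 ?wriesz_ge0.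
- exact: measurable_dform mc mU.
have mF : measurable_fun setT (fun x => \int[dw]_y H (x, y))%E.
  exact: (@measurable_fun_fubini_tonelli_F _ _ _ _ _ dw H mH H0).
rewrite -(ge0_integral_sboost v1 mF) => [|x]; last exact: integral_ge0.
apply: eq_integral => x _.
have mHx z : measurable_fun setT (fun y => H (z, y)).
  exact: (measurableT_comp mH (measurable_pair1 z)).
rewrite -(ge0_integral_sboost v1 (mHx _))// -ge0_integralZr//.
- apply: eq_integral => y _; rewrite /H/= -!sqr_cfactor -!EFinM; congr EFin.
  rewrite -riesz1_sboost; ring.
- apply: emeasurable_funM; first exact: (measurableT_comp (mHx _) (measurable_sboost _)).
  apply/measurable_EFinP.
  have := measurable_funX 2 (proj1 bmeas_cfactor).
  by congr (measurable_fun _ _); apply/funext => y; rewrite sqr_cfactor.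
- by move=> y _; rewrite mule_ge0// lee_fin -sqr_cfactor sqr_ge0.
- by rewrite lee_fin -sqr_cfactor sqr_ge0.
Qed.

Lemma cvg_riesz x y : x != y ->
  riesz (1 + (1 + N%:R)^-1) x y @[N --> \oo] --> (@riesz R n 1 x y : R).
Proof.
move=> xy; pose m : R := 1 - qd x y.
have m0 : 0 < m.
  rewrite subr_gt0 lt_neqAle qd_le1 andbT.
  by apply/eqP => /qd_eq1 e; rewrite e eqxx in xy.
apply: (@cvgn_eq _ (fun N => riesz 1 x y + (riesz (1 + (1 + N%:R)^-1) x y - riesz 1 x y))).
  by move=> N; rewrite addrC subrK.
rewrite -[X in _ --> X]addr0; apply: cvgD; first exact: cvg_cst.
apply/norm_cvg0P; pose C := 2 ^- n.+1 * (m `^ (- a) * a / m).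
apply: (@squeeze_cvgr _ _ _ _ (cst 0) (fun N => C * (1 + N%:R)^-1)).
- apply: nearW => N; rewrite /cst normr_ge0/= /riesz -mulrBr normrM ger0_norm ?invr_ge0 ?exprn_ge0//.
  rewrite /C -[X in _ <= X]mulrA ler_wpM2l ?invr_ge0 ?exprn_ge0//.
  have d0 : 0 <= (1 + N%:R)^-1 :> R by rewrite invr_ge0 addr_ge0.
  rewrite (le_trans (powRN_lip (ltW a0) m0 _ (lexx m)))//; first by rewrite /m lerB// lerDl.
  rewrite -/m -/(1 - qd x y) /m (_ : 1 + _ - qd x y - (1 - qd x y) = (1 + N%:R)^-1); last by ring.
  by rewrite ger0_norm// -!mulrA [_^-1 * (1 - _)^-1]mulrC.
- exact: cvg_cst.
- rewrite -(mulr0 C); apply: cvgM; first exact: cvg_cst.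
  exact: cvg_inv_addn.
Qed.

(** Let the regularisation tend to 0 in [dform_commutator]: the forms converge monotonically and the
    commutator uniformly. With $J$ the Jacobian, the added term is $C_n\int u(\Phi)^2J\ln J$, which
    is $C_n$ times the change of the entropy. *)
Lemma energy_ctrans u : sqi dw u -> energy (ctrans u) =
  (energy u + (@Cn R n.+1 * I (fun w => u (Phi w) ^+ 2 * (cfactor w ^+ 2 * lnfactor w)))%:E)%E.
Proof.
move=> hu; pose dl (N : nat) : R := (1 + N%:R)^-1.
have dl0 N : 0 < dl N by rewrite invr_gt0 ltr_wpDr.
have hU := sqi_comp_sboost hu; have hT := sqi_ctrans hu.
have mr N : measurable_fun setT (fun p : S * S => riesz (1 + dl N) p.1 p.2).
  by case: (@bmeas2_riesz R n (1 + dl N) _) => //; rewrite ltrDl.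
have rnd x y : nondecreasing_seq (fun N => @riesz R n (1 + dl N) x y).
  move=> N M NM; rewrite ler_wpM2l ?invr_ge0 ?exprn_ge0// !powRN.
  have h K : 0 < 1 + dl K - qd x y.
    by rewrite addrAC ltr_wpDl// subr_ge0 qd_le1.
  rewrite lef_pV2 ?posrE ?powR_gt0//; apply: ge0_ler_powR; [exact: ltW|exact/ltW|exact/ltW|].
  by rewrite lerD2r lerD2l lef_pV2 ?posrE ?ltr_wpDr// lerD2l ler_nat.
have ne (g : S -> R) x y : g x != g y -> x != y by apply: contra_neq => ->.
have c1 := @cvg_dform _ _ _ dw (fun N => riesz (1 + dl N)) (riesz 1) (ctrans u) mr
  (fun N => riesz_ge0 _) rnd (proj1 hT) (fun x y h => cvg_riesz (ne (ctrans u) x y h)).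
have c2 := @cvg_dform _ _ _ dw (fun N => wriesz (1 + dl N))
  (wriesz 1) (fun w => u (Phi w)).
have {}c2 : (dform dw (wriesz (1 + dl N))
    (fun w => u (Phi w)) @[N --> \oo] --> energy u)%E.
  rewrite -(dform_sboost (proj1 hu)); apply: c2.
  - move=> N; apply: measurable_funM (mr N); apply: measurable_funM.
      exact: (measurableT_comp (proj1 bmeas_cfactor) measurable_fst).
    exact: (measurableT_comp (proj1 bmeas_cfactor) measurable_snd).
  - by move=> N x y; exact: wriesz_ge0.
  - by move=> x y N M NM; rewrite ler_wpM2l ?rnd// mulr_ge0 ?ltW ?cfactor_gt0.
  - exact: (proj1 hU).
  - move=> x y h; apply: cvgM; first exact: cvg_cst.
    exact: cvg_riesz (ne (fun w => u (Phi w)) x y h).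
pose c (N : nat) : R := 2 * I (fun x => u (Phi x) ^+ 2 * (cfactor x * commutator (dl N) x)).
have i1 f : bmeas f -> intg dw (fun x => u (Phi x) ^+ 2 * f x).
  move=> bf; have := intgM bf (proj2 hU); apply: eq_integrable => // x _ /=.
  by rewrite mulrC.
have bc N := bmeas_commutator (dl0 N).
have c3 : c N @[N --> \oo] --> (@Cn R n.+1 *
    I (fun w => u (Phi w) ^+ 2 * (cfactor w ^+ 2 * lnfactor w)) : R).
  pose L := I (fun x => u (Phi x) ^+ 2 * (cfactor x * (@Cn R n.+1 / 2 * (cfactor x * lnfactor x)))).
  have bL : bmeas (fun x => cfactor x * (@Cn R n.+1 / 2 * (cfactor x * lnfactor x))).
    apply: bmeasM bmeas_cfactor _; apply: bmeasZ; exact: bmeasM bmeas_cfactor bmeas_lnfactor.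
  have -> : @Cn R n.+1 * I (fun w => u (Phi w) ^+ 2 * (cfactor w ^+ 2 * lnfactor w)) = 2 * L.
    rewrite /L -!IZ; last 2 first.
    - exact: i1.
    - by apply: i1; apply: bmeasM bmeas_lnfactor; apply: bmeasX; exact: bmeas_cfactor.
    by apply: eq_I => x; field.
  apply: cvgnZ; apply/cvgrPdist_le => e e0.
  pose A := I (fun x => u (Phi x) ^+ 2 * cfactor x).
  have A0 : 0 <= A by apply: I_ge0 => x; rewrite mulr_ge0 ?sqr_ge0// ltW// cfactor_gt0.
  have A1 : 0 < A + 1 by rewrite ltr_wpDl.
  have [d0 d00 hd] := commutator_cvg (divr_gt0 e0 A1).
  have := @cvg_inv_addn R 1 ltr01; move/cvgrPdist_lt => /(_ _ d00); apply: filterS => N.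
  rewrite sub0r normrN (gtr0_norm (dl0 N)) => dN.
  have {}hd := hd (dl N) (introT andP (conj (dl0 N) dN)).
  have bM : bmeas (fun x => cfactor x * commutator (dl N) x) by exact: bmeasM bmeas_cfactor _.
  rewrite -IB; [|exact: i1|exact: i1].
  have iB := intgB (i1 _ bL) (i1 _ bM).
  rewrite (le_trans (norm_I iB))// (@le_trans _ _ (e / (A + 1) * A))//; last first.
    by rewrite mulrAC ler_pdivrMr// ler_wpM2l ?(ltW e0)// lerDl.
  rewrite /A -IZ; last exact: i1 bmeas_cfactor.
  apply: le_I; [exact: intg_norm|by apply: intgZ; exact: i1 bmeas_cfactor|move=> x].
  have uc0 : 0 <= u (Phi x) ^+ 2 * cfactor x.
    by apply: mulr_ge0; [exact: sqr_ge0|exact/ltW/cfactor_gt0].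
  by rewrite -mulrBr -mulrBr mulrA normrM ger0_norm// mulrC ler_wpM2r// distrC.
rewrite energyE; apply: (cvg_unique _ c1) => //.
rewrite (_ : (fun N => dform dw (riesz (1 + dl N)) (ctrans u)) =
  (fun N => dform dw (wriesz (1 + dl N)) (fun w => u (Phi w)) + (c N)%:E)%E); last first.
  by apply/funext => N; rewrite dform_commutator.
apply: cvgeD => //; first exact: fin_num_adde_defl.
by apply: cvg_EFin c3; exact: nearW.
Qed.

End ConformalEnergy.

(** * The deficit of normalised functions *)

Section Deficit.
Context {R : realType} {n : nat}.
Notation S := (sphere R n.+1).
Notation dw := (@surface R n.+1).
Notation I f := (Rintegral dw setT f).
Notation a := (n.+1%:R / 2 : R).
Notation sph := (fine (dw setT)).
Implicit Types (x y w : S) (u : S -> R).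

Lemma norm_xlnx (t : R) : 0 <= t -> `|t * ln t| <= t * lnp t + 1.
Proof.
rewrite le_eqVlt => /predU1P[<-|t0]; first by rewrite !mul0r normr0 add0r.
have [t1|t1] := leP 1 t.
  have l0 := mulr_ge0 (ltW t0) (ln_ge0 t1).
  by rewrite /lnp max_r// ger0_norm// lerDl.
have l0 : ln t <= 0 by rewrite ln_le0// ltW.
rewrite ler0_norm; last exact: mulr_ge0_le0 (ltW t0) l0.
have h : - ln t <= t^-1 - 1.
  have s1 : -1 < t^-1 - 1 by rewrite ltrBrDr addNr invr_gt0.
  have := le_ln1Dx s1; rewrite addrC subrK lnV ?posrE//; lra.
rewrite -mulrN (le_trans (ler_wpM2l (ltW t0) h))// mulrBr divff ?gt_eqF// mulr1.
have l1 := mulr_ge0 (ltW t0) (lnp_ge0 t).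
by rewrite (@le_trans _ _ 1) ?lerDr// lerBlDr lerDl ltW.
Qed.

Definition admissible u := [/\ sqi dw u, I (fun x => u x ^+ 2) = 1 & (energy u < +oo)%E].

Definition sqr_entropy u : R := I (fun x => u x ^+ 2 * ln (u x ^+ 2)).

(** On unit functions it differs from [LS] by the constant $C_n\ln|\mathbb S|$ ([deficitE]). *)
Definition deficit u : R := fine (energy u) - @Cn R n.+1 * sqr_entropy u.

Lemma measurable_lnf (f : S -> R) : measurable_fun setT f -> measurable_fun setT (fun x => ln (f x)).
Proof. by move=> mf; exact: (measurableT_comp (@measurable_ln R) mf). Qed.

Lemma energy_ge0 u : (0 <= energy u)%E.
Proof. by rewrite energyE; apply: dform_ge0 => x y; exact: riesz_ge0. Qed.

Lemma energy_fin u : (energy u < +oo)%E -> energy u = (fine (energy u))%:E.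
Proof. by move=> h; rewrite fineK// ge0_fin_numE// energy_ge0. Qed.

(** Finite energy makes the entropy finite, by [weak_log_sobolev]; this is what gives the
    real-valued deficit its meaning. *)
Lemma intg_sqr_lnp u : admissible u -> intg dw (fun x => u x ^+ 2 * lnp (u x ^+ 2)).
Proof.
move=> [hu u1 uE].
have C0 : 0 < @Cn R n.+1 := Cn_gt0.
have m : measurable_fun setT (fun x => u x ^+ 2 * lnp (u x ^+ 2)).
  apply: measurable_funM; first exact: measurable_funX (proj1 hu).
  by apply: (measurableT_comp measurable_lnp); exact: measurable_funX (proj1 hu).
have h : intg dw (fun x => @Cn R n.+1 * (u x ^+ 2 * lnp (u x ^+ 2))).
  apply/integrableP; split.
    by apply/measurable_EFinP; exact: measurable_funM.
  apply: le_lt_trans (_ : (energy u + (@weak_const R n)%:E < +oo)%E); last first.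
    by rewrite lte_add_pinfty// ltry.
  apply: le_trans (weak_log_sobolev hu u1); rewrite le_eqVlt; apply/orP; left; apply/eqP.
  apply: eq_integral => x _ /=; rewrite ger0_norm//.
  by apply: mulr_ge0 (ltW C0) _; rewrite mulr_ge0 ?sqr_ge0 ?lnp_ge0.
have := intgZ (@Cn R n.+1)^-1 h; apply: eq_integrable => // x _ /=.
by rewrite mulKf ?gt_eqF.
Qed.

Lemma intg_sqr_ln u : admissible u -> intg dw (fun x => u x ^+ 2 * ln (u x ^+ 2)).
Proof.
move=> hu; have [[mu _] _ _] := hu.
apply: (@intg_le _ _ _ dw _ (fun x => u x ^+ 2 * lnp (u x ^+ 2) + 1)).
- apply: measurable_funM; first exact: measurable_funX.
  by apply: measurable_lnf; exact: measurable_funX.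
- move=> x; rewrite (le_trans (norm_xlnx (sqr_ge0 _)))// ler_norm//.
- by apply: intgD; [exact: intg_sqr_lnp|exact/bmeas_intg/bmeas_cst].
Qed.

Lemma deficitE u : DL R n.+1 u -> L2norm u = 1 ->
  admissible u /\ LS u = (deficit u - @Cn R n.+1 * ln sph)%:E.
Proof.
move=> [/LfunP hu uE] u1; have [mu iu] := hu.
have u2 : I (fun x => u x ^+ 2) = 1.
  have u0 : 0 <= I (fun x => u x ^+ 2) by apply: I_ge0 => x; exact: sqr_ge0.
  by rewrite -(sqr_sqrtr u0) -L2normE// u1 expr1n.
have gu : admissible u by [].
split => //; rewrite /LS (energy_fin uE) /entropy u1.
have s0 : 0 < sph := surface_gt0 _.
have iL := intg_sqr_ln gu.
have -> : (\int[dw]_w (u w ^+ 2 * ln (u w ^+ 2 * sph / 1 ^+ 2))%:E)%E =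
    (sqr_entropy u + ln sph)%:E.
  have -> : sqr_entropy u + ln sph = I (fun x => u x ^+ 2 * ln (u x ^+ 2) + ln sph * u x ^+ 2).
    by rewrite ID//; [rewrite IZ// u2 mulr1|exact: intgZ].
  rewrite IE; last by apply: intgD => //; exact: intgZ.
  apply: eq_integral => x _; congr EFin; rewrite expr1n divr1.
  have [->|x0] := eqVneq (u x) 0; first by rewrite expr0n/= !mul0r mulr0 addr0.
  have x2 : 0 < u x ^+ 2 by rewrite lt0r sqrf_eq0 x0 sqr_ge0.
  by rewrite lnM ?posrE// mulrDr [X in _ + X]mulrC.
by rewrite -EFinM -EFinB /deficit; congr EFin; ring.
Qed.

Section boost.
Variable v : R.
Hypothesis v1 : `|v| < 1.

Lemma ln_sqr_cfactor w : ln (cfactor v w ^+ 2) = lnfactor v w.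
Proof.
have k0 := kappa_gt0 v1 w.
by rewrite lnXn ?powR_gt0// /cfactor ln_powR /lnfactor -mulr_natl; field.
Qed.

Lemma deficit_ctrans u : admissible u ->
  admissible (ctrans v u) /\ deficit (ctrans v u) = deficit u.
Proof.
move=> gu; have [hu u1 uE] := gu; have [mu iu] := hu.
have hT := sqi_ctrans v1 hu; have eT := energy_ctrans v1 hu.
have TE : (energy (ctrans v u) < +oo)%E.
  by rewrite eT (energy_fin uE) -EFinD ltry.
have gT : admissible (ctrans v u) by split=> //; rewrite I_sqr_ctrans.
split => //; rewrite /deficit eT (energy_fin uE) -EFinD/= /sqr_entropy.
have iL := intg_sqr_ln gu; have hU := sqi_comp_sboost v1 hu.
have b1 : bmeas (fun w => cfactor v w ^+ 2 * lnfactor v w).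
  by apply: bmeasM (bmeas_lnfactor v1); apply: bmeasX; exact: bmeas_cfactor.
have i1 : intg dw (fun w => u (sboost v w) ^+ 2 * (cfactor v w ^+ 2 * lnfactor v w)).
  by have := intgM b1 (proj2 hU); apply: eq_integrable => // x _ /=; rewrite mulrC.
have i2 := intg_sboost v1 iL.
rewrite -(I_sboost v1 (intg_measurable iL)).
have -> : I (fun x => ctrans v u x ^+ 2 * ln (ctrans v u x ^+ 2)) =
    I (fun w => u (sboost v w) ^+ 2 * (cfactor v w ^+ 2 * lnfactor v w)) +
    I (fun w => u (sboost v w) ^+ 2 * ln (u (sboost v w) ^+ 2) * cfactor v w ^+ 2).
  rewrite -ID//; apply: eq_I => w; rewrite /ctrans exprMn.
  have [->|x0] := eqVneq (u (sboost v w)) 0; first by rewrite expr0n/= !(mulr0, mul0r) addr0.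
  have c0 := cfactor_gt0 v1 w.
  have s0 : 0 < u (sboost v w) ^+ 2 by rewrite lt0r sqrf_eq0 x0 sqr_ge0.
  have -> : ln (cfactor v w ^+ 2 * u (sboost v w) ^+ 2) = lnfactor v w + ln (u (sboost v w) ^+ 2).
    by rewrite -ln_sqr_cfactor lnM ?posrE// exprn_gt0.
  ring.
ring.
Qed.

End boost.

Section swap.
Variable i : 'I_n.+2.

Definition strans u w : R := u (sswap i w).

Lemma I_sswap (f : S -> R) : measurable_fun setT f -> I (fun w => f (sswap i w)) = I f.
Proof. by move=> mf; congr fine; rewrite -(integral_sswap i (measurableT_comp _ mf)). Qed.

Lemma intg_sswap f : intg dw f -> intg dw (fun w => f (sswap i w)).
Proof.
move=> hf; have mf := intg_measurable hf.
have mfs : measurable_fun setT (fun w => f (sswap i w)).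
  exact: (measurableT_comp mf (measurable_sswap i)).
apply/integrableP; split; first exact/measurable_EFinP.
case/integrableP: hf => mf' ; apply: le_lt_trans.
have mf2 : measurable_fun setT (fun w => `|(f w)%:E|%E) by exact: measurableT_comp.
by rewrite -(ge0_integral_sswap i mf2).
Qed.

Lemma energy_strans u : measurable_fun setT u -> energy (strans u) = energy u.
Proof.
move=> mu; rewrite !energyE /dform.
have mr : measurable_fun setT (fun p : S * S => riesz 1 p.1 p.2).
  apply: measurable_funM => //; apply: (measurableT_comp (measurable_powR _)).
  by apply: measurable_funB => //; case: (@bmeas_qd2 R n).
have mU : measurable_fun setT (strans u).
  exact: (measurableT_comp mu (measurable_sswap _)).
pose H (p : S * S) := ((u p.1 - u p.2) ^+ 2 * riesz 1 p.1 p.2)%:E.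
have mH : measurable_fun setT H by exact: measurable_dform.
have H0 p : (0 <= H p)%E by rewrite lee_fin mulr_ge0 ?sqr_ge0 ?riesz_ge0.
rewrite (ge0_integral_prod dw mH H0) ge0_integral_prod; first last.
- by move=> p; rewrite lee_fin mulr_ge0 ?sqr_ge0 ?riesz_ge0.
- exact: measurable_dform mr mU.
have mF : measurable_fun setT (fun x => \int[dw]_y H (x, y))%E.
  exact: (@measurable_fun_fubini_tonelli_F _ _ _ _ _ dw H mH H0).
rewrite -(ge0_integral_sswap i mF) => [|x]; last exact: integral_ge0.
apply: eq_integral => x _.
have mHx z : measurable_fun setT (fun y => H (z, y)).
  exact: (measurableT_comp mH (measurable_pair1 z)).
transitivity (\int[dw]_y H (sswap i x, sswap i y))%E.
  by apply: eq_integral => y _; rewrite /H/= /strans /riesz qd_sswap.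
exact: (ge0_integral_sswap i (mHx _) (fun y => H0 _)).
Qed.

Lemma deficit_strans u : admissible u ->
  admissible (strans u) /\ deficit (strans u) = deficit u.
Proof.
move=> gu; have [hu u1 uE] := gu; have [mu iu] := hu.
have iL := intg_sqr_ln gu.
split; last first.
  by rewrite /deficit energy_strans// /sqr_entropy -(I_sswap (intg_measurable iL)).
split; last by rewrite energy_strans.
  split; first exact: (measurableT_comp mu (measurable_sswap _)).
  exact: (intg_sswap iu).
transitivity (I (fun x => u x ^+ 2)) => //; exact: (I_sswap (intg_measurable iu)).
Qed.

End swap.

End Deficit.

(** * The action of the symmetries on the set M *)

Section Bubbles.
Context {R : realType} {n : nat}.
Notation S := (sphere R n.+1).
Notation dw := (@surface R n.+1).
Notation I f := (Rintegral dw setT f).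
Notation a := (n.+1%:R / 2 : R).
Notation sph := (fine (dw setT)).
Notation T := (n.+2.-tuple R).
Implicit Types (x y w : S) (u phi psi : S -> R) (xi : T).

Lemma norm_cosd x y : `|cosd x y| <= 1.
Proof. have := qd_ge0 x y; have := qd_le1 x y; rewrite /qd ler_norml; lra. Qed.

Lemma norm_dotp_le xi w : `|dotp xi (val w)| <= enorm xi.
Proof.
have [eta ->] := exists_direction xi.
by rewrite normrM ger0_norm ?sqrtr_ge0// ler_piMr ?sqrtr_ge0// norm_cosd.
Qed.

Lemma bubble_base_gt0 xi w : unit_ball xi -> 0 < 1 - dotp xi (val w).
Proof.
move=> h; rewrite subr_gt0 (le_lt_trans (ler_norm _))// (le_lt_trans (norm_dotp_le _ _))//.
Qed.

Lemma bmeas_dotp xi : bmeas (fun w : S => dotp xi (val w)).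
Proof.
have [eta h] := exists_direction xi.
have := bmeasZ (enorm xi) (bmeas_cosd eta); congr bmeas.
by apply/funext => w; rewrite h.
Qed.

Lemma bmeas_bubble c xi : unit_ball xi -> bmeas (@bubble R n.+1 c xi).
Proof.
move=> h; apply: bmeasZ; split.
  apply: (measurableT_comp (measurable_powR _)).
  by apply: measurable_funB => //; case: (bmeas_dotp xi).
exists ((1 - enorm xi) `^ (- a)) => w; rewrite ger0_norm ?powR_ge0// !powRN.
have h1 : 0 < 1 - enorm xi by rewrite subr_gt0.
have h2 := bubble_base_gt0 w h.
rewrite lef_pV2 ?posrE ?powR_gt0//.
apply: ge0_ler_powR; [by rewrite divr_ge0|exact/ltW|exact/ltW|].
by rewrite lerD2l lerN2 (le_trans (ler_norm _))// norm_dotp_le.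
Qed.

(** Relativistic composition of velocities: the action of the boost on the parameter ball, seen as
    Klein's model of hyperbolic space. *)
Definition ballmap (v : R) xi : T :=
  tcons ((thead xi - v) / (1 - v * thead xi),
    [tuple Num.sqrt (1 - v ^+ 2) * tnth xi (lift ord0 i) / (1 - v * thead xi) | i < n.+1]).

Lemma dotp_recl xi (z : T) : dotp xi z =
  thead xi * thead z + \sum_(i < n.+1) tnth xi (lift ord0 i) * tnth z (lift ord0 i).
Proof. by rewrite /dotp big_ord_recl. Qed.

Lemma enorm_lt1 xi : (enorm xi < 1) = (dotp xi xi < 1).
Proof.
rewrite -sqr_enorm -[X in _ = (_ < X)](expr1n R 2).
by rewrite ltr_sqr ?nnegrE ?sqrtr_ge0.
Qed.

Lemma norm_thead_lt1 xi : unit_ball xi -> `|thead xi| < 1.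
Proof.
rewrite /unit_ball/= enorm_lt1 dotp_recl -expr2 => h.
rewrite -(@expr_lt1 _ 2)// real_normK ?num_real//; apply: le_lt_trans h.
by rewrite lerDl sumr_ge0// => i _; rewrite -expr2 sqr_ge0.
Qed.

Lemma thead_ballmap v xi : thead (ballmap v xi) = (thead xi - v) / (1 - v * thead xi).
Proof. by rewrite /thead /ballmap tnth_tcons0. Qed.

Lemma tnth_ballmap v xi (i : 'I_n.+1) : tnth (ballmap v xi) (lift ord0 i) =
  Num.sqrt (1 - v ^+ 2) * tnth xi (lift ord0 i) / (1 - v * thead xi).
Proof. by rewrite /ballmap tnth_tconsS tnth_mktuple. Qed.

Section ball.
Variables (v : R) (xi : T).
Hypotheses (v1 : `|v| < 1) (xi1 : unit_ball xi).
Let s := Num.sqrt (1 - v ^+ 2).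

Let s0 : 0 < s.
Proof. by have := gamma_gt0 v1; rewrite invr_gt0. Qed.

Let s2 : s ^+ 2 = 1 - v ^+ 2.
Proof. by rewrite sqr_sqrtr// ltW// subr_gt0 -real_normK ?num_real// exprn_ilt1. Qed.

Lemma ball_den_gt0 : 0 < 1 - v * thead xi.
Proof.
rewrite subr_gt0 (le_lt_trans (ler_norm _))// normrM.
have := norm_thead_lt1 xi1; have := normr_ge0 v; have := normr_ge0 (thead xi); have := v1.
by move: `|v| `|thead xi| => p q; nra.
Qed.

Lemma unit_ball_ballmap : unit_ball (ballmap v xi).
Proof.
have d0 := ball_den_gt0.
rewrite /unit_ball/= enorm_lt1 dotp_recl thead_ballmap.
have := xi1; rewrite /unit_ball/= enorm_lt1 dotp_recl.
rewrite [X in _ -> _ + X < 1](eq_bigr (fun i => (s / (1 - v * thead xi)) ^+ 2 *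
  (tnth xi (lift ord0 i) * tnth xi (lift ord0 i)))); last first.
  move=> i _; rewrite !tnth_ballmap -/s; field; exact/lt0r_neq0.
rewrite -mulr_sumr; move: (\sum_(i < _) _) (thead xi) d0 => q t d0 q1.
rewrite exprMn s2 -(ltr_pM2r (exprn_gt0 2 d0)) mul1r.
have -> : ((t - v) / (1 - v * t) * ((t - v) / (1 - v * t)) +
   (1 - v ^+ 2) * (1 - v * t)^-1 ^+ 2 * q) * (1 - v * t) ^+ 2 =
   (t - v) ^+ 2 + (1 - v ^+ 2) * q by field; exact/lt0r_neq0.
have := mulr_gt0 (exprn_gt0 2 s0) (_ : 0 < 1 - (t * t + q)); rewrite s2 subr_gt0 => /(_ q1).
move=> h; rewrite -subr_gt0; apply: lt_le_trans h _; rewrite le_eqVlt; apply/orP; left.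
by apply/eqP; ring.
Qed.

(** $1-\xi\cdot\omega$ is the Minkowski product of $(1,\xi)$ and $(1,\omega)$, so a boost of
    $\omega$ amounts to the inverse boost of $\xi$. *)
Lemma ctrans_bubble c :
  ctrans v (@bubble R n.+1 c xi) = bubble (c * (s^-1 * (1 - v * thead xi)) `^ (- a)) (ballmap v xi).
Proof.
have d0 := ball_den_gt0; apply/funext => w; rewrite /ctrans /cfactor /bubble.
have k0 := kappa_gt0 v1 w; have b0 := bubble_base_gt0 (sboost v w) xi1.
have b1 := bubble_base_gt0 w unit_ball_ballmap.
have sd0 : 0 < s^-1 * (1 - v * thead xi) by rewrite mulr_gt0 ?invr_gt0.
rewrite mulrCA -[RHS]mulrA -!powRM ?ltW//; congr (c * _ `^ _).
rewrite !dotp_recl mulrBr mulr1 mulrDr mulr_sumr.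
rewrite -/(crd (sboost v w) ord0) -/(crd w ord0) [kappa v w * (_ * _)]mulrCA.
rewrite (_ : thead (val (sboost v w)) = crd (sboost v w) ord0)// kappa_crd0//.
rewrite (_ : thead (val w) = crd w ord0)//.
rewrite (eq_bigr (fun i => tnth xi (lift ord0 i) * crd w (lift ord0 i))); last first.
  by move=> i _; rewrite mulrCA -/(crd (sboost v w) _) kappa_crdS.
rewrite thead_ballmap.
rewrite [X in _ = _ * (_ - (_ + X))](eq_bigr (fun i => s / (1 - v * thead xi) *
  (tnth xi (lift ord0 i) * crd w (lift ord0 i)))); last first.
  by move=> i _; rewrite tnth_ballmap -/s -/(crd w _); ring.
rewrite -mulr_sumr kappaE -/s; move: (\sum_(i < _) _) (thead xi) (crd w ord0) s s0 d0 => q t c0 p p0 d0.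
field; rewrite !gt_eqF//.
Qed.

End ball.

Lemma ballmapK v xi : `|v| < 1 -> unit_ball xi -> ballmap v (ballmap (- v) xi) = xi.
Proof.
move=> v1 h; have v1' : `|- v| < 1 by rewrite normrN.
have d0 := ball_den_gt0 v1' h; have d1 := ball_den_gt0 v1 (unit_ball_ballmap v1' h).
have s0 : 0 < 1 - v ^+ 2 by rewrite subr_gt0 -real_normK ?num_real// exprn_ilt1.
have s2 : Num.sqrt (1 - v ^+ 2) ^+ 2 = 1 - v ^+ 2 by rewrite sqr_sqrtr// ltW.
have dn := lt0r_neq0 d0; have sn := lt0r_neq0 s0.
have e : 1 - v * thead (ballmap (- v) xi) = (1 - v ^+ 2) / (1 - - v * thead xi).
  by rewrite thead_ballmap; field.
apply: eq_from_tnth => i; have [j ->|->] := unliftP ord0 i.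
  rewrite !tnth_ballmap e sqrrN.
  transitivity (Num.sqrt (1 - v ^+ 2) ^+ 2 / (1 - v ^+ 2) * tnth xi (lift ord0 j)).
    by field; rewrite dn sn.
  by rewrite s2 divff// mul1r.
rewrite -/(thead (ballmap v (ballmap (- v) xi))) -/(thead xi) thead_ballmap e thead_ballmap.
by field; rewrite dn sn.
Qed.

Lemma strans_bubble i c xi : strans i (@bubble R n.+1 c xi) = bubble c (tswap i xi).
Proof.
apply/funext => w; rewrite /strans /bubble val_sswap; congr (_ * (1 - _) `^ _).
have tK (z : T) : tswap i (tswap i z) = z.
  by apply: eq_from_tnth => j; rewrite !tnth_mktuple tpermK.
by rewrite -{1}(tK xi) dotp_tswap.
Qed.

Definition sqdist u phi : R := I (fun x => (u x - phi x) ^+ 2).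

(** The correspondence of points of $M$ goes from [U] to [u]: this direction carries lower bounds
    for the distances from [u] over to [U]. *)
Definition Mequiv u U := [/\ admissible U, deficit U = deficit u &
  forall phi, M R n.+1 phi -> exists2 psi, M R n.+1 psi & sqdist U phi = sqdist u psi].

Lemma Mequiv_refl u : admissible u -> Mequiv u u.
Proof. by move=> gu; split=> // phi; exists phi. Qed.

Lemma Mequiv_trans u1 u2 u3 : Mequiv u1 u2 -> Mequiv u2 u3 -> Mequiv u1 u3.
Proof.
move=> [g2 d2 m2] [g3 d3 m3]; split=> //; first by rewrite d3.
by move=> phi /m3[psi2 /m2[psi1 h1 e1] e2]; exists psi1 => //; rewrite e2.
Qed.

Lemma Mequiv_boost v u c xi : `|v| < 1 -> admissible u -> unit_ball xi ->
  exists (U : S -> R) (c' : R), Mequiv u U /\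
    sqdist U (@bubble R n.+1 c' (ballmap v xi)) = sqdist u (@bubble R n.+1 c xi).
Proof.
move=> v1 gu hxi; have [gT dT] := deficit_ctrans v1 gu.
have iso c0 xi0 : unit_ball xi0 ->
    sqdist (ctrans v u) (ctrans v (bubble c0 xi0)) = sqdist u (bubble c0 xi0).
  move=> h; have [[mu _] _ _] := gu.
  rewrite /sqdist -(I_sqr_ctrans v1 (u := fun x => u x - bubble c0 xi0 x)).
    by apply: eq_I => w; rewrite /ctrans mulrBr.
  by apply: measurable_funB => //; case: (bmeas_bubble c0 h).
exists (ctrans v u); eexists; split; last first.
  by rewrite -(iso c _ hxi) ctrans_bubble.
split => // phi [c0 [xi0 h0 ->]].
have v1' : `|- v| < 1 by rewrite normrN.
have h1 := unit_ball_ballmap v1' h0.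
have d1 := ball_den_gt0 v1 h1.
pose q := ((Num.sqrt (1 - v ^+ 2))^-1 * (1 - v * thead (ballmap (- v) xi0))) `^ (- a).
have q0 : 0 < q by rewrite powR_gt0// mulr_gt0// gamma_gt0.
exists (bubble (c0 / q) (ballmap (- v) xi0)); first by exists (c0 / q), (ballmap (- v) xi0).
have e : bubble c0 xi0 = ctrans v (bubble (c0 / q) (ballmap (- v) xi0)).
  by rewrite ctrans_bubble// -/q divfK ?gt_eqF// ballmapK.
by rewrite e; exact: iso.
Qed.

Lemma unit_ball_tswap i xi : unit_ball xi -> unit_ball (tswap i xi).
Proof. by rewrite /unit_ball/= enorm_tswap. Qed.

Lemma Mequiv_swap i u c xi : admissible u -> unit_ball xi ->
  Mequiv u (strans i u) /\
    sqdist (strans i u) (@bubble R n.+1 c (tswap i xi)) = sqdist u (@bubble R n.+1 c xi).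
Proof.
move=> gu hxi; have [gT dT] := deficit_strans i gu.
have iso c0 xi0 : unit_ball xi0 ->
    sqdist (strans i u) (bubble c0 (tswap i xi0)) = sqdist u (bubble c0 xi0).
  move=> h; have [[mu _] _ _] := gu; rewrite -strans_bubble.
  rewrite /sqdist -(I_sswap i (f := fun x => (u x - bubble c0 xi0 x) ^+ 2))//.
  apply: measurable_funX.
  by apply: measurable_funB => //; case: (bmeas_bubble c0 h).
split; last exact: iso.
split => // phi [c0 [xi0 h0 ->]].
have tK (z : T) : tswap i (tswap i z) = z.
  by apply: eq_from_tnth => j; rewrite !tnth_mktuple tpermK.
exists (bubble c0 (tswap i xi0)); first by exists c0, (tswap i xi0) => //; exact: unit_ball_tswap.
by rewrite -iso ?tK//; exact: unit_ball_tswap.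
Qed.

(** Bring the coordinate [i] of the parameter to the front, boost with exactly that velocity, and
    swap back. The other coordinates are only rescaled, so zeros obtained earlier persist. *)
Lemma Mequiv_kill i u c xi : admissible u -> unit_ball xi ->
  exists (U : S -> R) (c' : R) (xi' : T), [/\ Mequiv u U, unit_ball xi',
    sqdist U (@bubble R n.+1 c' xi') = sqdist u (@bubble R n.+1 c xi),
    tnth xi' i = 0 & forall j, tnth xi j = 0 -> tnth xi' j = 0].
Proof.
move=> gu hxi; have [m1 e1] := Mequiv_swap i c gu hxi.
have h1 := unit_ball_tswap i hxi; set xi1 := tswap i xi in e1 h1.
pose v := thead xi1.
have v1 : `|v| < 1 := norm_thead_lt1 h1.
have g1 : admissible (strans i u) by case: m1.
have [U2 [c2 [m2 e2]]] := Mequiv_boost c v1 g1 h1.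
have h2 := unit_ball_ballmap v1 h1; set xi2 := ballmap v xi1 in e2 h2.
have g2 : admissible U2 by case: m2.
have [m3 e3] := Mequiv_swap i c2 g2 h2.
exists (strans i U2), c2, (tswap i xi2); split.
- exact: Mequiv_trans (Mequiv_trans m1 m2) m3.
- exact: unit_ball_tswap.
- exact: (etrans e3 (etrans e2 e1)).
- by rewrite tnth_mktuple tpermR -/(thead xi2) thead_ballmap /v subrr mul0r.
move=> j j0; rewrite tnth_mktuple.
have : tnth xi1 (tperm ord0 i j) = 0 by rewrite tnth_mktuple tpermK.
have [k ->|->] := unliftP ord0 (tperm ord0 i j) => hk.
  by rewrite tnth_ballmap hk mulr0 mul0r.
by rewrite -/(thead xi2) thead_ballmap /v subrr mul0r.
Qed.

Lemma bubble0 c xi w : (forall i, tnth xi i = 0) -> @bubble R n.+1 c xi w = c.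
Proof.
move=> h; rewrite /bubble /dotp big1 => [|i _]; last by rewrite h mul0r.
rewrite subr0; have -> : 1 `^ (- a) = 1 :> R by rewrite powR1.
by rewrite mulr1.
Qed.

Lemma Mequiv_center u c xi : admissible u -> unit_ball xi ->
  exists U (c' : R), Mequiv u U /\ sqdist U (cst c') = sqdist u (@bubble R n.+1 c xi).
Proof.
move=> gu hxi.
have H k : (k <= n.+2)%N -> exists (U : S -> R) (c' : R) (xi' : T), [/\ Mequiv u U, unit_ball xi',
    sqdist U (@bubble R n.+1 c' xi') = sqdist u (@bubble R n.+1 c xi) &
    forall j : 'I_n.+2, (j < k)%N -> tnth xi' j = 0].
  elim: k => [|k IH] kn.
    by exists u, c, xi; split=> //; exact: Mequiv_refl.
  have [U [c' [xi' [mU h' e z]]]] := IH (ltnW kn).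
  have gU : admissible U by case: mU.
  have [U2 [c2 [xi2 [m2 h2 e2 z2 zz2]]]] := Mequiv_kill (Ordinal kn) c' gU h'.
  have m3 := Mequiv_trans mU m2.
  have e3 := etrans e2 e.
  have z3 : forall j : 'I_n.+2, (j < k.+1)%N -> tnth xi2 j = 0.
    move=> j; rewrite ltnS leq_eqVlt => /predU1P[jk|jk]; last exact/zz2/z.
    have -> : j = Ordinal kn by exact: val_inj.
    exact: z2.
  by exists U2, c2, xi2; split; [exact: m3|exact: h2|exact: e3|exact: z3].
have [U [c' [xi' [mU h' e z]]]] := H _ (leqnn _).
have cE : cst c' = bubble c' xi' :> (S -> R).
  by apply/funext => w; exact: esym (bubble0 c' w (fun j => z j (ltn_ord j))).
by exists U, c'; split; [exact: mU|rewrite cE; exact: e].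
Qed.

End Bubbles.

(** * Stability *)

Section LogTaylor.
Context {R : realType}.
Implicit Types x y t : R.

Lemma ln1D_ge x : -1 < x -> x / (1 + x) <= ln (1 + x).
Proof.
move=> x1; have y0 : 0 < 1 + x by rewrite -ltrBlDl sub0r.
have h : -1 < (1 + x)^-1 - 1 by rewrite ltrBrDr addNr invr_gt0.
have := le_ln1Dx h; rewrite addrC subrK lnV ?posrE// lerNl; apply: le_trans.
by rewrite (_ : x / (1 + x) = - ((1 + x)^-1 - 1)) //; field; rewrite gt_eqF.
Qed.

(** Its derivative $(t-1)^3/t$ changes sign at 1 only, so its minimum is the value 0 at $t=1$. *)
Let cubic t : R := (t - 1) - (t - 1) ^+ 2 / 2 + (t - 1) ^+ 3 / 3 - ln t.

Let is_derive_cubic t : 0 < t -> is_derive t (1 : R) cubic ((t - 1) ^+ 3 / t).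
Proof.
move=> t0; pose g : R -> R := id - cst 1.
have dl := is_derive1_ln t0.
have -> : cubic = g - 2^-1 *: g ^+ 2 + 3^-1 *: g ^+ 3 - @ln R.
  apply/funext => s; rewrite /cubic /g /= !fctE /=.
  by congr (_ - _ + _ - _); rewrite [RHS]mulrC.
have dg : is_derive t 1 g (1 - 0) by apply: is_deriveB.
have d2 := @is_deriveX _ _ g 2 t 1 _ dg; have d3 := @is_deriveX _ _ g 3 t 1 _ dg.
have z2 := @is_deriveZ _ _ _ _ 2^-1 t 1 _ d2; have z3 := @is_deriveZ _ _ _ _ 3^-1 t 1 _ d3.
apply: (is_derive_eq (is_deriveB (is_deriveD (is_deriveB dg z2) z3) dl)).
have -> : g t = t - 1 by [].
by rewrite /GRing.scale/=; field; rewrite gt_eqF.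
Qed.

Let cubic_ge0 t : 0 < t -> 0 <= cubic t.
Proof.
move=> t0; have c1 : cubic 1 = 0 by rewrite /cubic ln1; field.
have dd s : 0 < s -> derivable cubic s 1 by move=> s0; have [] := is_derive_cubic s0.
have d1 (s : R) : 0 < s -> derive1 cubic s = (s - 1) ^+ 3 / s.
  by move=> s0; rewrite derive1E; have [_ ->] := is_derive_cubic s0.
have cont b1 b2 : 0 < b1 -> {within `[b1, b2], continuous cubic}.
  move=> b0; apply: derivable_within_continuous => s; rewrite in_itv/= => /andP[bs _].
  by apply: dd; exact: lt_le_trans bs.
have [t1|/ltW t1] := leP t 1.
  rewrite -c1; apply: (@ler0_derive1_nincr _ cubic t 1 _ _ _ t 1 (lexx t) t1 (lexx 1)).
  - by move=> s; rewrite in_itv/= => /andP[ts _]; apply: dd; exact: lt_trans ts.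
  - move=> s; rewrite in_itv/= => /andP[ts s1]; have s0 := lt_trans t0 ts.
    rewrite d1// ler_pdivrMr// mul0r exprS nmulr_rle0 ?sqr_ge0// subr_lt0//.
  - exact: cont.
rewrite -c1; apply: (@ger0_derive1_ndecr _ cubic 1 t _ _ _ 1 t (lexx 1) t1 (lexx t)).
- by move=> s; rewrite in_itv/= => /andP[s1 _]; apply: dd; exact: lt_trans s1.
- move=> s; rewrite in_itv/= => /andP[s1 _]; have s0 := lt_trans ltr01 s1.
  by rewrite d1//; apply: divr_ge0 (ltW s0); rewrite exprn_ge0// subr_ge0 ltW.
- exact: cont.
Qed.

Lemma ln1D_le_cubic x : -1 < x -> ln (1 + x) <= x - x ^+ 2 / 2 + x ^+ 3 / 3.
Proof.
move=> x1; have y0 : 0 < 1 + x by rewrite -ltrBlDl sub0r.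
have := cubic_ge0 y0; rewrite /cubic (addrC 1) addrK; move: (ln _) => l; lra.
Qed.

(** The upper bound [ln1D_le_cubic] applied to $1/(1+x)$. *)
Lemma ln1D_ge_cubic x : `|x| <= 2^-1 -> x - x ^+ 2 / 2 - 4 * `|x| ^+ 3 <= ln (1 + x).
Proof.
move=> x1; have := x1; rewrite ler_norml => /andP[xm xM].
have y0 : 0 < 1 + x by lra.
have z1 : -1 < (1 + x)^-1 - 1 by rewrite ltrBrDr addNr invr_gt0.
have := ln1D_le_cubic z1; rewrite addrC subrK lnV ?posrE// => h.
pose w := (1 + x)^-1; have w2 : 0 <= w <= 2.
  rewrite invr_ge0 ltW//= -[X in _ <= X](invrK 2) lef_pV2 ?posrE ?invr_gt0//; lra.
have wx : w - 1 = - (x * w) by rewrite /w; field; rewrite gt_eqF.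
have e1 : w = 1 - x * w by rewrite -wx; ring.
rewrite -/w wx in h.
have e2 : x * w + (x * w) ^+ 2 / 2 = x - x ^+ 2 / 2 + x ^+ 4 * w ^+ 2 / 2.
  by rewrite /w; field; rewrite gt_eqF.
have xn := normr_ge0 x.
have h3 : - (`|x| ^+ 3 * w ^+ 3) <= (x * w) ^+ 3.
  have : `|(x * w) ^+ 3| = `|x| ^+ 3 * w ^+ 3.
    by rewrite normrX normrM exprMn (ger0_norm (_ : 0 <= w))//; case/andP: w2.
  by have := ler_norm (- (x * w) ^+ 3); rewrite normrN => *; lra.
have w3 : w ^+ 3 <= 8.
  have -> : (8 : R) = 2 ^+ 3 by rewrite -natrX.
  by case/andP: w2 => ? ?; rewrite lerXn2r// nnegrE.
have h4 : `|x| ^+ 3 * w ^+ 3 <= `|x| ^+ 3 * 8 by rewrite ler_wpM2l// exprn_ge0.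
have h5 : 0 <= x ^+ 4 * w ^+ 2 by rewrite mulr_ge0 ?exprn_even_ge0//.
have q0 : 0 <= `|x| ^+ 3 by rewrite exprn_ge0.
have m1 : (-1 : R) ^+ 3 = -1 by rewrite -signr_odd expr1.
move: h h3 h4 h5 e2 q0; rewrite sqrrN exprNn m1.
move: (x * w) (ln (1 + x)) (`|x| ^+ 3 * w ^+ 3) (`|x| ^+ 3) (x ^+ 4 * w ^+ 2) => p l qw q r.
by move: (p ^+ 3) (p ^+ 2) => p3 p2 *; lra.
Qed.

Lemma sqr_ln_upper x : `|x| <= 2^-1 ->
  (1 + x) ^+ 2 * ln ((1 + x) ^+ 2) <= 2 * x + 3 * x ^+ 2 + `|x| ^+ 3.
Proof.
move=> x1; have := x1; rewrite ler_norml => /andP[xm xM].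
have y0 : 0 < 1 + x by lra.
rewrite lnXn// -[ln _ *+ 2]mulr_natl.
have h := ln1D_le_cubic (_ : -1 < x); have {}h := h ltac:(lra).
rewrite (@le_trans _ _ ((1 + x) ^+ 2 * (2 * (x - x ^+ 2 / 2 + x ^+ 3 / 3))))//.
  by rewrite ler_wpM2l ?sqr_ge0// ler_wpM2l.
have -> : (1 + x) ^+ 2 * (2 * (x - x ^+ 2 / 2 + x ^+ 3 / 3)) =
  2 * x + 3 * x ^+ 2 + x ^+ 3 * ((2 + x + 2 * x ^+ 2) / 3) by field.
rewrite lerD2l; have b0 : 0 <= (2 + x + 2 * x ^+ 2) / 3 <= 1 by nra.
case/andP: b0 => b0 b1.
by rewrite (le_trans (ler_norm _))// normrM normrX (ger0_norm b0) ler_piMr.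
Qed.

Lemma sqr_ln_lower x : `|x| <= 2^-1 ->
  2 * x + 3 * x ^+ 2 - 19 * `|x| ^+ 3 <= (1 + x) ^+ 2 * ln ((1 + x) ^+ 2).
Proof.
move=> x1; have := x1; rewrite ler_norml => /andP[xm xM].
have y0 : 0 < 1 + x by lra.
rewrite lnXn// -[ln _ *+ 2]mulr_natl.
have h := ln1D_ge_cubic x1.
rewrite (@le_trans _ _ ((1 + x) ^+ 2 * (2 * (x - x ^+ 2 / 2 - 4 * `|x| ^+ 3))))//; last first.
  by rewrite ler_wpM2l ?sqr_ge0// ler_wpM2l.
have -> : (1 + x) ^+ 2 * (2 * (x - x ^+ 2 / 2 - 4 * `|x| ^+ 3)) =
  2 * x + 3 * x ^+ 2 - x ^+ 4 - 8 * (1 + x) ^+ 2 * `|x| ^+ 3 by field.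
have q0 : 0 <= `|x| ^+ 3 by rewrite exprn_ge0.
have h4 : x ^+ 4 <= `|x| ^+ 3.
  have -> : x ^+ 4 = `|x| ^+ 3 * `|x|.
    by rewrite -exprSr -normrX ger0_norm// exprn_even_ge0.
  by rewrite ler_piMr// (le_trans x1)// invf_le1// ler1n.
have h5 : (1 + x) ^+ 2 * `|x| ^+ 3 <= 9 / 4 * `|x| ^+ 3 by rewrite ler_wpM2r//; nra.
rewrite -[8 * _ * _]mulrA.
by move: ((1 + x) ^+ 2 * `|x| ^+ 3) (x ^+ 4) (`|x| ^+ 3) h5 h4 q0 => *; lra.
Qed.

(** [t] is the excess of $|x|$ over the truncation level. As $t\ge dl$, the terms in $t$ and in
    $t^2$ are at most multiples of $t^2/dl$, and these multiples add up to 22. *)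
Lemma sqr_ln_large dl t x : 0 < dl <= 2^-1 -> dl <= t -> `|x| = t + dl ->
  (1 + x) ^+ 2 * ln ((1 + x) ^+ 2) - 2 * x - 3 * x ^+ 2 <= t ^+ 2 * (ln (t ^+ 2) + 22 / dl).
Proof.
move=> /andP[d0 d1] dt xE; have t0 := lt_le_trans d0 dt.
have y1 : 1 < 1 + dl + t by lra.
have y0 : 0 < 1 + dl + t by lra.
have s1 : (1 + x) ^+ 2 * ln ((1 + x) ^+ 2) <= (1 + dl + t) ^+ 2 * ln ((1 + dl + t) ^+ 2).
  have le2 : (1 + x) ^+ 2 <= (1 + dl + t) ^+ 2.
    rewrite -real_normK ?num_real//; apply: lerXn2r; rewrite ?nnegrE ?normr_ge0//; first exact: ltW.
    by rewrite (le_trans (ler_normD _ _))// normr1 xE; lra.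
  have l0 : 0 <= ln ((1 + dl + t) ^+ 2) by rewrite ln_ge0// exprn_ege1// ltW.
  have [h|h] := leP ((1 + x) ^+ 2) 1.
    apply: (@le_trans _ _ 0); last exact: mulr_ge0 (sqr_ge0 _) l0.
    exact: mulr_ge0_le0 (sqr_ge0 _) (ln_le0 h).
  apply: ler_pM; [exact: sqr_ge0|by rewrite ln_ge0// ltW|exact: le2|].
  have h0 : 0 < (1 + x) ^+ 2 := lt_trans ltr01 h.
  by rewrite ler_ln ?posrE// exprn_gt0.
have L1 : ln (1 + dl + t) <= 2 * t.
  have : ln (1 + (dl + t)) <= dl + t by apply: le_ln1Dx; lra.
  by rewrite addrA; move: (ln _) => l; lra.
have L0 : 0 <= ln (1 + dl + t) by rewrite ln_ge0// ltW.
have L2 : t ^+ 2 * ln (1 + dl + t) <= t ^+ 2 * ln t + (1 + dl) * t.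
  have -> : ln (1 + dl + t) = ln t + ln (1 + (1 + dl) / t).
    rewrite -lnM ?posrE ?addr_gt0 ?divr_gt0//; last lra.
    by congr ln; field; rewrite gt_eqF.
  have h : ln (1 + (1 + dl) / t) <= (1 + dl) / t.
    by apply: le_ln1Dx; rewrite (lt_le_trans (ltrN10 R))// divr_ge0 ?ltW//; lra.
  rewrite mulrDr lerD2l (le_trans (ler_wpM2l (sqr_ge0 t) h))// le_eqVlt; apply/orP; left.
  by apply/eqP; field; rewrite gt_eqF.
have k1 : t <= t ^+ 2 / dl by rewrite ler_pdivlMr// expr2 ler_pM2l.
have e1 : ln ((1 + dl + t) ^+ 2) = 2 * ln (1 + dl + t) by rewrite lnXn// mulr_natl.
have e2 : ln (t ^+ 2) = 2 * ln t by rewrite lnXn// mulr_natl.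
rewrite e1 in s1; rewrite e2.
have s2 : (1 + dl + t) ^+ 2 * (2 * ln (1 + dl + t)) <=
    2 * (t ^+ 2 * ln t) + 2 * ((1 + dl) * t) + 2 * ((1 + dl) ^+ 2 + 2 * (1 + dl) * t) * (2 * t).
  have -> : (1 + dl + t) ^+ 2 * (2 * ln (1 + dl + t)) = 2 * (t ^+ 2 * ln (1 + dl + t)) +
    2 * ((1 + dl) ^+ 2 + 2 * (1 + dl) * t) * ln (1 + dl + t) by ring.
  rewrite lerD//; first by move: L2; move: (t ^+ 2 * _) (t ^+ 2 * _) ((1 + dl) * t) => *; lra.
  apply: ler_wpM2l => //; rewrite mulr_ge0// addr_ge0 ?sqr_ge0// !mulr_ge0 ?ltW//; lra.
have xn : - x <= t + dl by rewrite -xE -normrN ler_norm.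
have x2 : 0 <= x ^+ 2 by rewrite sqr_ge0.
have s3 : 2 * ((1 + dl) * t) + 2 * ((1 + dl) ^+ 2 + 2 * (1 + dl) * t) * (2 * t) + 2 * (t + dl) <=
    16 * t + 12 * t ^+ 2.
  have t2 : 0 <= t ^+ 2 by rewrite sqr_ge0.
  have a1 : dl * t <= 2^-1 * t by rewrite ler_wpM2r// ltW.
  have a2 : dl * (dl * t) <= 2^-1 * (2^-1 * t) by rewrite ler_pM ?mulr_ge0// ltW.
  have a3 : dl * t ^+ 2 <= 2^-1 * t ^+ 2 by rewrite ler_wpM2r.
  have -> : 2 * ((1 + dl) * t) + 2 * ((1 + dl) ^+ 2 + 2 * (1 + dl) * t) * (2 * t) + 2 * (t + dl) =
    8 * t + 10 * (dl * t) + 4 * (dl * (dl * t)) + 8 * t ^+ 2 + 8 * (dl * t ^+ 2) + 2 * dl by ring.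
  by move: (dl * t) (dl * (dl * t)) (t ^+ 2) (dl * t ^+ 2) t2 a1 a2 a3 => *; lra.
have k2 : t ^+ 2 <= 2^-1 * (t ^+ 2 / dl).
  rewrite mulrCA ler_peMr ?sqr_ge0// ler_pdivlMr// mul1r; lra.
rewrite mulrDr [t ^+ 2 * (22 / _)](_ : _ = 22 * (t ^+ 2 / dl)); last by ring.
rewrite [t ^+ 2 * (2 * _)](_ : _ = 2 * (t ^+ 2 * ln t)); last by ring.
move: s1 s2 s3 xn x2 k1 k2.
move: (_ * ln ((1 + x) ^+ 2)) (_ * (2 * ln (1 + dl + t))) (t ^+ 2 * ln t) (t ^+ 2 / dl)
  (2 * ((1 + dl) * t)) (_ * (2 * t)) => q1 q2 q3 q4 q5 q6 s1 s2 s3 xn x2 k1 k2; lra.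
Qed.

(** [nu] will be the mass of the perturbation. For $|x|>2\,dl$ its smallness makes $\ln(t^2/\nu)$
    exceed $\ln t^2$ by at least $B+22/dl$. For $|x|\le2\,dl$ the second-order expansion applies,
    and $Bt^2$ is absorbed by the logarithm if $t^2\ge e^B\nu$, otherwise by a small multiple of
    $x^2$. *)
Lemma sqr_ln_main dl B nu x : 0 < dl <= 4^-1 -> 0 <= B -> 0 < nu ->
  ln nu <= - B - 22 / dl -> let t := Num.max (`|x| - dl) 0 in
  (1 + x) ^+ 2 * ln ((1 + x) ^+ 2) <= 2 * x + 3 * x ^+ 2 +
    (2 * dl + expR B * B * nu / dl ^+ 2) * x ^+ 2 + t ^+ 2 * lnp (t ^+ 2 / nu) - B * t ^+ 2.
Proof.
move=> /andP[d0 d1] B0 nu0 lnu; set t := Num.max _ _; rewrite /=.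
have t0 : 0 <= t by rewrite le_max lexx orbT.
have x2 : `|x| ^+ 2 = x ^+ 2 by rewrite real_normK// num_real.
have c0 : 0 <= expR B * B * nu / dl ^+ 2.
  apply: divr_ge0 (sqr_ge0 _); apply: mulr_ge0 (ltW nu0); exact: mulr_ge0 (expR_ge0 _) B0.
have l0 := lnp_ge0 (t ^+ 2 / nu).
have [xs|xl] := leP `|x| (2 * dl).
  have x1 : `|x| <= 2^-1 by lra.
  have h := sqr_ln_upper x1.
  have h3 : `|x| ^+ 3 <= 2 * dl * x ^+ 2 by rewrite exprS x2 ler_wpM2r ?sqr_ge0.
  have h4 : B * t ^+ 2 <= expR B * B * nu / dl ^+ 2 * x ^+ 2 + t ^+ 2 * lnp (t ^+ 2 / nu).
    have [tE|tgt] := leP (`|x| - dl) 0.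
      have -> : t = 0 by rewrite /t; apply/max_idPr.
      by rewrite expr0n/= mulr0 mul0r addr0 mulr_ge0 ?sqr_ge0.
    have [hA|hA] := leP (expR B * nu) (t ^+ 2).
      rewrite (@le_trans _ _ (t ^+ 2 * lnp (t ^+ 2 / nu)))//; last first.
        by rewrite lerDr mulr_ge0 ?sqr_ge0.
      rewrite mulrC ler_wpM2l ?sqr_ge0// /lnp.
      have hA' : expR B <= t ^+ 2 / nu by rewrite ler_pdivlMr.
      rewrite -[X in X <= _](expRK B) ler_ln ?posrE ?expR_gt0//; last by rewrite lt_max ltr01.
      by rewrite le_max hA' orbT.
    rewrite (@le_trans _ _ (expR B * B * nu / dl ^+ 2 * x ^+ 2))//; last first.
      by rewrite lerDl mulr_ge0 ?sqr_ge0.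
    rewrite (@le_trans _ _ (B * (expR B * nu)))//; first by rewrite ler_wpM2l// ltW.
    rewrite (_ : _ * x ^+ 2 = B * (expR B * nu) * (x ^+ 2 / dl ^+ 2)); last by ring.
    have bn0 : 0 <= B * (expR B * nu) by exact: mulr_ge0 B0 (mulr_ge0 (expR_ge0 _) (ltW nu0)).
    rewrite ler_peMr//.
    rewrite ler_pdivlMr ?exprn_gt0// mul1r -x2 ler_sqr ?nnegrE ?ltW//; lra.
  move: h h3 h4; rewrite [(2 * dl + _) * _]mulrDl.
  move: ((1 + x) ^+ 2 * ln ((1 + x) ^+ 2)) (2 * dl * x ^+ 2) (`|x| ^+ 3) (B * t ^+ 2)
    (expR B * B * nu / dl ^+ 2 * x ^+ 2) (t ^+ 2 * lnp _) (x ^+ 2).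
  by move=> q1 q2 q3 q4 q5 q6 q7 h h3 h4; lra.
have tE : t = `|x| - dl by rewrite /t; apply/max_idPl; lra.
have dt : dl <= t by rewrite tE; lra.
have d12 : 0 < dl <= 2^-1 by rewrite d0 /=; lra.
have h := sqr_ln_large d12 dt (_ : `|x| = t + dl).
have {}h := h ltac:(by rewrite tE subrK).
have tgt : 0 < t := lt_le_trans d0 dt.
have h2 : t ^+ 2 * (ln (t ^+ 2) + 22 / dl) <= t ^+ 2 * (lnp (t ^+ 2 / nu) - B).
  rewrite ler_wpM2l ?sqr_ge0//.
  have : ln (t ^+ 2) - ln nu <= lnp (t ^+ 2 / nu).
    rewrite -ln_div ?posrE ?exprn_gt0// /lnp ler_ln ?posrE ?divr_gt0 ?exprn_gt0//.
      by rewrite le_max lexx orbT.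
    by rewrite lt_max ltr01.
  by move: lnu; move: (22 / dl) (ln _) (ln nu) (lnp _) => q1 q2 q3 q4; lra.
have h3 : 0 <= (2 * dl + expR B * B * nu / dl ^+ 2) * x ^+ 2.
  by rewrite mulr_ge0 ?sqr_ge0// addr_ge0// mulr_ge0// ltW.
move: h h2 h3; rewrite [t ^+ 2 * (_ - B)]mulrBr [t ^+ 2 * B]mulrC.
move: ((1 + x) ^+ 2 * ln ((1 + x) ^+ 2)) (t ^+ 2 * (ln (t ^+ 2) + 22 / dl))
  (t ^+ 2 * lnp _) (B * t ^+ 2) => q1 q2 q4 q5.
move: (_ * x ^+ 2) => q3.
by move: (x ^+ 2) => q6 h h2 h3; lra.
Qed.

End LogTaylor.

(** * Scalar inequalities for the bubbles *)

Section PowerTaylor.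
Context {R : realType}.
Variable a : R.
Hypothesis a0 : 0 < a.
Implicit Types x s t : R.

Lemma powRN_ge x : -1 < x -> 1 - a * x <= (1 + x) `^ (- a).
Proof.
move=> x1; have y0 : 0 < 1 + x by rewrite -ltrBlDl sub0r.
rewrite /powR gt_eqF// (le_trans _ (expR_ge1Dx _))// lerD2l mulNr lerN2.
by rewrite ler_pM2l// le_ln1Dx.
Qed.

Lemma powR_ge x : -1 < x -> 1 + a * (x / (1 + x)) <= (1 + x) `^ a.
Proof.
move=> x1; have y0 : 0 < 1 + x by rewrite -ltrBlDl sub0r.
by rewrite /powR gt_eqF// (le_trans _ (expR_ge1Dx _))// lerD2l ler_pM2l// ln1D_ge.
Qed.

Lemma powRN_taylor x : `|x| <= (4 * (a + 1))^-1 ->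
  `|(1 + x) `^ (- a) - 1 + a * x| <= (2 * a + 3 * a ^+ 2) * x ^+ 2.
Proof.
move=> x1; have ap := a0; have a10 : 0 < 4 * (a + 1) by lra.
have ax : a * `|x| <= 4^-1.
  rewrite (le_trans (ler_wpM2l (ltW a0) x1))// ler_pdivrMr//; lra.
have x4 : `|x| <= 4^-1 by rewrite (le_trans x1)// lef_pV2 ?posrE//; lra.
have := x4; rewrite ler_norml => /andP[xm xM].
have xN1 : -1 < x by lra.
have y0 : 0 < 1 + x by lra.
pose w := (1 + x)^-1; have w43 : 0 <= w <= 4 / 3.
  by rewrite invr_ge0 ltW//= -[X in _ <= X]invf_div lef_pV2 ?posrE//; lra.
pose z := a * (x * w).
have zl : `|z| <= 3^-1.
  rewrite /z !normrM (gtr0_norm a0) mulrA (@le_trans _ _ (4^-1 * (4 / 3)))//.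
    case/andP: w43 => w0 w1; rewrite (ger0_norm w0); apply: ler_pM => //.
    exact: mulr_ge0 (ltW a0) (normr_ge0 x).
  by rewrite mulrA mulVf// mul1r.
have zl' := zl; rewrite ler_norml in zl'; case/andP: zl' => zm zM.
have z1 : 0 < 1 + z by lra.
have up : (1 + x) `^ (- a) <= 1 - z + 3 / 2 * z ^+ 2.
  rewrite powRN (@le_trans _ _ (1 + z)^-1)//.
    by rewrite lef_pV2 ?posrE ?powR_gt0//; exact: powR_ge.
  rewrite -div1r ler_pdivrMr//.
  have -> : (1 - z + 3 / 2 * z ^+ 2) * (1 + z) = 1 + z ^+ 2 * (1 / 2 + 3 / 2 * z) by field.
  by rewrite lerDl mulr_ge0 ?sqr_ge0//; lra.
have lo := powRN_ge xN1.
have zE : - z = - a * x + a * (x ^+ 2 * w) by rewrite /z /w; field; rewrite gt_eqF.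
have x2 : 0 <= x ^+ 2 by rewrite sqr_ge0.
have b1 : a * (x ^+ 2 * w) <= a * (x ^+ 2 * (4 / 3)).
  by case/andP: w43 => w0 w1; rewrite !ler_wpM2l// ltW.
have b2 : z ^+ 2 <= a ^+ 2 * (x ^+ 2 * 2).
  rewrite /z !exprMn ler_wpM2l ?sqr_ge0// ler_wpM2l//.
  rewrite (@le_trans _ _ ((4 / 3) ^+ 2))//; last by lra.
  by case/andP: w43 => w0 w1; rewrite ler_sqr ?nnegrE//; lra.
have b3 : 0 <= a * x ^+ 2 by rewrite mulr_ge0// ltW.
have b4 : 0 <= a ^+ 2 * x ^+ 2 by rewrite mulr_ge0 ?sqr_ge0.
rewrite (_ : a * (x ^+ 2 * (4 / 3)) = 4 / 3 * (a * x ^+ 2)) in b1; last by ring.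
rewrite (_ : a ^+ 2 * (x ^+ 2 * 2) = 2 * (a ^+ 2 * x ^+ 2)) in b2; last by ring.
rewrite (_ : _ * x ^+ 2 = 2 * (a * x ^+ 2) + 3 * (a ^+ 2 * x ^+ 2)); last by ring.
rewrite mulNr in zE; rewrite ler_norml.
move: up lo b1 b2 b3 b4 zE; move: ((1 + x) `^ _) (a * (x ^+ 2 * w)) (z ^+ 2) (a ^+ 2 * x ^+ 2) (a * x ^+ 2) (a * x).
by move=> q1 q2 q3 q4 q5 q6 *; lra.
Qed.

(** Uniform up to $s=1$, where the power may blow up: away from 0 the remainder is controlled by the
    power itself, whence the weight $(1-st)^{-a}+1$. *)
Lemma powRN_taylor_global : exists2 C : R, 0 <= C & forall s t, 0 <= s < 1 -> `|t| <= 1 ->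
  `|(1 - s * t) `^ (- a) - 1 - a * (s * t)| <= C * s ^+ 2 * ((1 - s * t) `^ (- a) + 1).
Proof.
have ap := a0; pose x0 := (4 * (a + 1))^-1; have x00 : 0 < x0 by rewrite invr_gt0; lra.
pose C1 := 2 * a + 3 * a ^+ 2; pose C2 := (1 + a) / x0 ^+ 2.
have C10 : 0 <= C1 by rewrite addr_ge0 ?mulr_ge0 ?sqr_ge0 ?ltW.
have C20 : 0 <= C2 by rewrite divr_ge0 ?sqr_ge0//; lra.
exists (C1 + C2) => [|s t /andP[s0 s1] t1]; first exact: addr_ge0.
have v0 : 0 <= (1 - s * t) `^ (- a) by exact: powR_ge0.
have st : `|s * t| <= s by rewrite normrM (ger0_norm s0) ler_piMr.
have s2 := sqr_ge0 s.
have [h|h] := leP `|s * t| x0.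
  have := powRN_taylor (_ : `|- (s * t)| <= x0); rewrite normrN => /(_ h).
  rewrite mulrN -/C1 => /le_trans -> //.
  rewrite sqrrN exprMn.
  have t2 : t ^+ 2 <= 1 by rewrite -real_normK ?num_real// exprn_ile1.
  have hh : s ^+ 2 * t ^+ 2 <= s ^+ 2 by rewrite ler_piMr.
  rewrite (@le_trans _ _ (C1 * s ^+ 2)) ?ler_wpM2l//.
  rewrite (@le_trans _ _ ((C1 + C2) * s ^+ 2)) ?ler_wpM2r ?lerDl//.
  by rewrite ler_peMr ?lerDr// mulr_ge0// addr_ge0.
have sx : x0 <= s by rewrite (le_trans (ltW h)).
have k : 1 <= s ^+ 2 / x0 ^+ 2.
  by rewrite ler_pdivlMr ?exprn_gt0// mul1r ler_sqr ?nnegrE// ltW.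
rewrite (@le_trans _ _ ((1 + a) * ((1 - s * t) `^ (- a) + 1)))//.
  have h1 := ler_normB ((1 - s * t) `^ (- a) - 1) (a * (s * t)).
  have h2 := ler_normB ((1 - s * t) `^ (- a)) 1.
  have h3 : `|a * (s * t)| <= a.
    by rewrite normrM (gtr0_norm a0); apply: ler_piMr (ltW a0) (le_trans st (ltW s1)).
  have h4 : 0 <= a * (1 - s * t) `^ (- a) by rewrite mulr_ge0// ltW.
  rewrite normr1 (ger0_norm v0) in h2; rewrite mulrDl mul1r mulrDr mulr1.
  by move: h1 h2 h3 h4; move=> *; lra.
rewrite ler_wpM2r ?addr_ge0// (@le_trans _ _ (C2 * s ^+ 2)) ?ler_wpM2r ?lerDr//.
by rewrite /C2 mulrAC -mulrA ler_peMr//; lra.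
Qed.

(** A quantitative form of the fact that $(1-st)^{-a}-1$ has the sign of $t$; it bounds the first
    moment of a bubble from below. *)
Lemma powRN_mono s t : 0 <= s < 1 -> `|t| <= 1 ->
  a / (2 * (1 + a)) * s * (t ^+ 2 * (1 - s * t) `^ (- a)) <= ((1 - s * t) `^ (- a) - 1) * t.
Proof.
move=> /andP[s0 s1] t1; set c := a / _.
have ap := a0; have a1 : 0 < 2 * (1 + a) by lra.
have c0 : 0 <= c by rewrite divr_ge0// ltW.
have cE : c * (1 + a) = a / 2 by rewrite /c; field; lra.
have st : `|s * t| < 1 by rewrite normrM (ger0_norm s0) (le_lt_trans _ s1)// ler_piMr.
have := st; rewrite ltr_norml => /andP[stm stM].
have y0 : 0 < 1 - s * t by lra.
have v0 : 0 < (1 - s * t) `^ (- a) by rewrite powR_gt0.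
have [tp|tn] := leP 0 t.
  have x0 : 0 <= s * t by rewrite mulr_ge0.
  have h := powRN_ge (_ : -1 < - (s * t)); have {}h := h ltac:(lra).
  rewrite mulrN opprK in h.
  rewrite (_ : _ * (t ^+ 2 * _) = (c * (s * t) * (1 - s * t) `^ (- a)) * t); last by ring.
  rewrite ler_wpM2r// lerBrDr addrC -lerBrDr.
  move: h v0 x0 stM; move: ((1 - s * t) `^ _) => v; move: (s * t) => x h v0 x0 xM.
  have cx : c * x <= c by rewrite ler_piMr// ltW.
  have cl : c <= 1 / 2 by rewrite /c ler_pdivrMr//; lra.
  rewrite (_ : v - c * x * v = v * (1 - c * x)); last by ring.
  rewrite (@le_trans _ _ ((1 + a * x) * (1 - c * x)))//; last by rewrite ler_wpM2r//; lra.
  rewrite (_ : _ * _ = 1 + x * (a - c * (1 + a * x))); last by ring.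
  rewrite lerDl mulr_ge0//.
  have : c * (1 + a * x) <= c * (1 + a) by rewrite ler_wpM2l// lerD2l ler_piMr ?ltW.
  by rewrite cE; move: (c * _) => q; lra.
have x0 : 0 <= - (s * t) by rewrite -mulrN mulr_ge0// oppr_ge0 ltW.
have h := powR_ge (_ : -1 < - (s * t)); have {}h := h ltac:(lra).
rewrite (_ : _ * (t ^+ 2 * _) = (c * (- (s * t)) * (1 - s * t) `^ (- a)) * - t); last by ring.
rewrite (_ : (_ - 1) * t = (1 - (1 - s * t) `^ (- a)) * - t); last by ring.
apply: ler_wpM2r; first by rewrite oppr_ge0 ltW.
rewrite powRN; have w0 : 0 < (1 - s * t) `^ a by rewrite powR_gt0.
rewrite lerBrDr -(ler_pM2r w0) mul1r mulrDl divfK ?gt_eqF// mulVf ?gt_eqF//.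
rewrite addrC (le_trans _ h)// lerD2l.
have x1 : - (s * t) <= 1 by lra.
rewrite mulrA ler_pdivlMr// /c; move: (- (s * t)) x0 x1 => x x0 x1.
have e : a / (2 * (1 + a)) * x * (1 + x) = a * x * ((1 + x) / (2 * (1 + a))) by ring.
rewrite e ler_piMr ?mulr_ge0 ?(ltW a0)// ler_pdivrMr// mul1r; lra.
Qed.

End PowerTaylor.

Lemma lee_cvg (R : realType) (u v : nat -> \bar R) (l m : \bar R) :
  (u @ \oo --> l -> v @ \oo --> m -> (forall N, u N <= v N) -> l <= m)%E.
Proof.
move=> ul vm uv; rewrite -(cvg_lim _ ul)// -(cvg_lim _ vm)//.
by apply: lee_lim; [exact: cvgP ul|exact: cvgP vm|exact: nearW].
Qed.

(** * Functions of degree at most one *)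

Section DegreeOne.
Context {R : realType} {n : nat}.
Notation S := (sphere R n.+1).
Notation dw := (@surface R n.+1).
Notation I f := (Rintegral dw setT f).
Notation a := (n.+1%:R / 2 : R).
Notation sph := (fine (dw setT)).
Notation T := (n.+2.-tuple R).
Implicit Types (x y z w : S) (u r : S -> R).

Lemma bmeas_cosdM x y : bmeas (fun w : S => cosd x w * cosd y w).
Proof. by apply: bmeasM; exact: bmeas_cosd. Qed.

(** The case $i=j=0$ of [zonal_divergence]; [I_cosd_cosd] is the case $i=0$, $j=1$. *)
Lemma I_cosd x : I (fun w => cosd x w) = 0.
Proof.
have h : I (fun w => - n.+1%:R * cosd x w) = 0.
  transitivity (I (fun w => 0%:R * qd x w ^+ 0.-1 * ((1 - cosd x w ^+ 2) / 2) * qd x w ^+ 0 +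
    qd x w ^+ 0 * (0%:R * qd x w ^+ 0.-1 * ((cosd x x - cosd x w * cosd x w) / 2)) -
    n.+1%:R * cosd x w * (qd x w ^+ 0 * qd x w ^+ 0))); last exact: zonal_divergence.
  by apply: eq_I => w; rewrite !expr0; ring.
rewrite IZ in h; last exact/bmeas_intg/bmeas_cosd.
by move/eqP: h; rewrite mulf_eq0 oppr_eq0 pnatr_eq0/= => /eqP.
Qed.

Lemma I_cosd_cosd x y : I (fun w => cosd x w * cosd y w) = sph / n.+2%:R * cosd x y.
Proof.
have b1 : intg dw (fun w : S => cosd x w) by exact/bmeas_intg/bmeas_cosd.
have b2 : intg dw (fun w : S => cosd x w * cosd y w) by exact/bmeas_intg/bmeas_cosdM.
have h : I (fun w => cosd x y / 2 - n.+1%:R / 2 * cosd x w - n.+2%:R / 2 * (cosd x w * cosd y w)) = 0.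
  transitivity (I (fun w => 0%:R * qd x w ^+ 0.-1 * ((1 - cosd x w ^+ 2) / 2) * qd y w ^+ 1 +
    qd x w ^+ 0 * (1%:R * qd y w ^+ 1.-1 * ((cosd x y - cosd x w * cosd y w) / 2)) -
    n.+1%:R * cosd x w * (qd x w ^+ 0 * qd y w ^+ 1))); last exact: zonal_divergence.
  by apply: eq_I => w; rewrite !expr0 expr1 [qd y w]/qd -natr1 -[n.+1%:R]natr1; field.
have ic : intg dw (fun _ : S => cosd x y / 2) by exact/bmeas_intg/bmeas_cst.
rewrite IB in h; [|by apply: intgB => //; exact: intgZ|exact: intgZ].
rewrite IB// in h; last exact: intgZ.
have e1 := IZ (n.+1%:R / 2) b1; have e2 := IZ (n.+2%:R / 2) b2.
rewrite e1 e2 (I_cosd x) mulr0 subr0 in h.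
have e : I (fun _ : S => cosd x y / 2) = cosd x y / 2 * sph by exact: Icst.
rewrite e in h.
have n2 : n.+2%:R != 0 :> R by rewrite pnatr_eq0.
move/eqP: h; rewrite subr_eq0 => /eqP h.
apply: (@mulfI _ (n.+2%:R / 2)); first by rewrite mulf_neq0// invr_eq0 pnatr_eq0.
by rewrite -h; move: (n.+2%:R : R) n2 => N2 n2; field.
Qed.

(** From $j=2$ on, [zonal_mx_rec] with $i=1$ determines the entry, the eigenvalues of indices $j$
    and 1 being different; the cases $j=0,1$ are computed. Hence $G_j$ maps functions of degree at
    most 1 to such functions. *)
Lemma zonal_mx1_affine j : exists A B : R, forall x y, zonal_mx 1 j x y = A + B * cosd x y.
Proof.
have [N] := ubnP j; elim: N j => // N IH [|[|j]] jN.
- exists (sph / 2), 0 => x y; rewrite mul0r addr0.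
  transitivity (I (fun w => 2^-1 + 2^-1 * cosd x w)).
    by apply: eq_I => w; rewrite expr0 expr1 /qd; field.
  have b1 : intg dw (fun w : S => cosd x w) by exact/bmeas_intg/bmeas_cosd.
  rewrite ID; [|exact/bmeas_intg/bmeas_cst|exact: intgZ].
  by rewrite IZ// I_cosd mulr0 addr0 (Icst dw 2^-1) mulrC.
- exists (sph / 4), (sph / n.+2%:R / 4) => x y.
  have b1 z : intg dw (fun w : S => cosd z w) by exact/bmeas_intg/bmeas_cosd.
  have b2 : intg dw (fun w : S => cosd x w * cosd y w) by exact/bmeas_intg/bmeas_cosdM.
  transitivity (I (fun w => 4^-1 + 4^-1 * cosd x w + 4^-1 * cosd y w + 4^-1 * (cosd x w * cosd y w))).
    by apply: eq_I => w; rewrite !expr1 /qd; field.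
  have ic : intg dw (fun _ : S => 4^-1 : R) by exact/bmeas_intg/bmeas_cst.
  rewrite ID; [|by apply: intgD; [apply: intgD => //; exact: intgZ|exact: intgZ]|exact: intgZ].
  rewrite ID; [|by apply: intgD => //; exact: intgZ|exact: intgZ].
  rewrite ID//; last exact: intgZ.
  rewrite !IZ// !I_cosd !mulr0 !addr0 (Icst dw 4^-1) I_cosd_cosd.
  by rewrite [4^-1 * sph]mulrC; congr (_ + _); rewrite mulrA [4^-1 * _]mulrC.
have [A [B AB]] := IH j.+1 (leq_trans (leqnn _) jN).
have ne : beltrami_a (R := R) (n := n) j.+2 - beltrami_a (R := R) (n := n) 1 != 0.
  by rewrite gt_eqF// subr_gt0 beltrami_a_lt.
pose D := beltrami_a (R := R) (n := n) j.+2 - beltrami_a (R := R) (n := n) 1.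
pose b1 := beltrami_b (R := R) (n := n) 1; pose b2 := beltrami_b (R := R) (n := n) j.+2.
exists ((b2 * A - b1 * @qmom R n j.+2) / D), (b2 * B / D) => x y.
have := zonal_mx_rec 1 j.+2 x y; rewrite /= AB.
have -> : zonal_mx 0 j.+2 x y = @qmom R n j.+2.
  by rewrite -(I_qdX y); apply: eq_I => w; rewrite expr0 mul1r.
rewrite -/b1 -/b2 => h; apply: (mulfI ne); rewrite -/D in ne *.
rewrite [LHS](_ : _ = b2 * (A + B * cosd x y) - b1 * @qmom R n j.+2); first by field.
rewrite /D mulrBl; move: h; move: (_ * zonal_mx _ _ _ _) (beltrami_a 1 * _) => p q h.
by move: h; move: (b1 * _) (b2 * _) => X Y h; lra.
Qed.

Lemma gq_cosd_affine j : exists A B : R, forall x y,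
  I (fun w => gq j x w * cosd y w) = A + B * cosd x y.
Proof.
have [A [B AB]] := zonal_mx1_affine j.
exists ((2 * A - @qmom R n j) / @qmom R n j), (2 * B / @qmom R n j) => x y.
have q0 : @qmom R n j != 0 by rewrite gt_eqF// qmom_gt0.
have i1 : intg dw (fun w => qd y w ^+ 1 * qd x w ^+ j).
  by apply: bmeas_intg; apply: bmeasM; apply: bmeasX; exact: bmeas_qd.
have i2 : intg dw (fun w => qd x w ^+ j) by apply: bmeas_intg; apply: bmeasX; exact: bmeas_qd.
transitivity (I (fun w => 2 / @qmom R n j * (qd y w ^+ 1 * qd x w ^+ j) - (@qmom R n j)^-1 * qd x w ^+ j)).
  by apply: eq_I => w; rewrite /gq expr1 [qd y w]/qd; field.
rewrite IB; [|exact: intgZ|exact: intgZ].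
rewrite !IZ// I_qdX -/(zonal_mx 1 j y x) AB [cosd y x]cosdC; field.
exact: q0.
Qed.

Lemma sqi_dotp (z : T) : sqi dw (fun w : S => dotp z (val w)).
Proof. exact/bmeas_sqi/bmeas_dotp. Qed.

Lemma I_dotp (z : T) : I (fun w => dotp z (val w)) = 0.
Proof.
have [eta h] := exists_direction z.
transitivity (I (fun w => enorm z * cosd eta w)); first by apply: eq_I => w; rewrite h.
by rewrite IZ ?I_cosd ?mulr0//; exact/bmeas_intg/bmeas_cosd.
Qed.

Lemma I_dotp_cosd (z : T) y : I (fun w => dotp z (val w) * cosd w y) = sph / n.+2%:R * dotp z (val y).
Proof.
have [eta h] := exists_direction z.
transitivity (I (fun w => enorm z * (cosd eta w * cosd y w))).
  by apply: eq_I => w; rewrite h [cosd w y]cosdC mulrA.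
rewrite IZ; last exact/bmeas_intg/bmeas_cosdM.
by rewrite I_cosd_cosd h mulrCA.
Qed.

Lemma intg_sqi_bmeas u f : sqi dw u -> bmeas f -> intg dw (fun w => u w * f w).
Proof. by move=> hu bf; apply: sqiM hu _; exact: bmeas_sqi. Qed.

(** The factor is the inverse of the integral of a squared coordinate, by [I_cosd_cosd]. *)
Definition deg1_coef r : T := [tuple n.+2%:R / sph * I (fun w => r w * crd w i) | i < n.+2].

Definition deg1_part r w : R := I r / sph + dotp (deg1_coef r) (val w).

Lemma bmeas_deg1_part r : bmeas (deg1_part r).
Proof. by apply: bmeasD; [exact: bmeas_cst|exact: bmeas_dotp]. Qed.

Let sph0 : sph != 0. Proof. by rewrite gt_eqF// surface_gt0. Qed.

Lemma dotp_deg1_coef r y : sqi dw r ->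
  sph / n.+2%:R * dotp (deg1_coef r) (val y) = I (fun w => r w * cosd w y).
Proof.
move=> hr; have n2 : n.+2%:R != 0 :> R by rewrite pnatr_eq0.
have i1 i : intg dw (fun w => r w * crd w i) by apply: intg_sqi_bmeas => //; exact: bmeas_crd.
transitivity (\sum_(i < n.+2) I (fun w => crd y i * (r w * crd w i))).
  rewrite /dotp mulr_sumr; apply: eq_bigr => i _; rewrite tnth_mktuple IZ//.
  rewrite /crd; move: (n.+2%:R : R) n2 (Rintegral _ _ _) => N2 n2 r1.
  by field; rewrite sph0 n2.
rewrite -I_sum; last by move=> i; exact: intgZ.
apply: eq_I => w; rewrite /cosd /dotp mulr_sumr; apply: eq_bigr => i _.
by rewrite /crd; ring.
Qed.

Lemma deg1_orth r : sqi dw r -> I (fun w => r w - deg1_part r w) = 0 /\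
  forall y, I (fun w => (r w - deg1_part r w) * cosd w y) = 0.
Proof.
move=> hr; have ir := sqi_intg hr; have bh := bmeas_deg1_part r.
have ic : intg dw (fun _ : S => I r / sph) by exact/bmeas_intg/bmeas_cst.
have id := sqi_intg (sqi_dotp (deg1_coef r)).
have n2 : n.+2%:R != 0 :> R by rewrite pnatr_eq0.
split=> [|y].
  rewrite IB//; last exact: bmeas_intg.
  by rewrite ID// I_dotp addr0 (Icst dw (I r / sph)) divfK ?subrr.
have b1 : bmeas (fun w : S => cosd w y).
  by have := bmeas_cosd y; congr bmeas; apply/funext => w; rewrite cosdC.
have i1 := intg_sqi_bmeas hr b1.
have i2 : intg dw (fun w => dotp (deg1_coef r) (val w) * cosd w y).
  by apply: bmeas_intg; apply: bmeasM => //; exact: bmeas_dotp.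
have i3 : intg dw (fun w => I r / sph * cosd w y) by apply: intgZ; exact: bmeas_intg.
transitivity (I (fun w => r w * cosd w y - (I r / sph * cosd w y + dotp (deg1_coef r) (val w) * cosd w y))).
  by apply: eq_I => w; rewrite /deg1_part; ring.
rewrite IB//; last exact: intgD.
rewrite ID// IZ; last exact: bmeas_intg.
have -> : I (fun w => cosd w y) = 0.
  by rewrite -(I_cosd y); apply: eq_I => w; rewrite cosdC.
by rewrite mulr0 add0r I_dotp_cosd dotp_deg1_coef// subrr.
Qed.

Lemma orth_deg1 q (c : R) (z : T) : sqi dw q -> I q = 0 -> (forall y, I (fun w => q w * cosd w y) = 0) ->
  I (fun w => q w * (c + dotp z (val w))) = 0.
Proof.
move=> hq q0 q1; have [eta h] := exists_direction z.
have iq := sqi_intg hq.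
have b1 : bmeas (fun w : S => cosd w eta).
  by have := bmeas_cosd eta; congr bmeas; apply/funext => w; rewrite cosdC.
have i1 := intg_sqi_bmeas hq b1.
transitivity (I (fun w => c * q w + enorm z * (q w * cosd w eta))).
  by apply: eq_I => w; rewrite h [cosd w _]cosdC; ring.
by rewrite ID ?IZ ?q0 ?q1 ?mulr0 ?addr0//; exact: intgZ.
Qed.

Lemma gq_deg1 j (c : R) (z : T) : exists (c' : R) (z' : T), forall x,
  I (fun w => gq j x w * (c + dotp z (val w))) = c' + dotp z' (val x).
Proof.
have [eta h] := exists_direction z; have [A [B AB]] := gq_cosd_affine j.
have i1 x : intg dw (fun w => gq j x w) by apply: bmeas_intg; exact: bmeas_gq.
have i2 x : intg dw (fun w => gq j x w * cosd eta w).
  by apply: bmeas_intg; apply: bmeasM; [exact: bmeas_gq|exact: bmeas_cosd].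
exists (c + enorm z * A), [tuple B * tnth z i | i < n.+2] => x.
transitivity (I (fun w => c * gq j x w + enorm z * (gq j x w * cosd eta w))).
  by apply: eq_I => w; rewrite h; ring.
rewrite ID ?IZ ?I_gq//; [|exact: intgZ|exact: intgZ].
have -> : dotp [tuple B * tnth z i | i < n.+2] (val x) = B * dotp z (val x).
  by rewrite /dotp mulr_sumr; apply: eq_bigr => i _; rewrite tnth_mktuple mulrA.
by rewrite h AB [cosd x eta]cosdC; ring.
Qed.

(** Write $r=q+h$ with [h] the projection on degree at most 1. As $G_j$ preserves these functions
    ([gq_deg1]) the forms have no cross terms, and $\langle h,G_jh\rangle\le\|h\|^2$; so the energy
    of [q] is at most that of [r]. *)
Lemma energy_gap_deg1 r : sqi dw r ->
  ((@lam2 R n * (I (fun x => r x ^+ 2) - I (fun x => deg1_part r x ^+ 2)))%:E <= energy r)%E.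
Proof.
move=> hr; pose h := deg1_part r; pose q w := r w - h w.
have bh := bmeas_deg1_part r; have hh := bmeas_sqi dw bh.
have hq : sqi dw q by exact: sqiB.
have [q0 q1] := deg1_orth hr.
have qh (c : R) (z : T) : I (fun w => q w * (c + dotp z (val w))) = 0 by exact: orth_deg1.
have iq := sqi_intg hq; have ih := sqi_intg hh.
have r2 : I (fun x => r x ^+ 2) = I (fun x => q x ^+ 2) + I (fun x => h x ^+ 2).
  transitivity (I (fun x => q x ^+ 2 + h x ^+ 2 + 2 * (q x * h x))).
    by apply: eq_I => x; rewrite /q; ring.
  have iqh := sqiM hq hh.
  rewrite ID; [|exact: intgD (proj2 hq) (proj2 hh)|exact: intgZ].
  rewrite ID ?IZ//; [|exact: (proj2 hq)|exact: (proj2 hh)].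
  by rewrite qh mulr0 addr0.
have -> : I (fun x => r x ^+ 2) - I (fun x => deg1_part r x ^+ 2) = I (fun x => q x ^+ 2).
  by rewrite r2 addrK.
apply: le_trans (energy_gap hq q0 q1) _.
have c1 := cvg_energy hq; have c2 := cvg_energy hr.
apply: (lee_cvg c1 c2) => N; rewrite lee_fin ler_wpM2l//.
  by rewrite mulr_ge0 ?divr_ge0 ?exprn_ge0// ltW// surface_gt0.
apply: ler_sum => j _; rewrite ler_wpM2l ?(ltW (cf_gt0 _ _))//.
have bk : bmeas2 (@gq R n j) by exact: bmeas_gq2.
have [c' [z' hE]] := gq_deg1 j (I r / sph) (deg1_coef r).
have kq x := intg_kernel x bk iq; have kh x := intg_kernel x bk ih.
have bkq := bmeas_kernel bk iq; have bkh := bmeas_kernel bk ih.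
have i1 := intg_sqi_bmeas hq bkq; have i2 := intg_sqi_bmeas hq bkh.
have i3 := intg_sqi_bmeas hh bkq; have i4 := intg_sqi_bmeas hh bkh.
have cr : I (fun x => q x * I (fun y => gq j x y * h y)) = 0.
  rewrite -(qh c' z'); apply: eq_I => x; congr (_ * _); exact: hE.
have cr' : I (fun x => h x * I (fun y => gq j x y * q y)) = 0.
  rewrite (kernel_swap bk ih iq) -cr; apply: eq_I => x; congr (_ * _).
  by apply: eq_I => y; rewrite gqC.
have -> : qform dw (@gq R n j) r = qform dw (@gq R n j) q + qform dw (@gq R n j) h.
  transitivity (I (fun x => q x * I (fun y => gq j x y * q y) + q x * I (fun y => gq j x y * h y) +
    (h x * I (fun y => gq j x y * q y) + h x * I (fun y => gq j x y * h y)))).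
    apply: eq_I => x.
    have -> : I (fun y => gq j x y * r y) = I (fun y => gq j x y * q y) + I (fun y => gq j x y * h y).
      by rewrite -ID//; apply: eq_I => y; rewrite /q; ring.
    by rewrite /q; ring.
  rewrite ID; [|exact: intgD|exact: intgD].
  by rewrite ID// ID// cr cr' addr0 add0r.
have le : qform dw (@gq R n j) h <= I (fun x => h x ^+ 2).
  apply: qform_le_sqr => //; [exact: gqC|exact: gq_ge0|exact: I_gq|exact: (proj2 hh)].
rewrite r2; move: le; move: (qform _ _ q) (qform _ _ h) (I _) (I _) => p1 p2 p3 p4.
lra.
Qed.

Lemma gap_approx : exists2 C : R, 0 <= C & forall r (e : R), sqi dw r ->
  `|I r| <= e -> (forall i, `|I (fun w => r w * crd w i)| <= e) ->
  ((@lam2 R n * I (fun x => r x ^+ 2) - C * e ^+ 2)%:E <= energy r)%E.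
Proof.
have s0 : 0 < sph := surface_gt0 _.
have l0 : 0 <= @lam2 R n.
  have G0 : 0 < Gamma a :> R := Gamma_half_gt0 n.
  rewrite lam2E; apply: addr_ge0; first by apply: mulr_ge0 => //; exact: ltW Cn_gt0.
  apply: divr_ge0; first by apply: mulr_ge0 => //; exact: powR_ge0.
  by apply: mulr_ge0; [exact: ltW|rewrite addr_ge0].
pose K : R := sph^-1 + n.+2%:R * (n.+2%:R / sph).
have K0 : 0 <= K.
  apply: addr_ge0; first by rewrite invr_ge0 ltW.
  by apply: mulr_ge0 => //; apply: divr_ge0 => //; exact: ltW.
exists (@lam2 R n * (K ^+ 2 * sph)) => [|r e hr e1 e2].
  by apply: mulr_ge0 l0 _; apply: mulr_ge0 (sqr_ge0 _) (ltW s0).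
have e0 : 0 <= e by rewrite (le_trans _ e1).
apply: le_trans (energy_gap_deg1 hr); rewrite lee_fin mulrBr lerD2l lerN2 -mulrA.
apply: ler_wpM2l => //.
have hb w : `|deg1_part r w| <= K * e.
  rewrite (le_trans (ler_normD _ _))// mulrDl lerD//.
    by rewrite normrM (gtr0_norm (_ : 0 < sph^-1)) ?invr_gt0// mulrC ler_wpM2l// invr_ge0 ltW.
  rewrite /dotp (le_trans (ler_norm_sum _ _ _))//.
  rewrite (@le_trans _ _ (\sum_(i < n.+2) n.+2%:R / sph * e))//.
    apply: ler_sum => i _; rewrite tnth_mktuple !normrM normfV (gtr0_norm s0) normr_nat.
    rewrite -[leRHS]mulr1; apply: ler_pM => //; first by rewrite mulr_ge0// divr_ge0// ltW.
      by apply: ler_wpM2l; [rewrite divr_ge0// ltW|exact: e2].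
    exact: norm_crd.
  by rewrite sumr_const card_ord -[_ *+ n.+2]mulr_natl mulrA.
have hI : I (fun x => deg1_part r x ^+ 2) <= I (fun=> (K * e) ^+ 2).
  apply: le_I; [by apply: bmeas_intg; apply: bmeasX; exact: bmeas_deg1_part|exact/bmeas_intg/bmeas_cst|].
  move=> w; rewrite -real_normK ?num_real// ler_sqr ?nnegrE ?mulr_ge0//.
by rewrite (le_trans hI)// (Icst dw ((K * e) ^+ 2)) exprMn mulrAC.
Qed.

End DegreeOne.

(** * Perturbations of a constant *)

Section NearConstant.
Context {R : realType} {n : nat}.
Notation S := (sphere R n.+1).
Notation dw := (@surface R n.+1).
Notation I f := (Rintegral dw setT f).
Notation a := (n.+1%:R / 2 : R).
Notation sph := (fine (dw setT)).
Implicit Types (x y z w : S) (u r t : S -> R).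

Lemma measurable_riesz1 : measurable_fun setT (fun p : S * S => riesz 1 p.1 p.2).
Proof.
apply: measurable_funM => //; apply: (measurableT_comp (measurable_powR _)).
by apply: measurable_funB => //; case: (@bmeas_qd2 R n).
Qed.

Lemma energyZ (c : R) u : measurable_fun setT u ->
  energy (fun x => c * u x) = ((c ^+ 2)%:E * energy u)%E.
Proof.
move=> mu; rewrite !energyE /dform -ge0_integralZl//.
- by apply: eq_integral => p _; rewrite -EFinM; congr EFin; ring.
- by apply: measurable_dform => //; exact: measurable_riesz1.
- by move=> p _; rewrite lee_fin mulr_ge0 ?sqr_ge0 ?riesz_ge0.
- by rewrite lee_fin sqr_ge0.
Qed.

Lemma energyD_cst (c : R) u : energy (fun x => c + u x) = energy u.
Proof. by rewrite !energyE; apply: eq_integral => p _; congr EFin; ring. Qed.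

Lemma energy_split u r t : measurable_fun setT r -> measurable_fun setT t ->
  (forall x y, (r x - r y) ^+ 2 + (t x - t y) ^+ 2 <= (u x - u y) ^+ 2) ->
  measurable_fun setT u -> (energy r + energy t <= energy u)%E.
Proof.
move=> mr mt h mu; rewrite !energyE /dform.
have p0 (f : S -> R) (p : S * S) : (0 <= ((f p.1 - f p.2) ^+ 2 * riesz 1 p.1 p.2)%:E)%E.
  by rewrite lee_fin mulr_ge0 ?sqr_ge0 ?riesz_ge0.
have mf (f : S -> R) : measurable_fun setT f ->
    measurable_fun setT (fun p : S * S => ((f p.1 - f p.2) ^+ 2 * riesz 1 p.1 p.2)%:E).
  by move=> m; apply: measurable_dform => //; exact: measurable_riesz1.
have m1 := mf _ mr; have m2 := mf _ mt; have m3 := mf _ mu.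
rewrite -ge0_integralD//; apply: ge0_le_integral => //.
- by move=> p _; rewrite adde_ge0.
- exact: emeasurable_funD.
by move=> p _; rewrite -EFinD lee_fin -mulrDl ler_wpM2r ?riesz_ge0.
Qed.

Lemma lnp_le (s1 s2 : R) : s1 <= s2 -> lnp s1 <= lnp s2.
Proof.
move=> s12; rewrite /lnp ler_ln ?posrE ?lt_max ?ltr01//.
by rewrite ge_max !le_max lexx/= s12 orbT.
Qed.

Lemma measurable_sqr_lnp t (nu : R) : measurable_fun setT t ->
  measurable_fun setT (fun x => t x ^+ 2 * lnp (t x ^+ 2 / nu)).
Proof.
move=> mt; apply: measurable_funM; first exact: measurable_funX.
apply: (measurableT_comp measurable_lnp); apply: measurable_funM => //.
exact: measurable_funX.
Qed.

(** The case of zero mass, in which [weak_scaled] cannot rescale to unit norm. *)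
Lemma sqr_lnp_null t (nu : R) : sqi dw t -> I (fun x => t x ^+ 2) = 0 ->
  intg dw (fun x => t x ^+ 2 * lnp (t x ^+ 2 / nu)) /\
  I (fun x => t x ^+ 2 * lnp (t x ^+ 2 / nu)) = 0.
Proof.
move=> [mt it] t0; have mg := measurable_sqr_lnp nu mt.
pose f (x : S) := (t x ^+ 2)%:E; pose g (x : S) := (t x ^+ 2 * lnp (t x ^+ 2 / nu))%:E.
have mf : measurable_fun setT f by apply/measurable_EFinP; exact: measurable_funX.
have mg' : measurable_fun setT g by exact/measurable_EFinP.
have ae0 : ae_eq dw setT f (cst 0%E).
  apply/(ae_eq_integral_abs _ measurableT mf).
  transitivity (\int[dw]_x f x)%E; last by rewrite /f -IE// t0.
  by apply: eq_integral => x _ /=; rewrite ger0_norm ?sqr_ge0.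
have g0 : (\int[dw]_x `|g x| = 0)%E.
  apply/(ae_eq_integral_abs _ measurableT mg'); move: ae0; apply: filterS => x h xT.
  by have [] := h xT => /= e; rewrite /g e mul0r.
split; first by apply/integrableP; split => //; rewrite [X in (X < _)%E]g0.
transitivity (fine (\int[dw]_x `|g x|)%E); last by rewrite g0.
congr fine; apply: eq_integral => x _ /=.
by rewrite ger0_norm// mulr_ge0 ?sqr_ge0 ?lnp_ge0.
Qed.

(** [weak_log_sobolev] applied to $t/\|t\|$, by homogeneity; enlarging the reference mass to [nu]
    only decreases the logarithm. *)
Lemma weak_scaled t (nu : R) : sqi dw t -> (energy t < +oo)%E -> 0 < nu ->
  I (fun x => t x ^+ 2) <= nu ->
  intg dw (fun x => t x ^+ 2 * lnp (t x ^+ 2 / nu)) /\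
  @Cn R n.+1 * I (fun x => t x ^+ 2 * lnp (t x ^+ 2 / nu)) <=
    fine (energy t) + @weak_const R n * I (fun x => t x ^+ 2).
Proof.
move=> ht tE nu0 tnu; have [mt it] := ht.
have E0 : 0 <= fine (energy t) by rewrite fine_ge0// energy_ge0.
have C0 : 0 < @Cn R n.+1 := Cn_gt0.
have N0 : 0 <= I (fun x => t x ^+ 2) by apply: I_ge0 => x; exact: sqr_ge0.
move: N0; rewrite le_eqVlt => /predU1P[/esym N0|N0].
  by have [h1 h2] := sqr_lnp_null nu ht N0; split => //; rewrite h2 N0 !mulr0 addr0.
set N2 := I (fun x => t x ^+ 2) in N0 tnu *.
pose c := (Num.sqrt N2)^-1; have c0 : 0 < c by rewrite invr_gt0 sqrtr_gt0.
have c2 : c ^+ 2 = N2^-1 by rewrite exprVn sqr_sqrtr// ltW.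
pose u x := c * t x.
have gu : admissible u.
  split; first exact: sqiZ.
    transitivity (I (fun x => c ^+ 2 * t x ^+ 2)); first by apply: eq_I => x; rewrite exprMn.
    by rewrite IZ// c2 mulVf// gt_eqF.
  by rewrite energyZ// (energy_fin tE) -EFinM ltry.
have [hu u1 uE] := gu; have iu := intg_sqr_lnp gu.
have := weak_log_sobolev hu u1.
have iu' : intg dw (fun x => @Cn R n.+1 * (u x ^+ 2 * lnp (u x ^+ 2))) by exact: intgZ.
rewrite -IE// energyZ// (energy_fin tE) -EFinM -EFinD lee_fin IZ// c2 => h.
have hN x : N2 * (u x ^+ 2 * lnp (u x ^+ 2)) = t x ^+ 2 * lnp (t x ^+ 2 / N2).
  have -> : u x ^+ 2 = t x ^+ 2 / N2 by rewrite /u exprMn c2 mulrC.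
  by rewrite mulrA; congr (_ * _); rewrite mulrC divfK ?gt_eqF.
have it2 : intg dw (fun x => t x ^+ 2 * lnp (t x ^+ 2 / N2)).
  by have := intgZ N2 iu; apply: eq_integrable => // x _ /=; rewrite hN.
have le x : t x ^+ 2 * lnp (t x ^+ 2 / nu) <= t x ^+ 2 * lnp (t x ^+ 2 / N2).
  by rewrite ler_wpM2l ?sqr_ge0// lnp_le// ler_wpM2l ?sqr_ge0// lef_pV2 ?posrE.
have ge0 s x : 0 <= t x ^+ 2 * lnp s by rewrite mulr_ge0 ?sqr_ge0 ?lnp_ge0.
have itn : intg dw (fun x => t x ^+ 2 * lnp (t x ^+ 2 / nu)).
  apply: intg_le it2 => [|x]; first exact: measurable_sqr_lnp.
  by rewrite !ger0_norm.
split => //.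
rewrite (@le_trans _ _ (@Cn R n.+1 * I (fun x => t x ^+ 2 * lnp (t x ^+ 2 / N2))))//.
  by apply: ler_wpM2l; [exact: ltW|exact: le_I].
have e : I (fun x => t x ^+ 2 * lnp (t x ^+ 2 / N2)) = N2 * I (fun x => u x ^+ 2 * lnp (u x ^+ 2)).
  by rewrite -IZ//; apply: eq_I => x; rewrite hN.
rewrite e mulrCA; have := ler_wpM2l (ltW N0) h.
by rewrite mulrDr mulVKf ?gt_eqF//= [N2 * @weak_const R n]mulrC.
Qed.

Section clamp.
Variable dl : R.
Hypothesis d0 : 0 < dl.

Definition clamp (s : R) : R := Num.max (- dl) (Num.min dl s).

Lemma clampE s : clamp s = if s <= - dl then - dl else if dl <= s then dl else s.
Proof.
have d := d0; rewrite /clamp; case: (leP s (- dl)) => h1.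
  by rewrite (min_r (_ : s <= dl)) ?(max_l h1)//; lra.
case: (leP dl s) => h2; first by rewrite max_r//; lra.
by rewrite max_r// ltW.
Qed.

Lemma norm_clamp s : `|s - clamp s| = Num.max (`|s| - dl) 0.
Proof.
have d := d0; rewrite clampE; case: (leP s (- dl)) => h1.
  rewrite ler0_norm; last lra.
  by rewrite ler0_norm ?max_l//; lra.
case: (leP dl s) => h2.
  by rewrite !ger0_norm ?max_l//; lra.
rewrite subrr normr0 max_r//; have : `|s| <= dl by rewrite ler_norml; lra.
lra.
Qed.

(** [clamp] and its complement are both nondecreasing, so their increments have a nonnegative
    product. *)
Lemma clamp_split s1 s2 :
  (clamp s1 - clamp s2) ^+ 2 + ((s1 - clamp s1) - (s2 - clamp s2)) ^+ 2 <= (s1 - s2) ^+ 2.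
Proof.
suff h : 0 <= (clamp s1 - clamp s2) * ((s1 - clamp s1) - (s2 - clamp s2)).
  rewrite -subr_ge0 (_ : _ - _ = 2 * ((clamp s1 - clamp s2) * ((s1 - clamp s1) - (s2 - clamp s2)))).
    by rewrite mulr_ge0.
  ring.
have d := d0; wlog le12 : s1 s2 / s1 <= s2.
  move=> h; have [|/ltW] := leP s1 s2; first exact: h.
  by move=> /h; rewrite -mulrNN !opprB.
rewrite -mulrNN !opprB !clampE; apply: mulr_ge0; do 4?case: ifPn; rewrite -?ltNge; lra.
Qed.

Lemma clamp_sqr_le s : `|s - clamp s| <= s ^+ 2 / dl.
Proof.
rewrite norm_clamp ge_max; apply/andP; split; last by rewrite divr_ge0 ?sqr_ge0 ?ltW.
rewrite ler_pdivlMr// -real_normK ?num_real//; have := normr_ge0 s; have := d0.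
by move: `|s| => q; nra.
Qed.

Lemma measurable_clamp u : measurable_fun setT u -> measurable_fun setT (fun x => clamp (u x)).
Proof. by move=> mu; apply: measurable_maxr => //; exact: measurable_minr. Qed.

Lemma bmeas_clamp u : measurable_fun setT u -> bmeas (fun x => clamp (u x)).
Proof.
move=> mu; split; first exact: measurable_clamp.
exists dl => x; rewrite clampE; have d := d0.
by case: (leP (u x) (- dl)) => h1; [|case: (leP dl (u x)) => h2]; rewrite ler_norml; lra.
Qed.

End clamp.

Lemma ln_small (c : R) : exists2 e0 : R, 0 < e0 & forall s, 0 < s <= e0 -> ln s <= c.
Proof.
exists (expR c); first exact: expR_gt0.
by move=> s /andP[s0 se]; rewrite -[X in _ <= X]expRK ler_ln ?posrE ?expR_gt0.
Qed.

(* Truncate r at a small level: the spectral gap is applied to the bounded part,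
   for which the logarithm is expanded to second order, and the weak logarithmic
   Sobolev inequality to the remainder. *)
Lemma near_constant_bound (K eps : R) : 0 <= K -> 0 < eps -> exists2 e0 : R, 0 < e0 &
  forall r, sqi dw r -> (energy r < +oo)%E -> I r = 0 -> 0 < I (fun x => r x ^+ 2) <= e0 ->
  (forall i, `|I (fun w => r w * crd w i)| <= K * I (fun x => r x ^+ 2)) ->
  intg dw (fun x => (1 + r x) ^+ 2 * ln ((1 + r x) ^+ 2)) ->
  (@lam2 R n - 3 * @Cn R n.+1 - eps) * I (fun x => r x ^+ 2) <=
  fine (energy r) - @Cn R n.+1 * I (fun x => (1 + r x) ^+ 2 * ln ((1 + r x) ^+ 2)).
Proof.
move=> K0 eps0; have C0 : 0 < @Cn R n.+1 := Cn_gt0.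
have [Cg Cg0 gap] := @gap_approx R n.
have l0 : 0 < @lam2 R n.
  have G0 : 0 < Gamma a :> R := Gamma_half_gt0 n.
  rewrite lam2E; apply: ltr_wpDr; last exact: mulr_gt0.
  apply: divr_ge0; first by apply: mulr_ge0 => //; exact: powR_ge0.
  by apply: mulr_ge0; [exact: ltW|rewrite addr_ge0].
have W0 : 0 <= @weak_const R n.
  have s0 : 0 <= sph := ltW (surface_gt0 _).
  have k0 : 0 <= 2 ^- n.+1 :> R by rewrite invr_ge0 exprn_ge0.
  have q0 : 0 <= Num.sqrt sph by exact: sqrtr_ge0.
  apply: addr_ge0; apply: mulr_ge0 => //.
  - by apply: mulr_ge0 => //; apply: mulr_ge0.
  - by apply: mulr_ge0 (sqr_ge0 _) (ltW (ell_gt0 _)).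
  - by apply: mulr_ge0; [exact: mulr_ge0|exact: addr_ge0].
have weak t nu := @weak_scaled t nu.
move: (@weak_const R n) (@lam2 R n) (@Cn R n.+1) W0 l0 C0 gap weak => W l2 C W0 l0 C0 gap weak0.
(* Young's parameter. The losses caused by [th], by [dl] and by the terms of order $P^2$ are each
   kept below $\frac{\varepsilon}{4}P$. *)
pose th := eps / (4 * l2); have th0 : 0 < th by rewrite divr_gt0// mulr_gt0.
have thE : l2 * th = eps / 4 by rewrite /th; field; rewrite gt_eqF.
(* The price of a unit of $\|r_2\|^2$: the constant of the weak inequality plus the loss [l2 / th]
   of Young's inequality in [low]. *)
pose B := (W + l2 / th) / C.
have B0 : 0 <= B by apply: divr_ge0 (ltW C0); apply: addr_ge0 => //; apply: divr_ge0; exact: ltW.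
have BE : C * B = W + l2 / th by rewrite /B mulrC divfK ?gt_eqF.
pose dl := Num.min 4^-1 (eps / (8 * C)).
have d0 : 0 < dl by rewrite lt_min invr_gt0 ltr0n/= divr_gt0// mulr_gt0.
have d4 : 0 < dl <= 4^-1 by rewrite d0 ge_min lexx.
have dC : C * (2 * dl) <= eps / 4.
  have : dl <= eps / (8 * C) by rewrite ge_min lexx orbT.
  rewrite ler_pdivlMr ?mulr_gt0//; lra.
have [e1 e10 he1] := ln_small (- B - 22 / dl).
pose k2 := C * (expR B * B / dl ^+ 2); have k20 : 0 <= k2.
  by rewrite mulr_ge0 ?(ltW C0)// divr_ge0 ?sqr_ge0// mulr_ge0 ?expR_ge0.
(* As $|r_2|\le r^2/dl$, the mean and the first moments of the bounded part are at most
   $(K+dl^{-1})P$; in the gap this costs a multiple of the square, of order $P^2$. *)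
pose k3 := Cg * (K + dl^-1) ^+ 2; have k30 : 0 <= k3 by rewrite mulr_ge0 ?sqr_ge0.
pose e0 := Num.min e1 (eps / 4 / (k2 + k3 + 1)).
have k1 : 0 < k2 + k3 + 1 by rewrite ltr_wpDl// addr_ge0.
have e00 : 0 < e0 by rewrite lt_min e10 !divr_gt0.
exists e0 => // r hr rE r0 /andP[P0 Pe] rK iL.
set P := I (fun x => r x ^+ 2) in P0 Pe rK *.
have [mr ir2] := hr; have ir := sqi_intg hr.
have lnP : ln P <= - B - 22 / dl by apply: he1; rewrite P0 (le_trans Pe)// ge_min lexx.
have kP : (k2 + k3) * P <= eps / 4.
  have : P <= eps / 4 / (k2 + k3 + 1) by rewrite (le_trans Pe)// ge_min lexx orbT.
  by rewrite ler_pdivlMr//; move: P0 k1; nra.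
pose r1 x := clamp dl (r x); pose r2 x := r x - r1 x.
have b1 : bmeas r1 by exact: bmeas_clamp.
have s1 : sqi dw r1 by exact: bmeas_sqi.
have s2 : sqi dw r2 by exact: sqiB.
have r2n x : `|r2 x| = Num.max (`|r x| - dl) 0 by rewrite /r2 norm_clamp.
have r2sq x : r2 x ^+ 2 = Num.max (`|r x| - dl) 0 ^+ 2 by rewrite -r2n real_normK ?num_real.
have split : (energy r1 + energy r2 <= energy r)%E.
  by apply: energy_split (proj1 s1) (proj1 s2) _ mr => x y; exact: clamp_split.
have E1 : (energy r1 < +oo)%E.
  by apply: le_lt_trans rE; apply: le_trans split; rewrite leeDl ?energy_ge0.
have E2 : (energy r2 < +oo)%E.
  by apply: le_lt_trans rE; apply: le_trans split; rewrite leeDr ?energy_ge0.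
rewrite (energy_fin E1) (energy_fin E2) (energy_fin rE) -EFinD lee_fin in split.
have N0 : 0 <= I (fun x => r2 x ^+ 2) by apply: I_ge0 => x; exact: sqr_ge0.
have N2P : I (fun x => r2 x ^+ 2) <= P.
  apply: le_I (proj2 s2) ir2 _ => x; rewrite r2sq -[leRHS]real_normK ?num_real//.
  rewrite ler_sqr ?nnegrE ?normr_ge0 ?le_max ?lexx ?orbT// ge_max normr_ge0 andbT.
  by rewrite lerBlDr lerDl ltW.
have [iln weak] := weak0 _ _ s2 E2 P0 N2P.
have i2 : I (fun x => `|r2 x|) <= dl^-1 * P.
  rewrite -IZ//; apply: le_I; [exact/intg_norm/sqi_intg|exact: intgZ|move=> x].
  by rewrite mulrC; exact: clamp_sqr_le.
have i2' : 0 <= dl^-1 * P by rewrite mulr_ge0 ?invr_ge0 ?ltW.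
have ir1 := sqi_intg s1; have ir2' := sqi_intg s2.
pose e := (K + dl^-1) * P.
have a1 : `|I r1| <= e.
  have -> : I r1 = - I r2.
    by rewrite /r2 IB// r0 sub0r opprK.
  by rewrite normrN (le_trans (norm_I ir2'))// (le_trans i2)// /e mulrDl lerDr mulr_ge0// ltW.
have a2 i : `|I (fun w => r1 w * crd w i)| <= e.
  have c1 := intg_sqi_bmeas s2 (@bmeas_crd R n i); have c2 := intg_sqi_bmeas hr (@bmeas_crd R n i).
  have -> : I (fun w => r1 w * crd w i) = I (fun w => r w * crd w i) - I (fun w => r2 w * crd w i).
    by rewrite -IB//; apply: eq_I => w; rewrite /r2; ring.
  rewrite (le_trans (ler_normB _ _))// /e mulrDl lerD// (le_trans (norm_I c1))// (le_trans _ i2)//.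
  apply: le_I; [exact: intg_norm|exact: intg_norm|move=> w].
  by rewrite normrM ler_piMr// norm_crd.
have {}gap := gap r1 e s1 a1 a2; rewrite (energy_fin E1) lee_fin in gap.
have low : (1 - th) * P - th^-1 * I (fun x => r2 x ^+ 2) <= I (fun x => r1 x ^+ 2).
  rewrite -IZ// -IZ; last exact: (proj2 s2).
  rewrite -IB; [|exact: intgZ|by apply: intgZ; exact: (proj2 s2)].
  apply: le_I; [|exact: (proj2 s1)|move=> x].
    by apply: intgB; apply: intgZ => //; exact: (proj2 s2).
  rewrite (_ : r1 x = r x - r2 x); last by rewrite /r2 opprB addrC subrK.
  rewrite -subr_ge0 (_ : _ - _ = (th * r x - r2 x) ^+ 2 / th + r2 x ^+ 2); last by field; rewrite gt_eqF.
  by apply: addr_ge0 (sqr_ge0 _); exact: divr_ge0 (sqr_ge0 _) (ltW th0).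
pose q := 2 * dl + expR B * B * P / dl ^+ 2.
have up : I (fun x => (1 + r x) ^+ 2 * ln ((1 + r x) ^+ 2)) <=
    (3 + q) * P + I (fun x => r2 x ^+ 2 * lnp (r2 x ^+ 2 / P)) - B * I (fun x => r2 x ^+ 2).
  have i3 : intg dw (fun x => B * r2 x ^+ 2) by apply: intgZ; exact: (proj2 s2).
  have i4 : intg dw (fun x => (3 + q) * r x ^+ 2) by exact: intgZ.
  have i5 : intg dw (fun x => 2 * r x) by exact: intgZ.
  have -> : (3 + q) * P + I (fun x => r2 x ^+ 2 * lnp (r2 x ^+ 2 / P)) - B * I (fun x => r2 x ^+ 2) =
    I (fun x => 2 * r x + (3 + q) * r x ^+ 2 + r2 x ^+ 2 * lnp (r2 x ^+ 2 / P) - B * r2 x ^+ 2).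
    rewrite IB//; last by apply: intgD => //; exact: intgD.
    rewrite ID//; last exact: intgD.
    by rewrite ID// !IZ// ?r0 ?mulr0 ?add0r//; exact: (proj2 s2).
  apply: le_I => //; first by apply: intgB => //; apply: intgD => //; exact: intgD.
  move=> x; have := sqr_ln_main (r x) d4 B0 P0 lnP; rewrite /= -r2sq => /le_trans; apply.
  by rewrite /q le_eqVlt; apply/orP; left; apply/eqP; ring.
have e2 : Cg * e ^+ 2 = k3 * P * P by rewrite /e /k3; ring.
have qE : C * q = C * (2 * dl) + k2 * P by rewrite /q /k2; ring.
move: split weak gap low up; rewrite e2.
move: (fine (energy r)) (fine (energy r1)) (fine (energy r2)) (I (fun x => r1 x ^+ 2)) N0
  (I (fun x => (1 + r x) ^+ 2 * ln ((1 + r x) ^+ 2))) (I (fun x => r2 x ^+ 2 * lnp _)) => E F1 F2 P1 N0 L LN.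
move: (I (fun x => r2 x ^+ 2)) N0 => N2 N0 split weak gap low up.
have u1 : C * L <= 3 * C * P + (C * (2 * dl) + k2 * P) * P + C * LN - (W + l2 / th) * N2.
  rewrite -qE -BE (_ : 3 * C * P + C * q * P + C * LN - C * B * N2 = C * ((3 + q) * P + LN - B * N2)); last by ring.
  by rewrite ler_wpM2l ?(ltW C0).
have u2 : l2 * P - eps / 4 * P - l2 / th * N2 <= l2 * P1.
  rewrite -thE (_ : l2 * P - l2 * th * P - l2 / th * N2 = l2 * ((1 - th) * P - th^-1 * N2)); last by ring.
  by rewrite ler_wpM2l ?(ltW l0).
have u3 : (C * (2 * dl)) * P <= eps / 4 * P by rewrite ler_wpM2r ?(ltW P0).
have u4 : k2 * P * P + k3 * P * P <= eps / 4 * P by rewrite -mulrDl -mulrDl ler_wpM2r ?(ltW P0).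
rewrite (_ : (l2 - 3 * C - eps) * P = l2 * P - 3 * C * P - eps * P); last by ring.
rewrite (mulrDl (C * (2 * dl)) (k2 * P) P) (mulrDl W (l2 / th) N2) in u1.
rewrite (_ : eps / 4 * P = eps * P / 4) in u2 u3 u4; last by ring.
have epsP : 0 < eps * P by rewrite mulr_gt0.
move: epsP u1 u2 u3 u4 split weak gap.
move: (C * (2 * dl) * P) (k2 * P * P) (k3 * P * P) (l2 / th * N2) (C * LN) (W * N2) (C * L) (l2 * P1).
move: (l2 * P) (3 * C * P) (eps * P) => x1 x2 x11 x3 x4 x5 x6 x7 x8 x9 x10.
by clear; move=> *; lra.
Qed.

End NearConstant.

(** * The local inequality and the remainder *)

Section Stability.
Context {R : realType} {n : nat}.
Notation S := (sphere R n.+1).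
Notation dw := (@surface R n.+1).
Notation I f := (Rintegral dw setT f).
Notation a := (n.+1%:R / 2 : R).
Notation sph := (fine (dw setT)).
Notation T := (n.+2.-tuple R).
Implicit Types (x y z w : S) (u r U : S -> R).

Definition rate : R := 8 * pi `^ a / (Gamma a * (n.+1%:R + 2)).

Lemma rate_gt0 : 0 < rate.
Proof.
have G0 : 0 < Gamma a :> R := Gamma_half_gt0 n.
apply: divr_gt0; first by apply: mulr_gt0 => //; rewrite powR_gt0 ?pi_gt0.
by apply: mulr_gt0 => //; rewrite ltr_wpDl.
Qed.

Let s0 : 0 < sph. Proof. exact: surface_gt0. Qed.

Definition axis (i : 'I_n.+2) (t : R) : T := [tuple if j == i then t else 0 | j < n.+2].

Lemma dotp_axis i t w : dotp (axis i t) (val w) = t * crd w i.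
Proof.
rewrite /dotp (bigD1 i)//= tnth_mktuple eqxx big1 ?addr0// => j ji.
by rewrite tnth_mktuple (negbTE ji) mul0r.
Qed.

Lemma unit_ball_axis i t : `|t| < 1 -> unit_ball (axis i t).
Proof.
move=> t1; rewrite /unit_ball/= enorm_lt1 /dotp (bigD1 i)//= big1 ?addr0 => [|j ji].
  by rewrite !tnth_mktuple eqxx -expr2 -real_normK ?num_real// exprn_ilt1.
by rewrite !tnth_mktuple (negbTE ji) mul0r.
Qed.

Lemma sqdist_cst u (c : R) : sqi dw u ->
  sqdist u (cst c) = I (fun x => u x ^+ 2) - 2 * c * I u + c ^+ 2 * sph.
Proof.
move=> hu; have iu := sqi_intg hu; have [_ iu2] := hu.
have ic : intg dw (fun _ : S => c ^+ 2) by exact/bmeas_intg/bmeas_cst.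
transitivity (I (fun x => u x ^+ 2 - 2 * c * u x + c ^+ 2)).
  by apply: eq_I => x /=; ring.
rewrite ID//; last by apply: intgB => //; exact: intgZ.
rewrite (Icst dw (c ^+ 2)) IB//; last exact: intgZ.
by rewrite IZ.
Qed.

(** Scaling out the mean [m] leaves the term $-C_n\ln m^2$; as $m^2(|\mathbb S|+\|r\|^2)=1$, it
    contributes at second order in [r]. *)
Lemma deficit_ratio U (m : R) : admissible U -> m != 0 -> I U = m * sph ->
  let r x := m^-1 * U x - 1 in
  [/\ sqi dw r, (energy r < +oo)%E, I r = 0, m ^+ 2 * (sph + I (fun x => r x ^+ 2)) = 1 &
    intg dw (fun x => (1 + r x) ^+ 2 * ln ((1 + r x) ^+ 2)) /\
    deficit U = m ^+ 2 * (fine (energy r) -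
      @Cn R n.+1 * I (fun x => (1 + r x) ^+ 2 * ln ((1 + r x) ^+ 2))) - @Cn R n.+1 * ln (m ^+ 2)].
Proof.
move=> gU m0 IU r; have [hU U1 UE] := gU; have [mU iU2] := hU; have iU := sqi_intg hU.
have m2 : 0 < m ^+ 2 by rewrite lt0r sqrf_eq0 m0 sqr_ge0.
have ic : intg dw (fun _ : S => 1 : R) by exact/bmeas_intg/bmeas_cst.
have hr : sqi dw r by apply: sqiB; [exact: sqiZ|exact/bmeas_sqi/bmeas_cst].
have UE' x : U x = m * (1 + r x) by rewrite /r addrC subrK mulVKf.
have eU : energy U = ((m ^+ 2)%:E * energy r)%E.
  rewrite -energyZ; last exact: (proj1 hr).
  by rewrite -(energyD_cst m (fun x => m * r x)); congr energy; apply/funext => x; rewrite [LHS]UE'; ring.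
have er : energy r = ((m ^- 2)%:E * energy U)%E.
  by rewrite eU muleA -EFinM mulVf ?mul1e// gt_eqF.
have rE : (energy r < +oo)%E by rewrite er (energy_fin UE) -EFinM ltry.
have ir := sqi_intg hr; have ir2 := proj2 hr.
have r0 : I r = 0.
  rewrite IB//; last exact: intgZ.
  by rewrite IZ// IU mulKf// (Icst dw 1) mul1r subrr.
have L1 x : (1 + r x) ^+ 2 * ln ((1 + r x) ^+ 2) = m ^- 2 * (U x ^+ 2 * ln (U x ^+ 2)) -
    ln (m ^+ 2) * m ^- 2 * U x ^+ 2.
  move: (U x) (1 + r x) (UE' x) => v y ->.
  have [->|y0] := eqVneq y 0; first by rewrite mulr0 expr0n/= !(mul0r, mulr0) subrr.
  have y2 : 0 < y ^+ 2 by rewrite lt0r sqrf_eq0 y0 sqr_ge0.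
  rewrite exprMn (lnM m2 y2); have mV : m ^- 2 * m ^+ 2 = 1 by rewrite mulVf// gt_eqF.
  transitivity (m ^- 2 * m ^+ 2 * (y ^+ 2 * ln (y ^+ 2))); first by rewrite mV mul1r.
  by move: (m ^- 2) (ln (m ^+ 2)) (ln (y ^+ 2)) => *; ring.
have iL := intg_sqr_ln gU.
have iL1 : intg dw (fun x => m ^- 2 * (U x ^+ 2 * ln (U x ^+ 2)) - ln (m ^+ 2) * m ^- 2 * U x ^+ 2).
  by apply: intgB; exact: intgZ.
have iLr : intg dw (fun x => (1 + r x) ^+ 2 * ln ((1 + r x) ^+ 2)).
  by apply: eq_integrable iL1 => // x _ /=; rewrite L1.
have LE : I (fun x => (1 + r x) ^+ 2 * ln ((1 + r x) ^+ 2)) =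
    m ^- 2 * sqr_entropy U - ln (m ^+ 2) * m ^- 2.
  transitivity (I (fun x => m ^- 2 * (U x ^+ 2 * ln (U x ^+ 2)) - ln (m ^+ 2) * m ^- 2 * U x ^+ 2)).
    by apply: eq_I => x; rewrite L1.
  rewrite IB; [|exact: intgZ|exact: intgZ].
  by rewrite (IZ _ iL) (IZ _ iU2) U1 mulr1.
split => //; last first.
  split => //; by rewrite /deficit eU (energy_fin rE) -EFinM LE /=; field.
transitivity (I (fun x => U x ^+ 2)); last exact: U1.
transitivity (I (fun x => m ^+ 2 * (1 + 2 * r x + r x ^+ 2))); last first.
  by apply: eq_I => x; rewrite UE'; ring.
have i1 : intg dw (fun x => 1 + 2 * r x) by apply: intgD => //; exact: intgZ.
rewrite IZ; last exact: intgD.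
by rewrite ID// ID ?IZ// ?r0 ?mulr0 ?addr0 ?(Icst dw 1) ?mul1r//; exact: intgZ.
Qed.

(* If 1 is almost the element of M nearest to 1 + r, comparison with the bubbles
   centred at +-e on the i-th axis shows that r is almost orthogonal to crd i. *)
Lemma orthogonality_error : exists2 K : R, 0 <= K & exists2 e0 : R, 0 < e0 & forall r e,
  sqi dw r -> 0 < e < e0 -> I (fun x => r x ^+ 2) <= sph ->
  (forall i t, `|t| < 1 -> I (fun x => r x ^+ 2) - 2 * sph * e ^+ 2 <=
    I (fun x => (r x - ((1 - t * crd x i) `^ (- a) - 1)) ^+ 2)) ->
  forall i, `|I (fun w => r w * crd w i)| <= K * e.
Proof.
have a0 : 0 < a by rewrite divr_gt0.
pose C1 : R := 2 * a + 3 * a ^+ 2; pose C2 : R := a + C1.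
have C10 : 0 <= C1.
  by apply: addr_ge0; apply: mulr_ge0; rewrite ?ler0n ?sqr_ge0 ?(ltW a0).
have C20 : 0 <= C2 by apply: addr_ge0 => //; exact: ltW.
(* Collects the Taylor error of the bubble, its squared norm and the error of near-minimality, after
   division by [2 * a * e]. *)
pose K : R := sph * (2 * C1 + C2 ^+ 2 + 2) / (2 * a).
have K0 : 0 <= K.
  apply: divr_ge0; last by apply: mulr_ge0 => //; exact: ltW.
  apply: mulr_ge0; first exact: ltW.
  by apply: addr_ge0 => //; apply: addr_ge0 (sqr_ge0 _); apply: mulr_ge0.
have a10 : 0 < 4 * (a + 1) by apply: mulr_gt0 => //; rewrite ltr_wpDl// ltW.
exists K => //; exists (Num.min 2^-1 (4 * (a + 1))^-1); first by rewrite lt_min !invr_gt0 a10 ltr0n.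
move=> r e hr /andP[e0]; rewrite lt_min => /andP[e12 ex] rs h i.
have [mr ir2] := hr; have ir := sqi_intg hr.
have bc := @bmeas_crd R n i; have irc := intg_sqi_bmeas hr bc.
have e1 : e < 1 by lra.
(* Near-minimality against the bubble of parameter [t] compares the linear term $2at\int r\,x_i$
   with errors of order $e^2$; the two signs of [t] bound the moment from both sides. *)
have one_side t : `|t| = e -> 2 * a * t * I (fun w => r w * crd w i) <= sph * (2 * C1 + C2 ^+ 2 + 2) * e ^+ 2.
  move=> te; have t1 : `|t| < 1 by rewrite te.
  pose b w := (1 - t * crd w i) `^ (- a) - 1.
  have tc w : `|- (t * crd w i)| <= e.
    by rewrite normrN normrM te ler_piMr ?(ltW e0)// norm_crd.
  have t2 w : (t * crd w i) ^+ 2 <= e ^+ 2.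
    by rewrite -real_normK ?num_real// -normrN ler_sqr ?nnegrE ?(ltW e0)//.
  have bT w : `|b w - a * (t * crd w i)| <= C1 * e ^+ 2.
    have := powRN_taylor a0 (le_trans (tc w) (ltW ex)); rewrite mulrN sqrrN -/C1.
    by move=> /le_trans; apply; rewrite ler_wpM2l.
  have bb w : `|b w| <= C2 * e.
    rewrite -[b w](subrK (a * (t * crd w i))) (le_trans (ler_normD _ _))// /C2 mulrDl addrC lerD//.
      by rewrite normrM (gtr0_norm a0) ler_pM2l// -normrN.
    by rewrite (le_trans (bT w))// ler_wpM2l// expr2 (ler_piMr (ltW e0) (ltW e1)).
  have bmb : bmeas b.
    split; last by exists (C2 * e).
    apply: measurable_funB => //; apply: (measurableT_comp (measurable_powR _)).
    by apply: measurable_funB => //; apply: measurable_funM => //; case: bc.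
  have irb := intg_sqi_bmeas hr bmb.
  have ib2 : intg dw (fun w => b w ^+ 2) by apply: bmeas_intg; exact: bmeasX.
  have Ib2 : I (fun w => b w ^+ 2) <= (C2 * e) ^+ 2 * sph.
    rewrite -(Icst dw); apply: le_I => //; first exact/bmeas_intg/bmeas_cst.
    by move=> w; rewrite /cst -real_normK ?num_real// ler_sqr ?nnegrE// mulr_ge0// ltW.
  have i2 : intg dw (fun x => 2 * (r x * b x)) by exact: intgZ.
  have e2 : I (fun x => (r x - b x) ^+ 2) =
      I (fun x => r x ^+ 2) - 2 * I (fun x => r x * b x) + I (fun x => b x ^+ 2).
    rewrite -IZ// -IB// -ID//; last exact: intgB.
    by apply: eq_I => x; ring.
  have := h i t t1; rewrite -/b e2 => h1.
  have ia : intg dw (fun x => `|r x|) by exact: intg_norm.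
  have Ir1 : I (fun x => `|r x|) <= sph.
    have ic : intg dw (fun _ : S => 2^-1 : R) by exact/bmeas_intg/bmeas_cst.
    have ih : intg dw (fun x => 2^-1 * r x ^+ 2) by exact: intgZ.
    apply: (@le_trans _ _ (I (fun x => 2^-1 + 2^-1 * r x ^+ 2))).
      apply: le_I => //; first exact: intgD.
      move=> x; rewrite -[r x ^+ 2]real_normK ?num_real//.
      by have := sqr_ge0 (`|r x| - 1); move: `|r x| => q; rewrite sqrrB1; clear; move=> *; lra.
    rewrite ID// IZ// (Icst dw 2^-1); move: rs; move: (I _) sph => p1 p2; clear; move=> *; lra.
  have low : a * t * I (fun w => r w * crd w i) - C1 * e ^+ 2 * sph <= I (fun x => r x * b x).
    have j1 : intg dw (fun w => a * t * (r w * crd w i)) by exact: intgZ.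
    have j2 : intg dw (fun w => C1 * e ^+ 2 * `|r w|) by exact: intgZ.
    apply: (@le_trans _ _ (I (fun w => a * t * (r w * crd w i) - C1 * e ^+ 2 * `|r w|))).
      rewrite IB// !IZ// lerD2l lerN2 ler_wpM2l// mulr_ge0 ?sqr_ge0//.
    apply: le_I => //; first exact: intgB.
    move=> x; have := ler_norm (- (r x * (b x - a * (t * crd x i)))).
    rewrite normrN normrM => h2; have h3 := ler_wpM2l (normr_ge0 (r x)) (bT x).
    rewrite (_ : r x * b x = a * t * (r x * crd x i) - (- (r x * (b x - a * (t * crd x i))))); last by ring.
    by rewrite lerD2l lerN2 (le_trans h2)// (le_trans h3)// mulrC.
  have -> : sph * (2 * C1 + C2 ^+ 2 + 2) * e ^+ 2 =
    2 * (C1 * e ^+ 2 * sph) + (C2 * e) ^+ 2 * sph + 2 * sph * e ^+ 2 by ring.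
  rewrite (_ : 2 * a * t * _ = 2 * (a * t * I (fun w => r w * crd w i))); last by ring.
  move: low h1 Ib2; move: (2 * sph * e ^+ 2) (C1 * e ^+ 2 * sph) ((C2 * e) ^+ 2 * sph) => q1 q2 q3.
  move: (a * t * I (fun w => r w * crd w i)) (I (fun x => r x * b x)) (I (fun x => r x ^+ 2)) (I (fun w => b w ^+ 2)) => q4 q5 q6 q7.
  by clear; move=> *; lra.
have ne : `|- e| = e by rewrite normrN gtr0_norm.
have h1 := one_side e (gtr0_norm e0); have h2 := one_side (- e) ne.
move: h1 h2; set J := I _; set Q := sph * _ => h1 h2.
have ae : 0 < 2 * a * e by apply: mulr_gt0 => //; exact: mulr_gt0.
have KE : K * e = Q * e ^+ 2 / (2 * a * e) by rewrite /K -/Q; field; rewrite !gt_eqF.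
rewrite KE ler_pdivlMr// -(gtr0_norm ae) -normrM ler_norml; apply/andP; split.
  by rewrite lerNl (_ : - _ = 2 * a * - e * J)//; ring.
by rewrite mulrC.
Qed.

(** [e] is a squared distance, so the tolerated defect of optimality [e ^+ 2] is of fourth order in
    the distance: small enough for the moments of [r] to be $O(e)$. *)
Lemma deficit_near_constant (eps : R) : 0 < eps < rate -> exists2 e0 : R, 0 < e0 & forall U (c e : R),
  admissible U -> 0 < e < e0 -> sqdist U (cst c) = e ->
  (forall phi, M R n.+1 phi -> e - e ^+ 2 <= sqdist U phi) ->
  (rate - eps) * e <= deficit U - @Cn R n.+1 * ln sph.
Proof.
move=> /andP[eps0 epsr]; have k0 := rate_gt0.
have [K K0 [e1 e10 orth]] := orthogonality_error.
pose K' := 2 * K / sph; have K'0 : 0 <= K' by apply: divr_ge0 (ltW s0); exact: mulr_ge0.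
have eps2 : 0 < eps / 2 by rewrite divr_gt0.
have [e2 e20 key] := @near_constant_bound R n K' (eps / 2) K'0 eps2.
pose e3 := Num.min (Num.min e1 2^-1) (Num.min (e2 / (2 * sph)) (eps / (2 * rate))).
have s20 : 0 < 2 * sph by exact: mulr_gt0.
have k20 : 0 < 2 * rate by exact: mulr_gt0.
exists e3.
  by rewrite !lt_min e10 invr_gt0 ltr0n/= !divr_gt0.
move=> U c e gU; rewrite !lt_min => /andP[e0 /andP[/andP[ee1 e12] /andP[ee2 ee3]]] cE hM.
have [hU U1 UE] := gU; have [mU iU2] := hU; have iU := sqi_intg hU.
(* The mean is the best constant; its squared distance [sm] lies between $e-e^2$ and $e$, and [r]
   becomes exactly orthogonal to the constants. *)
pose m := I U / sph; have IU : I U = m * sph by rewrite /m divfK// gt_eqF.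
pose sm := sqdist U (cst m).
have smE : sm = 1 - m ^+ 2 * sph by rewrite /sm sqdist_cst// U1 IU; ring.
have sme : sm <= e.
  rewrite -cE smE sqdist_cst// U1 IU.
  have : 0 <= (m - c) ^+ 2 * sph by apply: mulr_ge0 (sqr_ge0 _) (ltW s0).
  rewrite (_ : (m - c) ^+ 2 * sph = m ^+ 2 * sph - 2 * c * (m * sph) + c ^+ 2 * sph); last by ring.
  by move: (m ^+ 2 * sph) (2 * c * _) (c ^+ 2 * sph); clear; move=> *; lra.
have ball0 : unit_ball (axis ord0 0) by apply: unit_ball_axis; rewrite normr0.
have smM : e - e ^+ 2 <= sm.
  have -> : sm = sqdist U (bubble m (axis ord0 0)).
    apply: eq_I => x; rewrite bubble0// => j.
    by rewrite tnth_mktuple; case: ifP.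
  by apply: hM; exists m, (axis ord0 0).
have e2e : e ^+ 2 <= 2^-1 * e by rewrite expr2 ler_wpM2r// ltW.
have sm0 : 2^-1 * e <= sm by move: smM e2e; clear; move=> *; lra.
have ms : 2^-1 <= m ^+ 2 * sph.
  by move: sme e12; rewrite smE; move: (m ^+ 2 * sph); clear; move=> *; lra.
have m0 : m != 0.
  by apply/eqP => m0; move: ms; rewrite m0 expr0n/= mul0r leNgt invr_gt0 ltr0n.
have m2 : 0 < m ^+ 2 by rewrite lt0r sqrf_eq0 m0 sqr_ge0.
have [] := deficit_ratio gU m0 IU; set r := fun x => _; cbn zeta => hr rE r0 mP [iL dE].
set P := I (fun x => r x ^+ 2) in mP.
have mPs : m ^+ 2 * P = sm by rewrite smE -mP; ring.
have P0 : 0 < P by rewrite -(pmulr_rgt0 _ m2) mPs; apply: lt_le_trans sm0; exact: mulr_gt0.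
have Ps : P <= 2 * sph * e.
  rewrite -(ler_pM2l m2) mPs (le_trans sme)//.
  rewrite (_ : m ^+ 2 * _ = 2 * e * (m ^+ 2 * sph)); last by ring.
  have := ler_wpM2l (ltW e0) ms; move: (m ^+ 2 * sph) => q h.
  by move: h; clear; move=> *; lra.
have sP : sph * e <= 2 * P.
  rewrite -(ler_pM2l m2) [m ^+ 2 * (2 * P)]mulrCA mPs [m ^+ 2 * _]mulrA.
  have : m ^+ 2 * sph * e <= 1 * e.
    apply: ler_wpM2r; first exact: ltW.
    by rewrite -mP ler_pM2l// lerDl ltW.
  by move: (m ^+ 2 * sph * e) sm0; clear; move=> *; lra.
have Psph : P <= sph.
  rewrite (le_trans Ps)// mulrAC; apply: ler_piMl; first exact: ltW.
  by move: e12; clear; move=> *; lra.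
have rc : forall i, `|I (fun w => r w * crd w i)| <= K' * P.
  move=> i; have h := orth r e hr (introT andP (conj e0 ee1)) Psph _ i.
  rewrite (le_trans (h _))//; last first.
    rewrite /K' (_ : 2 * K / sph * P = K * (2 * P / sph)); last by ring.
    by apply: ler_wpM2l => //; rewrite ler_pdivlMr// mulrC.
  move=> j t t1; have hb : unit_ball (axis j t) by exact: unit_ball_axis.
  have := hM (bubble m (axis j t)) (ex_intro _ m (ex_intro2 _ _ (axis j t) hb erefl)).
  have -> : sqdist U (bubble m (axis j t)) =
      m ^+ 2 * I (fun x => (r x - ((1 - t * crd x j) `^ (- a) - 1)) ^+ 2).
    have bb := bmeas_bubble 1 hb.
    rewrite -IZ.
      apply: eq_I => x; rewrite /bubble dotp_axis -exprMn; congr (_ ^+ 2).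
      by rewrite /r; field.
    have hs : sqi dw (fun x => r x - (bubble 1 (axis j t) x - 1)).
      by apply: sqiB => //; apply: bmeas_sqi; apply: bmeasB => //; exact: bmeas_cst.
    have := proj2 hs; apply: eq_integrable => // x _ /=.
    by rewrite /bubble dotp_axis mul1r.
  move=> h1; rewrite -(ler_pM2l m2) (le_trans _ h1)// mulrBr -/P mPs.
  have : 2^-1 * (2 * e ^+ 2) <= m ^+ 2 * sph * (2 * e ^+ 2).
    by apply: ler_wpM2r => //; rewrite mulr_ge0 ?sqr_ge0.
  rewrite (_ : m ^+ 2 * (2 * sph * e ^+ 2) = m ^+ 2 * sph * (2 * e ^+ 2)); last by ring.
  by move: (m ^+ 2 * sph * _) sme; clear; move=> *; lra.
have P2 : 0 < P <= e2.
  rewrite P0 (le_trans Ps)//; move: ee2; rewrite ltr_pdivlMr// => h; rewrite mulrC; exact: ltW.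
have := key r hr rE r0 P2 rc iL; rewrite -/P => kb.
(* Since $m^2|\mathbb S|=1-sm$, the normalisation gives back $C_n\,sm$, which turns the $3C_n$ of
   the entropy into $2C_n$. *)
have lnb : ln (m ^+ 2) + ln sph <= - sm.
  rewrite -lnM ?posrE// smE.
  have ms0 : 0 < m ^+ 2 * sph by exact: mulr_gt0.
  have := @le_ln1Dx R (m ^+ 2 * sph - 1); rewrite addrCA subrr addr0 opprB; apply.
  by rewrite ltrBrDr addNr.
rewrite dE; have C0 : 0 < @Cn R n.+1 := Cn_gt0.
have l2E : @lam2 R n = 2 * @Cn R n.+1 + rate by exact: lam2E.
rewrite l2E in kb; have := ler_wpM2l (ltW m2) kb; have := ler_wpM2l (ltW C0) lnb.
rewrite [m ^+ 2 * (_ * P)](_ : _ = (2 * @Cn R n.+1 + rate - 3 * @Cn R n.+1 - eps / 2) * sm); last by rewrite -mPs; ring.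
move: (m ^+ 2 * (_ - _)) (ln (m ^+ 2)) (ln sph) => q l1 l3.
have fin : (rate - eps) * e <= (rate - eps / 2) * sm.
  have kn : 0 < rate - eps / 2 by move: eps0 epsr; clear; move=> *; lra.
  rewrite (@le_trans _ _ ((rate - eps / 2) * (e - e ^+ 2)))//; last by rewrite ler_pM2l.
  have : e * rate <= eps / 2.
    by move: ee3; rewrite ltr_pdivlMr//; clear; move=> *; lra.
  move=> h; rewrite -subr_ge0 (_ : _ - _ = e * (eps / 2 - e * rate + e * (eps / 2))); last by field.
  apply: mulr_ge0; [exact: ltW|apply: addr_ge0; first by rewrite subr_ge0].
  by apply: mulr_ge0; exact: ltW.
move: fin; move: (@Cn R n.+1) C0 => C C0.
rewrite [(2 * C + rate - 3 * C - eps / 2) * sm](_ : _ = (rate - eps / 2) * sm - C * sm); last by ring.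
rewrite mulrDr; move: ((rate - eps / 2) * sm) ((rate - eps) * e) (C * l1) (C * l3).
by move=> q1 q2 q3 q4; rewrite mulrN; move: (C * sm) => q5; clear; move=> *; lra.
Qed.

Lemma M_nonempty : exists2 phi, M R n.+1 phi & True.
Proof.
exists (bubble 1 (axis ord0 0)) => //; exists 1, (axis ord0 0) => //.
by apply: unit_ball_axis; rewrite normr0.
Qed.

Lemma L2norm_sub u phi : sqi dw u -> M R n.+1 phi ->
  L2norm (u \- phi) = Num.sqrt (sqdist u phi).
Proof.
move=> [mu _] [c [xi h ->]]; rewrite L2normE//.
by apply: measurable_funB => //; case: (bmeas_bubble c h).
Qed.

Lemma sqdist_ge0 u phi : 0 <= sqdist u phi.
Proof. by apply: I_ge0 => x; exact: sqr_ge0. Qed.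

Lemma distM_lbound u : has_lbound [set L2norm (u \- phi) | phi in M R n.+1].
Proof. by exists 0 => _ [phi _ <-]; rewrite /L2norm fine_ge0// Lnorm_ge0. Qed.

Lemma distM_ge0 u : 0 <= distM u.
Proof.
have [phi Mphi _] := M_nonempty; apply: lb_le_inf; first by exists (L2norm (u \- phi)), phi.
by move=> _ [psi _ <-]; rewrite /L2norm fine_ge0// Lnorm_ge0.
Qed.

Lemma distM_sqr_le u phi : sqi dw u -> M R n.+1 phi -> distM u ^+ 2 <= sqdist u phi.
Proof.
move=> hu Mphi; rewrite -(sqr_sqrtr (sqdist_ge0 u phi)) ler_sqr ?nnegrE ?distM_ge0 ?sqrtr_ge0//.
rewrite -L2norm_sub//; apply: ge_inf; first exact: distM_lbound.
by exists phi.
Qed.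

Lemma distM_near u (q : R) : sqi dw u -> distM u ^+ 2 < q ->
  exists2 phi, M R n.+1 phi & sqdist u phi < q.
Proof.
move=> hu dq; have [phi0 M0 _] := M_nonempty.
have q0 : 0 < q by rewrite (le_lt_trans _ dq)// sqr_ge0.
have sq : distM u < Num.sqrt q.
  by rewrite -(ltr_sqr (distM_ge0 u) (sqrtr_ge0 q)) sqr_sqrtr// ltW.
have hi : has_inf [set L2norm (u \- phi) | phi in M R n.+1].
  by split; [exists (L2norm (u \- phi0)), phi0|exact: distM_lbound].
have eps0 : 0 < Num.sqrt q - distM u by rewrite subr_gt0.
have [_ [phi Mphi <-]] := inf_adherent eps0 hi.
rewrite -/(distM u) addrC subrK L2norm_sub// => h; exists phi => //.
by rewrite -(ltr_sqrt _ q0).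
Qed.

Lemma local_bound (eps : R) : 0 < eps < rate -> exists2 d0 : R, 0 < d0 & forall u,
  admissible u -> 0 < distM u < d0 ->
  (rate - eps) * distM u ^+ 2 <= deficit u - @Cn R n.+1 * ln sph.
Proof.
move=> /andP[eps0 epsr]; have [e0 e00 core] := deficit_near_constant (introT andP (conj eps0 epsr)).
exists (Num.min 1 (e0 / 2)); first by rewrite lt_min ltr01 divr_gt0.
move=> u gu; rewrite lt_min => /andP[d0 /andP[d1 de]]; set d := distM u in d0 d1 de *.
have [hu _ _] := gu.
have d2 : 0 < d ^+ 2 by rewrite exprn_gt0.
have d4 : 0 < d ^+ 4 by rewrite exprn_gt0.
(* A point of $M$ at squared distance [e] below $d^2+d^4$ is optimal up to $e^2$: as $e\ge d^2$, one
   has $e-e^2\le e-d^4<d^2$. *)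
have dd4 : d ^+ 2 < d ^+ 2 + d ^+ 4 by rewrite ltrDl.
have [phi Mphi sphi] := distM_near hu dd4.
have e_ge := distM_sqr_le hu Mphi; rewrite -/d in e_ge.
have [c [xi hxi phiE]] := Mphi.
have [U [c' [[gU dU mU] eU]]] := Mequiv_center c gu hxi.
rewrite -phiE in eU.
pose e := sqdist u phi.
have e0' : 0 < e < e0.
  rewrite (lt_le_trans d2 e_ge)/=; apply: lt_le_trans sphi _.
  have dd : d ^+ 2 <= d by rewrite expr2 ler_piMl ?ltW.
  have dd5 : d ^+ 4 <= d by rewrite exprS ler_piMr ?(ltW d0)// exprn_ile1// ltW.
  lra.
have hM psi : M R n.+1 psi -> e - e ^+ 2 <= sqdist U psi.
  move=> /mU[psi' M' ->]; apply: le_trans (distM_sqr_le hu M'); rewrite -/d.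
  have : (d ^+ 2) ^+ 2 <= e ^+ 2 by rewrite ler_sqr ?nnegrE ?(ltW d2) ?sqdist_ge0.
  rewrite -exprM; move: sphi; rewrite -/e; lra.
have := core U c' e gU e0' eU hM; rewrite dU; apply: le_trans.
by apply: ler_wpM2l => //; rewrite subr_ge0 ltW.
Qed.

(** Makes the supremum defining the remainder finite. *)
Lemma global_bound u : admissible u -> - @weak_const R n <= deficit u.
Proof.
move=> gu; have [hu u1 uE] := gu.
have u1' : I (fun x => u x ^+ 2) <= 1 by rewrite u1.
have [i1 h] := weak_scaled hu uE ltr01 u1'.
have le : sqr_entropy u <= I (fun x => u x ^+ 2 * lnp (u x ^+ 2 / 1)).
  apply: le_I => //; first exact: intg_sqr_ln.
  move=> x; rewrite divr1; apply: ler_wpM2l; first exact: sqr_ge0.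
  have [s1|s1] := leP (u x ^+ 2) 1; first by apply: le_trans (lnp_ge0 _); exact: ln_le0.
  by rewrite /lnp max_r// ltW.
move: h; rewrite u1 mulr1.
have C0 : 0 < @Cn R n.+1 := Cn_gt0.
have := ler_wpM2l (ltW C0) le; rewrite /deficit.
move: (@Cn R n.+1 * _) (fine _) (@weak_const R n) (@Cn R n.+1 * _) => *; lra.
Qed.

Lemma stability : stable_with n.+1 rate.
Proof.
pose dfc u := deficit u - @Cn R n.+1 * ln sph.
(* [- rho t] is the largest shortfall among admissible functions at distance [t]; including 0 keeps
   the set nonempty and its supremum nonnegative. *)
pose A t := [set q : R | q = 0 \/ exists2 u, admissible u /\ distM u = t & q = rate * t ^+ 2 - dfc u].
pose rho t := - sup (A t).
have A0 t : A t 0 by left.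
have Aub t : has_ubound (A t).
  exists (Num.max 0 (rate * t ^+ 2 + @weak_const R n + @Cn R n.+1 * ln sph)) => q [->|[u [gu _] ->]].
    by rewrite le_max lexx.
  rewrite le_max; apply/orP; right; rewrite /dfc; have := global_bound gu.
  by move: (deficit u) (@weak_const R n) (_ * ln _) (_ * t ^+ 2) => *; lra.
exists rho => [|u uD u1].
  apply/cvgrPdist_le => eps eps0.
  (* [local_bound] asks for a value below [rate]. *)
  pose eps' := Num.min eps (rate / 2).
  have e'0 : 0 < eps' < rate.
    have := rate_gt0; rewrite lt_min eps0 gt_min => k0; rewrite divr_gt0//=.
    by apply/orP; right; lra.
  have [d0 d00 hd] := local_bound e'0.
  near=> t.
  have t0 : 0 < t by near: t; exact: nbhs_right_gt.
  have td : t < d0 by near: t; exact: nbhs_right_lt.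
  have t2 : 0 < t ^+ 2 by rewrite exprn_gt0.
  rewrite sub0r normrN /rho mulNr normrN ger0_norm; last first.
    by apply: divr_ge0 (ltW t2); apply: ub_le_sup.
  rewrite ler_pdivrMr//; apply: ge_sup; first by exists 0.
  move=> q [->|[u [gu ut] ->]]; first by rewrite mulr_ge0 ?ltW.
  have := hd u gu; rewrite ut t0 td => /(_ isT); rewrite -/(dfc u).
  have : eps' * t ^+ 2 <= eps * t ^+ 2 by rewrite ler_pM2r// ge_min lexx.
  by rewrite mulrBl; move: (_ * t ^+ 2) (_ * t ^+ 2) (_ * t ^+ 2) (dfc u) => *; lra.
have [gu ->] := deficitE uD u1; rewrite lee_fin -/(dfc u) /rho.
have : rate * distM u ^+ 2 - dfc u <= sup (A (distM u)).
  by apply: ub_le_sup => //; right; exists u.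
by move: (dfc u) (sup _) (_ * _) => *; lra.
Unshelve. all: by end_near.
Qed.

End Stability.

(** * Sharpness *)

Section Sharpness.
Context {R : realType} {n : nat}.
Notation S := (sphere R n.+1).
Notation dw := (@surface R n.+1).
Notation I f := (Rintegral dw setT f).
Notation a := (n.+1%:R / 2 : R).
Notation sph := (fine (dw setT)).
Notation T := (n.+2.-tuple R).
Notation bub xi := (@bubble R n.+1 1 xi).
Implicit Types (x y z w : S) (u r U : S -> R) (xi : T).

Let s0 : 0 < sph. Proof. exact: surface_gt0. Qed.
Let a0 : 0 < a. Proof. by rewrite divr_gt0. Qed.

Let enorm_ball xi : unit_ball xi -> 0 <= enorm xi < 1.
Proof. by move=> h; rewrite sqrtr_ge0. Qed.

(** By [powRN_mono] the moment is at least a multiple of $|\xi|\,W$, where $W$ integrates $\cos^2$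
    against the bubble. To compare $W$ with the mass, bound the bubble by $4\cos^2$ times itself
    where $|\cos|\ge1/2$, and by $2^a$ elsewhere; [L] adds up the two parts. *)
Lemma bubble_moment : exists2 k : R, 0 < k & forall xi eta, unit_ball xi ->
  (forall w, dotp xi (val w) = enorm xi * cosd eta w) ->
  k * enorm xi * I (bub xi) <= I (fun w => bub xi w * cosd eta w).
Proof.
pose q : R := 2 `^ a; have q0 : 0 < q by rewrite powR_gt0.
have qV : (2 : R) `^ (- a) = q^-1 by rewrite powRN.
pose L : R := q * q * n.+2%:R + 4.
have L0 : 0 < L by apply: addr_gt0 => //; apply: mulr_gt0 => //; exact: mulr_gt0.
pose k : R := a / (2 * (1 + a)).
have k0 : 0 < k by apply: divr_gt0 => //; apply: mulr_gt0 => //; exact: addr_gt0.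
exists (k / L); first exact: divr_gt0.
move=> xi eta hxi etaE; have s1 := enorm_ball hxi; have /andP[s00 s11] := s1.
have bE w : bub xi w = (1 - enorm xi * cosd eta w) `^ (- a) by rewrite /bubble mul1r etaE.
have bv := bmeas_bubble 1 hxi; have bt := bmeas_cosd eta.
have bt2 : bmeas (fun w => cosd eta w ^+ 2) by exact: bmeasX.
have iv : intg dw (bub xi) by exact: bmeas_intg.
have it : intg dw (cosd eta) by exact: bmeas_intg.
have ivt : intg dw (fun w => bub xi w * cosd eta w) by apply/bmeas_intg/bmeasM.
have it2 : intg dw (fun w => cosd eta w ^+ 2) by exact: bmeas_intg.
have itv : intg dw (fun w => cosd eta w ^+ 2 * bub xi w) by apply/bmeas_intg/bmeasM.
pose W := I (fun w => cosd eta w ^+ 2 * bub xi w).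
have h1 : k * enorm xi * W <= I (fun w => bub xi w * cosd eta w).
  have -> : I (fun w => bub xi w * cosd eta w) = I (fun w => bub xi w * cosd eta w - cosd eta w).
    by rewrite IB// I_cosd subr0.
  rewrite -IZ//; apply: le_I => [||w]; [exact: intgZ|exact: intgB|].
  by have := powRN_mono a0 s1 (norm_cosd eta w); rewrite -bE mulrBl mul1r.
have base w : 0 < 1 - enorm xi * cosd eta w.
  by have := bubble_base_gt0 w hxi; rewrite etaE.
have st w : `|enorm xi * cosd eta w| <= `|cosd eta w|.
  by rewrite normrM (ger0_norm s00) ler_piMl// ltW.
have vlow w : q^-1 <= bub xi w.
  rewrite bE -qV !powRN lef_pV2 ?posrE ?powR_gt0//.
  apply: ge0_ler_powR; rewrite ?nnegrE ?(ltW a0) ?(ltW (base w))//.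
  have := le_trans (st w) (norm_cosd eta w); rewrite ler_norml => /andP[+ _].
  by rewrite lerNl => h; rewrite [leRHS](_ : _ = 1 + 1) ?lerD2l//; ring.
have vup w : bub xi w <= q + 4 * (cosd eta w ^+ 2 * bub xi w).
  have v0 : 0 <= bub xi w by rewrite bE powR_ge0.
  have [t2|t2] := leP 1 (4 * cosd eta w ^+ 2).
    rewrite mulrA (@le_trans _ _ (4 * cosd eta w ^+ 2 * bub xi w)) ?lerDr ?(ltW q0)//.
    by rewrite ler_peMl.
  apply: (@le_trans _ _ q); last first.
    by rewrite lerDl; apply: mulr_ge0 => //; apply: mulr_ge0 => //; exact: sqr_ge0.
  have hq : q^-1 = 2^-1 `^ a.
    apply: (mulfI (lt0r_neq0 q0)); rewrite mulfV ?gt_eqF// /q -powRM//.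
    by rewrite mulfV ?powR1// pnatr_eq0.
  rewrite bE powRN -[leRHS]invrK lef_pV2 ?posrE ?invr_gt0 ?powR_gt0// hq.
  apply: ge0_ler_powR; rewrite ?nnegrE ?(ltW a0) ?(ltW (base w)) ?invr_ge0//.
  have th : `|cosd eta w| <= 2^-1.
    rewrite leNgt; apply/negP => t3; move: t2; rewrite -real_normK ?num_real//.
    have q4 : 4 * 2^-1 ^+ 2 = 1 :> R by field.
    apply/negP; rewrite -leNgt; apply: (@le_trans _ _ (4 * 2^-1 ^+ 2)); first by rewrite q4.
    by rewrite ler_pM2l// ler_sqr ?nnegrE ?invr_ge0// ltW.
  have := le_trans (st w) th; rewrite ler_norml => /andP[_ h].
  by rewrite lerBrDl -lerBrDr (le_trans h)// lerBrDl [leLHS](_ : _ = 1)//; field.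
have t2E : I (fun w => cosd eta w ^+ 2) = sph / n.+2%:R.
  transitivity (I (fun w => cosd eta w * cosd eta w)); first by apply: eq_I => w; rewrite expr2.
  by rewrite I_cosd_cosd cosdxx mulr1.
have Wlow : q^-1 * (sph / n.+2%:R) <= W.
  rewrite -t2E -IZ//; apply: le_I => // [|w]; first exact: intgZ.
  by rewrite mulrC; apply: ler_wpM2l; [exact: sqr_ge0|exact: vlow].
have Vup : I (bub xi) <= L * W.
  have ic : intg dw (fun _ : S => q) by exact/bmeas_intg/bmeas_cst.
  have i4 : intg dw (fun w => 4 * (cosd eta w ^+ 2 * bub xi w)) by exact: intgZ.
  apply: (@le_trans _ _ (q * sph + 4 * W)).
    rewrite -(Icst dw q) -IZ// -ID//.
    by apply: le_I => //; exact: intgD.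
  rewrite [L * W](_ : _ = q * q * n.+2%:R * W + 4 * W); last by rewrite /L; ring.
  rewrite lerD2r.
  have nz : (n.+2%:R : R) != 0 by rewrite pnatr_eq0.
  rewrite (_ : q * sph = q * q * n.+2%:R * (q^-1 * (sph / n.+2%:R))); last first.
    have gen (N q' s' : R) : N != 0 -> q' != 0 -> q' * s' = q' * q' * N * (q'^-1 * (s' / N)).
      by move=> ? ?; field; apply/andP.
    exact: gen nz (lt0r_neq0 q0).
  by apply: ler_wpM2l => //; apply: mulr_ge0 => //; apply: mulr_ge0; exact: ltW.
apply: le_trans h1; rewrite (_ : k / L * _ * _ = k * enorm xi * (I (bub xi) / L)); last by ring.
apply: ler_wpM2l; first by apply: mulr_ge0 => //; exact: ltW.
by rewrite ler_pdivrMr// mulrC.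
Qed.

(** Bernoulli's inequality, whose linear term integrates to 0. *)
Lemma bubble_mass xi : unit_ball xi -> sph <= I (bub xi).
Proof.
move=> hxi; have [eta etaE] := exists_direction xi.
have ic : intg dw (fun _ : S => 1 : R) by exact/bmeas_intg/bmeas_cst.
have it : intg dw (fun w => a * enorm xi * cosd eta w).
  exact/bmeas_intg/bmeasZ/bmeas_cosd.
have -> : sph = I (fun w => 1 + a * enorm xi * cosd eta w).
  rewrite ID// (Icst dw 1) mul1r IZ ?I_cosd ?mulr0 ?addr0//.
  exact/bmeas_intg/bmeas_cosd.
apply: le_I => [||w]; [exact: intgD|exact/bmeas_intg/bmeas_bubble|].
have b0 := bubble_base_gt0 w hxi; rewrite /bubble mul1r.
have := @powRN_ge _ _ a0 (- dotp xi (val w)); rewrite mulrN opprK etaE mulrA; apply.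
by rewrite -etaE; move: b0; clear; move=> *; lra.
Qed.

(** [Y] annihilates the terms of the bubble of order 0 and 1 in $\xi$; the rest is bounded by
    [powRN_taylor_global], and [bubble_mass] absorbs the constant in its weight. *)
Lemma bubble_quadratic Y : bmeas Y -> I Y = 0 -> (forall y, I (fun w => Y w * cosd w y) = 0) ->
  exists2 C : R, 0 <= C & forall xi, unit_ball xi ->
    `|I (fun w => Y w * bub xi w)| <= C * enorm xi ^+ 2 * I (bub xi).
Proof.
move=> bY Y0 Y1; have [C C0 hC] := powRN_taylor_global a0; have [mY [B YB]] := bY.
have B0 : 0 <= B.
  by apply: le_trans (YB (sphere_proj [tuple 0 | i < n.+2])); exact: normr_ge0.
exists (2 * (B * C)) => [|xi hxi]; first by apply: mulr_ge0 => //; exact: mulr_ge0.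
have [eta etaE] := exists_direction xi.
have bt := bmeas_cosd eta; have bv := bmeas_bubble 1 hxi.
have ib : intg dw (fun w => B * (C * enorm xi ^+ 2 * (bub xi w + 1))).
  by apply: bmeas_intg; apply: bmeasZ; apply: bmeasZ; apply: bmeasD => //; exact: bmeas_cst.
have ic : intg dw (fun _ : S => 1 : R) by exact/bmeas_intg/bmeas_cst.
have bd : bmeas (fun w => Y w * (bub xi w - 1 - a * (enorm xi * cosd eta w))).
  apply: bmeasM => //; apply: bmeasB; last by apply: bmeasZ; exact: bmeasZ.
  by apply: bmeasB => //; exact: bmeas_cst.
have -> : I (fun w => Y w * bub xi w) = I (fun w => Y w * (bub xi w - 1 - a * (enorm xi * cosd eta w))).
  have iYv : intg dw (fun w => Y w * bub xi w) by apply/bmeas_intg/bmeasM.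
  have iY : intg dw Y by exact: bmeas_intg.
  have iYt : intg dw (fun w => Y w * cosd w eta).
    apply/bmeas_intg/bmeasM => //; have := bt; congr (bmeas _).
    by apply/funext => w; exact: cosdC.
  transitivity (I (fun w => Y w * bub xi w - Y w - a * enorm xi * (Y w * cosd w eta))).
    rewrite IB; [|exact: intgB|exact: intgZ].
    by rewrite IB// IZ// Y0 Y1 mulr0 !subr0.
  by apply: eq_I => w; rewrite (cosdC w eta); ring.
apply: le_trans (norm_I (bmeas_intg _ bd)) _.
apply: (@le_trans _ _ (I (fun w => B * (C * enorm xi ^+ 2 * (bub xi w + 1))))).
  apply: le_I => // [|w]; first by apply: intg_norm; exact: bmeas_intg.
  rewrite normrM; apply: ler_pM => //.
  by have := hC _ _ (enorm_ball hxi) (norm_cosd eta w); rewrite /bubble mul1r etaE.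
rewrite IZ; last by apply: bmeas_intg; apply: bmeasZ; apply: bmeasD => //; exact: bmeas_cst.
rewrite IZ; last by apply: bmeas_intg; apply: bmeasD => //; exact: bmeas_cst.
rewrite ID//; last exact: bmeas_intg.
rewrite (Icst dw 1) mul1r; have h := bubble_mass hxi.
rewrite [leRHS](_ : _ = B * (C * enorm xi ^+ 2 * (I (bub xi) + I (bub xi)))); last by ring.
apply: ler_wpM2l => //; apply: ler_wpM2l; last by rewrite lerD2l.
by apply: mulr_ge0 (sqr_ge0 _).
Qed.

(* That is, the constant 1 is the element of M nearest to 1 + e Y. *)
Lemma nearest_bubble Y : bmeas Y -> I Y = 0 -> (forall y, I (fun w => Y w * cosd w y) = 0) ->
  exists2 e0 : R, 0 < e0 & forall e phi, 0 < e < e0 -> M R n.+1 phi ->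
    e ^+ 2 * I (fun w => Y w ^+ 2) <= sqdist (fun w => 1 + e * Y w) phi.
Proof.
move=> bY Y0 Y1; have [k k0 mom] := bubble_moment; have [C C0 quad] := bubble_quadratic bY Y0 Y1.
have k2 : 0 < k ^+ 2 by rewrite exprn_gt0.
exists (Num.min (k ^+ 2) 1 / (4 * C + 1)).
  by apply: divr_gt0; [rewrite lt_min k2 ltr01|rewrite ltr_wpDl// mulr_ge0].
move=> e phi /andP[e0]; rewrite ltr_pdivlMr; last by rewrite ltr_wpDl// mulr_ge0.
rewrite lt_min => /andP[ek e1] [c [xi hxi phiE]].
have [eta etaE] := exists_direction xi; have [s00 s11] := andP (enorm_ball hxi).
have bv := bmeas_bubble 1 hxi; have bt := bmeas_cosd eta.
have {phiE}phiE w : phi w = c * bub xi w by rewrite phiE /bubble mul1r.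
set s := enorm xi in s00 s11; set V := I (bub xi).
have Vs : sph <= V := bubble_mass hxi.
have V0 : 0 <= V := le_trans (ltW s0) Vs.
pose D := I (fun w => (1 - c * bub xi w) ^+ 2).
have bd : bmeas (fun w => 1 - c * bub xi w).
  by apply: bmeasB; [exact: bmeas_cst|exact: bmeasZ].
have sd : sqi dw (fun w => 1 - c * bub xi w) by exact: bmeas_sqi.
have D0 : 0 <= D by apply: I_ge0 => w; exact: sqr_ge0.
have i1 : intg dw (fun _ : S => 1 : R) by exact/bmeas_intg/bmeas_cst.
have iv : intg dw (bub xi) by exact: bmeas_intg.
have it : intg dw (cosd eta) by exact: bmeas_intg.
have ivt : intg dw (fun w => bub xi w * cosd eta w) by apply/bmeas_intg/bmeasM.
(* Cauchy-Schwarz against 1, and in [D2] against the coordinate along $\xi$: the squared distance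
   [D] from 1 to the bubble controls the defect of mass and also $|c|\,|\xi|$ times the mass. *)
have D1 : (sph - c * V) ^+ 2 <= D * sph.
  have sc : sqi dw (fun _ : S => 1 : R) by exact/bmeas_sqi/bmeas_cst.
  have := CS sd sc.
  rewrite [I (fun w => _ * 1)](_ : _ = sph - c * V); last first.
    rewrite -(mul1r sph) -(Icst dw 1) -IZ// -IB//; last exact: intgZ.
    by apply: eq_I => w; rewrite mulr1.
  rewrite [I (fun w => 1 ^+ 2)](_ : _ = sph)//.
  by rewrite -[RHS]mul1r -(Icst dw 1); apply: eq_I => w; rewrite expr1n.
have D2 : (c * (k * s * V)) ^+ 2 <= D * sph.
  have := CS sd (bmeas_sqi dw bt).
  rewrite [I (fun w => _ * cosd eta w)](_ : _ = - (c * I (fun w => bub xi w * cosd eta w))); last first.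
    rewrite -[LHS]/(I _) (@eq_I _ _ _ _ _ (fun w => cosd eta w - c * (bub xi w * cosd eta w))); last first.
      by move=> w; ring.
    by rewrite IB//; [rewrite I_cosd IZ// sub0r|exact: intgZ].
  rewrite sqrrN => h; apply: (@le_trans _ _ ((c * I (fun w => bub xi w * cosd eta w)) ^+ 2)).
    rewrite !exprMn; apply: ler_wpM2l; first exact: sqr_ge0.
    have kV : 0 <= k * s * V by apply: mulr_ge0 => //; apply: mulr_ge0 => //; exact: ltW.
    have h2 := mom xi eta hxi etaE.
    by rewrite -!exprMn ler_sqr ?nnegrE//; exact: le_trans kV h2.
  apply: le_trans h _; apply: ler_wpM2l => //.
  apply: (@le_trans _ _ (I (fun _ : S => 1))); last by rewrite (Icst dw 1) mul1r.
  apply: le_I => //; first by apply: bmeas_intg; exact: bmeasX.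
  by move=> w; rewrite -real_normK ?num_real// exprn_ile1// norm_cosd.
have q1 : `|I (fun w => Y w * bub xi w)| <= C * s ^+ 2 * V := quad xi hxi.
have iY2 : intg dw (fun w => Y w ^+ 2) by apply: bmeas_intg; exact: bmeasX.
have iY : intg dw Y by exact: bmeas_intg.
have iYv : intg dw (fun w => Y w * bub xi w) by apply/bmeas_intg/bmeasM.
have sdE : sqdist (fun w => 1 + e * Y w) phi =
    D - 2 * e * c * I (fun w => Y w * bub xi w) + e ^+ 2 * I (fun w => Y w ^+ 2).
  transitivity (I (fun w => (1 - c * bub xi w) ^+ 2 + 2 * e * Y w -
      2 * e * c * (Y w * bub xi w) + e ^+ 2 * Y w ^+ 2)).
    by apply: eq_I => w; rewrite phiE; ring.
  have j1 : intg dw (fun w => (1 - c * bub xi w) ^+ 2) by exact: (proj2 sd).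
  have j2 : intg dw (fun w => 2 * e * Y w) by exact: intgZ.
  have j3 : intg dw (fun w => 2 * e * c * (Y w * bub xi w)) by exact: intgZ.
  have j4 : intg dw (fun w => e ^+ 2 * Y w ^+ 2) by exact: intgZ.
  rewrite ID//; last by apply: intgB => //; exact: intgD.
  rewrite IB//; last exact: intgD.
  by rewrite ID// (IZ _ iY) (IZ _ iYv) (IZ _ iY2) Y0 mulr0 addr0.
rewrite sdE lerDr subr_ge0.
have absJ : 2 * e * c * I (fun w => Y w * bub xi w) <= 2 * e * C * s ^+ 2 * (`|c| * V).
  apply: le_trans (ler_norm _) _; rewrite normrM -[2 * e * c]mulrA normrM (ger0_norm (ler0n _ 2)) normrM (gtr0_norm e0).
  rewrite [leRHS](_ : _ = 2 * (e * `|c|) * (C * s ^+ 2 * V)); last by ring.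
  by apply: ler_wpM2l => //; apply: mulr_ge0 => //; apply: mulr_ge0 => //; exact: ltW.
apply: le_trans absJ _; rewrite -(ler_pM2r s0).
have s2 : 0 <= s ^+ 2 := sqr_ge0 _; have s21 : s ^+ 2 <= 1 by rewrite exprn_ile1// ltW.
have cV0 : 0 <= `|c| * V by exact: mulr_ge0.
move: D2; rewrite (_ : (c * (k * s * V)) ^+ 2 = k ^+ 2 * s ^+ 2 * (`|c| * V) ^+ 2); last first.
  by rewrite [(`|c| * V) ^+ 2]exprMn real_normK ?num_real//; ring.
have D1' : (sph - `|c| * V) ^+ 2 <= D * sph.
  apply: le_trans D1.
  have : c * (sph * V) <= `|c| * (sph * V).
    by apply: ler_wpM2r (ler_norm c); apply: mulr_ge0 => //; exact: ltW.
  rewrite (_ : (sph - `|c| * V) ^+ 2 = sph ^+ 2 - 2 * (`|c| * (sph * V)) + `|c| ^+ 2 * V ^+ 2); last by ring.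
  rewrite real_normK ?num_real// (_ : (sph - c * V) ^+ 2 = sph ^+ 2 - 2 * (c * (sph * V)) + c ^+ 2 * V ^+ 2); last by ring.
  by move: (sph ^+ 2) (c * _) (`|c| * _) (c ^+ 2 * _); clear; move=> *; lra.
have eC : 4 * (e * C) <= Num.min (k ^+ 2) 1.
  rewrite le_min; apply/andP; split; rewrite -[4 * _](_ : e * (4 * C + 1) - e = _); try by ring.
    by move: ek; clear -e0; move=> *; lra.
  by move: e1; clear -e0; move=> *; lra.
move: eC; rewrite le_min => /andP[eCk eC1] D2.
rewrite [leLHS](_ : _ = 2 * (e * C) * s ^+ 2 * (`|c| * V * sph)); last by ring.
have eC0 : 0 <= e * C by apply: mulr_ge0 => //; exact: ltW.
set g := `|c| * V in cV0 D1' D2 *.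
(* If the bubble carries at least half the mass of the constant 1, [D2] beats the cross term, both
   being of order $s^2$; otherwise the defect of mass in [D1] does. *)
have [gs|gs] := leP sph (2 * g).
  apply: le_trans D2.
  apply: (@le_trans _ _ (2 * (e * C) * s ^+ 2 * (g * (2 * g)))).
    by apply: ler_wpM2l; [apply: mulr_ge0 => //; exact: mulr_ge0|exact: ler_wpM2l].
  rewrite [leLHS](_ : _ = 4 * (e * C) * (s ^+ 2 * g ^+ 2)); last by ring.
  by rewrite -[leRHS]mulrA; apply: ler_wpM2r => //; apply: mulr_ge0 => //; exact: sqr_ge0.
apply: le_trans D1'; apply: (@le_trans _ _ (2 * (e * C) * (g * sph))).
  apply: ler_wpM2r; first by apply: mulr_ge0 => //; exact: ltW.
  by apply: ler_piMr => //; exact: mulr_ge0.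
have : 4 * (e * C) * (g * sph) <= 1 * (g * sph).
  by apply: ler_wpM2r => //; apply: mulr_ge0 => //; exact: ltW.
have : 0 <= (sph - 2 * g) * (sph - 2^-1 * g).
  by apply: mulr_ge0; move: gs cV0; clear; move=> *; lra.
rewrite (_ : (_ - _) * _ = (sph - g) ^+ 2 - 2^-1 * (g * sph)); last by field.
move: (g * sph) => gS; rewrite -[4 * _ * gS]mulrA -[2 * _ * gS]mulrA; move: (e * C * gS) ((sph - g) ^+ 2).
by clear; move=> *; lra.
Qed.

Lemma sharpness (K : R) : @rate R n < K -> ~ stable_with n.+1 K.
Proof.
move=> rK [rho rho0 hst].
have [Y [bY q0 Y0 Y1 EY]] := @energy_extremal R n.
set q := I (fun x => Y x ^+ 2) in q0 EY.
have [mY [B YB]] := bY.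
have B0 : 0 <= B.
  by apply: le_trans (YB (sphere_proj [tuple 0 | i < n.+2])); exact: normr_ge0.
have [e1 e10 nb] := nearest_bubble bY Y0 Y1.
have C0 : 0 < @Cn R n.+1 := Cn_gt0.
(* The first summand comes from the logarithm of the normalisation, the second from the cubic error
   in [sqr_ln_lower]. *)
pose C : R := @Cn R n.+1 * q / sph + 19 * @Cn R n.+1 * B ^+ 3 * sph / q.
have CC0 : 0 <= C.
  apply: addr_ge0; apply: divr_ge0 (ltW _) => //; apply: mulr_ge0; try exact: ltW.
  by apply: mulr_ge0; [apply: mulr_ge0 => //; exact: ltW|exact: exprn_ge0].
have iY : intg dw Y by exact: bmeas_intg.
have iY2 : intg dw (fun w => Y w ^+ 2) by apply: bmeas_intg; exact: bmeasX.
have i1 : intg dw (fun _ : S => 1 : R) by exact/bmeas_intg/bmeas_cst.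
(* [d] is the distance to $M$ of $1+eY$ normalised and [m2] the square of the normalising factor.
   The computed value of $LS$ there is confronted with the assumed lower bound. *)
have main e : 0 < e -> e < e1 -> e < 1 -> e * B < 2^-1 -> let m2 := (sph + e ^+ 2 * q)^-1 in
    exists2 d : R, 0 <= d & d ^+ 2 = m2 * (e ^+ 2 * q) /\ K * d ^+ 2 + rho d <= d ^+ 2 * (@rate R n + C * e).
  move=> e0 ee1 e_1 eB m2; pose P := e ^+ 2 * q.
  have P0 : 0 < P by apply: mulr_gt0 => //; exact: exprn_gt0.
  have sP : 0 < sph + P by exact: addr_gt0.
  pose m := (Num.sqrt (sph + P))^-1.
  have m0 : 0 < m by rewrite invr_gt0 sqrtr_gt0.
  have mm : m ^+ 2 = m2 by rewrite exprVn sqr_sqrtr// ltW.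
  pose U w := m * (1 + e * Y w).
  have b1 : bmeas (fun w => 1 + e * Y w) by apply: bmeasD; [exact: bmeas_cst|exact: bmeasZ].
  have bU : bmeas U by exact: bmeasZ.
  have hU : sqi dw U by exact: bmeas_sqi.
  have ieY : intg dw (fun w => e * Y w) by exact: intgZ.
  have IU : I U = m * sph.
    by rewrite IZ ?ID ?(Icst dw 1) ?mul1r ?(IZ _ iY) ?Y0 ?mulr0 ?addr0//; exact: bmeas_intg.
  have U1 : I (fun w => U w ^+ 2) = 1.
    transitivity (I (fun w => m ^+ 2 * (1 + 2 * e * Y w + e ^+ 2 * Y w ^+ 2))).
      by apply: eq_I => w; rewrite /U; ring.
    have j1 : intg dw (fun w => 2 * e * Y w) by exact: intgZ.
    have j2 : intg dw (fun w => e ^+ 2 * Y w ^+ 2) by exact: intgZ.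
    rewrite IZ; last by apply: intgD => //; exact: intgD.
    rewrite ID//; last exact: intgD.
    rewrite ID// (Icst dw 1) mul1r (IZ _ iY) Y0 mulr0 addr0 (IZ _ iY2) mm.
    by rewrite mulVf// gt_eqF.
  have EU : energy U = (m ^+ 2 * (e ^+ 2 * (@lam2 R n * q)))%:E.
    rewrite energyZ; last by case: b1.
    by rewrite energyD_cst energyZ// EY -!EFinM.
  have gU : admissible U by split => //; rewrite EU ltry.
  have DU : DL R n.+1 U by split; [apply/LfunP|case: gU].
  have NU : L2norm U = 1 by rewrite L2normE ?U1 ?sqrtr1//; case: hU.
  have dM : distM U ^+ 2 = m2 * P.
    have ball0 : unit_ball (axis ord0 0 : T) by apply: unit_ball_axis; rewrite normr0.
    apply/eqP; rewrite eq_le; apply/andP; split.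
      have M0 : M R n.+1 (bubble m (axis ord0 0)) by exists m, (axis ord0 0).
      apply: le_trans (distM_sqr_le hU M0) _.
      rewrite (_ : sqdist _ _ = I (fun w => m ^+ 2 * e ^+ 2 * Y w ^+ 2)).
        rewrite (IZ _ iY2) -/q mm -mulrA; exact: lexx.
      apply: eq_I => w; rewrite bubble0 => [|j]; last by rewrite tnth_mktuple; case: ifP.
      by rewrite /U; ring.
    rewrite leNgt; apply/negP => /(distM_near hU)[phi [c [xi hxi phiE]]].
    apply/negP; rewrite -leNgt.
    have Mc : M R n.+1 (bubble (m^-1 * c) xi) by exists (m^-1 * c), xi.
    have := nb e _ (introT andP (conj e0 ee1)) Mc; rewrite -/q -/P => /(ler_wpM2l (sqr_ge0 m)).
    rewrite mm => /le_trans; apply; rewrite -mm -IZ; last first.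
      apply: bmeas_intg; apply: bmeasX; apply: bmeasB => //; exact: bmeas_bubble.
    rewrite le_eqVlt; apply/orP; left; apply/eqP; apply: eq_I => w.
    by rewrite phiE /bubble /U -exprMn; congr (_ ^+ 2); rewrite mulrBr -[m^-1 * c * _]mulrA mulVKf ?gt_eqF.
  exists (distM U); first exact: distM_ge0.
  split => //.
  have := hst U DU NU; have [_ ->] := deficitE DU NU; rewrite lee_fin => /le_trans; apply.
  have [] := deficit_ratio gU (lt0r_neq0 m0) IU; set r := fun w => _; cbn zeta => hr rE r0 mP [iL ->].
  have rY w : r w = e * Y w by rewrite -[r w]/(m^-1 * (m * (1 + e * Y w)) - 1) mulKf ?gt_eqF// addrAC subrr add0r.
  have Er : fine (energy r) = @lam2 R n * P.
    rewrite (_ : r = fun w => e * Y w); last exact/funext.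
    by rewrite energyZ// EY -EFinM /= /P mulrCA.
  have ent : 3 * P - 19 * (e * B) ^+ 3 * sph <= I (fun w => (1 + r w) ^+ 2 * ln ((1 + r w) ^+ 2)).
    have -> : 3 * P - 19 * (e * B) ^+ 3 * sph = I (fun w => 2 * e * Y w + 3 * e ^+ 2 * Y w ^+ 2 - 19 * (e * B) ^+ 3).
      have j1 : intg dw (fun w => 2 * e * Y w) by exact: intgZ.
      have j2 : intg dw (fun w => 3 * e ^+ 2 * Y w ^+ 2) by exact: intgZ.
      have j3 : intg dw (fun _ : S => 19 * (e * B) ^+ 3) by exact/bmeas_intg/bmeas_cst.
      rewrite IB//; last exact: intgD.
      by rewrite ID// (IZ _ iY) (IZ _ iY2) Y0 mulr0 add0r (Icst dw (19 * (e * B) ^+ 3)) /P mulrA.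
    apply: le_I => // [|w].
      apply: intgB; last exact/bmeas_intg/bmeas_cst.
      by apply: intgD; exact: intgZ.
    have rB : `|r w| <= e * B by rewrite rY normrM (gtr0_norm e0) ler_pM2l.
    have := sqr_ln_lower (le_trans rB (ltW eB)); apply: le_trans.
    have : `|r w| ^+ 3 <= (e * B) ^+ 3.
      by apply: lerXn2r; rewrite ?nnegrE ?normr_ge0// mulr_ge0// ltW.
    rewrite [in 2 * r w]rY [r w ^+ 2](_ : _ = e ^+ 2 * Y w ^+ 2); last by rewrite rY exprMn.
    rewrite -[3 * e ^+ 2 * _]mulrA -[2 * e * _]mulrA.
    by move: (`|r w| ^+ 3) ((e * B) ^+ 3) (e * Y w) (e ^+ 2 * _); clear; move=> *; lra.
  rewrite Er dM; have l2E : @lam2 R n = 2 * @Cn R n.+1 + @rate R n by exact: lam2E.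
  have lnb : - (ln (m ^+ 2) + ln sph) <= P / sph.
    have Ps : 0 < P / sph by exact: divr_gt0.
    rewrite -lnM ?posrE ?exprn_gt0// mm -lnV ?posrE; last by rewrite mulr_gt0 ?invr_gt0.
    have -> : (m2 * sph)^-1 = 1 + P / sph.
      have gen (s p : R) : s != 0 -> s + p != 0 -> ((s + p)^-1 * s)^-1 = 1 + p / s.
        by move=> ? ?; field; apply/andP.
      exact: gen (lt0r_neq0 s0) (lt0r_neq0 sP).
    by apply: le_ln1Dx; rewrite (lt_trans _ Ps)// ltrN10.
  rewrite mm l2E.
  have h1 := ler_wpM2l (ltW C0) lnb; have h2 := ler_wpM2l (ltW C0) ent.
  have m20 : 0 < m2 by rewrite invr_gt0.
  have h3 := ler_wpM2l (ltW m20) h2.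
  rewrite mm in h1; apply: (@le_trans _ _ (m2 * P * (@rate R n + (@Cn R n.+1 * (e ^+ 2 * q) / sph + 19 * @Cn R n.+1 * B ^+ 3 * sph / q * e)))); last first.
    apply: ler_wpM2l; first by apply: mulr_ge0; exact: ltW.
    rewrite lerD2l [C * e]mulrDl lerD2r.
    rewrite (_ : @Cn R n.+1 * (e ^+ 2 * q) / sph = @Cn R n.+1 * q / sph * e ^+ 2); last by ring.
    apply: ler_wpM2l; first by apply: divr_ge0 (ltW s0); apply: mulr_ge0; exact: ltW.
    by rewrite expr2; apply: ler_piMl; exact: ltW.
  have PE : @Cn R n.+1 * (P / sph) = m2 * (@Cn R n.+1 * P) + m2 * P * (@Cn R n.+1 * P / sph).
    have gen (s p z : R) : s != 0 -> s + p != 0 ->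
        z * (p / s) = (s + p)^-1 * (z * p) + (s + p)^-1 * p * (z * p / s).
      by move=> ? ?; field; apply/andP.
    exact: gen (lt0r_neq0 s0) (lt0r_neq0 sP).
  have eq3 : m2 * P * (19 * @Cn R n.+1 * B ^+ 3 * sph / q * e) =
      m2 * (@Cn R n.+1 * (19 * (e * B) ^+ 3 * sph)).
    have gen (q' z s y : R) : q' != 0 ->
        y * (e ^+ 2 * q') * (19 * z * B ^+ 3 * s / q' * e) = y * (z * (19 * (e * B) ^+ 3 * s)).
      by move=> ?; field.
    exact: gen (lt0r_neq0 q0).
  rewrite -/P [leRHS](_ : _ = m2 * P * @rate R n + m2 * P * (@Cn R n.+1 * P / sph) +
    m2 * (@Cn R n.+1 * (19 * (e * B) ^+ 3 * sph))); last by rewrite -eq3; ring.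
  move: h1 h3; rewrite PE.
  set J := I _; set l1 := ln m2; set l2 := ln sph.
  set z := m2 * P * (@Cn R n.+1 * P / sph).
  rewrite (_ : m2 * (@Cn R n.+1 * (3 * P - 19 * (e * B) ^+ 3 * sph)) =
    3 * (m2 * (@Cn R n.+1 * P)) - m2 * (@Cn R n.+1 * (19 * (e * B) ^+ 3 * sph))); last by ring.
  rewrite (_ : m2 * ((2 * @Cn R n.+1 + @rate R n) * P - @Cn R n.+1 * J) =
    2 * (m2 * (@Cn R n.+1 * P)) + m2 * P * @rate R n - m2 * (@Cn R n.+1 * J)); last by ring.
  rewrite mulrN mulrDr.
  move: (m2 * (@Cn R n.+1 * P)) (m2 * P * @rate R n) z (m2 * (@Cn R n.+1 * J)).
  move: (m2 * (@Cn R n.+1 * _)) (@Cn R n.+1 * l1) (@Cn R n.+1 * l2).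
  by clear; move=> *; lra.
pose eps := (K - @rate R n) / 3.
have eps0 : 0 < eps by rewrite divr_gt0// subr_gt0.
have [t0 /= t00 ht0] := (cvgrPdist_lt _ _).1 rho0 eps eps0.
(* Chosen so that $d\le e\,c$: a small [e] brings [d] into the range where [rho] is controlled. *)
pose c := 1 + q / sph; have c1 : 1 <= c by rewrite lerDl ltW// divr_gt0.
have c0 : 0 < c := lt_le_trans ltr01 c1.
have B1 : 0 < B + 1 by rewrite ltr_wpDl.
have C1 : 0 < C + 1 by rewrite ltr_wpDl.
have [e e0] : exists2 e : R, 0 < e &
    e < Num.min (Num.min e1 1) (Num.min (2^-1 / (B + 1)) (Num.min (eps / (C + 1)) (t0 / c))).
  set mn := Num.min _ _; have mn0 : 0 < mn.
    by rewrite !lt_min e10 ltr01 (divr_gt0 _ B1) ?(divr_gt0 eps0 C1) ?(divr_gt0 t00 c0) ?invr_gt0.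
  by exists (mn / 2); [rewrite divr_gt0|rewrite ltr_pdivrMr// ltr_pMr// ltr1n].
rewrite !lt_min !ltr_pdivlMr// => /andP[/andP[ee1 e_1] /and3P[eB eC et]].
have eB' : e * B < 2^-1 by move: eB e0; clear; move=> *; lra.
have [d d0 [dE]] := main e e0 ee1 e_1 eB'.
have se : 0 < (sph + e ^+ 2 * q)^-1 by rewrite invr_gt0 addr_gt0// mulr_gt0// exprn_gt0.
have d2 : 0 < d ^+ 2 by rewrite dE; apply: mulr_gt0 => //; apply: mulr_gt0 => //; exact: exprn_gt0.
have d1 : 0 < d by rewrite lt_neqAle d0 andbT; apply: contraTneq d2 => <-; rewrite expr0n ltxx.
have dt : d < t0.
  rewrite -ltr_sqr ?nnegrE ?(ltW t00)// (@le_lt_trans _ _ ((e * c) ^+ 2))//; last first.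
    by rewrite ltr_sqr ?nnegrE ?(ltW t00)//; apply: mulr_ge0; exact: ltW.
  have -> : d ^+ 2 = e ^+ 2 * ((sph + e ^+ 2 * q)^-1 * q) by rewrite mulrCA.
  rewrite exprMn; apply: ler_wpM2l; first exact: sqr_ge0.
  apply: (@le_trans _ _ (q / sph)).
    rewrite mulrC; apply: ler_wpM2l; first exact: ltW.
    by rewrite lef_pV2 ?posrE ?addr_gt0 ?mulr_gt0 ?exprn_gt0// lerDl ltW// mulr_gt0 ?exprn_gt0.
  apply: (@le_trans _ _ c); first by rewrite lerDr.
  by rewrite expr2 ler_peMl// ltW.
have bd : ball 0 t0 d by rewrite /ball/= sub0r normrN gtr0_norm.
have := ht0 d bd d1; rewrite sub0r normrN ; rewrite ltr_norml => /andP[h1 _].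
have -> : rho d = rho d / d ^+ 2 * d ^+ 2 by rewrite divfK ?gt_eqF.
rewrite -mulrDl [leRHS]mulrC ler_pM2r// => h2.
move: h1 h2 eC e0; rewrite /eps; move: rK; move: (@rate R n) (rho d / _).
by clear; move=> *; lra.
Qed.

End Sharpness.

Theorem theorem1p2 (R : realType) (n : nat) (hn : (1 <= n)%N) :
  let K0 : R := 8 * pi `^ (n%:R / 2) / (Gamma (n%:R / 2) * (n%:R + 2)) in
  stable_with n K0 /\ (forall K : R, K0 < K -> ~ stable_with n K).
Proof.
by case: n hn => [//|n _]; split; [exact: stability|exact: sharpness].
Qed.
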